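(* Let $V$ be a finite even-dimensional real vector space with a fixed volume form, let $N$ be a closed connected manifold of dimension $d$ with universal cover $\widetilde{N}$ and $\Gamma=\pi_1(N)$, and let $\rho:\Gamma\to\mathrm{SL}(V)$ be a representation. Let $u:\widetilde{N}\to\mathrm{Gr}_d^{\mathrm{mix}}(\mathcal{Q})$ be a $\rho$-equivariant continuous map that admits a $\rho$-equivariant fitting flow $\Phi$. Then there exist $C,D>0$ such that the projections to $\widetilde{N}$ of the flow lines of $\Phi$ are $(C,D)$-quasi-geodesics. Moreover for every $(x,y)\in \widetilde{N}^2$ there exists a flow line whose projection to $\widetilde{N}$ starts at $x$ and ends at $y$.
   Context: $S^2V$ is the space of symmetric tensors and $\mathcal{Q}=S^2V^*$ its dual, the space of symmetric bilinear forms on $V$, with the natural actions of $\mathrm{SL}(V)$ and the pairing $q(s)=\mathrm{Tr}(q\circ s)$. $S^2V^{>0}$ is the set of positive definite tensors; a form $q\in\mathcal{Q}$ is positive if positive definite. $\mathrm{Gr}_d(\mathcal{Q})$ is the Grassmannian of $d$-dimensional subspaces (pencils) of $\mathcal{Q}$; for a pencil $P$, $P^\circ=\{s\in S^2V: q(s)=0\ \forall q\in P\}$; $P$ is mixed if $P^\circ\cap S^2V^{>0}\neq\emptyset$, and $\mathrm{Gr}_d^{\mathrm{mix}}(\mathcal{Q})$ is the set of mixed pencils. For a continuous map $u:M\to\mathrm{Gr}_d(\mathcal{Q})$ let $u^*\mathcal{E}=\{(x,q):x\in M,\ q\in u(x)\}$ and let $\mathbb{S}u^*\mathcal{E}$ be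 the sphere bundle over $M$ obtained by removing the zero section and quotienting by positive scalars. A fitting flow for $u$ is a continuous flow $(\Phi_t)_{t\in\mathbb{R}}$ on $\mathbb{S}u^*\mathcal{E}$ such that for all $(x,[q])$ and all $t>0$, writing $\Phi_t(x,[q])=(x',[q'])$, one can choose representatives with $q'-q$ positive. It is $\rho$-equivariant if it commutes with $\gamma\cdot(x,[q])=(\gamma x,[\rho(\gamma)\cdot q])$. A $(C,D)$-quasi-geodesic in a metric space $(X,d)$ is a curve $\gamma:\mathbb{R}\to X$ with $\frac1C|t_1-t_2|-D\le d(\gamma(t_1),\gamma(t_2))\le C|t_1-t_2|+D$ for all $t_1,t_2\in\mathbb{R}$. Here $\widetilde{N}$ carries the distance of any fixed $\Gamma$-invariant Riemannian metric (lifted from $N$), and flow lines are parametrized by the flow time. *)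

(* Defs.v *)
From HB Require Import structures.
From mathcomp Require Import all_boot all_order all_algebra generic_quotient.
From mathcomp Require Import all_classical all_reals all_analysis.

Set Implicit Arguments.
Unset Strict Implicit.
Unset Printing Implicit Defensive.

Import Order.TTheory GRing.Theory Num.Theory.
Import numFieldNormedType.Exports.

Local Open Scope classical_set_scope.
Local Open Scope ring_scope.
Local Open Scope quotient_scope.

Section LinearAlgebra.
Context {R : realType}.

Local Notation dual V := 'Hom(V, R^o).

(* A bilinear form q is encoded as the linear map v |-> q(v, -). *)
Definition bform (V : vectType R) : Type := 'Hom(V, dual V).

HB.instance Definition _ (V : vectType R) :=
  Vector.copy (bform V) 'Hom(V, dual V).

(* [v2r] is a linear isomorphism onto some R^m, so this is the usual topology
   of a finite-dimensional real vector space. *)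
HB.instance Definition _ (V : vectType R) :=
  Topological.copy (bform V)
    (initial_topology (VectorInternalTheory.v2r : bform V -> 'rV[R]__)).

Variable V : vectType R.

Definition form_val (q : bform V) (v w : V) : R := (q v : dual V) w.

Definition form_symmetric (q : bform V) : Prop :=
  forall v w, form_val q v w = form_val q w v.

Definition form_positive (q : bform V) : Prop :=
  forall v, v != 0 -> 0 < form_val q v v.

(* (h . q)(v, w) = q(h^-1 v, h^-1 w) *)
Definition form_act (h : 'End(V)) (q : bform V) : bform V :=
  linfun (fun v : V => ((q ((h^-1)%VF v) : dual V) \o h^-1)%VF).

(* An element of V (x) V is encoded as a linear map V^* -> V. *)
Definition tensor : Type := 'Hom(dual V, V).

Definition tensor_val (s : tensor) (a b : dual V) : R := a (s b).

Definition tensor_symmetric (s : tensor) : Prop :=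
  forall a b, tensor_val s a b = tensor_val s b a.

Definition tensor_positive (s : tensor) : Prop :=
  forall a, a != 0 -> 0 < tensor_val s a a.

Definition lfun_trace (W : vectType R) (f : 'End(W)) : R :=
  \tr (passmx.mxof (vbasis {:W}) (vbasis {:W}) f).

Definition pairing (q : bform V) (s : tensor) : R :=
  lfun_trace ((q : 'Hom(V, dual V)) \o s)%VF.

Definition mixed (P : {vspace bform V}) : Prop :=
  exists s : tensor, [/\ tensor_symmetric s, tensor_positive s
    & forall q, q \in P -> pairing q s = 0].

Definition volume_form (vol : ('I_(\dim {:V}) -> V) -> R) : Prop :=
  [/\ forall f i (a : R) (x y : V),
        vol (dfwith f i (a *: x + y)) =
          a * vol (dfwith f i x) + vol (dfwith f i y),
      forall f i j, i != j -> f i = f j -> vol f = 0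
    & exists f, vol f != 0].

Definition SL (vol : ('I_(\dim {:V}) -> V) -> R) : set 'End(V) :=
  [set h | forall f, vol (fun i => h (f i)) = vol f].

End LinearAlgebra.

Arguments tensor {R} V.

Section Grassmannian.
Context {R : realType} (V : vectType R) (d : nat).

Definition frames : set {ptws 'I_d -> bform V} :=
  [set b | (forall i, form_symmetric (b i)) /\ free [seq b i | i : 'I_d]].

Definition frame_span (b : frames) : {vspace bform V} :=
  <<[seq set_val b i | i : 'I_d]>>%VS.

Definition frame_rel (b b' : frames) : bool := frame_span b == frame_span b'.

Lemma frame_rel_refl : reflexive frame_rel.
Proof. by move=> b; rewrite /frame_rel eqxx. Qed.

Lemma frame_rel_sym : symmetric frame_rel.
Proof. by move=> b b'; rewrite /frame_rel eq_sym. Qed.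

Lemma frame_rel_trans : transitive frame_rel.
Proof. by move=> b a c; rewrite /frame_rel => /eqP-> /eqP->. Qed.

Definition frame_equiv := EquivRel _ frame_rel_refl frame_rel_sym frame_rel_trans.

Definition Gr := quotient_topology {eq_quot frame_equiv}.

HB.instance Definition _ := Topological.on Gr.
HB.instance Definition _ := Quotient.on Gr.

Definition pencil (P : Gr) : {vspace bform V} := frame_span (repr P).

End Grassmannian.

Section SphereBundle.
Context {R : realType} {V : vectType R} {d : nat} {M : topologicalType}.
Variable u : M -> Gr V d.

(* the pullback of the tautological bundle, with the zero section removed *)
Definition pullback0 : set (M * bform V) :=
  [set z | z.2 \in pencil (u z.1) /\ z.2 != 0].

Definition ray_rel (a b : pullback0) : bool :=
  `[< (set_val a).1 = (set_val b).1 /\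
      exists c : R, 0 < c /\ (set_val b).2 = c *: (set_val a).2 >].

Lemma ray_rel_refl : reflexive ray_rel.
Proof.
by move=> a; apply/asboolP; split=> //; exists 1; rewrite ltr01 scale1r.
Qed.

Lemma ray_rel_trans : transitive ray_rel.
Proof.
move=> b a c /asboolP[ab [k [k0 Ek]]] /asboolP[bc [l [l0 El]]].
apply/asboolP; split; first by rewrite ab.
by exists (l * k); rewrite mulr_gt0 // El Ek scalerA.
Qed.

Lemma ray_rel_sym : symmetric ray_rel.
Proof.
suff H a b : ray_rel a b -> ray_rel b a by move=> a b; apply/idP/idP; apply: H.
move=> /asboolP[ab [k [k0 Ek]]]; apply/asboolP; split=> //.
by exists k^-1; rewrite invr_gt0 k0 Ek scalerA mulVf ?scale1r // gt_eqF.
Qed.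

Definition ray_equiv := EquivRel _ ray_rel_refl ray_rel_sym ray_rel_trans.

Definition sphere_bundle := quotient_topology {eq_quot ray_equiv}.

HB.instance Definition _ := Topological.on sphere_bundle.
HB.instance Definition _ := Quotient.on sphere_bundle.

Definition ray_class (a : pullback0) : sphere_bundle := \pi_sphere_bundle a.

Definition base_point (z : sphere_bundle) : M := (set_val (repr z)).1.

Definition continuous_flow (Phi : R -> sphere_bundle -> sphere_bundle) : Prop :=
  [/\ continuous (fun tz : R * sphere_bundle => Phi tz.1 tz.2),
      forall z, Phi 0 z = z
    & forall s t z, Phi (s + t) z = Phi s (Phi t z)].

Definition fitting_flow (Phi : R -> sphere_bundle -> sphere_bundle) : Prop :=
  continuous_flow Phi /\
  forall z t, 0 < t -> exists a b : pullback0,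
    [/\ z = ray_class a, Phi t z = ray_class b
      & form_positive ((set_val b).2 - (set_val a).2)].

(* w = (f, h) . z for the action (f, h) . (x, [q]) = (f x, [h . q]); stated as
   a relation, since (f, h) preserves the sphere bundle only if u is
   equivariant *)
Definition sphere_act (f : M -> M) (h : 'End(V)) (z w : sphere_bundle) : Prop :=
  exists a b : pullback0, [/\ z = ray_class a, w = ray_class b
    & set_val b = (f (set_val a).1, form_act h (set_val a).2)].

End SphereBundle.

Section Coverings.
Context {R : realType}.

Definition simply_connected (X : topologicalType) : Prop :=
  [/\ [set: X] !=set0,
      forall x y : X, exists c : R -> X,
        [/\ {within `[0, 1], continuous c}, c 0 = x & c 1 = y]
    & forall c : R -> X, {within `[0, 1], continuous c} -> c 0 = c 1 ->
        exists H : R * R -> X,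
          {within `[0, 1] `*` `[0, 1], continuous H} /\
          forall t, t \in `[0, 1] ->
            [/\ H (0, t) = c t, H (1, t) = c 0, H (t, 0) = c 0
              & H (t, 1) = c 0]].

Definition evenly_covered (E B : topologicalType) (p : E -> B) (U : set B) :=
  exists S : set (set E),
    [/\ p @^-1` U = \bigcup_(W in S) W, trivIset S id
      & forall W, S W -> open W /\
          exists s : B -> E, [/\ {within U, continuous s},
            forall y, U y -> W (s y) /\ p (s y) = y
            & forall z, W z -> s (p z) = z]].

Definition covering_map (E B : topologicalType) (p : E -> B) : Prop :=
  [/\ continuous p, forall y, exists x, p x = y
    & forall y, exists2 U, open_nbhs y U & evenly_covered p U].

Definition universal_cover (E B : topologicalType) (p : E -> B) : Prop :=
  covering_map p /\ simply_connected E.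

End Coverings.

Arguments simply_connected R X : clear implicits.
Arguments universal_cover R {E B} p.

Section Deck.
Context {E B : topologicalType} (p : E -> B).

Definition deck_transformation : set (E -> E) :=
  [set f | [/\ continuous f, p \o f = p
    & exists f' : E -> E, [/\ continuous f', cancel f f' & cancel f' f]]].

(* When p is a universal cover, this group is the fundamental group of B,
   acting on the cover. *)
Definition deck : Type := deck_transformation.
HB.instance Definition _ := Choice.on deck.

Definition deck_fun (a : deck) : E -> E := set_val a.
Coercion deck_fun : deck >-> Funclass.

Lemma deck_inj (a b : deck) : a =1 b -> a = b.
Proof. by move=> ab; apply: val_inj; apply/funext => x; exact: ab. Qed.

Lemma deck_one_subproof : deck_transformation id.
Proof.
have cid : continuous (id : E -> E) by move=> x; exact: cvg_id.
by split; [exact: cid | exact: funext | exists id].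
Qed.

Lemma deck_mul_subproof (a b : deck) : deck_transformation (a \o b).
Proof.
case: (set_valP a) => ca pa [a' [ca' aK a'K]].
case: (set_valP b) => cb pb [b' [cb' bK b'K]].
split.
- by move=> x; apply: continuous_comp; [exact: cb | exact: ca].
- by rewrite compA /deck_fun pa pb.
- exists (b' \o a'); split.
  + by move=> x; apply: continuous_comp; [exact: ca' | exact: cb'].
  + exact: (can_comp aK bK).
  + exact: (can_comp b'K a'K).
Qed.

Lemma deck_inv_ex (a : deck) :
  exists f, [/\ deck_transformation f, cancel a f & cancel f a].
Proof.
case: (set_valP a) => ca pa [a' [ca' aK a'K]]; exists a'; split=> //; split=> //.
  by apply/funext => x; rewrite -[in LHS]pa /= a'K.
by exists a; split.
Qed.

Definition deck_one : deck := SigSub (mem_set deck_one_subproof).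
Definition deck_mul (a b : deck) : deck :=
  SigSub (mem_set (deck_mul_subproof a b)).
Definition deck_inv (a : deck) : deck :=
  let: exist f Hf := cid (deck_inv_ex a) in
  let: And3 Hf _ _ := Hf in SigSub (mem_set Hf).

Fact deck_mulA : associative deck_mul.
Proof. by move=> a b c; apply: deck_inj. Qed.

Fact deck_mul1 : left_id deck_one deck_mul.
Proof. by move=> a; apply: deck_inj. Qed.

Fact deck_mulV : left_inverse deck_one deck_inv deck_mul.
Proof.
by move=> a; apply: deck_inj => x; rewrite /deck_inv; case: cid => f [? K ?]; exact: K.
Qed.

Fact deck_mul1r : right_id deck_one deck_mul.
Proof. by move=> a; apply: deck_inj. Qed.

Fact deck_mulrV : right_inverse deck_one deck_inv deck_mul.
Proof.
by move=> a; apply: deck_inj => x; rewrite /deck_inv; case: cid => f [? ? K]; exact: K.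
Qed.

HB.instance Definition _ := isGroup.Build deck
  deck_mulA deck_mul1 deck_mul1r deck_mulV deck_mulrV.

End Deck.

Section Manifolds.
Context {R : realType}.

Fixpoint Ck {V W : normedModType R} (k : nat) (U : set V) (f : V -> W) : Prop :=
  if k is k'.+1 then
    (forall x, U x -> differentiable f x) /\
    (forall v, Ck k' U (fun x => 'D_v f x))
  else forall x, U x -> {for x, continuous f}.

Definition smooth_on {V W : normedModType R} (U : set V) (f : V -> W) : Prop :=
  forall k, Ck k U f.

Record smooth_atlas (d : nat) (N : topologicalType) := SmoothAtlas {
  chart_index : Type;
  chart_dom : chart_index -> set N;
  chart : chart_index -> N -> 'rV[R]_d;
  chart_inv : chart_index -> 'rV[R]_d -> N;
  chart_at : N -> chart_index;
  chart_at_dom : forall x, chart_dom (chart_at x) x;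
  chart_dom_open : forall i, open (chart_dom i);
  chart_img_open : forall i, open (chart i @` chart_dom i);
  chartK : forall i x, chart_dom i x -> chart_inv i (chart i x) = x;
  chart_continuous : forall i x, chart_dom i x -> {for x, continuous (chart i)};
  chart_inv_continuous : forall i x, chart_dom i x ->
    {for chart i x, continuous (chart_inv i)};
  chart_transition_smooth : forall i j,
    smooth_on (chart i @` (chart_dom i `&` chart_dom j))
      (chart j \o chart_inv i)
}.

Definition closed_connected (N : topologicalType) : Prop :=
  [/\ hausdorff_space N, compact [set: N] & connected [set: N]].

Context {d : nat} {N : topologicalType} (A : smooth_atlas d N).

(* [g i y] is the Gram matrix at y of the metric read in the chart i. *)
Definition riemannian_metric (g : chart_index A -> 'rV[R]_d -> 'M[R]_d) : Prop :=
  [/\ forall i y, (chart i @` chart_dom i) y ->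
        (g i y)^T = g i y /\
        forall v : 'rV[R]_d, v != 0 -> 0 < (v *m g i y *m v^T) 0 0,
      forall i, smooth_on (chart i @` chart_dom i) (g i)
    & forall i j y (v w : 'rV[R]_d),
        (chart i @` (chart_dom i `&` chart_dom j)) y ->
        let tau := chart j \o chart_inv i in
        (v *m g i y *m w^T) 0 0 =
          ('D_v tau y *m g j (tau y) *m ('D_w tau y)^T) 0 0].

(* Curves are defined on all of R, also when only their restriction to [0, 1] is
   used: a C^1 curve on [0, 1] extends, and no one-sided derivatives are needed. *)
Definition C1_curve (c : R -> N) : Prop :=
  forall t i, chart_dom (s := A) i (c t) ->
    derivable (chart i \o c) t 1 /\ {for t, continuous (derive1 (chart i \o c))}.

Definition speed (g : chart_index A -> 'rV[R]_d -> 'M[R]_d) (c : R -> N) (t : R) : R :=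
  let i := chart_at A (c t) in
  let v := derive1 (chart i \o c) t in
  Num.sqrt ((v *m g i (chart i (c t)) *m v^T) 0 0).

Definition curve_length (g : chart_index A -> 'rV[R]_d -> 'M[R]_d) (c : R -> N) : R :=
  \int[lebesgue_measure]_(t in `[0, 1]) speed g c t.

(* The distance on E of the Riemannian metric p^*g, for a covering p : E -> N:
   p^*g gives a curve of E the length of its projection. *)
Definition lifted_distance (E : topologicalType) (p : E -> N)
    (g : chart_index A -> 'rV[R]_d -> 'M[R]_d) (x y : E) : R :=
  inf [set l | exists c : R -> E,
    [/\ continuous c, C1_curve (p \o c), c 0 = x, c 1 = y
      & l = curve_length g (p \o c)]].

End Manifolds.

Arguments smooth_atlas R d N : clear implicits.

Definition quasi_geodesic {R : realType} {X : Type} (dist : X -> X -> R)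
    (C D : R) (c : R -> X) : Prop :=
  forall t1 t2 : R,
    C^-1 * `|t1 - t2| - D <= dist (c t1) (c t2) <= C * `|t1 - t2| + D.

Section Equivariance.
Context {R : realType} {V : vectType R} {d : nat}.
Context {E B : topologicalType} {p : E -> B}.

Definition representation (vol : ('I_(\dim {:V}) -> V) -> R)
    (rho : deck p -> 'End(V)) : Prop :=
  (forall a, SL vol (rho a)) /\
  (forall a b, rho (a * b)%g = (rho a \o rho b)%VF).

Definition equivariant_map (rho : deck p -> 'End(V)) (u : E -> Gr V d) : Prop :=
  forall (a : deck p) x,
    [set q | q \in pencil (u (a x))] =
    form_act (rho a) @` [set q | q \in pencil (u x)].

Definition equivariant_flow (rho : deck p -> 'End(V)) (u : E -> Gr V d)
    (Phi : R -> sphere_bundle u -> sphere_bundle u) : Prop :=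
  forall (a : deck p) t z w,
    sphere_act a (rho a) z w -> sphere_act a (rho a) (Phi t z) (Phi t w).

End Equivariance.

(* Main.v *)
(* By mixedness every pencil u y is killed by a functional th that is positive on
   the nonzero positive semidefinite forms, and every nonzero element of a pencil
   is indefinite. By cocompactness the flow multiplies forms, up to scaling, by a
   definite factor mu > 1 per unit of time, in the sense that r' - mu r and
   r' - r/mu are positive. Compare sizes of forms by a rho-equivariant family of
   norms on V: along a curve of length l sizes change at most exponentially in l,
   while along a flow line of duration t they change by a factor at least mu^t;
   hence l is at least linear in t.

   For the second part, let th be positive on positive forms and killed by u y. A
   fitting flow strictly increases th, so long flow lines from x make th positive,
   and if th did not vanish on the disc swept out by them, it would retract the
   ball onto its boundary, against Brouwer. So th vanishes on u y' for some y' on a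
   flow line from x. The zero of th is unique: locally because the disc of short
   flow lines from a zero can be pushed off any other nearby zero, again
   contradicting Brouwer, and globally by continuation along segments in the convex
   set of functionals positive on positive forms. So y' = y. *)
Require Import Defs.
From HB Require Import structures.
From mathcomp Require Import all_boot all_order all_algebra.
From mathcomp Require Import ring lra zify.

Set Implicit Arguments.
Unset Strict Implicit.
Unset Printing Implicit Defensive.

Import Order.TTheory GRing.Theory Num.Theory.

Local Open Scope ring_scope.

(** * Kuhn's lemma and Brouwer's theorem *)

Section Kuhn.
Context {d : nat}.
Local Notation pt := {ffun 'I_d -> nat}.
Implicit Types (v w : pt) (D : {set 'I_d}) (c : pt -> 'F_2) (s : seq (pt -> 'F_2)) (i j : 'I_d).

(** Degree and transversality arguments are replaced by one analytic statement: a continuous field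
    on a ball that agrees with the identity on the boundary has a zero. To apply it over a disc in
    the cover, the bundle of pencils must be trivialized there; this is done by products of
    orthogonal projectors taken at finely spaced points, which asks only for continuity of [u].
    General position is replaced by counting: a Lipschitz map misses values arbitrarily close to 0
    on the boundary of a cube. The cover is not compact, yet all constants must be uniform. Hence an
    estimate is first proved near a point, in a form invariant under deck transformations, and then
    spread by compactness of the base. The norms need no continuity in the base point, since the
    bounds wanted are coarse. As [u] is only continuous, zeros are not continued by an implicit
    function theorem but in small steps: existence comes from flow discs, uniqueness holds within a
    fixed radius, and the admissible error is measured relatively to the functional itself. *)

Lemma addF2 (x : 'F_2) : x + x = 0.
Proof. by rewrite -mulr2n -mulr_natr (_ : 2%:R = 0) ?mulr0//; apply: val_inj. Qed.

Lemma addKF2 (a b c : 'F_2) : a + b + (b + c) = a + c.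
Proof. by rewrite addrA -(addrA a) addF2 addr0. Qed.

Definition shift (v : pt) (i : 'I_d) : pt := [ffun j => v j + (j == i)]%N.

Lemma shiftC v i j : shift (shift v i) j = shift (shift v j) i.
Proof. by apply/ffunP => k; rewrite !ffunE addnAC. Qed.

(* The cup product dc_1 u ... u dc_n, summed over all the monotone lattice
   paths from v whose steps use pairwise distinct directions of D. *)
Fixpoint cup (s : seq (pt -> 'F_2)) (D : {set 'I_d}) (v : pt) : 'F_2 :=
  if s is c :: s' then
    \sum_(i in D) (c (shift v i) + c v) * cup s' (D :\ i) (shift v i)
  else 1.

(** Every unordered pair is counted twice, and 2 = 0 in ['F_2]. *)
Lemma sum_sym_F2 (D : {set 'I_d}) (f : 'I_d -> 'I_d -> 'F_2) :
  (forall i j, f i j = f j i) -> \sum_(i in D) \sum_(j in D :\ i) f i j = 0.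
Proof.
move=> fC.
rewrite pair_big_dep/= (bigID (fun x : 'I_d * 'I_d => (x.1 < x.2)%N))/=.
rewrite [X in X + _](reindex_inj (h := fun x : 'I_d * 'I_d => (x.2, x.1)))/=; last first.
  by move=> [a b] [a' b'] [-> ->].
under eq_bigr do rewrite fC.
rewrite (eq_bigl (fun x : 'I_d * 'I_d =>
  ((x.1 \in D) && (x.2 \in D :\ x.1)) && ~~ (x.1 < x.2)%N)) ?addF2//.
move=> [a b] /=; rewrite !inE -leqNgt ltn_neqAle.
by case: (a \in D); case: (b \in D); rewrite ?andbF//= ?andbT eq_sym;
  rewrite -val_eqE/=; case: eqP.
Qed.

(** A product of differentials is closed: comparing opposite faces of the cell, the two orders of
    any pair of steps contribute equally and cancel. *)
Lemma cup_cocycle s D v :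
  \sum_(j in D) (cup s (D :\ j) (shift v j) + cup s (D :\ j) v) = 0.
Proof.
elim: s D v => [|c s IH] D v /=.
  by rewrite big1// => i _; rewrite addF2.
rewrite big_split/=.
have -> : \sum_(j in D) \sum_(i in D :\ j)
    (c (shift v i) + c v) * cup s (D :\ j :\ i) (shift v i) =
  \sum_(j in D) \sum_(i in D :\ j)
    (c (shift v j) + c v) * cup s (D :\ j :\ i) (shift (shift v j) i).
  rewrite (exchange_big_dep (mem D))/=; last first.
    by move=> i j _; rewrite !inE => /andP[].
  apply: eq_bigr => i iD.
  transitivity (\sum_(j in D :\ i)
      (c (shift v i) + c v) * cup s (D :\ i :\ j) (shift v i)).
    apply: eq_big => [j|j _]; last by rewrite !setDDl setUC.
    by rewrite !inE iD andbT eq_sym andbC.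
  rewrite -!big_distrr/=; congr (_ * _).
  apply/eqP; rewrite -subr_eq0 -sumrB -[X in _ == X](IH (D :\ i) (shift v i)).
  apply/eqP; apply: eq_bigr => j _; rewrite addrC; congr (_ + _).
  by apply/eqP; rewrite eq_sym -subr_eq0 opprK addF2.
rewrite -big_split/=.
under eq_bigr do rewrite -big_split/=.
under eq_bigr => i _ do under eq_bigr => j _ do rewrite -mulrDl.
apply: sum_sym_F2 => i j; rewrite shiftC !setDDl setUC; congr (_ * _).
by rewrite !addKF2.
Qed.

(** Stokes on one cell: since the product over [s] is closed by [cup_cocycle], multiplying it by the
    differential of [c] gives the coboundary of [c] times that product. *)
Lemma cup_stokes c s D v :
  cup (c :: s) D v = \sum_(i in D)
    (c (shift v i) * cup s (D :\ i) (shift v i) + c v * cup s (D :\ i) v).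
Proof.
rewrite big_split/= -[X in _ + X]mulr_sumr.
have /eqP := cup_cocycle s D v; rewrite big_split/= addr_eq0 => /eqP E.
have -> : \sum_(i in D) cup s (D :\ i) v = \sum_(i in D) cup s (D :\ i) (shift v i).
  rewrite E; apply/eqP; rewrite eq_sym -subr_eq0 -opprD oppr_eq0 addF2//.
rewrite mulr_sumr -big_split/=; apply: eq_bigr => i _; by rewrite mulrDl.
Qed.

(** A path with steps in [D] never changes the coordinate [j], so the factor coming from [c]
    vanishes along it. *)
Lemma cup_const s (D : {set 'I_d}) v (c : pt -> 'F_2) (j : 'I_d) :
  List.In c s -> j \notin D ->
  (forall w w' : pt, w j = v j -> w' j = v j -> c w = c w') -> cup s D v = 0.
Proof.
elim: s D v => [//|c' s IH] D v /= [<-|cs] jD cc.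
  apply: big1 => i iD; rewrite (cc (shift v i) v) ?addF2 ?mul0r//.
  rewrite ffunE; case: eqP => [ji|_]; last by rewrite addn0.
  by rewrite ji iD in jD.
apply: big1 => i iD; rewrite IH ?mulr0//; first by rewrite !inE (negPf jD) andbF.
move=> w w'; rewrite ffunE; case: eqP => [ji|_]; last by rewrite addn0; exact: cc.
by rewrite ji iD in jD.
Qed.

(** A nonzero summand is a lattice path inside the cell on which every label changes across some
    edge. *)
Lemma cup_neq0 s D v c : cup s D v != 0 -> List.In c s ->
  exists w w' : pt, [/\ forall j, (v j <= w j <= v j + (j \in D))%N,
    forall j, (v j <= w' j <= v j + (j \in D))%N & c w != c w'].
Proof.
elim: s D v => [//|c' s IH] D v /= H.
have [i iD] : exists2 i, i \in D &
   (c' (shift v i) + c' v) * cup s (D :\ i) (shift v i) != 0.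
  apply/exists_inP; apply: contraNT H => /exists_inPn H.
  by apply/eqP; apply: big1 => i iD; apply/eqP; have := H i iD; rewrite negbK.
rewrite mulf_eq0 negb_or => /andP[H1 H2] [<-|cs].
  exists (shift v i), v; split.
  - move=> j; rewrite ffunE leq_addr/= leq_add2l; case: eqP => // ->.
    by rewrite iD.
  - by move=> j; rewrite leqnn leq_addr.
  - by apply: contra H1 => /eqP ->; rewrite addF2.
have [w [w' [h1 h2 h3]]] := IH _ _ H2 cs.
have aux (w0 : pt) j : (shift v i j <= w0 j <= shift v i j + (j \in D :\ i))%N ->
   (v j <= w0 j <= v j + (j \in D))%N.
  rewrite ffunE !inE; case: eqP => [->|_]/=; last by rewrite addn0.
  by rewrite iD addn0 => /andP[h ->]; rewrite (leq_trans _ h)// leq_addr.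
by exists w, w'; split => // j; apply: aux.
Qed.

Section Grid.
Context {p : nat}.
Local Notation ipt := {ffun 'I_d -> 'I_p.+1}.

Definition nat_pt (a : ipt) : pt := [ffun j => a j : nat].

(** Lower corners of the cells of dimension [#|D|] that lie in the face of the grid where all
    coordinates outside [D] equal [p]. *)
Definition grid_cell (D : {set 'I_d}) (a : ipt) :=
  [forall j, if j \in D then (a j < p)%N else a j == p :> nat].

Definition upd (v : pt) i t : pt := [ffun j => if j == i then t else v j].

Lemma sum_telescope D i (f : pt -> 'F_2) : i \in D ->
  \sum_(a | grid_cell D a) (f (shift (nat_pt a) i) + f (nat_pt a)) =
  \sum_(a | grid_cell (D :\ i) a) (f (nat_pt a) + f (upd (nat_pt a) i 0)).
Proof.
move=> iD.
(* The cells are grouped into lines parallel to the direction [i], each line being indexed by its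
   last point. *)
pose up (a : ipt) (t : 'I_p.+1) : ipt := [ffun j => if j == i then t else a j].
rewrite (partition_big (fun a => up a ord_max) (grid_cell (D :\ i)))/=; last first.
  move=> a /forallP ca; apply/forallP => j; have := ca j; rewrite !inE ffunE.
  by case: (j == i) => //= _; rewrite eqxx.
apply: eq_bigr => a /forallP ca.
have ai : a i = ord_max.
  by have := ca i; rewrite !inE eqxx/= => /eqP ?; apply: val_inj.
rewrite (reindex_onto (up a) (fun a' => a' i))/=; last first.
  move=> a' /andP[_ /eqP <-]; apply/ffunP => j; rewrite !ffunE.
  by case: eqP => [->|].
rewrite (eq_bigl (fun t : 'I_p.+1 => (t < p)%N)); last first.
  move=> t; apply/idP/idP => [/andP[/andP[/forallP/(_ i)]]|tp].
    by rewrite iD ffunE eqxx.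
  rewrite ffunE !eqxx andbT; apply/andP; split.
    apply/forallP => j; rewrite ffunE; case: eqP => [->|/eqP ji]; first by rewrite iD.
    by have := ca j; rewrite !inE ji.
  by apply/eqP/ffunP => j; rewrite !ffunE; case: eqP => [->|].
pose g (t : nat) := f (upd (nat_pt a) i t).
transitivity (\sum_(t < p.+1 | (t < p)%N) (g t.+1 + g t)).
  apply: eq_bigr => t _; congr (f _ + f _); apply/ffunP => j; rewrite !ffunE;
  by case: eqP; rewrite ?addn1 ?addn0.
rewrite -(big_ord_widen _ (fun t => g t.+1 + g t) (leqnSn p)).
have -> : f (nat_pt a) = g p.
  congr f; apply/ffunP => j; rewrite !ffunE; case: eqP => [->|//].
  by rewrite ai.
have -> : f (upd (nat_pt a) i 0) = g 0%N by [].
clearbody g; elim: p {ai ca up a f} => [|n IHn].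
  by rewrite big_ord0 addF2.
by rewrite big_ord_recr/= IHn addrC addKF2.
Qed.

(** Induction on the codimension [k] of the face. By Stokes only its boundary counts: on faces
    normal to some [i > k] a later factor is constant, and of the two faces normal to [k] the label
    [c] kills the one at 0 and keeps the one at [p] with weight 1. *)
Lemma cup_grid (k : nat) (s : seq (pt -> 'F_2)) :
  (0 < p)%N -> size s = (d - k)%N -> (k <= d)%N ->
  (forall (n : nat) (i : 'I_d) (v : pt), i = (k + n)%N :> nat ->
     v i = 0%N -> nth (fun=> 0) s n v = 0) ->
  (forall (n : nat) (i : 'I_d) (v : pt), i = (k + n)%N :> nat ->
     v i = p -> nth (fun=> 0) s n v = 1) ->
  \sum_(a | grid_cell [set i : 'I_d | (k <= i)%N] a)
     cup s [set i : 'I_d | (k <= i)%N] (nat_pt a) = 1.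
Proof.
move=> p0; elim: s k => [|c s IH] k /= Hs kd H0 H1.
  rewrite (big_pred1 [ffun=> ord_max]) => [//|a /=].
  have dk : k = d by apply/eqP; rewrite eqn_leq kd/= -subn_eq0 -Hs.
  apply/forallP/eqP => [ca|->].
    apply/ffunP => j; have := ca j; rewrite inE leqNgt dk ltn_ord/= ffunE => /eqP ?.
    exact: val_inj.
  by move=> j; rewrite inE leqNgt dk ltn_ord/= ffunE/=.
have {kd}kd : (k < d)%N by rewrite -subn_gt0 -Hs.
pose io := Ordinal kd.
have DE : [set i : 'I_d | (k <= i)%N] :\ io = [set i : 'I_d | (k.+1 <= i)%N].
  by apply/setP => i; rewrite !inE ltn_neqAle -val_eqE/= eq_sym.
under eq_bigr do rewrite -/(cup (c :: s) _ _) cup_stokes.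
rewrite exchange_big/= (bigD1 io)/=; last by rewrite inE.
rewrite [X in _ + X]big1 ?addr0; last first.
  move=> i; rewrite inE => /andP[ki iio].
  rewrite (@sum_telescope _ _ (fun v => c v * cup s _ v)) ?inE//.
  apply: big1 => a /forallP ca.
  have [m im] : exists m, i = (k + m.+1)%N :> nat.
    exists (i - k.+1)%N; rewrite addnS -addSn subnKC//.
    by rewrite ltn_neqAle ki andbT eq_sym -val_eqE/= in iio *.
  have ms : (m < size s)%N.
    have : (i < d)%N by []. 
    by rewrite im; move: Hs => /= Hs; rewrite -ltn_subRL -Hs ltnS.
  have cin : List.In (nth (fun=> 0) s m) s.
    by elim: s m ms {IH Hs H0 H1 im} => [//|c' s IH] [|m] /= ms; [left|right; exact: IH].
  have iD : i \notin [set i0 : 'I_d | (k <= i0)%N] :\ i by rewrite !inE eqxx.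
  rewrite (cup_const cin iD) ?mulr0 ?add0r; last first.
    have E : nat_pt a i = p.
      by have := ca i; rewrite !inE eqxx/= ffunE => /eqP.
    rewrite E => w w' wi w'i.
    by rewrite -[nth _ s m w]/(nth _ (c :: s) m.+1 w) -[nth _ s m w']/(nth _ (c :: s) m.+1 w') !(H1 m.+1 i).
  rewrite (cup_const cin iD) ?mulr0//.
  rewrite ffunE eqxx => w w' wi w'i.
  by rewrite -[nth _ s m w]/(nth _ (c :: s) m.+1 w) -[nth _ s m w']/(nth _ (c :: s) m.+1 w') !(H0 m.+1 i).
rewrite (@sum_telescope _ _ (fun v => c v * cup s _ v)) ?inE//= DE.
rewrite -[RHS](IH k.+1)//.
- apply: eq_bigr => a /forallP ca.
  rewrite -[c (nat_pt a)]/(nth (fun=> 0) (c :: s) 0 (nat_pt a)).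
  rewrite -[c (upd _ _ _)]/(nth (fun=> 0) (c :: s) 0 (upd (nat_pt a) io 0)).
  rewrite (H1 0%N io (nat_pt a)) ?addn0 ?mul1r//; last first.
    by have := ca io; rewrite !inE/= ltnn ffunE => /eqP.
  by rewrite (H0 0%N io (upd _ _ _)) ?addn0 ?mul0r ?addr0// ffunE eqxx.
- by rewrite subnS -Hs.
- by move=> n i v ik; apply: (H0 n.+1 i); rewrite ik addSnnS.
- by move=> n i v ik; apply: (H1 n.+1 i); rewrite ik addSnnS.
Qed.

(** The product of the differentials of all labels sums to 1 over the grid, so it is nonzero on some
    cell, and there every label takes both values. *)
Lemma kuhn (l : 'I_d -> pt -> bool) : (0 < p)%N ->
  (forall i v, v i = 0%N -> l i v = false) ->
  (forall i v, v i = p -> l i v = true) ->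
  exists v : pt, (forall i, v i < p)%N /\
    forall i, exists w w' : pt, [/\ forall j, (v j <= w j <= (v j).+1)%N,
      forall j, (v j <= w' j <= (v j).+1)%N & l i w != l i w'].
Proof.
move=> p0 l0 l1.
pose b2F (b : bool) : 'F_2 := b%:R.
pose s := [seq (fun v => b2F (l i v)) | i <- enum 'I_d].
have nths n (i : 'I_d) v : i = (0 + n)%N :> nat -> nth (fun=> 0) s n v = b2F (l i v).
  rewrite add0n => <-; rewrite (nth_map i) ?size_enum_ord//.
  by rewrite nth_ord_enum.
have : \sum_(a | grid_cell [set i : 'I_d | (0 <= i)%N] a)
     cup s [set i : 'I_d | (0 <= i)%N] (nat_pt a) = 1.
  apply: cup_grid => //.
  - by rewrite size_map size_enum_ord subn0.
  - by move=> n i v ik vi; rewrite (nths _ i)// l0.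
  - by move=> n i v ik vi; rewrite (nths _ i)// l1.
move=> S1.
have [a ca na] : exists2 a, grid_cell [set i : 'I_d | (0 <= i)%N] a &
     cup s [set i : 'I_d | (0 <= i)%N] (nat_pt a) != 0.
  apply/exists_inP; apply: contraT => /exists_inPn H.
  have : (1 : 'F_2) != 0 by apply: oner_neq0.
  rewrite -S1 big1 ?eqxx// => a ca; apply/eqP.
  by have := H a ca; rewrite negbK.
exists (nat_pt a); split.
  by move=> i; move/forallP: ca => /(_ i); rewrite inE/= ffunE.
move=> i.
have cin : List.In (fun v => b2F (l i v)) s.
  rewrite /s; have : i \in enum 'I_d by rewrite mem_enum.
  elim: (enum 'I_d) => [//|j r IH] /=; rewrite in_cons => /orP[/eqP ->|/IH]; by [left|right].
have [w [w' [h1 h2 h3]]] := cup_neq0 na cin.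
exists w, w'; split.
- by move=> j; have := h1 j; rewrite inE/= addn1.
- by move=> j; have := h2 j; rewrite inE/= addn1.
- by apply: contra h3 => /eqP ->.
Qed.
End Grid.
End Kuhn.

From mathcomp Require Import all_classical all_reals all_analysis.

Import numFieldNormedType.Exports.

Local Open Scope classical_set_scope.
Local Open Scope ring_scope.

(** * Continuity and compactness in spaces of matrices *)

Lemma open_comp_near {T U : topologicalType} (f : T -> U) (A : set U) x :
  {for x, continuous f} -> open A -> A (f x) -> \forall y \near x, A (f y).
Proof. by move=> fc oA Af; apply: fc; exact: open_nbhs_nbhs. Qed.

Lemma cont_pair {S T U : topologicalType} (f : S -> T) (g : S -> U) s :
  {for s, continuous f} -> {for s, continuous g} ->
  {for s, continuous (fun x => (f x, g x))}.
Proof. by move=> cf cg; exact: (cvg_pair cf cg). Qed.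

Lemma cont_comp {S T U : topologicalType} (f : S -> T) (g : T -> U) s :
  {for s, continuous f} -> {for f s, continuous g} ->
  {for s, continuous (fun x => g (f x))}.
Proof. exact: continuous_comp. Qed.

Lemma cont_near_eq {X Y : topologicalType} (f g : X -> Y) x :
  (\forall x' \near x, f x' = g x') -> {for x, continuous g} -> {for x, continuous f}.
Proof.
move=> fg cg V; rewrite /= (nbhs_singleton fg) => /cg gV.
have h : \forall x' \near x, V (g x') by [].
suff : \forall x' \near x, V (f x') by [].
by apply: filterS2 fg h => x' ->.
Qed.

Lemma cont_slice_l {X Y Z : topologicalType} (H : X -> Y -> Z) y :
  continuous (fun z : X * Y => H z.1 z.2) -> continuous (fun x => H x y).
Proof.
move=> cH x; apply: (@cont_comp _ _ _ (fun x => (x, y)) (fun z => H z.1 z.2)) (cH _).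
exact: cont_pair (@cvg_id _ (nbhs x)) (@cvg_cst _ y _ (nbhs x) _).
Qed.

Lemma cont_slice_r {X Y Z : topologicalType} (H : X -> Y -> Z) x :
  continuous (fun z : X * Y => H z.1 z.2) -> continuous (H x).
Proof.
move=> cH y; apply: (@cont_comp _ _ _ (fun y => (x, y)) (fun z => H z.1 z.2)) (cH _).
exact: cont_pair (@cvg_cst _ x _ (nbhs y) _) (@cvg_id _ (nbhs y)).
Qed.

Lemma compact_unif {X : topologicalType} {I : Type} (K : set X) (F : set_system I)
  {FF : Filter F} (P : I -> X -> Prop) : compact K ->
  (forall x, K x -> \forall x' \near x & i \near F, P i x') ->
  \forall i \near F, K `<=` P i.
Proof. by move=> /compact_near_coveringP cK; exact: cK. Qed.

Section RowVectors.
Context {R : realType}.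

Lemma cont_addr {V : normedModType R} (x0 : V) : continuous (fun w : V => w + x0).
Proof. by move=> v; apply: cvgD; [exact: cvg_id|exact: cvg_cst]. Qed.

Lemma cont_norm_sub {V : normedModType R} (x0 : V) : continuous (fun w : V => `|w - x0|).
Proof.
move=> v; apply: (@cont_comp _ _ _ (fun w : V => w - x0) (fun w : V => `|w|)).
  exact: cont_addr.
exact: norm_continuous.
Qed.

Lemma rV_normleP {n} (w : 'rV[R]_n) (e : R) : 0 <= e ->
  (forall i, `|w 0 i| <= e) <-> `|w| <= e.
Proof.
move=> e0; rewrite [`|w|]/Num.norm/= mx_normrE; split=> [h|/bigmax_leP[_ h] i].
  by apply/bigmax_leP; split => // -[i j] _ /=; rewrite ord1.
exact: (h (0, i)).
Qed.

Lemma rV_coord_le {n} (w : 'rV[R]_n) i : `|w 0 i| <= `|w|.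
Proof. by move: i; apply/rV_normleP. Qed.

Lemma rV_norm_attained {n} (w : 'rV[R]_n) : 0 < `|w| -> exists i, `|w 0 i| = `|w|.
Proof.
move=> w0; have [|[i j] E] := @mx_norm_neq0 _ _ _ w; first by rewrite gt_eqF.
by exists j; rewrite [in RHS]/Num.norm/= E/= ord1.
Qed.

Lemma near_lt {T : topologicalType} (f : T -> R) x c :
  {for x, continuous f} -> f x < c -> \forall y \near x, f y < c.
Proof.
by move=> fc fx; apply: (open_comp_near _ (@open_lt R c)).
Qed.

Lemma near_gt {T : topologicalType} (f : T -> R) x c :
  {for x, continuous f} -> c < f x -> \forall y \near x, c < f y.
Proof.
by move=> fc fx; apply: (open_comp_near _ (@open_gt R c)).
Qed.

Lemma cvg_coord {T} {F : set_system T} {FF : Filter F} {m n} (f : T -> 'M[R]_(m, n))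
  (l : 'M[R]_(m, n)) i j : f t @[t --> F] --> l -> f t i j @[t --> F] --> l i j.
Proof. move=> fl; apply: (cvg_comp _ (fun M : 'M[R]_(m, n) => M i j) fl).
exact: coord_continuous. Qed.

Lemma cvg_mx {T} {F : set_system T} {FF : Filter F} {m n} (f : T -> 'M[R]_(m, n))
  (l : 'M[R]_(m, n)) :
  (forall i j, f t i j @[t --> F] --> l i j) -> f t @[t --> F] --> l.
Proof.
move=> fl A [P lP PA]; near=> t; apply: PA => i j; move: (i) (j).
near: t; apply: filter_forall => {}i; apply: filter_forall => {}j.
exact: (fl _ _ _ (lP i j)).
Unshelve. all: by end_near. Qed.

Lemma cvg_bigsum {T} {F : set_system T} {FF : Filter F} {V : normedModType R} {I : finType}
  (P : pred I) (f : I -> T -> V) (l : I -> V) :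
  (forall i, P i -> f i t @[t --> F] --> l i) ->
  \sum_(i | P i) f i t @[t --> F] --> \sum_(i | P i) l i.
Proof.
move=> fl; elim: (index_enum I) => [|i s IH].
  by rewrite big_nil; under eq_cvg do rewrite big_nil; exact: cvg_cst.
rewrite big_cons; under eq_cvg do rewrite big_cons.
by case: ifP => // /fl fi; exact: cvgD.
Qed.

Lemma cvg_mulmx {T} {F : set_system T} {FF : Filter F} {m n p}
  (f : T -> 'M[R]_(m, n)) (g : T -> 'M[R]_(n, p)) (a : 'M[R]_(m, n)) (b : 'M[R]_(n, p)) :
  f t @[t --> F] --> a -> g t @[t --> F] --> b -> f t *m g t @[t --> F] --> a *m b.
Proof.
move=> fa gb; apply: cvg_mx => i j; rewrite mxE.
under eq_cvg do rewrite mxE.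
by apply: cvg_bigsum => k _; apply: cvgM; exact: cvg_coord.
Qed.

Lemma cvg_trmx {T} {F : set_system T} {FF : Filter F} {m n}
  (f : T -> 'M[R]_(m, n)) (a : 'M[R]_(m, n)) : f t @[t --> F] --> a -> (f t)^T @[t --> F] --> a^T.
Proof.
move=> fa; apply: cvg_mx => i j; rewrite mxE.
by under eq_cvg do rewrite mxE; exact: cvg_coord.
Qed.

Lemma cvg_prod_fin {T} {F : set_system T} {FF : Filter F} {I : finType}
  (f : I -> T -> R) (l : I -> R) :
  (forall i, f i t @[t --> F] --> l i) ->
  \prod_i f i t @[t --> F] --> \prod_i l i.
Proof.
move=> fl; elim: (index_enum I) => [|i s IH].
  by rewrite big_nil; under eq_cvg do rewrite big_nil; exact: cvg_cst.
by rewrite big_cons; under eq_cvg do rewrite big_cons; exact: cvgM.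
Qed.

Lemma cvg_det {T} {F : set_system T} {FF : Filter F} {n}
  (f : T -> 'M[R]_n) (a : 'M[R]_n) : f t @[t --> F] --> a -> \det (f t) @[t --> F] --> \det a.
Proof.
move=> fa; rewrite /determinant; apply: cvg_bigsum => s _.
by apply: cvgM; [exact: cvg_cst|apply: cvg_prod_fin => i; exact: cvg_coord].
Qed.

Lemma cvg_invmx {T} {F : set_system T} {FF : Filter F} {n}
  (f : T -> 'M[R]_n) (a : 'M[R]_n) : f t @[t --> F] --> a -> a \in unitmx ->
  (forall t, f t \in unitmx) -> invmx (f t) @[t --> F] --> invmx a.
Proof.
move=> fa ua uf; rewrite /invmx ua.
under eq_cvg do rewrite uf.
apply: cvg_mx => i j; rewrite !mxE; under eq_cvg do rewrite !mxE.
rewrite /cofactor; apply: cvgM; first apply: cvgV.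
- by have := ua; rewrite unitmxE unitfE.
- exact: cvg_det.
apply: cvgM; first exact: cvg_cst.
apply: cvg_det; apply: cvg_mx => k l; rewrite !mxE.
by under eq_cvg do rewrite !mxE; exact: cvg_coord.
Qed.

Lemma rV_closed_ball_compact {n} (r : R) : compact [set w : 'rV[R]_n | `|w| <= r].
Proof.
apply: bounded_closed_compact.
  by exists r; split => [|x rx y /= /le_trans]; [exact: num_real|apply; exact: ltW].
apply: (@closed_comp _ _ (fun w : 'rV[R]_n => `|w|) [set x | x <= r]).
  by move=> w _; exact: norm_continuous.
exact: closed_le.
Qed.

Lemma rV_closed_ball_compact_at {n} (x0 : 'rV[R]_n) (r : R) :
  compact [set w : 'rV[R]_n | `|w - x0| <= r].
Proof.
apply: bounded_closed_compact.
  exists (`|x0| + r); split => [|x rx y /= yr]; first exact: num_real.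
  rewrite ltW// (le_lt_trans _ rx)// -[y](subrK x0) addrC.
  by rewrite (le_trans (ler_normD _ _))// lerD2l.
have h : continuous (fun w : 'rV[R]_n => `|w - x0|).
  exact: cont_norm_sub.
by apply: (@closed_comp _ _ _ [set x | x <= r]) => [w _|]; [exact: h|exact: closed_le].
Qed.

Lemma rV_sphere_compact {n} (r : R) : compact [set w : 'rV[R]_n | `|w| = r].
Proof.
apply: (subclosed_compact _ (@rV_closed_ball_compact n r)).
  apply: (@closed_comp _ _ (fun w : 'rV[R]_n => `|w|) [set x | x = r]).
    by move=> w _; exact: norm_continuous.
  exact: closed_eq.
by move=> w /= ->.
Qed.

End RowVectors.

Section Brouwer.
Context {R : realType}.

(* Poincare-Miranda, by Kuhn's lemma applied to the signs of the coordinates of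
   f on fine grids. *)
Lemma brouwer_zero {d} (f : 'rV[R]_d -> 'rV[R]_d) :
  continuous f ->
  (forall (w : 'rV[R]_d) i, `|w| <= 2 -> `|w 0 i| = 2 -> f w 0 i = w 0 i) ->
  exists2 w : 'rV[R]_d, `|w| <= 2 & f w = 0.
Proof.
move=> fc fb; apply: contrapT => nf.
have {}nf (w : 'rV[R]_d) : `|w| <= 2 -> f w != 0.
  by move=> w2; apply/eqP => fw; apply: nf; exists w.
(* If [f] has no zero, near each point some coordinate of [f] keeps its sign, at a scale uniform by
   compactness. The radius [5 / n.+1] exceeds the side [4 / n.+1] of the cells of the grid [X]. *)
pose P (n : nat) (x : 'rV[R]_d) := exists i,
  (forall y : 'rV[R]_d, `|x - y| <= 5 / n.+1%:R -> 0 < f y 0 i) \/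
  (forall y : 'rV[R]_d, `|x - y| <= 5 / n.+1%:R -> f y 0 i < 0).
have [n _ nP] : \forall n \near \oo, [set w : 'rV[R]_d | `|w| <= 2] `<=` P n.
  have /compact_near_coveringP := @rV_closed_ball_compact R d 2; apply => x /= x2.
  have [i fi] : exists i, f x 0 i != 0.
    have := nf _ x2; apply: contraNP => /forallNP h; apply/eqP/rowP => i.
    by rewrite mxE; apply/eqP; have := h i; case: eqP.
  have fic : {for x, continuous (fun y => f y 0 i)}.
    exact: cvg_coord (fc x).
  have [e e0 he] : exists2 e : R, 0 < e &
      (forall y : 'rV[R]_d, `|x - y| < e -> 0 < f y 0 i) \/ (forall y : 'rV[R]_d, `|x - y| < e -> f y 0 i < 0).
    have [fi0|fi0|fi0] := ltgtP (f x 0 i) 0; last by rewrite fi0 eqxx in fi.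
      have /nbhs_ballP[e /= e0 h] : \forall y \near x, f y 0 i < 0.
        exact: (near_lt fic).
      exists e => //; right => y xy; apply: h.
      by rewrite -ball_normE.
    have /nbhs_ballP[e /= e0 h] : \forall y \near x, 0 < f y 0 i.
      exact: (near_gt fic).
    by exists e => //; left => y xy; apply: h; rewrite -ball_normE.
  exists (ball x (e / 2), [set n | 5 / n.+1%:R < e / 2]).
    split; first by apply: nbhsx_ballx; lra.
    have e10 : 0 < e / 10 by lra.
    have := near_infty_natSinv_lt (PosNum e10); apply: filterS => n /= h.
    by rewrite (_ : e / 2 = 5 * (e / 10)) ?ltr_pM2l//; field.
  move=> [y m] [/=]; rewrite -ball_normE/= => xy me.
  exists i; have aux (z : 'rV[R]_d) : `|y - z| <= 5 / m.+1%:R -> `|x - z| < e.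
    move=> yz; rewrite (le_lt_trans (ler_distD y _ _))// (splitr e) ltrD//.
    exact: le_lt_trans yz me.
  by case: he => he; [left|right] => z /aux; exact: he.
pose X (v : {ffun 'I_d -> nat}) : 'rV[R]_d := \row_i (-2 + 4 * (v i)%:R / n.+1%:R).
have n0 : 0 < n.+1%:R :> R by rewrite ltr0n.
(* The labels are forced on the faces as [kuhn] demands; by the boundary condition on [f] the forced
   values agree with its sign, which is [lE]. *)
pose l i (v : {ffun 'I_d -> nat}) := if v i == 0%N then false else
  if v i == n.+1 then true else 0 < f (X v) 0 i.
have [||v [vp hv]] := @kuhn d n.+1 l (ltn0Sn n).
- by move=> i v; rewrite /l => ->.
- by move=> i v; rewrite /l => ->; rewrite eqxx.
have X2 (w : {ffun 'I_d -> nat}) : (forall j, v j <= w j <= (v j).+1)%N -> `|X w| <= 2.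
  move=> h; apply/rV_normleP => // i; rewrite mxE.
  have /andP[_ hi] := h i; have hw : (w i <= n.+1)%N by apply: leq_trans hi (vp i).
  have : 0 <= (w i)%:R / n.+1%:R :> R /\ (w i)%:R / n.+1%:R <= 1 :> R.
    by split; rewrite ?divr_ge0// ler_pdivrMr// mul1r ler_nat.
  rewrite ler_norml -mulrA; move: (_ / _) => q [? ?]; apply/andP; split; lra.
have lE i (w : {ffun 'I_d -> nat}) : (forall j, v j <= w j <= (v j).+1)%N ->
    l i w = (0 < f (X w) 0 i).
  move=> h; rewrite /l; case: eqP => [wi0|_].
    have E : X w 0 i = -2 by rewrite mxE wi0 mulr0 mul0r addr0.
    by rewrite fb ?X2// E ?normrN ?normr_nat//; apply/esym/negbTE; lra.
  case: eqP => [wi0|//].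
  have E : X w 0 i = 2 by rewrite mxE wi0; field; rewrite gt_eqF.
  by rewrite fb ?X2// E ?normr_nat// ltr0n.
have dX (w : {ffun 'I_d -> nat}) : (forall j, v j <= w j <= (v j).+1)%N ->
    `|X v - X w| <= 5 / n.+1%:R.
  move=> h; apply/rV_normleP => [|i]; first by rewrite divr_ge0.
  rewrite !mxE; have /andP[h1 h2] := h i.
  have -> : -2 + 4 * (v i)%:R / n.+1%:R - (-2 + 4 * (w i)%:R / n.+1%:R)
     = - (4 * ((w i)%:R - (v i)%:R)) / n.+1%:R :> R by field; rewrite gt_eqF.
  rewrite normrM normrN normrM [`|_^-1|]ger0_norm ?invr_ge0// ler_wpM2r ?invr_ge0//.
  rewrite -natrB// [X in _ * X]ger0_norm// ger0_norm//.
  have : (w i - v i)%:R <= 1 :> R by rewrite (_ : 1 = 1%:R)// ler_nat leq_subLR addn1.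
  lra.
have [|i iP] := nP n (leqnn n) (X v); first by apply: X2 => j; rewrite leqnn/=.
have [w [w' [hw hw']]] := hv i; rewrite !lE//.
case: iP => iP.
  by rewrite !iP ?dX.
by rewrite !ltNge !(ltW (iP _ _)) ?dX.
Qed.
End Brouwer.

(** * Coverings and deck transformations *)

Section Connectedness.
Context {T : topologicalType}.

(** A locally constant property holds on a relatively open and closed subset of [A]. The
    continuation arguments below, in time or in space, are mostly reduced to this. *)
Lemma connected_ind (A : set T) (P : T -> Prop) (t0 : T) :
  connected A ->
  (forall t, A t -> \forall t' \near t, A t' -> (P t' <-> P t)) ->
  A t0 -> P t0 -> forall t, A t -> P t.
Proof.
move=> cA loc At0 Pt0.
suff E : A `&` P = A by move=> t; rewrite -[A t]/(A t) -E => -[].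
apply: cA.
- by exists t0.
- exists [set t | A t -> P t]°; first exact: open_interior.
  rewrite predeqE => t; split => [[At Pt]|[At /interior_subset Pt]].
    split=> //; have := loc t At; rewrite /interior/=.
    by apply: filterS => t' h /h [_]; exact.
  by split=> //; exact: Pt.
- exists (~` [set t | A t -> ~ P t]°); first exact/open_closedC/open_interior.
  rewrite predeqE => t; split => [[At Pt]|[At Pt]].
    by split=> // /interior_subset/(_ At).
  split=> //; apply: contrapT => nPt; apply: Pt.
  have := loc t At; rewrite /interior/=.
  by apply: filterS => t' h At' Pt'; apply: nPt; apply/h.
Qed.

Lemma within_comp {S U : topologicalType} (A : set T) (f : T -> U) (g : S -> T) :
  {within A, continuous f} -> continuous g -> (forall s, A (g s)) ->
  continuous (f \o g).
Proof.
move=> /subspace_continuousP cf cg Ag s V fV.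
have h : nbhs (g s) [set y | A y -> V (f y)] := cf _ (Ag s) V fV.
suff : \forall s' \near s, V (f (g s')) by [].
have h2 : \forall s' \near s, [set y | A y -> V (f y)] (g s') := cg s _ h.
by apply: filterS h2 => s' /=; apply; exact: Ag.
Qed.

End Connectedness.

Section Paths.
Context {R : realType}.

Lemma cont_if {X : topologicalType} (f g : R -> X) (a : R) :
  continuous f -> continuous g -> f a = g a ->
  continuous (fun t => if t <= a then f t else g t).
Proof.
move=> cf cg fg t U Ut.
suff : \forall x \near t, U (if x <= a then f x else g x) by [].
have [ta|ta|ta] := ltgtP t a; rewrite /= in Ut.
- rewrite ifT ?ltW// in Ut; near=> x; have -> : x <= a by near: x; exact: lt_le_nbhsl.
  by near: x; exact: cf.
- rewrite ifF ?leNgt ?ta// in Ut; near=> x; have -> : (x <= a) = false.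
    by apply/negbTE; rewrite -ltNge; near: x; exact: lt_nbhsr.
  by near: x; exact: cg.
- rewrite ta lexx in Ut *; near=> x; case: ifP => _; near: x; first exact: cf.
  by apply: cg; rewrite -fg.
Unshelve. all: by end_near. Qed.

(** Composing with [clamp] extends a curve known on a segment to the whole line. *)
Definition clamp (a b t : R) : R := Num.min b (Num.max a t).

Lemma clamp_continuous a b : continuous (clamp a b).
Proof.
move=> t; apply: continuous_min; first exact: cvg_cst.
by apply: continuous_max; [exact: cvg_cst|exact: cvg_id].
Qed.

Lemma clamp_itv a b t : a <= b -> a <= clamp a b t <= b.
Proof.
by move=> ab; rewrite /clamp ge_min lexx/= le_min ab le_max lexx.
Qed.

Lemma clampE a b t : a <= t <= b -> clamp a b t = t.
Proof. by move=> /andP[at_ tb]; rewrite /clamp max_r// min_r. Qed.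

Definition pcat {X : Type} (f g : R -> X) (t : R) : X :=
  if t <= 2^-1 then f (2 * t) else g (2 * t - 1).

Lemma pcat_continuous {X : topologicalType} (f g : R -> X) :
  continuous f -> continuous g -> f 1 = g 0 -> continuous (pcat f g).
Proof.
move=> cf cg fg.
have c2 : continuous (fun t : R => 2 * t) by move=> t; apply: cvgM; [exact: cvg_cst|exact: cvg_id].
apply: (@cont_if _ (fun t => f (2 * t)) (fun t => g (2 * t - 1)) 2^-1).
- by move=> t; apply: (@continuous_comp _ _ _ (fun t : R => 2 * t) f); [exact: c2|exact: cf].
- move=> t; apply: (@continuous_comp _ _ _ (fun t : R => 2 * t - 1) g); last exact: cg.
  by apply: cvgB; [exact: c2|exact: cvg_cst].
- by rewrite divff// subrr.
Qed.

Lemma pcat0 {X : Type} (f g : R -> X) : pcat f g 0 = f 0.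
Proof. by rewrite /pcat invr_ge0 ler0n mulr0. Qed.

Lemma pcat1 {X : Type} (f g : R -> X) : pcat f g 1 = g 1.
Proof. by rewrite /pcat ifF; [congr g; lra|apply/negbTE; lra]. Qed.

Lemma path_connected_connected {X : topologicalType} (x : X) :
  (forall y, exists c : R -> X, [/\ continuous c, c 0 = x & c 1 = y]) ->
  connected [set: X].
Proof.
move=> /choice[c hc].
have -> : [set: X] = \bigcup_(y in setT) (c y @` `[0, 1]).
  apply/esym; rewrite -subTset => y _; exists y => //; exists 1.
    by rewrite /= in_itv/= ler01 lexx.
  by case: (hc y).
apply: bigcup_connected.
  exists x => y _ /=; exists 0; first by rewrite /= in_itv/= ler01 lexx.
  by case: (hc y).
move=> y _; apply: connected_continuous_connected; first exact: segment_connected.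
by apply: continuous_subspaceT; case: (hc y).
Qed.

End Paths.

Section Covering.
Context {R : realType} {E B : topologicalType} (p : E -> B).
Hypothesis p_cov : covering_map p.

Lemma evenly_coveredP (b : B) : exists U : set B, open_nbhs b U /\
  forall e, U (p e) -> exists (W : set E) (s : B -> E),
    [/\ open W, W e, forall z, U z -> {for z, continuous s},
        forall z, U z -> W (s z) /\ p (s z) = z & forall z, W z -> U (p z) /\ s (p z) = z].
Proof.
case: p_cov => cp sp /(_ b)[U oU [S [SU tS hS]]]; exists U; split=> // e Ue.
have [W SW We] : (\bigcup_(W in S) W) e by rewrite -SU.
have [oW [s [cs hs1 hs2]]] := hS _ SW.
exists W, s; split => //.
- move=> z Uz; case: oU => oU _.
  by move: cs; rewrite continuous_open_subspace// => /(_ z); apply; rewrite inE.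
- move=> z Wz; split; last exact: hs2.
  by have : (\bigcup_(W in S) W) z by [exists W]; rewrite -SU.
Qed.

(** Distinct points of one fibre lie in different sheets. This takes the place of a Hausdorff
    condition in the uniqueness of lifts, and yields that condition in [covering_hausdorff]. *)
Lemma fiber_separated (e e' : E) : p e = p e' -> e <> e' ->
  exists W W' : set E, [/\ open_nbhs e W, open_nbhs e' W' & W `&` W' = set0].
Proof.
case: p_cov => cp sp /(_ (p e))[U oU [S [SU tS hS]]] pee ee'.
have Ue : U (p e) by case: oU.
have [W SW We] : (\bigcup_(W in S) W) e by rewrite -SU.
have [W' SW' We'] : (\bigcup_(W in S) W) e' by rewrite -SU /= -pee.
have [oW [s [cs hs1 hs2]]] := hS _ SW.
have [oW' _] := hS _ SW'.
exists W, W'; split=> //.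
apply: contrapT => /eqP/set0P[z [Wz W'z]].
have WW' : W = W' by apply: tS => //; exists z.
by apply: ee'; rewrite -(hs2 _ We) pee hs2// WW'.
Qed.

Lemma lift_unique {T : topologicalType} (A : set T) (f g : T -> E) t0 :
  connected A -> (forall t, A t -> {for t, continuous f}) ->
  (forall t, A t -> {for t, continuous g}) ->
  (forall t, A t -> p (f t) = p (g t)) -> A t0 -> f t0 = g t0 ->
  forall t, A t -> f t = g t.
Proof.
move=> cA cf cg pfg At0 fg0.
apply: (@connected_ind _ A (fun t => f t = g t) t0) => // t At.
have [fgt|fgt] := pselect (f t = g t).
  have [U [[oU Ut] /(_ (f t) Ut)[W [s [oW Wft _ _ hW]]]]] := evenly_coveredP (p (f t)).
  near=> t' => At'; split=> // _.
  have Wf : W (f t') by near: t'; exact: (open_comp_near (cf _ At)).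
  have Wg : W (g t') by near: t'; apply: (open_comp_near (cg _ At)) => //; rewrite -fgt.
  by have [_ <-] := hW _ Wf; have [_ <-] := hW _ Wg; rewrite pfg.
have [W [W' [[oW Wf] [oW' W'g] WW']]] := fiber_separated (pfg _ At) fgt.
near=> t' => At'; split=> // fgt'.
have Wf' : W (f t') by near: t'; exact: (open_comp_near (cf _ At)).
have Wg' : W' (g t') by near: t'; exact: (open_comp_near (cg _ At)).
have : (W `&` W') (f t') by split => //; rewrite fgt'.
by rewrite WW'.
Unshelve. all: by end_near. Qed.

Lemma path_lift (c : R -> B) (e0 : E) : continuous c -> p e0 = c 0 ->
  exists l : R -> E, [/\ continuous l, l 0 = e0 & forall t, 0 <= t <= 1 -> p (l t) = c t].
Proof.
move=> cc pe0.
pose P (T : R) := exists l : R -> E, [/\ continuous l, l 0 = e0 & forall t, 0 <= t <= T -> p (l t) = c t].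
apply: (@connected_ind _ `[0 : R, 1]%classic P 0) => //; last 1 first.
- by rewrite /= in_itv/= ler01 lexx.
- exact: segment_connected.
- move=> T T0.
  have [U [[oU Ut] hU]] := evenly_coveredP (c T).
  have /nbhs_ballP[e /= e_gt0 he] := open_comp_near (cc T) oU Ut.
  (* Over an evenly covered [U] a lift up to [T1] is continued up to [T2] by the section through
     [l T1]. Used in both directions, this makes [P] locally constant. *)
  have key T1 T2 : ball T e T1 -> ball T e T2 -> 0 <= T1 -> P T1 -> P T2.
    move=> bT1 bT2 T10 [l [cl l0 pl]].
    have [T21|T12] := leP T2 T1.
      by exists l; split=> // t /andP[t0 tT2]; apply: pl; rewrite t0 (le_trans tT2).
    have cU t : T1 <= t <= T2 -> U (c t).
      move=> /andP[t1 t2]; apply: he; move: bT1 bT2; rewrite -!ball_normE/= !ltr_distl.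
      by move=> /andP[a1 a2] /andP[a3 a4]; apply/andP; split; lra.
    have pT1 : p (l T1) = c T1 by apply: pl; rewrite T10 lexx.
    have [|W [s [oW Wl cs hs1 hs2]]] := hU (l T1).
      by rewrite pT1; apply: cU; rewrite lexx ltW.
    pose g t := s (c (clamp T1 T2 t)).
    exists (fun t => if t <= T1 then l t else g t); split.
    + apply: cont_if => //.
        move=> t; apply: (@continuous_comp _ _ _ (c \o clamp T1 T2) s).
          by apply: continuous_comp; [exact: clamp_continuous|exact: cc].
        by apply: cs; apply: cU; exact/clamp_itv/ltW.
      by rewrite /g clampE ?lexx ?ltW// -pT1; have [_ ->] := hs2 _ Wl.
    + by rewrite T10.
    + move=> t /andP[t0 tT2]; case: leP => tT1; first by apply: pl; rewrite t0.
      rewrite /g clampE; last by rewrite (ltW tT1) tT2.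
      have Uct : U (c t) by apply: cU; rewrite (ltW tT1) tT2.
      by rewrite (hs1 _ Uct).2.
  near=> T' => T'0.
  have bT' : ball T e T' by near: T'; exact: nbhsx_ballx.
  have bT : ball T e T by exact: ballxx.
  move: T0 T'0; rewrite /= !in_itv/= => /andP[T0 _] /andP[T'0 _].
  by split; apply: key.
- by rewrite /= in_itv/= ler01 lexx.
- exists (cst e0); split=> //; first by move=> ?; exact: cvg_cst.
  by move=> t /= h; rewrite pe0; congr c; apply/eqP; rewrite eq_le.
Unshelve. all: by end_near. Qed.

Lemma itv_min_max (T T1 T2 e t : R) : `|T - T1| < e -> `|T - T2| < e -> 0 <= T1 <= 1 -> 0 <= T2 <= 1 ->
  Num.min T1 T2 <= t <= Num.max T1 T2 -> 0 <= t <= 1 /\ `|T - t| < e.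
Proof.
rewrite ge_min le_max !ltr_distl => /andP[? ?] /andP[? ?] /andP[? ?] /andP[? ?] /andP[/orP[?|?] /orP[?|?]]; split; apply/andP; split; lra.
Qed.

(** Near a given time the lift is a local section applied to [H], so continuity in [s] passes to
    nearby times, and along [[0, 1]] by connectedness. *)
Lemma lift_continuous {S : topologicalType} (H : S -> R -> B) (l : S -> R -> E) s0 :
  continuous (fun x : S * R => H x.1 x.2) -> (forall s, continuous (l s)) ->
  (forall s t, 0 <= t <= 1 -> p (l s t) = H s t) ->
  {for s0, continuous (fun s => l s 0)} -> {for s0, continuous (fun s => l s 1)}.
Proof.
move=> cH cl pl cl0.
have i01 (t : R) : (`[0 : R, 1]%classic t) = (0 <= t <= 1) by rewrite /= in_itv.
apply: (@connected_ind _ `[0 : R, 1]%classic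
  (fun t => {for s0, continuous (fun s => l s t)}) 0) => //; last 1 first.
- by rewrite i01 ler01 lexx.
- exact: segment_connected.
- move=> T T01.
  have [U [[oU Ut] hU]] := evenly_coveredP (H s0 T).
  have [[N0 N1] /= [sN0 TN1] hN] := open_comp_near (cH (s0, T)) oU Ut.
  have /nbhs_ballP[e /= e_gt0 he] := TN1.
  have key T1 T2 : ball T e T1 -> ball T e T2 -> 0 <= T1 <= 1 -> 0 <= T2 <= 1 ->
      {for s0, continuous (fun s => l s T1)} -> {for s0, continuous (fun s => l s T2)}.
    move=> bT1 bT2 T101 T201 cT1.
    have [|W [s [oW Wl cs hs1 hs2]]] := hU (l s0 T1).
      by rewrite pl//; apply: (hN (s0, T1)); split; [exact: nbhs_singleton|exact: he].
    have lE : \forall s' \near s0, l s' T2 = s (H s' T2).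
      near=> s'.
      have Ws' : W (l s' T1) by near: s'; exact: (open_comp_near cT1).
      have Ns' : N0 s' by near: s'.
      pose J := `[Num.min T1 T2, Num.max T1 T2]%classic : set R.
      move: bT1 bT2; rewrite -!ball_normE/= => bT1 bT2.
      have J01 t : J t -> 0 <= t <= 1 /\ ball T e t.
        rewrite /J /= in_itv/= -ball_normE; exact: itv_min_max.
      apply: (@lift_unique _ J (l s') (fun t => s (H s' t)) T1).
      + exact: segment_connected.
      + by move=> t _; exact: cl.
      + move=> t /J01[_ bt].
        have ct : {for t, continuous (H s')} by exact: (cont_slice_r cH).
        apply: (continuous_comp ct); apply: cs.
        by apply: (hN (s', t)); split=> //; exact: he.
      + move=> t /J01[t01 bt]; rewrite pl//.
        have Ust : U (H s' t) by apply: (hN (s', t)); split=> //; exact: he.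
        by rewrite (hs1 _ Ust).2.
      + by rewrite /J /= in_itv/= ge_min lexx/= le_max lexx.
      + by rewrite -pl//; have [_ ->] := hs2 _ Ws'.
      + by rewrite /J /= in_itv/= ge_min lexx orbT/= le_max lexx orbT.
    have cT : {for s0, continuous (fun s => H s T2)} by exact: (cont_slice_l cH).
    have cc : {for s0, continuous (s \o (fun s => H s T2))}.
      apply: (continuous_comp cT); apply: cs.
      by apply: (hN (s0, T2)); split; [exact: nbhs_singleton|exact: he].
    exact: cont_near_eq lE cc.
  rewrite i01 in T01; near=> T'; rewrite in_itv/= => T'01.
  have bT' : ball T e T' by near: T'; exact: nbhsx_ballx.
  by split; apply: key => //; exact: ballxx.
- by rewrite i01 ler01 lexx.
Unshelve. all: by end_near. Qed.

Lemma covering_hausdorff : hausdorff_space B -> hausdorff_space E.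
Proof.
move=> hB; rewrite open_hausdorff => e e' /eqP ee'.
have cp : continuous p by case: p_cov.
have [pee|/eqP pee] := pselect (p e = p e').
  have [W [W' [[oW We] [oW' We'] WW']]] := fiber_separated pee ee'.
  by exists (W, W'); rewrite ?inE//= WW' eqxx.
move: hB; rewrite open_hausdorff => /(_ _ _ pee)[[U U'] /= [Ue Ue'] [oU oU' UU']].
exists (p @^-1` U, p @^-1` U') => /=.
  by move: Ue Ue'; rewrite !inE.
split; [by move/continuousP: cp; apply|by move/continuousP: cp; apply|].
by rewrite -preimage_setI (eqP UU') preimage_set0.
Qed.

Lemma covering_open e (U : set E) : nbhs e U -> nbhs (p e) (p @` U).
Proof.
move=> eU.
have [V [[oV Ve] /(_ e Ve)[W [s [oW We cs hs1 hs2]]]]] := evenly_coveredP (p e).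
have [_ se] := hs2 _ We.
have : nbhs (s (p e)) U by rewrite se.
move=> /(cs _ Ve); rewrite near_simpl => h; near=> b.
exists (s b); first by near: b.
have [|_ ->//] := hs1 b _.
by near: b; exact: open_nbhs_nbhs.
Unshelve. all: by end_near. Qed.

End Covering.

(** * Monodromy of simply connected covers *)

Section Monodromy.
Context {R : realType} {E B : topologicalType} (p : E -> B).
Hypothesis p_cov : covering_map p.
Hypothesis E_sc : simply_connected R E.
Hypothesis E_lpc : forall (e : E) (U : set E), nbhs e U ->
  exists W : set E, nbhs e W /\ forall y, W y -> exists c : R -> E,
    [/\ continuous c, c 0 = e, c 1 = y & forall t, 0 <= t <= 1 -> U (c t)].

Let p_cont : continuous p. Proof. by case: p_cov. Qed.

Lemma path_between (x y : E) : exists c : R -> E, [/\ continuous c, c 0 = x & c 1 = y].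
Proof.
case: E_sc => _ /(_ x y)[c [cc c0 c1]] _; exists (c \o clamp 0 1); split.
- apply: within_comp cc _ _; first exact: clamp_continuous.
  by move=> s; rewrite /= in_itv/=; exact: clamp_itv.
- by rewrite /= clampE ?lexx ?ler01.
- by rewrite /= clampE ?lexx ?ler01.
Qed.

Lemma cover_connected : connected [set: E].
Proof.
case: (E_sc) => -[x _] _ _.
exact: (path_connected_connected (path_between x)).
Qed.

Lemma itv01E (t : R) : `[0 : R, 1]%classic t = (0 <= t <= 1).
Proof. by rewrite /= in_itv. Qed.

(** Lift a contraction of the loop, projected to the base. The end of the lifted path stays over a
    fixed point, hence is constant in the homotopy parameter; it is [l 1] at the start of the
    homotopy and [l 0] at its end. *)
Lemma loop_lift_closed (c l : R -> E) : continuous c -> c 0 = c 1 -> continuous l ->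
  (forall t, 0 <= t <= 1 -> p (l t) = p (c t)) -> l 1 = l 0.
Proof.
move=> cc c01 cl plc.
have [_ _ /(_ c (continuous_subspaceT cc) c01)[H0 [cH0 H0E]]] := E_sc.
pose H (s t : R) := p (H0 (clamp 0 1 s, clamp 0 1 t)).
have cH : continuous (fun x : R * R => H x.1 x.2).
  move=> x; apply: (@cont_comp _ _ _ (fun x => H0 (clamp 0 1 x.1, clamp 0 1 x.2)) p);
    last exact: p_cont.
  apply: (within_comp cH0 (g := fun x : R * R => (clamp 0 1 x.1, clamp 0 1 x.2))) => [{}x|{}x].
    apply: (cont_pair (f := fun x : R * R => clamp 0 1 x.1) (g := fun x : R * R => clamp 0 1 x.2)).
      by apply: (@cont_comp _ _ _ (fun x : R * R => x.1) (clamp 0 1)); [exact: cvg_fst|exact: clamp_continuous].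
    by apply: (@cont_comp _ _ _ (fun x : R * R => x.2) (clamp 0 1)); [exact: cvg_snd|exact: clamp_continuous].
  by split; rewrite /= in_itv/=; exact: clamp_itv.
have z01 : 0 <= (0 : R) <= 1 by apply/andP; split; [exact: lexx|exact: ler01].
have o01 : 0 <= (1 : R) <= 1 by apply/andP; split; [exact: ler01|exact: lexx].
have HE (s t : R) : 0 <= s <= 1 -> 0 <= t <= 1 -> H s t = p (H0 (s, t)).
  by move=> s01 t01; rewrite /H !clampE.
have Hs0 s : H s 0 = p (c 0).
  have /H0E[_ _ E0 _] : clamp 0 1 s \in `[0 : R, 1].
    by rewrite in_itv/=; exact: clamp_itv.
  by rewrite /H (clampE z01) E0.
have Hs1 s : H s 1 = p (c 0).
  have /H0E[_ _ _ E0] : clamp 0 1 s \in `[0 : R, 1].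
    by rewrite in_itv/=; exact: clamp_itv.
  by rewrite /H (clampE o01) E0.
have /choice[L HL] s : exists k : R -> E, [/\ continuous k, k 0 = l 0 &
    forall t, 0 <= t <= 1 -> p (k t) = H s t].
  apply: path_lift => //; first exact: cont_slice_r cH.
  by rewrite Hs0 plc.
have cL s : continuous (L s) by case: (HL s).
have L0 s : L s 0 = l 0 by case: (HL s).
have pL s t : 0 <= t <= 1 -> p (L s t) = H s t by case: (HL s) => _ _; exact.
have cL1 : continuous (fun s => L s 1).
  move=> s; apply: (lift_continuous p_cov cH cL pL).
  have -> : (fun s => L s 0) = (fun=> l 0) by exact: funext.
  exact: cvg_cst.
have sg : connected `[0 : R, 1]%classic by exact: segment_connected.
have E0 : L 0 1 = l 1.
  apply: (lift_unique p_cov (t0 := 0) sg (fun t _ => @cL 0 t) (fun t _ => @cl t)).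
  - move=> t; rewrite itv01E => t01; rewrite pL// plc// HE//.
    by have [->] := H0E t t01.
  - by rewrite itv01E.
  - by rewrite L0.
  - by rewrite itv01E.
have E1 : L 1 1 = l 0.
  apply: (lift_unique p_cov (g := fun=> l 0) (t0 := 0) sg (fun t _ => @cL 1 t)).
  - by move=> t _; exact: cvg_cst.
  - move=> t; rewrite itv01E => t01; rewrite pL// HE// plc//.
    by have [_ ->] := H0E t t01.
  - by rewrite itv01E.
  - by rewrite L0.
  - by rewrite itv01E.
rewrite -E0; apply: (lift_unique p_cov (f := fun s => L s 1) (g := fun=> l 0) (t0 := 1) sg (fun s _ => @cL1 s)).
- by move=> t _; exact: cvg_cst.
- by move=> s _; rewrite pL// Hs1 plc.
- by rewrite itv01E.
- by [].
- by rewrite itv01E.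
Qed.

(* (e, e') is the endpoint of a path from (x, x') in the fibre product of p
   with itself. *)
Definition fiber_transport x x' e e' := exists l l' : R -> E,
  [/\ continuous l, continuous l', l 0 = x /\ l' 0 = x', l 1 = e /\ l' 1 = e' &
    forall t, 0 <= t <= 1 -> p (l t) = p (l' t)].

Lemma fiber_transport_ex x x' e : p x = p x' -> exists e', fiber_transport x x' e e'.
Proof.
move=> px; have [l [cl l0 l1]] := path_between x e.
have [||l' [cl' l'0 pl']] := path_lift p_cov (c := p \o l) (e0 := x').
- by move=> t; apply: continuous_comp (cl t) (@p_cont _).
- by rewrite /= l0 px.
by exists (l' 1), l, l'; split=> // t /pl' ->.
Qed.

(** The two paths to [e] form a loop at [x]. The lift of its projection from [x'] closes up, so its
    halves are the two transports, and they meet in the middle. *)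
Lemma fiber_transport_unique x x' e e1 e2 :
  fiber_transport x x' e e1 -> fiber_transport x x' e e2 -> e1 = e2.
Proof.
move=> [l1 [l1' [cl1 cl1' [l10 l1'0] [l11 l1'1] pl1]]].
move=> [l2 [l2' [cl2 cl2' [l20 l2'0] [l21 l2'1] pl2]]].
have crev : continuous (fun t : R => 1 - t).
  by move=> t; apply: cvgB; [exact: cvg_cst|exact: cvg_id].
pose c := pcat l1 (l2 \o (fun t => 1 - t)).
have cc : continuous c.
  apply: pcat_continuous => //; last by rewrite /= subr0 l11 l21.
  by move=> t; apply: cont_comp (crev t) (cl2 _).
have c0 : c 0 = x by rewrite /c pcat0.
have c1 : c 1 = x by rewrite /c pcat1/= subrr.
have px : p x = p x' by rewrite -l10 -l1'0 pl1// lexx ler01.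
have [||l [cl l0 pl]] := path_lift p_cov (c := p \o c) (e0 := x').
- by move=> t; apply: continuous_comp (cc t) (@p_cont _).
- by rewrite /= c0 px.
have l1E : l 1 = x' by rewrite (loop_lift_closed cc _ cl pl) ?c0 ?c1.
have sg : connected `[0 : R, 1]%classic by exact: segment_connected.
have A1 : l (1 / 2) = l1' 1.
  apply: (lift_unique p_cov (f := fun t : R => l (t / 2)) (g := l1') (t0 := 0) sg).
  - move=> t _; apply: (@cont_comp _ _ _ (fun t : R => t / 2) l); last exact: cl.
    by apply: cvgM; [exact: cvg_id|exact: cvg_cst].
  - by move=> t _; exact: cl1'.
  - move=> t; rewrite itv01E => /andP[t0 t1]; rewrite pl; last by apply/andP; split; lra.
    rewrite /= /c /pcat ifT; last by lra.
    by rewrite mulrCA divff// mulr1 pl1// t0.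
  - by rewrite itv01E lexx ler01.
  - by rewrite mul0r l0 l1'0.
  - by rewrite itv01E lexx ler01.
have A2 : l (1 - 1 / 2) = l2' 1.
  apply: (lift_unique p_cov (f := fun t : R => l (1 - t / 2)) (g := l2') (t0 := 0) sg).
  - move=> t _; apply: (@cont_comp _ _ _ (fun t : R => 1 - t / 2) l); last exact: cl.
    by apply: cvgB; [exact: cvg_cst|apply: cvgM; [exact: cvg_id|exact: cvg_cst]].
  - by move=> t _; exact: cl2'.
  - move=> t; rewrite itv01E => /andP[t0 t1]; rewrite pl; last by apply/andP; split; lra.
    rewrite /= /c /pcat; case: ifP => t2.
      have -> : t = 1 by lra.
      by rewrite (_ : 2 * _ = 1) ?l11 -?l21 ?pl2 ?lexx ?ler01//; lra.
    rewrite /= (_ : 1 - _ = t); last by lra.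
    by rewrite pl2// t0.
  - by rewrite itv01E lexx ler01.
  - by rewrite mul0r subr0 l1E l2'0.
  - by rewrite itv01E lexx ler01.
by rewrite -l1'1 -A1 -l2'1 -A2; congr l; lra.
Qed.

Lemma fiber_transport_cat x x' e e' f f' :
  fiber_transport x x' e e' -> fiber_transport e e' f f' -> fiber_transport x x' f f'.
Proof.
move=> [l1 [l1' [cl1 cl1' [l10 l1'0] [l11 l1'1] pl1]]].
move=> [l2 [l2' [cl2 cl2' [l20 l2'0] [l21 l2'1] pl2]]].
exists (pcat l1 l2), (pcat l1' l2'); split.
- by apply: pcat_continuous => //; rewrite l11 l20.
- by apply: pcat_continuous => //; rewrite l1'1 l2'0.
- by rewrite !pcat0.
- by rewrite !pcat1.
- move=> t /andP[t0 t1]; rewrite /pcat; case: ifP => t2.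
    by apply: pl1; apply/andP; split; lra.
  by apply: pl2; apply/andP; split; lra.
Qed.

Lemma fiber_transport_refl x x' : p x = p x' -> fiber_transport x x' x x'.
Proof.
by move=> px; exists (fun=> x), (fun=> x'); split=> //; move=> t; exact: cvg_cst.
Qed.

(** Transport is well defined by the previous uniqueness. Near [e] it is [p] followed by a local
    section, because short paths from [e] remain over an evenly covered set; this gives
    continuity. *)
Lemma fiber_transport_map x x' : p x = p x' ->
  exists f : E -> E, [/\ continuous f, p \o f = p, f x = x' &
    forall e, fiber_transport x x' e (f e)].
Proof.
move=> px; have /choice[f hf] := fun e => fiber_transport_ex e px.
have pf e : p (f e) = p e.
  by have [l [l' [_ _ _ [<- <-] ->]]] := hf e; rewrite ?lexx ?ler01.
exists f; split=> //; last 2 first.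
- exact: funext.
- exact: fiber_transport_unique (hf x) (fiber_transport_refl px).
move=> e.
have [U [[oU Ue] /(_ (f e))]] := evenly_coveredP p_cov (p e).
rewrite pf => /(_ Ue)[W [s [oW We cs hs1 hs2]]].
have [A [eA hA]] : exists A : set E, nbhs e A /\ forall y, A y -> exists c : R -> E,
    [/\ continuous c, c 0 = e, c 1 = y & forall t, 0 <= t <= 1 -> U (p (c t))].
  by apply: (@E_lpc e (p @^-1` U)); exact: (open_comp_near (@p_cont e) oU Ue).
apply: (@cont_near_eq _ _ _ (fun y => s (p y))); last first.
  by apply: (cont_comp (@p_cont e)); exact: cs.
apply: filterS eA => y /hA[c [cc c0 c1 Uc]].
apply: (fiber_transport_unique (hf y)); apply: (fiber_transport_cat (hf e)).
pose g t := s (p (c (clamp 0 1 t))).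
exists c, g; split=> //.
- move=> t; apply: (@cont_comp _ _ _ (fun t => p (c (clamp 0 1 t))) s).
    apply: (@cont_comp _ _ _ (fun t => c (clamp 0 1 t)) p); last exact: p_cont.
    by apply: cont_comp; [exact: clamp_continuous|exact: cc].
  by apply: cs; apply: Uc; exact: clamp_itv.
- split=> //; rewrite /g clampE ?lexx ?ler01// c0.
  by have [_] := hs2 _ We; rewrite pf.
- by split=> //; rewrite /g clampE ?lexx ?ler01// c1.
- by move=> t t01; rewrite /g clampE//; have /hs1[_ ->] := Uc t t01.
Qed.

Lemma lift_eq (f g : E -> E) x : continuous f -> continuous g ->
  p \o f = p \o g -> f x = g x -> f =1 g.
Proof.
move=> cf cg pfg fgx y.
apply: (lift_unique p_cov (t0 := x) cover_connected (fun t _ => @cf t) (fun t _ => @cg t)) => //.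
by move=> t _; exact: (congr1 (fun h => h t) pfg).
Qed.

(** The transports sending [x] to [x'] and back are inverse to each other: their composites are
    lifts of [p] with a fixed point. *)
Lemma deck_transitive x x' : p x = p x' -> exists a : deck p, a x = x'.
Proof.
move=> px.
have [f [cf pf fx _]] := fiber_transport_map px.
have [g [cg pg gx _]] := fiber_transport_map (esym px).
have fg : cancel f g.
  apply: (@lift_eq (g \o f) id x); rewrite /= ?fx//.
  - by move=> e; apply: cont_comp (cf e) (cg _).
  - by move=> e; exact: cvg_id.
  - by rewrite compA pg pf.
have gf : cancel g f.
  apply: (@lift_eq (f \o g) id x'); rewrite /= ?gx//.
  - by move=> e; apply: cont_comp (cg e) (cf _).
  - by move=> e; exact: cvg_id.
  - by rewrite compA pf pg.
have df : deck_transformation p f by split=> //; exists g.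
by exists (SigSub (mem_set df)).
Qed.

Lemma deck_cont (a : deck p) : continuous a.
Proof. by case: (set_valP a). Qed.

Lemma deck_proj (a : deck p) x : p (a x) = p x.
Proof. by case: (set_valP a) => _ /(congr1 (fun h => h x)). Qed.

Lemma deck_free (a b : deck p) x : a x = b x -> a = b.
Proof.
move=> abx; apply: deck_inj; apply: (lift_eq _ _ _ abx); try exact: deck_cont.
by apply/funext => y /=; rewrite !deck_proj.
Qed.

End Monodromy.

(** * Lengths of curves and the lifted distance *)

Section RealAnalysis.
Context {R : realType}.

(** Integrating from -1 makes the derivative two-sided on all of [[0, 1]]. *)
Lemma antiderivative (f : R -> R) : continuous f -> exists F : R -> R,
  (forall x : R, -1 < x -> is_derive x (1 : R) F (f x)) /\
  \int[lebesgue_measure]_(t in `[0, 1]) f t = F 1 - F 0.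
Proof.
move=> cf; pose F x := \int[lebesgue_measure]_(t in `[-1, x]) f t.
have dF (x : R) : -1 < x -> is_derive x (1 : R) F (f x).
  move=> x1; have xx : x < x + 1 by lra.
  have fi : (@lebesgue_measure R).-integrable `[-1, x + 1] (EFin \o f).
    apply: continuous_compact_integrable; first exact: segment_compact.
    exact: continuous_subspaceT.
  have [dF <-] := continuous_FTC1_closed xx fi x1 (cf x).
  by rewrite derive1E; exact: derivableP.
exists F; split=> //.
have cF x : -1 < x -> {for x, continuous F}.
  by move=> /dF[dFx _]; apply/differentiable_continuous/derivable1_diffP.
rewrite /Rintegral (@continuous_FTC2 _ f F)//=.
- exact: continuous_subspaceT.
- split.
  + move=> x; rewrite in_itv/= => /andP[x0 _].
    have x1 : -1 < x by apply: lt_trans x0; lra.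
    by have [] := dF x x1.
  + by apply: cvg_at_right_filter; apply: cF; lra.
  + by apply: cvg_at_left_filter; apply: cF; lra.
- move=> x; rewrite in_itv/= => /andP[x0 _]; rewrite derive1E.
  have x1 : -1 < x by apply: lt_trans x0; lra.
  by have [_ ->] := dF x x1.
Qed.

Lemma derive_ge0_le (f df : R -> R) (a b : R) : a <= b ->
  (forall x : R, a <= x <= b -> is_derive x (1 : R) f (df x)) ->
  (forall x, a <= x <= b -> 0 <= df x) -> f a <= f b.
Proof.
move=> ab hf h0.
have cf : {within `[a, b], continuous f}.
  apply: derivable_within_continuous => x; rewrite in_itv/= => /hf[]; exact.
have [ab'|ab'|<-//] := ltgtP a b; last by rewrite leNgt ab' in ab.
have df' x : x \in `]a, b[ -> is_derive x (1 : R) f (df x).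
  by rewrite in_itv/= => /andP[ax xb]; apply: hf; rewrite !ltW.
have [x xab E] := MVT ab' df' cf.
move: xab; rewrite in_itv/= => /andP[ax xb].
by rewrite -subr_ge0 E mulr_ge0 ?h0 ?ltW// subr_gt0.
Qed.

Lemma is_derive_sqr_max0 (x : R) :
  is_derive x (1 : R) (fun t : R => Num.max 0 t ^+ 2) (2 * Num.max 0 x).
Proof.
have [x0|x0|->] := ltgtP x 0.
- rewrite mulr0.
  have h : is_derive x (1 : R) (fun _ : R => 0 : R) 0 by exact: is_derive_cst.
  apply: near_eq_is_derive h; near=> t; rewrite max_l ?expr0n//=; near: t; exact: lt_le_nbhsl.
- have h : is_derive x (1 : R) (fun t : R => t ^+ 2) (2 * x).
    have -> : (fun t : R => t ^+ 2) = (id : R -> R) ^+ 2 by apply/funext => t; rewrite /= expr2.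
    by apply: is_derive_eq; rewrite expr1 -[_ *: _]/(_ * _) mulr1 -mulr_natl.
  apply: near_eq_is_derive h; near=> t.
  by rewrite max_r//; near: t; apply: filterS (lt_nbhsr x0) => y; exact: ltW.
- rewrite mulr0.
  suff h : (fun h : R => h^-1 *: (Num.max 0 (h *: (1 : R) + 0) ^+ 2 - Num.max (0 : R) 0 ^+ 2)) @ 0^' --> (0 : R).
    by split; [apply/cvg_ex; exists 0|exact: cvg_lim h].
  apply/cvgr0Pnorm_lt => e e0; near=> h.
  rewrite maxxx expr0n/= subr0 addr0 -[h *: 1]/(h * 1) mulr1.
  have h0 : h != 0 by near: h; exact: nbhs_dnbhs_neq.
  have he : `|h| < e by near: h; exact: dnbhs0_lt.
  rewrite -[_ *: _]/(_ * _) normrM normfV normrX ltr_pdivrMl ?normr_gt0//.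
  have : `|Num.max 0 h| <= `|h| by rewrite maxEle; case: ifP => //; rewrite normr0.
  move=> hm; rewrite expr2 (le_lt_trans (ler_pM _ _ hm hm))//.
  by rewrite ltr_pM2l ?normr_gt0.
Unshelve. all: by end_near. Qed.

(** A quadratic spline rising from 0 to 1 on [[1/4, 3/4]]. Its derivative [dstep] is a continuous
    tent with peak 4 at 1/2, which is where the factor 4 of [joined_ball] comes from. *)
Definition step (t : R) : R :=
  8 * (Num.max 0 (t - 1 / 4) ^+ 2 - 2 * Num.max 0 (t - 1 / 2) ^+ 2 + Num.max 0 (t - 3 / 4) ^+ 2).

Definition dstep (t : R) : R :=
  16 * (Num.max 0 (t - 1 / 4) - 2 * Num.max 0 (t - 1 / 2) + Num.max 0 (t - 3 / 4)).

Lemma is_derive_step (t : R) : is_derive t (1 : R) step (dstep t).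
Proof.
pose q (a : R) : R -> R := fun t => Num.max 0 (t - a) ^+ 2.
have h (a : R) : is_derive t (1 : R) (q a) (2 * Num.max 0 (t - a)).
  have -> : q a = (fun t : R => Num.max 0 t ^+ 2) \o shift (- a) by [].
  have hq := is_derive_sqr_max0 (t - a).
  have hs : is_derive t (1 : R) (shift (- a)) 1 by exact: is_derive_shift.
  by rewrite -[X in is_derive _ _ _ X]mulr1; exact: is_derive1_comp.
have -> : step = (8 : R) *: (q (1 / 4) - (2 : R) *: q (1 / 2) + q (3 / 4)) by [].
have h1 := h (1 / 4); have h2 := h (1 / 2); have h3 := h (3 / 4).
apply: is_derive_eq; rewrite /dstep -![_ *: _]/(_ * _); ring.
Qed.

Lemma dstep_continuous : continuous dstep.
Proof.
have h (a : R) : continuous (fun t => Num.max 0 (t - a)).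
  move=> t; apply: (@continuous_max _ _ (fun=> 0) (fun t : R => t - a)).
    exact: cvg_cst.
  by apply: cvgB; [exact: cvg_id|exact: cvg_cst].
move=> t; apply: cvgM; first exact: cvg_cst.
apply: cvgD; last exact: h.
apply: cvgB; first exact: h.
by apply: cvgM; [exact: cvg_cst|exact: h].
Qed.

Lemma step0 t : t <= 1 / 4 -> step t = 0.
Proof. by move=> h; rewrite /step !max_l ?expr0n/=; lra. Qed.

Lemma step1 t : 3 / 4 <= t -> step t = 1.
Proof. by move=> h; rewrite /step !max_r; lra. Qed.

Lemma dstep_itv t : 0 <= dstep t <= 4.
Proof.
rewrite /dstep; case: (leP 0 (t - 1 / 4)); case: (leP 0 (t - 1 / 2)); case: (leP 0 (t - 3 / 4)) => *; apply/andP; split; lra.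
Qed.

Lemma step_itv t : 0 <= step t <= 1.
Proof.
rewrite /step; case: (leP 0 (t - 1 / 4)); case: (leP 0 (t - 1 / 2)); case: (leP 0 (t - 3 / 4)) => *; apply/andP; split; nra.
Qed.

Lemma step_continuous : continuous step.
Proof. by move=> t; apply/differentiable_continuous/derivable1_diffP; case: (is_derive_step t). Qed.

End RealAnalysis.

Section Curves.
Context {R : realType} {d : nat} {N : topologicalType} (A : smooth_atlas R d N).
Variable g : chart_index A -> 'rV[R]_d -> 'M[R]_d.
Hypothesis g_metric : riemannian_metric g.

Local Notation idx := (chart_index A).
Local Notation dom := (chart_dom (s := A)).
Local Notation ch := (chart (s := A)).
Local Notation chi := (chart_inv (s := A)).

Definition qform (i : idx) (y v : 'rV[R]_d) : R := (v *m g i y *m v^T) 0 0.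

Definition chart_speed (i : idx) (c : R -> N) (t : R) : R :=
  Num.sqrt (qform i (ch i (c t)) (derive1 (ch i \o c) t)).

Lemma near_dom (c : R -> N) i t : continuous c -> dom i (c t) ->
  \forall s \near t, dom i (c s).
Proof. by move=> cc; apply: open_comp_near (cc t) (chart_dom_open i). Qed.

Lemma derive_transition i j (f : R -> 'rV[R]_d) t (y : 'rV[R]_d) : f t = y ->
  (ch i @` (dom i `&` dom j)) y -> derivable f t 1 ->
  derivable (ch j \o chi i \o f) t 1 /\
  derive1 (ch j \o chi i \o f) t = 'D_(derive1 f t) (ch j \o chi i) y.
Proof.
move=> fty hy df.
have dtau : differentiable (ch j \o chi i) y.
  by have [h _] := @chart_transition_smooth _ _ _ A i j 1%N; exact: h.
move/derivable1_diffP in df; split.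
  by apply/derivable1_diffP; apply: differentiable_comp; rewrite ?fty.
rewrite derive1E'; last by apply: differentiable_comp; rewrite ?fty.
by rewrite diff_comp ?fty//= derive1E' // deriveE.
Qed.

Lemma chart_speedE (c : R -> N) i j t : continuous c -> C1_curve A c ->
  dom i (c t) -> dom j (c t) -> chart_speed i c t = chart_speed j c t.
Proof.
move=> cc c1 it jt.
have hy : (ch i @` (dom i `&` dom j)) (ch i (c t)) by exists (c t).
have [df _] := c1 t i it.
have [_ E] := derive_transition (f := ch i \o c) erefl hy df.
have E2 : derive1 (ch j \o c) t = derive1 (ch j \o chi i \o (ch i \o c)) t.
  rewrite !derive1E; apply: near_eq_derive; near=> s.
  by rewrite /= chartK//; near: s; exact: near_dom.
case: g_metric => _ _ /(_ i j (ch i (c t)) (derive1 (ch i \o c) t) (derive1 (ch i \o c) t) hy).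
rewrite /chart_speed /qform E2 E => ->.
by rewrite /= chartK.
Unshelve. all: by end_near. Qed.

Lemma speedE (c : R -> N) i t : continuous c -> C1_curve A c ->
  dom i (c t) -> speed g c t = chart_speed i c t.
Proof. by move=> cc c1 it; rewrite -(chart_speedE cc c1 (chart_at_dom A (c t)) it). Qed.

Lemma g_continuous i y : (ch i @` dom i) y -> {for y, continuous (g i)}.
Proof. by case: g_metric => _ sm _ iy; have := sm i 0%N; exact. Qed.

Lemma qform_cvg {T} {F : set_system T} {FF : Filter F} i (y : T -> 'rV[R]_d) (v : T -> 'rV[R]_d) y0 v0 :
  (ch i @` dom i) y0 -> y t @[t --> F] --> y0 -> v t @[t --> F] --> v0 ->
  qform i (y t) (v t) @[t --> F] --> qform i y0 v0.
Proof.
move=> iy0 yy0 vv0; rewrite /qform; apply: cvg_coord.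
apply: cvg_mulmx; last exact: cvg_trmx.
by apply: cvg_mulmx => //; apply: cvg_comp yy0 _; exact: g_continuous.
Qed.

Lemma speed_continuous (c : R -> N) : continuous c -> C1_curve A c ->
  continuous (speed g c).
Proof.
move=> cc c1 t; pose i := chart_at A (c t).
have it : dom i (c t) by exact: chart_at_dom.
apply: (@cont_near_eq _ _ _ (chart_speed i c)).
  near=> s; apply: speedE => //; near: s; exact: near_dom.
have [df cdf] := c1 t i it.
apply: (@cont_comp _ _ _ (fun s => qform i (ch i (c s)) (derive1 (ch i \o c) s)) Num.sqrt); last exact: sqrt_continuous.
apply: qform_cvg.
- by exists (c t).
- apply: (@cont_comp _ _ _ c (ch i)); [exact: cc|exact: chart_continuous].
- exact: cdf.
Unshelve. all: by end_near. Qed.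

Lemma speed_ge0 (c : R -> N) t : 0 <= speed g c t.
Proof. exact: sqrtr_ge0. Qed.

Lemma curve_length_ge0 (c : R -> N) : 0 <= curve_length g c.
Proof. by apply: Rintegral_ge0 => t _; exact: speed_ge0. Qed.

Definition arclength (c : R -> N) (F : R -> R) :=
  forall x : R, -1 < x -> is_derive x (1 : R) F (speed g c x).

Lemma arclength_ex (c : R -> N) : continuous c -> C1_curve A c ->
  exists F, arclength c F /\ curve_length g c = F 1 - F 0.
Proof. by move=> cc c1; apply: antiderivative; exact: speed_continuous. Qed.

Lemma arclength_le (c : R -> N) F a b : arclength c F -> -1 < a -> a <= b -> F a <= F b.
Proof.
move=> hF a1 ab; apply: (derive_ge0_le (df := speed g c) ab) => x /andP[ax _].
  by apply: hF; exact: lt_le_trans ax.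
exact: speed_ge0.
Qed.

Lemma arclength_bound (c : R -> N) F L a b : arclength c F -> -1 < a -> a <= b ->
  (forall t, speed g c t <= L) -> F b - F a <= L * (b - a).
Proof.
move=> hF a1 ab cL.
have : L * a - F a <= L * b - F b; last by lra.
apply: (derive_ge0_le (f := fun x => L * x - F x) (df := fun x => L - speed g c x) ab) => x /andP[ax xb].
  have Fx := hF x (lt_le_trans a1 ax).
  have -> : (fun x => L * x - F x) = L *: (id : R -> R) - F by [].
  by apply: is_derive_eq; rewrite -[_ *: _]/(_ * _) mulr1.
by rewrite subr_ge0.
Qed.

(** On the compact unit sphere the norm is bounded and bounded away from 0, uniformly for base
    points near [y0]; homogeneity gives the other vectors. A single index [n] encodes both bounds,
    [n.+1] and its inverse. *)
Lemma metric_bounds i y0 : (ch i @` dom i) y0 -> exists (m M r : R),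
  [/\ 0 < m, 0 < M, 0 < r & forall y v, `|y - y0| <= r ->
     m * `|v| <= Num.sqrt (qform i y v) <= M * `|v|].
Proof.
move=> iy0.
pose P (z : 'rV[R]_d * nat) (v : 'rV[R]_d) :=
  (z.2.+1%:R^-1 <= Num.sqrt (qform i z.1 v) :> R) /\ (Num.sqrt (qform i z.1 v) <= z.2.+1%:R).
have : filter_prod (nbhs y0) \oo (fun z => [set v : 'rV[R]_d | `|v| = 1] `<=` P z).
  apply: (compact_unif (F := filter_prod (nbhs y0) \oo) (@rV_sphere_compact R d 1)) => v0 /= v01.
  have q0 : 0 < Num.sqrt (qform i y0 v0).
    case: g_metric => /(_ i y0 iy0)[_ gpos] _ _; rewrite sqrtr_gt0; apply: gpos.
    by rewrite -normr_gt0 v01.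
  pose q := Num.sqrt (qform i y0 v0).
  have cq : {for (v0, y0), continuous (fun z : 'rV[R]_d * 'rV[R]_d => Num.sqrt (qform i z.2 z.1))}.
    apply: (@cont_comp _ _ _ (fun z : 'rV[R]_d * 'rV[R]_d => qform i z.2 z.1) Num.sqrt); last exact: sqrt_continuous.
    by apply: qform_cvg => //; [exact: cvg_snd|exact: cvg_fst].
  have q2 : q / 2 < q by rewrite ltr_pdivrMr// ltr_pMr// ltr1n.
  have qq : q < q + 1 by rewrite ltrDl.
  have [[B1 B2] /= [vB1 yB2] hB] := filterI (near_gt cq q2) (near_lt cq qq).
  have n1 : \forall n \near \oo, n.+1%:R^-1 < q / 2 :> R.
    have q20 : 0 < q / 2 by rewrite divr_gt0.
    exact: near_infty_natSinv_lt (PosNum q20).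
  have n2 : \forall n \near \oo, q + 1 <= n%:R :> R by exact: nbhs_infty_ger.
  exists (B1, (B2 `*` [set n | n.+1%:R^-1 < q / 2 :> R /\ q + 1 <= n%:R])).
    split=> //=; exists (B2, [set n | n.+1%:R^-1 < q / 2 :> R /\ q + 1 <= n%:R]) => //=.
    by split=> //; exact: filterI.
  move=> [v [y n]] /= [B1v [B2y [h1 h2]]]; have /= [h3 h4] := hB (v, y) (conj B1v B2y).
  split=> /=; first exact/ltW/(lt_trans h1).
  by rewrite ltW// (lt_le_trans h4)// (le_trans h2)// ler_nat.
move=> [[B1 B2] /= [/nbhs_ballP[r /= r0 hr] [n _ hn]] hB].
exists n.+1%:R^-1, n.+1%:R, (r / 2); split => //.
- by rewrite divr_gt0.
move=> y v yr.
have [->|v0] := eqVneq v 0.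
  by rewrite normr0 !mulr0 /qform mul0mx mul0mx mxE sqrtr0 lexx.
have By : B1 y.
  by apply: hr; rewrite -ball_normE/= distrC (le_lt_trans yr)// ltr_pdivrMr// ltr_pMr// ltr1n.
have vn : 0 < `|v| by rewrite normr_gt0.
have n1 : `| `|v|^-1 *: v| = 1 by rewrite normrZ normfV normr_id mulVf// gt_eqF.
have [/= h1 h2] := hB (y, n) (conj By (hn n (leqnn n))) _ n1.
have E : Num.sqrt (qform i y v) = `|v| * Num.sqrt (qform i y (`|v|^-1 *: v)).
  have -> : qform i y (`|v|^-1 *: v) = `|v|^-2 * qform i y v.
    rewrite /qform linearZ/= -!scalemxAl -scalemxAr scalerA mxE; congr (_ * _).
    by rewrite -expr2 exprVn.
  rewrite sqrtrM ?exprn_ge0// -exprVn sqrtr_sqr ger0_norm ?invr_ge0//.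
  by rewrite mulrA divff ?mul1r// gt_eqF.
by rewrite E -![_ * `|v|]mulrC !ler_pM2l// h1 h2.
Qed.

End Curves.

Section CurveOperations.
Context {R : realType} {d : nat} {N : topologicalType} (A : smooth_atlas R d N).
Variable g : chart_index A -> 'rV[R]_d -> 'M[R]_d.

Local Notation dom := (chart_dom (s := A)).
Local Notation ch := (chart (s := A)).
Local Notation chi := (chart_inv (s := A)).

Definition C1_at (c : R -> N) (t : R) := forall i, dom i (c t) ->
  derivable (ch i \o c) t 1 /\ {for t, continuous (derive1 (ch i \o c))}.

Lemma C1_germ (c c' : R -> N) t : (\forall s \near t, c s = c' s) -> C1_at c' t -> C1_at c t.
Proof.
move=> cc' h i; rewrite (nbhs_singleton cc') => /h[df cdf].
have cc2 : \forall s \near t, \forall s' \near s, c s' = c' s' by exact: nbhs_interior cc'.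
split.
  apply: near_eq_derivable df; near=> s; rewrite /=; congr (ch i _); apply/esym.
  by near: s; exact: cc'.
apply: cont_near_eq cdf; near=> s; rewrite !derive1E; apply: near_eq_derive.
have : \forall s' \near s, c s' = c' s' by near: s; exact: cc2.
by apply: filterS => s' /= ->.
Unshelve. all: by end_near. Qed.

Lemma speed_germ (c c' : R -> N) t : (\forall s \near t, c s = c' s) ->
  speed g c t = speed g c' t.
Proof.
move=> cc'; rewrite /speed (nbhs_singleton cc').
suff -> : derive1 (ch (chart_at A (c' t)) \o c) t = derive1 (ch (chart_at A (c' t)) \o c') t by [].
by rewrite !derive1E; apply: near_eq_derive; apply: filterS cc' => s /= ->.
Qed.

Lemma derive_affine {V : normedModType R} (f : R -> V) (a b t : R) : derivable f (a * t + b) 1 ->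
  derivable (fun s => f (a * s + b)) t 1 /\
  derive1 (fun s => f (a * s + b)) t = a *: derive1 f (a * t + b).
Proof.
move=> /derivable1_diffP df.
pose aff (s : R) : R := a * s + b.
have daff : is_derive t (1 : R) aff a.
  have -> : aff = a *: (id : R -> R) + cst b by [].
  by apply: is_derive_eq; rewrite addr0 -[_ *: _]/(_ * _) mulr1.
have haff : differentiable aff t by apply/derivable1_diffP; case: daff.
have hc : differentiable (f \o aff) t by apply: differentiable_comp.
split; first by apply/derivable1_diffP; exact: hc.
rewrite -[LHS]/(derive1 (f \o aff) t) derive1E' // diff_comp//=.
have -> : 'd aff t 1 = a :> R by rewrite -deriveE//; case: daff.
by rewrite derive1E' // -linearZ/= -[_ *: _]/(_ * _) mulr1.
Qed.

Lemma C1_affine (c : R -> N) (a b t : R) : continuous c -> C1_at c (a * t + b) ->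
  (forall s, C1_at c s) ->
  C1_at (fun s => c (a * s + b)) t /\
  speed g (fun s => c (a * s + b)) t = Num.sqrt (a ^+ 2) * speed g c (a * t + b).
Proof.
move=> cc h hall.
have caff : continuous (fun s : R => a * s + b).
  move=> s; apply: cvgD; last exact: cvg_cst.
  by apply: cvgM; [exact: cvg_cst|exact: cvg_id].
have key i s : dom i (c (a * s + b)) ->
    derivable (ch i \o (fun s => c (a * s + b))) s 1 /\
    derive1 (ch i \o (fun s => c (a * s + b))) s = a *: derive1 (ch i \o c) (a * s + b).
  by move=> /(hall (a * s + b))[df _]; exact: (derive_affine df).
split.
  move=> i ict; split; first by have [] := key i t ict.
  have [_ cdf] := h i ict.
  apply: (@cont_near_eq _ _ _ (fun s => a *: derive1 (ch i \o c) (a * s + b))).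
    near=> s; have is_ : dom i (c (a * s + b)).
      near: s; apply: (open_comp_near (f := fun s => c (a * s + b))) => //.
        exact: cont_comp (caff t) (cc _).
      exact: chart_dom_open.
    by have [_] := key i s is_.
  have hc : {for t, continuous (fun s => derive1 (ch i \o c) (a * s + b))}.
    exact: (@cont_comp _ _ _ (fun s : R => a * s + b) (derive1 (ch i \o c)) t (caff t) cdf).
  by apply: cvgZ; [exact: cvg_cst|exact: hc].
rewrite /speed; have [_ ->] := key (chart_at A (c (a * t + b))) t (chart_at_dom A _).
rewrite -sqrtrM ?sqr_ge0//; congr Num.sqrt.
by rewrite linearZ/= -!scalemxAl -scalemxAr scalerA mxE expr2.
Unshelve. all: by end_near. Qed.

End CurveOperations.

Section Joined.
Context {R : realType} {d : nat} {N E : topologicalType} (A : smooth_atlas R d N).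
Variables (g : chart_index A -> 'rV[R]_d -> 'M[R]_d) (p : E -> N).
Hypothesis g_metric : riemannian_metric g.
Hypothesis p_cov : covering_map p.

Local Notation dom := (chart_dom (s := A)).
Local Notation ch := (chart (s := A)).
Local Notation chi := (chart_inv (s := A)).

Let p_cont : continuous p. Proof. by case: p_cov. Qed.

Let pc_cont (c : R -> E) : continuous c -> continuous (p \o c).
Proof. by move=> cc t; apply: continuous_comp (cc t) (@p_cont _). Qed.

(** Curves that are constant near their ends can be concatenated without matching velocities, and
    the result is again C^1. *)
Definition flat_ends (c : R -> E) := exists2 e : R, 0 < e &
  (forall t, t <= e -> c t = c 0) /\ (forall t, 1 - e <= t -> c t = c 1).

(** A workable substitute for distance at most [L]: bounding the speed pointwise, rather than the
    length, makes the relation easy to reverse, add and move by deck transformations. *)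
Definition joined (L : R) (x y : E) := exists c : R -> E,
  [/\ continuous c, forall t, C1_at A (p \o c) t, flat_ends c, c 0 = x /\ c 1 = y &
      forall t, speed g (p \o c) t <= L].

Lemma joined_le L L' x y : L <= L' -> joined L x y -> joined L' x y.
Proof.
by move=> LL [c [cc c1 fc cxy sc]]; exists c; split=> // t; exact: le_trans (sc t) LL.
Qed.

Lemma joined_sym L x y : joined L x y -> joined L y x.
Proof.
move=> [c [cc c1 [e e0 [f0 f1]] [c0 c1'] sc]].
have caff : continuous (fun s : R => -1 * s + 1).
  move=> s; apply: cvgD; last exact: cvg_cst.
  by apply: cvgM; [exact: cvg_cst|exact: cvg_id].
exists (fun t => c (-1 * t + 1)); split.
- by move=> t; exact: cont_comp (caff t) (cc _).
- by move=> t; have [] := C1_affine g (pc_cont cc) (c1 (-1 * t + 1)) c1.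
- exists e => //; rewrite mulr0 add0r mulr1 addNr; split=> t ht.
    by apply: f1; lra.
  by apply: f0; lra.
- by rewrite mulr0 add0r mulr1 addNr.
- move=> t; have [_] := C1_affine g (pc_cont cc) (c1 (-1 * t + 1)) c1.
  by rewrite -[X in speed g X]/(p \o (fun t => c (-1 * t + 1))) => ->; rewrite sqrrN expr1n sqrtr1 mul1r.
Qed.

Lemma joined_trans L L' x y z : 0 < L -> 0 < L' -> joined L x y -> joined L' y z ->
  joined (L + L') x z.
Proof.
move=> L0 L'0 [c [cc c1 [e e0 [f0 f1]] [c0 c1'] sc]] [c' [cc' c1_ [e' e'0 [f0' f1']] [c0' c1''] sc']].
(* Each curve receives a share of the unit interval proportional to its bound, so that both rescaled
   pieces have speed at most [L + L']. *)
pose a := L / (L + L').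
have LL : 0 < L + L' by rewrite addr_gt0.
have a0 : 0 < a by rewrite divr_gt0.
have a1 : 0 < 1 - a by rewrite subr_gt0 /a ltr_pdivrMr// mul1r ltrDl.
have aL : a^-1 * L = L + L' by rewrite /a invf_div divfK// gt_eqF.
have aL' : (1 - a)^-1 * L' = L + L'.
  have -> : 1 - a = L' / (L + L') by rewrite /a; field; rewrite gt_eqF.
  by rewrite invf_div divfK// gt_eqF.
pose b := (1 - a)^-1.
pose k t := if t <= a then c (a^-1 * t + 0) else c' (b * t + - (b * a)).
have caff (u v : R) : continuous (fun s : R => u * s + v).
  move=> s; apply: cvgD; last exact: cvg_cst.
  by apply: cvgM; [exact: cvg_cst|exact: cvg_id].
have ck : continuous k.
  apply: cont_if.
  - by move=> t; exact: cont_comp (caff _ _ t) (cc _).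
  - by move=> t; exact: cont_comp (caff _ _ t) (cc' _).
  - by rewrite mulVf ?gt_eqF// addr0 subrr c1' c0'.
(* near each time k is a reparametrization of one of the two curves, because
   both are constant near the junction *)
have germ (t : R) : (\forall s \near t, k s = c (a^-1 * s + 0)) \/
              (\forall s \near t, k s = c' (b * s + - (b * a))).
  have [ta|ta] := ltP t (a + e' * (1 - a)).
    have [ta'|ta'] := ltP t a.
      left; near=> s; rewrite /k ifT//; near: s.
      by apply: filterS (lt_nbhsl ta') => s; exact: ltW.
    left; near=> s; rewrite /k; case: ifPn => //; rewrite -ltNge => as_.
    have -> : c' (b * s + - (b * a)) = c' 0.
      apply: f0'; rewrite -mulrBr /b ler_pdivrMl// mulrC lerBlDl ltW//.
      by near: s; exact: lt_nbhsl.
    have -> : c (a^-1 * s + 0) = c 1.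
      apply: f1; rewrite addr0 (@le_trans _ _ 1)//; first by rewrite lerBlDl lerDr ltW.
      by rewrite ler_pdivlMl// mulr1 ltW.
    by rewrite c0' c1'.
  right; near=> s; rewrite /k ifF//; apply/negbTE; rewrite -ltNge; near: s.
  by apply: lt_nbhsr; apply: lt_le_trans ta; rewrite ltrDl mulr_gt0.
exists k; split=> //.
- move=> t; have [h|h] := germ t.
    apply: (C1_germ (c' := p \o (fun s => c (a^-1 * s + 0)))).
      by apply: filterS h => s /= ->.
    by have [] := C1_affine g (pc_cont cc) (c1 (a^-1 * t + 0)) c1.
  apply: (C1_germ (c' := p \o (fun s => c' (b * s + - (b * a))))).
    by apply: filterS h => s /= ->.
  by have [] := C1_affine g (pc_cont cc') (c1_ (b * t + - (b * a))) c1_.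
- pose e1 := Num.min (a * e) a; pose e2 := Num.min (e' * (1 - a)) ((1 - a) / 2).
  have k0 : k 0 = c 0 by rewrite /k ltW// mulr0 addr0.
  have k1 : k 1 = c' 1.
    rewrite /k ifF; last by apply/negbTE; rewrite -ltNge -subr_gt0.
    by congr c'; rewrite mulr1 /b; field; rewrite gt_eqF.
  exists (Num.min e1 e2); first by rewrite !lt_min a0 !mulr_gt0 ?invr_gt0.
  rewrite k0 k1; split=> t.
    rewrite !le_min => /andP[/andP[h1 h2] _]; rewrite /k h2 addr0.
    by apply: f0; rewrite ler_pdivrMl.
  move=> ht; have {ht} : 1 - t <= Num.min e1 e2 by lra.
  rewrite !le_min => /andP[_ /andP[h1 h2]]; rewrite /k ifF; last first.
    by apply/negbTE; rewrite -ltNge; lra.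
  by apply: f1'; rewrite -mulrBr /b ler_pdivlMl//; lra.
- split; first by rewrite /k ltW// mulr0 addr0.
  rewrite /k ifF; last by apply/negbTE; rewrite -ltNge -subr_gt0.
  by rewrite -c1''; congr c'; rewrite mulr1 /b; field; rewrite gt_eqF.
- move=> t; have [h|h] := germ t.
    rewrite (speed_germ g (c' := p \o (fun s => c (a^-1 * s + 0)))); last first.
      by apply: filterS h => s /= ->.
    have [_ ->] := C1_affine g (pc_cont cc) (c1 (a^-1 * t + 0)) c1.
    have ia : 0 <= a^-1 by rewrite invr_ge0 ltW.
    rewrite sqrtr_sqr ger0_norm// -aL.
    by rewrite ler_pM2l ?invr_gt0//; exact: sc.
  rewrite (speed_germ g (c' := p \o (fun s => c' (b * s + - (b * a))))); last first.
    by apply: filterS h => s /= ->.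
  have [_ ->] := C1_affine g (pc_cont cc') (c1_ (b * t + - (b * a))) c1_.
  have ib : 0 <= b by rewrite invr_ge0 ltW.
  by rewrite sqrtr_sqr ger0_norm// -aL' ler_pM2l ?invr_gt0//; exact: sc'.
Unshelve. all: by end_near. Qed.

Lemma joined_deck (a : deck p) L x y : joined L x y -> joined L (a x) (a y).
Proof.
move=> [c [cc c1 [e e0 [f0 f1]] [c0 c1'] sc]].
have E1 : p \o (a \o c) = p \o c by apply/funext => t /=; rewrite deck_proj.
exists (a \o c); split.
- by move=> t; apply: continuous_comp (cc t) (@deck_cont _ _ _ a _).
- by move=> t; rewrite E1.
- by exists e => //; split=> t ht /=; [rewrite f0|rewrite f1].
- by rewrite /= c0 c1'.
- by move=> t; rewrite E1.
Qed.

Lemma lifted_distance_le L x y : joined L x y -> lifted_distance p g x y <= L.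
Proof.
move=> [c [cc c1 fc [c0 c1'] sc]].
have C1 : C1_curve A (p \o c) by move=> t i; exact: c1.
apply: (@le_trans _ _ (curve_length g (p \o c))).
  apply: ge_inf; last by exists c.
  by exists 0 => l [k [_ _ _ _ ->]]; exact: curve_length_ge0.
have [F [hF ->]] := arclength_ex g_metric (pc_cont cc) C1.
have := arclength_bound hF (a := 0) (b := 1) (L := L) _ ler01 sc.
by rewrite subr0 mulr1; apply; lra.
Qed.

(** [joined] serves to make the set of lengths nonempty, so that its infimum is approached by actual
    curves. *)
Lemma lifted_distance_curve L x y l : joined L x y -> lifted_distance p g x y < l ->
  exists c : R -> E, [/\ continuous c, C1_curve A (p \o c), c 0 = x, c 1 = y &
    curve_length g (p \o c) < l].
Proof.
move=> [c [cc c1 fc [c0 c1'] sc]] xyl.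
have [|_ [k [ck k1 k0 k1' ->]] hk] := inf_lt _ xyl; last by exists k.
by exists (curve_length g (p \o c)), c; split=> // t i; exact: c1.
Qed.

End Joined.

(** * Charts lifted to the cover *)

Section LiftedCharts.
Context {R : realType} {d : nat} {N E : topologicalType} (A : smooth_atlas R d N).
Variables (g : chart_index A -> 'rV[R]_d -> 'M[R]_d) (p : E -> N).
Hypothesis g_metric : riemannian_metric g.
Hypothesis p_cov : covering_map p.
Hypothesis N_hausdorff : hausdorff_space N.

Local Notation dom := (chart_dom (s := A)).
Local Notation ch := (chart (s := A)).
Local Notation chi := (chart_inv (s := A)).

Let p_cont : continuous p. Proof. by case: p_cov. Qed.

(* A parametrization of a neighbourhood of e by a cube, inverse to a chart of N
   composed with p, on which the metric is comparable with the sup norm. *)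
Record cube_at (e : E) := Cube {
  ci : chart_index A;
  cr : R; cm : R; cM : R;
  cpsi : 'rV[R]_d -> E;
  cr_gt0 : 0 < cr; cm_gt0 : 0 < cm; cM_gt0 : 0 < cM;
  cdom : dom ci (p e);
  cpsi0 : cpsi (ch ci (p e)) = e;
  cpsi_dom : forall v, `|v - ch ci (p e)| <= cr -> dom ci (p (cpsi v));
  cpsiK : forall v, `|v - ch ci (p e)| <= cr -> ch ci (p (cpsi v)) = v;
  cpsi_cont : forall v, `|v - ch ci (p e)| <= cr -> {for v, continuous cpsi};
  cmetric : forall y v, `|y - ch ci (p e)| <= cr ->
    cm * `|v| <= Num.sqrt (qform g ci y v) <= cM * `|v|;
  copen : open [set e' | [/\ dom ci (p e'), `|ch ci (p e') - ch ci (p e)| < cr &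
    cpsi (ch ci (p e')) = e']]
}.

(** Compose the inverse of a chart with the section of [p] through [e], and shrink the radius until
    the metric bounds, the evenly covered set and [U] are all respected. *)
Lemma cube_ex (e : E) (U : set E) : nbhs e U ->
  exists c : cube_at e, forall v, `|v - ch (ci c) (p e)| <= cr c -> U (cpsi c v).
Proof.
move=> Ue; pose i := chart_at A (p e).
have ie : dom i (p e) by exact: chart_at_dom.
pose x0 := ch i (p e).
have [V [[oV Ve] /(_ e Ve)[W [s [oW We cs hs1 hs2]]]]] := evenly_coveredP p_cov (p e).
have ix0 : (ch i @` dom i) x0 by exists (p e).
have [m [M [r1 [m0 M0 r10 hm]]]] := metric_bounds g_metric ix0.
have chi0 : chi i x0 = p e by rewrite /x0 chartK.
have se : s (p e) = e by have [] := hs2 _ We.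
have cx0 : {for x0, continuous (chi i)} by exact: chart_inv_continuous.
have n1 : \forall v \near x0, V (chi i v).
  by apply: (open_comp_near cx0) => //; rewrite chi0.
have cs0 : {for x0, continuous (fun v => s (chi i v))}.
  by apply: (cont_comp cx0); rewrite chi0; exact: cs.
have n2 : \forall v \near x0, U (s (chi i v)).
  by apply: cs0; rewrite chi0 se.
have n3 : \forall v \near x0, (ch i @` dom i) v.
  by apply: open_nbhs_nbhs; split=> //; exact: chart_img_open.
have n4 : \forall v \near x0, V (chi i v) /\ U (s (chi i v)) /\ (ch i @` dom i) v.
  by apply: filterS3 n1 n2 n3 => v.
have /nbhs_ballP[r /= r0 hr] := n4.
pose r' := Num.min r1 (r / 2).
have r'0 : 0 < r' by rewrite lt_min r10 divr_gt0.
have near_ball v : `|v - x0| <= r' -> [/\ V (chi i v), U (s (chi i v)) & (ch i @` dom i) v].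
  move=> vr; have [|? [? ?] //] := hr v.
  rewrite -ball_normE/= distrC (le_lt_trans vr)// gt_min ltr_pdivrMr// ltr_pMr// ltr1n.
  by rewrite orbT.
have pch v : `|v - x0| <= r' -> p (s (chi i v)) = chi i v.
  by move=> /near_ball[Vv _ _]; have [] := hs1 _ Vv.
have dch v : `|v - x0| <= r' -> dom i (chi i v) /\ ch i (chi i v) = v.
  by move=> /near_ball[_ _ [y iy <-]]; rewrite !chartK.
have eq_W : [set e' | [/\ dom i (p e'), `|ch i (p e') - x0| < r' &
    s (chi i (ch i (p e'))) = e']] =
    W `&` (p @^-1` (dom i `&` [set y | `|ch i y - x0| < r'])).
  rewrite predeqE => e'; split=> [[h1 h2 h3]|[We' [h1 h2]]].
    split=> //; rewrite -h3.
    by have [Vv _ _] := near_ball _ (ltW h2); have [] := hs1 _ Vv.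
  by split=> //; rewrite chartK//; have [] := hs2 _ We'.
unshelve eexists.
  apply: (@Cube e i r' m M (fun v => s (chi i v))) => //.
  - by rewrite -/x0 chi0.
  - by move=> v vr; rewrite pch//; have [] := dch v vr.
  - by move=> v vr; rewrite pch//; have [] := dch v vr.
  - move=> v vr; have [Vv _ [y iy yv]] := near_ball v vr.
    apply: (@cont_comp _ _ _ (chi i) s); last exact: cs.
    by rewrite -yv; exact: chart_inv_continuous.
  - by move=> y v yr; apply: hm; rewrite (le_trans yr)// ge_min lexx.
  - rewrite eq_W; apply: openI => //.
    move/continuousP: p_cont; apply.
    rewrite openE => y [iy yr]; rewrite /interior/=.
    near=> z; split; near: z.
      by apply: open_nbhs_nbhs; split=> //; exact: chart_dom_open.
    apply: (@near_lt R _ (fun z => `|ch i z - x0|)) => //.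
    apply: (@cont_comp _ _ _ (fun z => ch i z - x0) (fun v => `|v|)); last exact: norm_continuous.
    by apply: cvgB; [exact: chart_continuous|exact: cvg_cst].
by move=> v vr /=; have [] := near_ball v vr.
Unshelve. all: by end_near. Qed.

Definition sheet {e} (c : cube_at e) : set E :=
  [set e' | [/\ dom (ci c) (p e'), `|ch (ci c) (p e') - ch (ci c) (p e)| < cr c &
    cpsi c (ch (ci c) (p e')) = e']].

Lemma sheet_nbhs {e} (c : cube_at e) : nbhs e (sheet c).
Proof.
apply: open_nbhs_nbhs; split; first exact: copen.
by split; [exact: cdom|rewrite subrr normr0 cr_gt0|exact: cpsi0].
Qed.

Lemma cpsi_sheet {e} (c : cube_at e) v : `|v - ch (ci c) (p e)| < cr c -> sheet c (cpsi c v).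
Proof. by move=> vr; split; rewrite ?cpsiK ?ltW//; exact: cpsi_dom (ltW vr). Qed.

Lemma convex_ball {e} (c : cube_at e) v w s : `|v - ch (ci c) (p e)| <= cr c ->
  `|w - ch (ci c) (p e)| <= cr c -> 0 <= s <= 1 ->
  `|(v + s *: (w - v)) - ch (ci c) (p e)| <= cr c.
Proof.
move=> vr wr /andP[s0 s1]; set x0 := ch _ _ in vr wr *.
have -> : v + s *: (w - v) - x0 = (1 - s) *: (v - x0) + s *: (w - x0).
  rewrite !scalerBr !scalerBl !scale1r; apply/rowP => j; rewrite !mxE; ring.
rewrite (le_trans (ler_normD _ _))// !normrZ (ger0_norm s0) ger0_norm ?subr_ge0//.
have -> : cr c = (1 - s) * cr c + s * cr c by ring.
by rewrite lerD// ler_wpM2l// subr_ge0.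
Qed.

Lemma line_cont (v w : 'rV[R]_d) (f : R -> R) : continuous f -> continuous (fun t => v + f t *: (w - v)).
Proof.
move=> cf t; apply: cvgD; first exact: cvg_cst.
by apply: cvgZ; [exact: cf|exact: cvg_cst].
Qed.

Lemma cover_lpc (e : E) (U : set E) : nbhs e U ->
  exists W : set E, nbhs e W /\ forall y, W y -> exists c : R -> E,
    [/\ continuous c, c 0 = e, c 1 = y & forall t, 0 <= t <= 1 -> U (c t)].
Proof.
move=> /cube_ex[c hU]; exists (sheet c); split; first exact: sheet_nbhs.
move=> y [iy yr yE]; set x0 := ch (ci c) (p e) in yr.
have x0r : `|x0 - x0| <= cr c by rewrite subrr normr0 ltW// cr_gt0.
have hb t := convex_ball x0r (ltW yr) (@clamp_itv _ 0 1 t ler01).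
exists (fun t => cpsi c (x0 + clamp 0 1 t *: (ch (ci c) (p y) - x0))); split.
- move=> t; apply: (@cont_comp _ _ _ (fun t => x0 + clamp 0 1 t *: (ch (ci c) (p y) - x0)) (cpsi c)).
    exact/line_cont/clamp_continuous.
  exact: cpsi_cont (hb t).
- by rewrite clampE ?lexx ?ler01// scale0r addr0 cpsi0.
- by rewrite clampE ?lexx ?ler01// scale1r addrC subrK.
- by move=> t _; exact: hU (hb t).
Qed.

(** The straight segment in the chart, run through by [step]: this makes the ends flat, and [dstep]
    is at most 4. *)
Lemma joined_ball {e} (c : cube_at e) v w : `|v - ch (ci c) (p e)| <= cr c ->
  `|w - ch (ci c) (p e)| <= cr c -> joined g p (cM c * (4 * `|w - v|)) (cpsi c v) (cpsi c w).
Proof.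
move=> vr wr; pose f (t : R) : 'rV[R]_d := v + step t *: (w - v).
have fr t : `|f t - ch (ci c) (p e)| <= cr c by exact: convex_ball vr wr (step_itv t).
have pf t : chi (ci c) (f t) = p (cpsi c (f t)).
  by rewrite -{1}(cpsiK (fr t)) chartK//; exact: cpsi_dom (fr t).
have cf : continuous (fun t => cpsi c (f t)).
  move=> t; apply: (@cont_comp _ _ _ f (cpsi c)); first exact/line_cont/step_continuous.
  exact: cpsi_cont (fr t).
have df (t : R) : is_derive t (1 : R) f (dstep t *: (w - v)).
  have h := is_derive_step t.
  have hd : differentiable (fun t : R => step t *: (w - v)) t.
    by apply: differentiableZl; apply/derivable1_diffP; case: h.
  have h2 : is_derive t (1 : R) (fun t : R => step t *: (w - v)) (dstep t *: (w - v)).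
    split; first by apply/derivable1_diffP.
    rewrite deriveE// diffZl//; last by apply/derivable1_diffP; case: h.
    by rewrite /= -deriveE; [case: h => _ ->|apply/derivable1_diffP; case: h].
  have -> : f = cst v + (fun t : R => step t *: (w - v)) by [].
  by rewrite -[X in is_derive _ _ _ X]add0r; exact: is_deriveD.
have key j t : dom j (p (cpsi c (f t))) ->
    derivable (ch j \o (p \o (fun t => cpsi c (f t)))) t 1 /\
    derive1 (ch j \o (p \o (fun t => cpsi c (f t)))) t =
    dstep t *: 'D_(w - v) (ch j \o chi (ci c)) (f t).
  move=> jt.
  have hy : (ch (ci c) @` (dom (ci c) `&` dom j)) (f t).
    by exists (p (cpsi c (f t))); [split=> //; exact: cpsi_dom (fr t)|exact: cpsiK (fr t)].
  have dft : derivable f t 1 by case: (df t).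
  have [d1 d2] := derive_transition (i := ci c) (f := f) erefl hy dft.
  have E1 : ch j \o (p \o (fun t => cpsi c (f t))) = ch j \o chi (ci c) \o f.
    by apply/funext => s /=; rewrite pf.
  have E2 : derive1 f t = dstep t *: (w - v) by rewrite derive1E; case: (df t).
  rewrite E1 d2 E2; split=> //.
  have dtau : differentiable (ch j \o chi (ci c)) (f t).
    by have [h _] := @chart_transition_smooth _ _ _ A (ci c) j 1%N; exact: h.
  by rewrite !deriveE// linearZ.
have C1 t : C1_at A (p \o (fun t => cpsi c (f t))) t.
  move=> j jt; split; first by have [] := key j t jt.
  have hy : (ch (ci c) @` (dom (ci c) `&` dom j)) (f t).
      by exists (p (cpsi c (f t))); [split=> //; exact: cpsi_dom (fr t)|exact: cpsiK (fr t)].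
  have cpf : continuous (p \o (fun t => cpsi c (f t))).
      by move=> s; exact: continuous_comp (cf s) (@p_cont _).
    apply: (@cont_near_eq _ _ _ (fun t => dstep t *: 'D_(w - v) (ch j \o chi (ci c)) (f t))).
      near=> s; have [|_ ->//] := key j s.
      by near: s; exact: (near_dom cpf).
    apply: cvgZ; first exact: dstep_continuous.
    apply: (@cont_comp _ _ _ f (fun y => 'D_(w - v) (ch j \o chi (ci c)) y)).
      exact/line_cont/step_continuous.
    by have [_ /(_ (w - v)) h] := @chart_transition_smooth _ _ _ A (ci c) j 1%N; exact: h.
exists (fun t => cpsi c (f t)); split=> //.
- exists (1 / 4) => //; rewrite /f; split=> t ht.
    by rewrite !step0//; lra.
  by rewrite !step1//; lra.
- by rewrite /f step0 ?step1 ?scale0r ?addr0 ?scale1r; [rewrite addrC subrK|lra|lra].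
- move=> t.
  have C1' : C1_curve A (p \o (fun t => cpsi c (f t))) by move=> s j; exact: C1.
  rewrite (speedE g_metric _ C1' (i := ci c)); last exact: cpsi_dom (fr t); last first.
    by move=> s; exact: continuous_comp (cf s) (@p_cont _).
    rewrite /chart_speed /= cpsiK//.
  have /andP[_ h] := cmetric (derive1 (ch (ci c) \o (p \o (fun t => cpsi c (f t)))) t) (fr t).
  apply: (le_trans h); rewrite ler_pM2l ?cM_gt0//.
  have -> : derive1 (ch (ci c) \o (p \o (fun t => cpsi c (f t)))) t = dstep t *: (w - v).
    have -> : derive1 (ch (ci c) \o (p \o (fun t => cpsi c (f t)))) t = derive1 f t.
      by congr (derive1 _ t); apply/funext => s /=; rewrite cpsiK.
    by rewrite derive1E; case: (df t).
  have /andP[s0 s4] := dstep_itv t.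
  by rewrite normrZ ger0_norm// ler_wpM2r.
Unshelve. all: by end_near. Qed.

Lemma kappa_near {e} (c : cube_at e) r : 0 < r ->
  \forall y \near e, sheet c y /\ `|ch (ci c) (p y) - ch (ci c) (p e)| < r.
Proof.
move=> r0; apply: filterI; first exact: sheet_nbhs.
apply: (@near_lt R _ (fun y => `|ch (ci c) (p y) - ch (ci c) (p e)|)); last first.
  by rewrite subrr normr0.
apply: (@cont_comp _ _ _ (fun y => ch (ci c) (p y) - ch (ci c) (p e)) (fun v => `|v|));
  last exact: norm_continuous.
apply: cvgB; last exact: cvg_cst.
have h1 : {for p e, continuous (ch (ci c))} by apply: chart_continuous; exact: cdom.
exact: (@cont_comp _ _ _ p (ch (ci c)) e (@p_cont e) h1).
Qed.

Lemma joined_near (e : E) r : 0 < r ->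
  exists Z0 : set E, nbhs e Z0 /\ forall y z, Z0 y -> Z0 z -> joined g p r y z.
Proof.
move=> r0; have [c _] := cube_ex (@filterT _ (nbhs e) _).
(* 8 is the factor 4 of [joined_ball] times 2, two points of the cube being at distance at most
   twice its radius. *)
have M8 : 0 < r / (8 * cM c) by rewrite divr_gt0// mulr_gt0// cM_gt0.
exists [set y | sheet c y /\ `|ch (ci c) (p y) - ch (ci c) (p e)| < r / (8 * cM c)].
split; first exact: kappa_near.
move=> y z [[_ yr yE] ym] [[_ zr zE] zm].
rewrite -yE -zE; apply: joined_le (joined_ball (ltW yr) (ltW zr)).
have h : `|ch (ci c) (p z) - ch (ci c) (p y)| <= 2 * (r / (8 * cM c)).
  rewrite -(subrKA (ch (ci c) (p e))) (le_trans (ler_normD _ _))//.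
  by rewrite [`|_ - ch _ (p y)|]distrC mulr2n mulrDl !mul1r lerD// ltW.
have -> : r = cM c * (4 * (2 * (r / (8 * cM c)))) by field; rewrite gt_eqF// cM_gt0.
by rewrite !ler_pM2l// cM_gt0.
Qed.

Lemma joined_ex (x y : E) : connected [set: E] -> exists2 L, 0 < L & joined g p L x y.
Proof.
move=> cE; apply: (@connected_ind _ [set: E] (fun y => exists2 L, 0 < L & joined g p L x y) x) => //.
  move=> e _; have [Z0 [Oe hO]] := joined_near e ltr01.
  have Oee := nbhs_singleton Oe.
  apply: filterS Oe => z Oz _; split=> -[L L0 xz]; exists (L + 1); rewrite ?addr_gt0//.
    by apply: joined_trans xz (hO _ _ Oz Oee).
  by apply: joined_trans xz (hO _ _ Oee Oz).
have [Z0 [Oe hO]] := joined_near x ltr01.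
by exists 1 => //; apply: hO; exact: nbhs_singleton.
Qed.

Lemma joined_locally_bounded (x y : E) : connected [set: E] ->
  exists Z0 Z1 : set E, [/\ nbhs x Z0, nbhs y Z1 &
    exists2 L, 0 < L & forall x' y', Z0 x' -> Z1 y' -> joined g p L x' y'].
Proof.
move=> cE; have [L L0 xy] := joined_ex x y cE.
have [Z0 [Oe hO]] := joined_near x ltr01; have [Z1 [Oe' hO']] := joined_near y ltr01.
exists Z0, Z1; split=> //; exists (1 + L + 1); first by rewrite !addr_gt0.
move=> x' y' Ox Oy; apply: (joined_trans _ _ _ _ (y := y)) => //; first by rewrite addr_gt0.
  by apply: joined_trans xy => //; apply: hO => //; exact: nbhs_singleton.
by apply: hO' => //; exact: nbhs_singleton.
Qed.

(** Each coordinate moves no faster than arclength divided by [cm]; this is integrated by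
    monotonicity of the sum and of the difference of the coordinate and the rescaled [F]. *)
Lemma kappa_lipschitz {e} (c : cube_at e) (k : R -> E) F a b : continuous k ->
  C1_curve A (p \o k) -> arclength g (p \o k) F -> 0 <= a -> a <= b ->
  (forall t, a <= t <= b -> sheet c (k t)) ->
  cm c * `|ch (ci c) (p (k b)) - ch (ci c) (p (k a))| <= F b - F a.
Proof.
move=> ck C1 hF a0 ab hk.
have cpk : continuous (p \o k) by move=> s; exact: continuous_comp (ck s) (@p_cont _).
have Fab : 0 <= F b - F a by rewrite subr_ge0; apply: (arclength_le hF) => //; lra.
rewrite -ler_pdivlMl ?cm_gt0//; apply/rV_normleP => [|j].
  by rewrite mulr_ge0// invr_ge0 ltW// cm_gt0.
pose f (t : R) := ch (ci c) (p (k t)) 0 j.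
pose v (t : R) := derive1 (ch (ci c) \o (p \o k)) t.
have df (t : R) : a <= t <= b -> is_derive t (1 : R) f (v t 0 j).
  move=> /hk[it _ _]; have [d1 _] := C1 t (ci c) it.
  split; first by have /derivable_mxP := d1; apply.
  by rewrite /v derive1E derive_mx// mxE.
have vb (t : R) : a <= t <= b -> `|v t 0 j| <= (cm c)^-1 * speed g (p \o k) t.
  move=> tab; have [it tr _] := hk t tab.
  rewrite (speedE g_metric cpk C1 it) ler_pdivlMl ?cm_gt0//.
  have /andP[h _] := cmetric (v t) (ltW tr); apply: le_trans h.
  by rewrite ler_pM2l ?cm_gt0// rV_coord_le.
have dF (t : R) : a <= t <= b -> is_derive t (1 : R) F (speed g (p \o k) t).
  by move=> /andP[ta _]; apply: hF; lra.
rewrite !mxE -/(f b) -/(f a) ler_norml; apply/andP; split.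
  suff : (cm c)^-1 * F a + f a <= (cm c)^-1 * F b + f b by lra.
  apply: (derive_ge0_le (f := fun t => (cm c)^-1 * F t + f t)
    (df := fun t => (cm c)^-1 * speed g (p \o k) t + v t 0 j) ab) => t tab.
    have h1 := df t tab; have h2 := dF t tab.
    have -> : (fun t => (cm c)^-1 * F t + f t) = (cm c)^-1 *: F + f by [].
    by apply: is_derive_eq.
  by have := vb t tab; rewrite ler_norml => /andP[]; lra.
suff : (cm c)^-1 * F a - f a <= (cm c)^-1 * F b - f b by lra.
apply: (derive_ge0_le (f := fun t => (cm c)^-1 * F t - f t)
  (df := fun t => (cm c)^-1 * speed g (p \o k) t - v t 0 j) ab) => t tab.
  have h1 := df t tab; have h2 := dF t tab.
  have -> : (fun t => (cm c)^-1 * F t - f t) = (cm c)^-1 *: F - f by [].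
  by apply: is_derive_eq.
by have := vb t tab; rewrite ler_norml => /andP[]; lra.
Qed.

(** A curve that starts in the half cube and is shorter than [cm] times a quarter of the radius
    cannot escape: as long as it stays in the sheet, [kappa_lipschitz] confines it to a compact
    part, the cube of ratio 3/4 = 1/2 + 1/4. *)
Lemma short_curves (e : E) (U : set E) : nbhs e U ->
  exists Z0 : set E, nbhs e Z0 /\ exists2 r, 0 < r & forall (k : R -> E) F a b,
    continuous k -> C1_curve A (p \o k) -> arclength g (p \o k) F -> 0 <= a -> a <= b ->
    Z0 (k a) -> F b - F a < r -> U (k b).
Proof.
move=> /cube_ex[c hU]; set x0 := ch (ci c) (p e) in hU.
have r2 : 0 < cr c / 2 by rewrite divr_gt0// cr_gt0.
exists [set y | sheet c y /\ `|ch (ci c) (p y) - x0| < cr c / 2].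
split; first exact: kappa_near.
exists (cm c * (cr c / 4)); first by rewrite mulr_gt0 ?cm_gt0// divr_gt0// cr_gt0.
move=> k F a b ck C1 hF a0 ab [ka kax] Fab.
suff h : forall t, a <= t <= b -> sheet c (k t).
  have [_ kr <-] : sheet c (k b) by apply: h; rewrite ab lexx.
  exact/hU/ltW.
have Eh : hausdorff_space E by exact: covering_hausdorff p_cov N_hausdorff.
pose C := cpsi c @` [set v | `|v - x0| <= 3 / 4 * cr c].
have rr : 3 / 4 * cr c < cr c by rewrite gtr_pMl ?cr_gt0//; lra.
have CE : C `<=` sheet c.
  by move=> _ [v vr <-]; apply: cpsi_sheet; exact: le_lt_trans vr rr.
have cC : closed C.
  apply: compact_closed => //; apply: continuous_compact.
    apply: continuous_in_subspaceT => v; rewrite inE /= => vr.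
    by apply: cpsi_cont; rewrite (le_trans vr)// ltW.
  exact: rV_closed_ball_compact_at.
pose P t := forall s, a <= s <= t -> sheet c (k s).
suff hP : forall t, `[a, b]%classic t -> P t.
  by move=> t tab; apply: (hP t); rewrite /= ?in_itv//= lexx; case/andP: tab => ->.
apply: (@connected_ind _ `[a, b]%classic P a); last 2 first.
- by rewrite /= in_itv/= lexx.
- by move=> s sa; have -> : s = a by apply/eqP; rewrite eq_le andbC.
- exact: segment_connected.
move=> t; rewrite /= in_itv/= => /andP[at_ tb].
have openk s : sheet c (k s) -> \forall s' \near s, sheet c (k s').
  by move=> ks; apply: (open_comp_near (ck s)) => //; exact: copen.
have [Pt|nPt] := pselect (P t).
  have kt : sheet c (k t) by apply: Pt; rewrite at_ lexx.
  have /nbhs_ballP[r /= r0 hr] := openk t kt.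
  near=> t' => /= _; split=> // _ s /andP[as_ st'].
  have [st|ts] := leP s t; first by apply: Pt; rewrite as_.
  apply: hr; rewrite -ball_normE/= ltr_distlC; apply/andP; split; first lra.
  have : t' < t + r by near: t'; apply: lt_nbhsl; lra.
  lra.
(* If [P] fails at [t], the curve was outside the sheet at some time strictly before [t]: otherwise
   [k t] would be a limit of points of the closed set [C], which lies in the sheet. *)
suff [s ast nks] : exists2 s, a <= s < t & ~ sheet c (k s).
  move/andP: ast => [as_ st].
  near=> t' => /= _; split=> // Pt'; exfalso; apply: nks; apply: Pt'.
  rewrite as_ ltW//; near: t'; exact: lt_nbhsr.
apply: contrapT => /forall2NP h; apply: nPt => s /andP[as_ st].
have h' s' : a <= s' < t -> sheet c (k s').
  by move=> hs'; have [//|/contrapT] := h s'.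
have [ts|st'] := leP t s; last by apply: h'; rewrite as_.
have {s as_ st ts} -> : s = t by apply/eqP; rewrite eq_le st.
have [<-//|at'] := eqVneq a t.
have {at_}at' : a < t by rewrite lt_neqAle at'.
apply: CE; apply: cC.
have inC s : a <= s < t -> C (k s).
  move=> /andP[as_ st]; have [_ _ <-] : sheet c (k s) by apply: h'; rewrite as_.
  exists (ch (ci c) (p (k s))) => //=.
  have := @kappa_lipschitz e c k F a s ck C1 hF a0 as_.
  have hs s' : a <= s' <= s -> sheet c (k s').
    by move=> /andP[h1 h2]; apply: h'; rewrite h1 (le_lt_trans h2).
  move=> /(_ hs) kl.
  have kl2 : cm c * `|ch (ci c) (p (k s)) - ch (ci c) (p (k a))| < cm c * (cr c / 4).
    apply: le_lt_trans kl (le_lt_trans _ Fab); rewrite lerD2r.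
    by apply: (arclength_le hF); lra.
  rewrite ltr_pM2l ?cm_gt0// in kl2.
  rewrite -(subrKA (ch (ci c) (p (k a)))) (le_trans (ler_normD _ _))//.
  have -> : 3 / 4 * cr c = cr c / 4 + cr c / 2 by field.
  by rewrite lerD// ltW.
move=> B /(ck t) kB.
have /nbhs_ballP[r /= r0 hr] : \forall s \near t, B (k s) by [].
pose s := Num.max a (t - r / 2).
have [s1 s2 s3] : [/\ a <= s, s < t & t - r < s].
  by rewrite /s le_max lexx gt_max lt_max; split=> //; [apply/andP; split; lra|apply/orP; right; lra].
exists (k s); split; first by apply: inC; rewrite s1.
by apply: hr; rewrite -ball_normE/= ltr_distlC; apply/andP; split; lra.
Unshelve. all: by end_near. Qed.

Lemma joined_short (e : E) (U : set E) : nbhs e U ->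
  exists Z0 : set E, nbhs e Z0 /\ exists2 r, 0 < r & forall y z, Z0 y -> joined g p r y z -> U z.
Proof.
move=> /short_curves[Z0 [Oe [r r0 hO]]]; exists Z0; split=> //.
exists (r / 2); first by rewrite divr_gt0.
move=> y z Oy [k [ck C1 _ [k0 k1] sk]].
have C1' : C1_curve A (p \o k) by move=> t i; exact: C1.
have cpk : continuous (p \o k) by move=> s; exact: continuous_comp (ck s) (@p_cont _).
have [F [hF _]] := arclength_ex g_metric cpk C1'.
rewrite -k1; apply: (hO k F 0 1) => //; first by rewrite k0.
have := arclength_bound hF (a := 0) (b := 1) (L := r / 2) _ ler01 sk.
by rewrite subr0 mulr1 => /(_ _)/le_lt_trans; apply; lra.
Qed.

End LiftedCharts.

(** * Symmetric forms and pencils *)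

Import VectorInternalTheory.

Section Forms.
Context {R : realType} (V : vectType R).
Notation B := (bform V).
Notation dual V := 'Hom(V, R^o).

Lemma form_valD (q q' : B) v w : form_val (q + q') v w = form_val q v w + form_val q' v w.
Proof. by rewrite /form_val lfunE /= lfunE. Qed.
Lemma form_valZ a (q : B) v w : form_val (a *: q) v w = a * form_val q v w.
Proof. by rewrite /form_val lfunE /= lfunE. Qed.
Lemma form_valN (q : B) v w : form_val (- q) v w = - form_val q v w.
Proof. by rewrite -scaleN1r form_valZ mulN1r. Qed.
Lemma form_valB (q q' : B) v w : form_val (q - q') v w = form_val q v w - form_val q' v w.
Proof. by rewrite form_valD form_valN. Qed.
Lemma form_val0 v w : form_val (0 : B) v w = 0.
Proof. by rewrite -(scale0r (0 : B)) form_valZ mul0r. Qed.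
Lemma form_valDl (q : B) v v' w : form_val q (v + v') w = form_val q v w + form_val q v' w.
Proof. by rewrite /form_val linearD lfunE. Qed.
Lemma form_valZl a (q : B) v w : form_val q (a *: v) w = a * form_val q v w.
Proof. by rewrite /form_val linearZ lfunE. Qed.
Lemma form_valDr (q : B) v w w' : form_val q v (w + w') = form_val q v w + form_val q v w'.
Proof. by rewrite /form_val linearD. Qed.
Lemma form_valZr a (q : B) v w : form_val q v (a *: w) = a * form_val q v w.
Proof. by rewrite /form_val linearZ. Qed.

Lemma form_ext (q q' : B) : (forall v w, form_val q v w = form_val q' v w) -> q = q'.
Proof. by move=> h; apply/lfunP => v; apply/lfunP => w; exact: h. Qed.

Lemma polarization (q : B) v w : form_symmetric q ->
  form_val q (v + w) (v + w) = form_val q v v + form_val q v w *+ 2 + form_val q w w.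
Proof. by move=> sq; rewrite !form_valDl !form_valDr (sq w v); ring. Qed.

Lemma form_symmetricZ a (q : B) : form_symmetric q -> form_symmetric (a *: q).
Proof. by move=> h v w; rewrite !form_valZ h. Qed.
Lemma form_symmetricD (q q' : B) : form_symmetric q -> form_symmetric q' ->
  form_symmetric (q + q').
Proof. by move=> h h' v w; rewrite !form_valD h h'. Qed.

Lemma form_symmetric_span (X : seq B) q : (forall x, x \in X -> form_symmetric x) ->
  q \in <<X>>%VS -> form_symmetric q.
Proof.
move=> h /(coord_span (X := in_tuple X)) ->; elim/big_ind: _.
- by move=> v w; rewrite !form_val0.
- by move=> a b; apply: form_symmetricD.
- by move=> i _; apply: form_symmetricZ; apply: h; rewrite mem_nth.
Qed.

Definition psd (q : B) := form_symmetric q /\ forall v, 0 <= form_val q v v.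

(** If [q(v, w)] were nonzero, adding a suitable multiple of [v] to [w] would make the value of [q]
    negative. *)
Lemma psd_kernel q v : psd q -> form_val q v v = 0 -> forall w, form_val q v w = 0.
Proof.
move=> [sq pq] vv w; apply/eqP; rewrite -[_ == 0]negbK; apply/negP => nz.
have := pq ((- (form_val q w w + 1) / (form_val q v w)) *: v + w).
rewrite polarization // !form_valZl !form_valZr vv !mulr0 add0r.
rewrite -mulrA mulVf // mulr1; have := pq w; lra.
Qed.

Definition rank1 (l : dual V) : B := linfun (fun v : V => l v *: l).

Lemma rank1E l v w : form_val (rank1 l) v w = l v * l w.
Proof.
have lin : linear (fun v : V => (l v *: l : dual V)).
  move=> a x y; apply/lfunP => z.
  by rewrite add_lfunE !scale_lfunE linearP scalerDl -scalerA.
pose f := GRing.isLinear.Build R V _ _ _ lin.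
pose F : {linear V -> dual V} := HB.pack (fun v : V => (l v *: l : dual V)) f.
by rewrite /form_val /rank1 (lfunE F) /= lfunE.
Qed.

(** Completing the square: the difference is semidefinite, being [q] evaluated after projecting
    along [v0], and its kernel gains [v0], so the rank drops. *)
Lemma limg_rank1_sub (q : B) v0 : psd q -> form_val q v0 v0 != 0 ->
  psd (q - (form_val q v0 v0)^-1 *: rank1 (q v0 : dual V)) /\
  (\dim (limg ((q - (form_val q v0 v0)^-1 *: rank1 (q v0 : dual V))%R : 'Hom(V, dual V)))
   < \dim (limg (q : 'Hom(V, dual V))))%N.
Proof.
move=> hq nz; have [sq pq] := hq; set c := form_val q v0 v0 in nz *.
set q' := q - _.
have c0 : 0 < c by rewrite lt_def nz pq.
have E v w : form_val q' v w = form_val q v w - c^-1 * (form_val q v0 v * form_val q v0 w).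
  by rewrite form_valB form_valZ rank1E.
have hq' : psd q'.
  split=> [v w|v]; first by rewrite !E sq (mulrC (form_val q v0 v)).
  rewrite E; have := pq (v - (c^-1 * form_val q v0 v) *: v0).
  rewrite -scaleNr polarization // !form_valZl !form_valZr -/c (sq v v0).
  suff -> : forall a b : R, a + - (c^-1 * b) * b *+ 2 + - (c^-1 * b) * (- (c^-1 * b) * c)
     = a - c^-1 * (b * b) by [].
  by move=> a b; rewrite mulr2n; field.
split=> //.
have ker_sub : (lker (q : 'Hom(V, dual V)) <= lker (q' : 'Hom(V, dual V)))%VS.
  apply/subvP => v; rewrite !memv_ker => /eqP qv; apply/eqP/lfunP => w.
  have qvw w' : form_val q v w' = 0 by rewrite /form_val qv lfunE.
  have := E v w; rewrite (sq v0 v) !qvw mul0r mulr0 subr0 => e.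
  by rewrite [RHS]lfunE; exact: e.
have v0ker : v0 \in lker (q' : 'Hom(V, dual V)).
  rewrite memv_ker; apply/eqP/lfunP => w; rewrite [RHS]lfunE.
  by have := E v0 w; rewrite -/c mulrA mulVf // mul1r subrr.
have v0n : v0 \notin lker (q : 'Hom(V, dual V)).
  apply/negP; rewrite memv_ker => /eqP e; move/eqP: nz; apply.
  by rewrite /c /form_val e lfunE.
have lt : (\dim (lker (q : 'Hom(V, dual V))) < \dim (lker (q' : 'Hom(V, dual V))))%N.
  rewrite ltnNge; apply/negP => le; move/negP: v0n; apply.
  by have := eqEdim (lker (q : 'Hom(V, dual V))) (lker (q' : 'Hom(V, dual V))); rewrite ker_sub le => /eqP ->.
have := limg_ker_dim (q : 'Hom(V, dual V)) fullv; have := limg_ker_dim (q' : 'Hom(V, dual V)) fullv; rewrite !capfv.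
lia.
Qed.

End Forms.

Section Trace.
Context {R : realType} (V : vectType R).
Notation B := (bform V).
Notation dual V := 'Hom(V, R^o).

Lemma lfun_traceE (W : vectType R) (f : 'End(W)) :
  lfun_trace f = \sum_i coord (vbasis {:W}) i (f (vbasis {:W})`_i).
Proof.
apply: eq_bigr => i _; rewrite /passmx.mxof mxE /= passmx.vecof_delta.
by rewrite passmx.coord_rVof.
Qed.

Lemma pairingD (q q' : B) s : pairing (q + q') s = pairing q s + pairing q' s.
Proof.
rewrite /pairing !lfun_traceE -big_split; apply: eq_bigr => i _ /=.
by rewrite !comp_lfunE add_lfunE linearD.
Qed.

Lemma pairingZ a (q : B) s : pairing (a *: q) s = a * pairing q s.
Proof.
rewrite /pairing !lfun_traceE big_distrr; apply: eq_bigr => i _ /=.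
by rewrite !comp_lfunE scale_lfunE linearZ.
Qed.

Lemma pairing_rank1 (l : dual V) s : pairing (rank1 l) s = tensor_val s l l.
Proof.
rewrite /pairing lfun_traceE /tensor_val {3}(coord_vbasis (memvf l)) !linear_sum.
apply: eq_bigr => i _ /=; rewrite comp_lfunE.
have -> : forall v, (rank1 l : 'Hom(V, dual V)) v = l v *: l.
  by move=> v; apply/lfunP => w; rewrite scale_lfunE; exact: rank1E.
by rewrite !linearZ /= mulrC.
Qed.

Lemma psd_eq0 (q : B) : psd q -> (forall v, form_val q v v = 0) -> q = 0.
Proof.
by move=> h h0; apply: form_ext => v w; rewrite form_val0; exact: psd_kernel.
Qed.

(** By induction on the rank, [q] is a positive combination of squares of linear forms [l], on which
    the pairing is [s(l, l)]. *)
Lemma pairing_psd_gt0 (q : B) s : psd q -> q != 0 -> tensor_positive s ->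
  0 < pairing q s.
Proof.
move=> + + sp; have [k le] := ubnP (\dim (limg (q : 'Hom(V, dual V)))).
elim: k q le => // k IH q le hq q0.
have [v0 nz] : exists v, form_val q v v != 0.
  apply: contrapT => h; move/eqP: q0; apply; apply: psd_eq0 => // v.
  by apply/eqP; rewrite -[_ == _]negbK; apply/negP => n; apply: h; exists v.
have [hq' lt] := limg_rank1_sub hq nz.
set q' := (X in psd X) in hq' lt; have -> : q = (form_val q v0 v0)^-1 *: rank1 (q v0 : dual V) + q'.
  by rewrite addrC subrK.
rewrite pairingD pairingZ pairing_rank1.
apply: ltr_wpDr; last first.
  apply: mulr_gt0; first by rewrite invr_gt0 lt_def nz; case: hq => _ ->.
  by apply: sp; apply: contraNneq nz; rewrite /form_val => ->; rewrite lfunE.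
have [->|n0] := eqVneq q' 0; first by rewrite -(scale0r (0 : B)) pairingZ mul0r.
by apply/ltW/IH => //; apply: leq_trans lt _; rewrite -ltnS.
Qed.

End Trace.

Section Coordinates.
Context {R : realType} (V : vectType R).
Notation B := (bform V).
Notation m := (dim B).
Notation n := (dim V).

Lemma cvg_v2r {T} {F : set_system T} {FF : Filter F} (f : T -> B) (q : B) :
  (v2r (f t) @[t --> F] --> v2r q) -> f t @[t --> F] --> q.
Proof.
move=> h A [C [[U oU <-] Cq] CA]; apply: filterS CA _.
by apply: h; exact: open_nbhs_nbhs.
Qed.

Lemma v2r_continuous : continuous (v2r : B -> 'rV[R]_m).
Proof. exact: initial_continuous. Qed.

Lemma r2v_continuous : continuous (r2v : 'rV[R]_m -> B).
Proof. move=> r.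
have E (t : 'rV[R]_m) : v2r (r2v t : B) = t by exact: r2vK.
have h : v2r (r2v t : B) @[t --> r] --> (v2r (r2v r : B) : 'rV[R]_m).
  by rewrite E (_ : (fun t => _) = id); [exact: cvg_id|apply/funext => t; exact: E].
exact: cvg_v2r h.
Qed.

(* Below, forms are row vectors r of coordinates and functionals on forms are
   column vectors th, paired by dval. *)
Definition quad (r : 'rV[R]_m) (v : V) : R := form_val (r2v r : B) v v.

Lemma quadD r r' v : quad (r + r') v = quad r v + quad r' v.
Proof. by rewrite /quad linearD form_valD. Qed.
Lemma quadZ a r v : quad (a *: r) v = a * quad r v.
Proof. by rewrite /quad linearZ form_valZ. Qed.
Lemma quadN r v : quad (- r) v = - quad r v.
Proof. by rewrite -scaleN1r quadZ mulN1r. Qed.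
Lemma quadB r r' v : quad (r - r') v = quad r v - quad r' v.
Proof. by rewrite quadD quadN. Qed.
Lemma quad0 v : quad 0 v = 0.
Proof. by rewrite -(scale0r (0 : 'rV_m)) quadZ mul0r. Qed.
Lemma quadZv a r v : quad r (a *: v) = a ^+ 2 * quad r v.
Proof. by rewrite /quad form_valZl form_valZr mulrA. Qed.

Lemma quad_coord r (w : 'rV[R]_n) : quad r (r2v w) =
  \sum_k \sum_i \sum_j r 0 k * (w 0 i * (w 0 j *
    form_val (r2v (delta_mx 0 k) : B) (r2v (delta_mx 0 i)) (r2v (delta_mx 0 j)))).
Proof.
have vr (s : seq 'I_m) (q : 'I_m -> B) v : form_val (\sum_(k <- s) q k) v v = \sum_(k <- s) form_val (q k) v v.
  by elim/big_rec2: _ => [|k x y _ <-]; rewrite ?form_val0 ?form_valD.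
have vl (s : seq 'I_n) (q : B) (f : 'I_n -> V) v : form_val q (\sum_(k <- s) f k) v = \sum_(k <- s) form_val q (f k) v.
  by elim/big_rec2: _ => [|k x y _ <-]; rewrite ?form_valDl // -(scale0r (0 : V)) form_valZl mul0r.
have vR (s : seq 'I_n) (q : B) (f : 'I_n -> V) v : form_val q v (\sum_(k <- s) f k) = \sum_(k <- s) form_val q v (f k).
  by elim/big_rec2: _ => [|k x y _ <-]; rewrite ?form_valDr // -(scale0r (0 : V)) form_valZr mul0r.
rewrite /quad {1}(row_sum_delta r) linear_sum vr; apply: eq_bigr => k _.
rewrite linearZ form_valZ {1}(row_sum_delta w) linear_sum vl mulr_sumr.
apply: eq_bigr => i _; rewrite linearZ form_valZl (row_sum_delta w) linear_sum vR !mulr_sumr.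
apply: eq_bigr => j _; rewrite linearZ form_valZr; congr (_ * (_ * (_ * _))).
by rewrite -row_sum_delta.
Qed.

Lemma quad_cvg {T} {F : set_system T} {FF : Filter F} (f : T -> 'rV[R]_m) (h : T -> 'rV[R]_n)
  (r : 'rV[R]_m) (w : 'rV[R]_n) :
  f t @[t --> F] --> r -> h t @[t --> F] --> w ->
  quad (f t) (r2v (h t)) @[t --> F] --> quad r (r2v w).
Proof.
move=> fr hw; rewrite quad_coord; under eq_cvg do rewrite quad_coord.
apply: cvg_bigsum => k _; apply: cvg_bigsum => i _; apply: cvg_bigsum => j _.
apply: cvgM; first exact: cvg_coord.
apply: cvgM; first exact: cvg_coord.
apply: cvgM; first exact: cvg_coord.
exact: cvg_cst.
Qed.

Definition posdef (r : 'rV[R]_m) := form_positive (r2v r : B).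

Lemma unit_vector (v : V) : v != 0 ->
  exists a (w : 'rV[R]_n), [/\ 0 < a, `|w| = 1 & v = a *: r2v w].
Proof.
move=> v0; have nv : 0 < `|v2r v : 'rV[R]_n|.
  by rewrite normr_gt0; apply: contra v0 => /eqP e; rewrite -(v2rK v) e linear0.
exists `|v2r v : 'rV[R]_n|, (`|v2r v : 'rV[R]_n|^-1 *: v2r v); split => //.
  by rewrite normrZ ger0_norm ?invr_ge0 // mulVf // gt_eqF.
by rewrite [r2v _]linearZ /= v2rK scalerA mulfV ?scale1r // gt_eqF.
Qed.

(** Positivity on the compact unit sphere is an open condition; scaling covers the other vectors. *)
Lemma posdef_open : open posdef.
Proof.
rewrite openE => r pr; rewrite /interior.
have := @compact_unif _ _ [set w : 'rV[R]_n | `|w| = 1] (nbhs (r : 'rV[R]_m)) _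
  (fun r' w => 0 < quad r' (r2v w)) (@rV_sphere_compact R n 1).
have h w : [set w : 'rV[R]_n | `|w| = 1] w ->
    \forall w' \near w & r' \near r, 0 < quad r' (r2v w').
  move=> w1; apply: (@near_gt _ _ (fun z : 'rV[R]_n * 'rV[R]_m => quad z.2 (r2v z.1)) (w, r)).
    by apply: quad_cvg; [exact: cvg_snd | exact: cvg_fst].
  apply: pr; apply: contraTneq isT => e.
  have : w = 0 by rewrite -(r2vK w) e linear0.
  by move=> w0; move: w1; rewrite /= w0 normr0 => /esym/eqP; rewrite oner_eq0.
move=> /(_ _ h); apply: filterS => r' K v v0.
have [a [w [a0 w1 ->]]] := unit_vector v0.
by rewrite -[form_val _ _ _]/(quad r' _) quadZv mulr_gt0 ?exprn_gt0 //; exact: K.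
Qed.

Lemma quad_v2r (q : B) v : quad (v2r q) v = form_val q v v.
Proof. by rewrite /quad v2rK. Qed.

Lemma posdef_v2rB (q q' : B) : form_positive (q - q') -> posdef (v2r q - v2r q').
Proof.
by move=> h v v0; rewrite -/(quad _ v) quadB !quad_v2r -form_valB; exact: h.
Qed.

Definition symm (r : 'rV[R]_m) := form_symmetric (r2v r : B).
Definition psdr (r : 'rV[R]_m) := psd (r2v r : B).

Lemma posdef_psd r : symm r -> posdef r -> psdr r.
Proof.
move=> sr pr; split=> // v; have [->|v0] := eqVneq v 0; last exact/ltW/pr.
by rewrite -(scale0r (0 : V)) form_valZl mul0r.
Qed.

Definition dval (r : 'rV[R]_m) (th : 'cV[R]_m) : R := (r *m th) 0 0.

Lemma dvalD r r' th : dval (r + r') th = dval r th + dval r' th.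
Proof. by rewrite /dval mulmxDl mxE. Qed.
Lemma dvalZ a r th : dval (a *: r) th = a * dval r th.
Proof. by rewrite /dval -scalemxAl mxE. Qed.
Lemma dvalB r r' th : dval (r - r') th = dval r th - dval r' th.
Proof. by rewrite dvalD -scaleN1r dvalZ mulN1r. Qed.
Lemma dvalDr r th th' : dval r (th + th') = dval r th + dval r th'.
Proof. by rewrite /dval mulmxDr mxE. Qed.
Lemma dvalZr a r th : dval r (a *: th) = a * dval r th.
Proof. by rewrite /dval -scalemxAr mxE. Qed.

Lemma dval_cvg {T} {F : set_system T} {FF : Filter F} (f : T -> 'rV[R]_m) (h : T -> 'cV[R]_m)
  (r : 'rV[R]_m) (w : 'cV[R]_m) :
  f t @[t --> F] --> r -> h t @[t --> F] --> w ->
  dval (f t) (h t) @[t --> F] --> dval r w.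
Proof. by move=> fr hw; apply: cvg_coord; exact: cvg_mulmx. Qed.

(** On symmetric forms these functionals are the positive definite tensors. From here on tensors
    appear only in this guise. *)
Definition dual_pos (th : 'cV[R]_m) := forall r, psdr r -> r != 0 -> 0 < dval r th.

Lemma dual_pos_conv (a b : R) th th' : 0 <= a -> 0 <= b -> 0 < a + b ->
  dual_pos th -> dual_pos th' -> dual_pos (a *: th + b *: th').
Proof.
move=> a0 b0 ab h h' r pr r0; rewrite dvalDr !dvalZr.
have h1 := h r pr r0; have h2 := h' r pr r0.
have [a_0|na] := eqVneq a 0; last first.
  apply: ltr_wpDr; first by rewrite mulr_ge0 // ltW.
  by rewrite mulr_gt0 // lt_def na.
by move: ab; rewrite a_0 mul0r !add0r => ?; rewrite mulr_gt0.
Qed.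

Lemma mixed_dual (P : {vspace B}) : mixed P ->
  exists th, dual_pos th /\ forall q : B, q \in P -> dval (v2r q) th = 0.
Proof.
move=> [s [ss sp sP]]; exists (\col_k pairing (r2v (delta_mx 0 k) : B) s).
have E (q : B) : dval (v2r q) (\col_k pairing (r2v (delta_mx 0 k) : B) s) = pairing q s.
  have ps (I : seq 'I_m) (f : 'I_m -> B) : pairing (\sum_(k <- I) f k) s = \sum_(k <- I) pairing (f k) s.
    elim/big_rec2: _ => [|k x y _ <-]; last by rewrite pairingD.
    by rewrite -(scale0r (0 : B)) pairingZ mul0r.
  rewrite /dval mxE -{2}(v2rK q) {2}(row_sum_delta (v2r q)) linear_sum ps.
  by apply: eq_bigr => k _; rewrite mxE linearZ pairingZ.
split=> [r pr r0|q qP]; last by rewrite E sP.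
rewrite -(r2vK r) E; apply: pairing_psd_gt0 => //.
by apply: contra r0 => /eqP e; rewrite -(r2vK r) e linear0.
Qed.

(** A nonzero positive semidefinite [q] would pair positively with the tensor that kills [P]. *)
Lemma mixed_indefinite (P : {vspace B}) q : mixed P -> q \in P -> q != 0 ->
  form_symmetric q -> exists v, form_val q v v < 0.
Proof.
move=> /mixed_dual [th [pth thP]] qP q0 sq; apply: contrapT => h.
have : 0 < dval (v2r q) th.
  apply: pth; last by apply: contra q0 => /eqP e; rewrite -(v2rK q) e linear0.
  rewrite /psdr v2rK; split=> // v; rewrite leNgt; apply/negP => l; apply: h.
  by exists v.
by rewrite thP // ltxx.
Qed.
End Coordinates.

Section Action.
Context {R : realType} (V : vectType R).
Notation B := (bform V).
Notation dual V := 'Hom(V, R^o).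

Lemma form_actE (h : 'End(V)) (q : B) v w :
  form_val (form_act h q) v w = form_val q (h^-1%VF v) (h^-1%VF w).
Proof.
have lin : linear (fun v : V => ((q ((h^-1)%VF v) : dual V) \o h^-1)%VF).
  move=> a x y; apply/lfunP => z.
  by rewrite add_lfunE scale_lfunE !comp_lfunE linearP [in LHS]linearP add_lfunE scale_lfunE.
pose F : {linear V -> dual V} := HB.pack (fun v : V => ((q ((h^-1)%VF v) : dual V) \o h^-1)%VF)
  (GRing.isLinear.Build R V _ _ _ lin).
by rewrite /form_val /form_act (lfunE F) /= comp_lfunE.
Qed.

Lemma form_actD h (q q' : B) : form_act h (q + q') = form_act h q + form_act h q'.
Proof. by apply: form_ext => v w; rewrite form_valD !form_actE form_valD. Qed.
Lemma form_actZ h a (q : B) : form_act h (a *: q) = a *: form_act h q.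
Proof. by apply: form_ext => v w; rewrite form_valZ !form_actE form_valZ. Qed.

Section Vol.
Variable vol : ('I_(\dim {:V}) -> V) -> R.
Hypothesis vol_form : volume_form vol.

(** Insert a vanishing linear combination of the vectors into the slot [j]: by alternation only its
    [j]-th term survives. *)
Lemma vol_free f : vol f != 0 -> free [tuple f i | i < \dim {:V}].
Proof.
case: vol_form => lin alt _ vf; apply/freeP => k k0 j.
pose G x := vol (dfwith f j x).
have GD a x y : G (a *: x + y) = a * G x + G y by rewrite /G lin.
have G0 : G 0 = 0 by have := GD 1 0 0; rewrite scaler0 addr0 mul1r; lra.
have Gs (I : seq 'I_(\dim {:V})) : G (\sum_(i <- I) k i *: f i) = \sum_(i <- I) k i * G (f i).
  by elim/big_rec2: _ => [|i x y _ <-] //; rewrite GD.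
have e : \sum_i k i *: f i = 0.
  by rewrite -[RHS]k0; apply: eq_bigr => i _; rewrite -tnth_nth tnth_mktuple.
have := Gs (index_enum _); rewrite e G0 (bigD1 j) //= big1 ?addr0.
  have -> : G (f j) = vol f.
    congr vol; apply/funext => i; have [->|n] := eqVneq j i; first by rewrite dfwithin.
    by rewrite dfwithout.
  by move=> /esym/eqP; rewrite mulf_eq0 (negbTE vf) orbF => /eqP.
move=> i ij; rewrite /G (alt _ i j) ?mulr0 //.
by rewrite dfwithin dfwithout // eq_sym.
Qed.

(** A tuple of nonzero volume is sent to a tuple of nonzero volume, that is, a basis to a basis. *)
Lemma SL_ker h : SL vol h -> lker h == 0%VS.
Proof.
case: vol_form => _ _ [f vf] hS.
have := vf; rewrite -(hS f) => /vol_free fr.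
have sp : (fullv <= limg h)%VS.
  have : basis_of fullv [tuple h (f i) | i < \dim {:V}].
    by rewrite basisEfree fr subvf size_tuple leqnn.
  move=> /span_basis <-; apply/span_subvP => v /mapP [i _ ->].
  by apply: memv_img; rewrite (span_basis (_ : basis_of fullv _)) ?memvf // basisEfree fr subvf size_tuple leqnn.
have := limg_ker_dim h fullv; rewrite capfv => e.
rewrite -dimv_eq0; have := dimvS sp; have := dimvS (subvf (limg h)).
by move: e; lia.
Qed.
End Vol.

Lemma form_act_positive h (q : B) : lker h == 0%VS -> form_positive q ->
  form_positive (form_act h q).
Proof.
move=> kh pq v v0; rewrite form_actE; apply: pq; apply: contra v0 => /eqP e.
by rewrite -(lker0_lfunVK kh v) e linear0.
Qed.

End Action.

(** * Orthogonal projectors and the Grassmannian *)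

Section Projectors.
Context {R : realType}.

Lemma gram_unit {d m} (A : 'M[R]_(d, m)) : row_free A -> A *m A^T \in unitmx.
Proof.
move=> fA; rewrite -row_free_unit -kermx_eq0; apply/eqP/row_matrixP => i.
rewrite row0; set x := row i _.
have : x *m (A *m A^T) = 0 by rewrite -row_mul mulmx_ker row0.
move=> e; have : x *m A *m (x *m A)^T = 0 by rewrite trmx_mul mulmxA -(mulmxA x) e mul0mx.
move=> /matrixP /(_ 0 0); rewrite !mxE => s0.
have : x *m A = 0.
  apply/rowP => j; rewrite [RHS]mxE; move/eqP: s0; rewrite psumr_eq0; last first.
    by move=> k _; rewrite [_^T _ _]mxE -expr2 sqr_ge0.
  by move=> /allP /(_ j (mem_index_enum _)); rewrite implyTb [_^T _ _]mxE -expr2 sqrf_eq0 => /eqP.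
by move=> xA; apply: (row_free_inj fA); rewrite xA mul0mx.
Qed.

(** The orthogonal projector onto the row space, acting on rows from the right. *)
Definition projmx {d m} (A : 'M[R]_(d, m)) : 'M[R]_m := A^T *m invmx (A *m A^T) *m A.

Lemma projmx_fix {d m} (A : 'M[R]_(d, m)) : row_free A -> A *m projmx A = A.
Proof. by move=> fA; rewrite /projmx !mulmxA mulmxV ?gram_unit // mul1mx. Qed.

Lemma projmx_sym {d m} (A : 'M[R]_(d, m)) : (projmx A)^T = projmx A.
Proof.
by rewrite /projmx !trmx_mul trmxK trmx_inv trmx_mul trmxK mulmxA.
Qed.

Lemma projmx_sub {d m} (A : 'M[R]_(d, m)) : (projmx A <= A)%MS.
Proof. exact: submxMl. Qed.

Lemma projmxP {d m} (A : 'M[R]_(d, m)) (r : 'rV[R]_m) : row_free A ->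
  (r <= A)%MS <-> r *m projmx A = r.
Proof.
move=> fA; split=> [/submxP [y ->]|<-]; first by rewrite -mulmxA projmx_fix.
exact: submx_trans (submxMl _ _) (projmx_sub _).
Qed.

(** Two symmetric idempotents with the same range absorb each other when multiplied from the right;
    transposing one of the two identities gives equality. *)
Lemma projmx_eq {d d' m} (A : 'M[R]_(d, m)) (A' : 'M[R]_(d', m)) :
  row_free A -> row_free A' -> (A :=: A')%MS -> projmx A = projmx A'.
Proof.
move=> fA fA' E.
have h (B1 B2 : 'M[R]_m) : (forall r : 'rV_m, r *m B1 *m B2 = r *m B1) -> B1 *m B2 = B1.
  by move=> h; apply/row_matrixP => i; rewrite row_mul !rowE h.
have h1 : projmx A *m projmx A' = projmx A.
  apply: h => r; apply/(projmxP _ fA'); rewrite -E.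
  exact: submx_trans (submxMl _ _) (projmx_sub _).
have h2 : projmx A' *m projmx A = projmx A'.
  apply: h => r; apply/(projmxP _ fA); rewrite E.
  exact: submx_trans (submxMl _ _) (projmx_sub _).
by rewrite -h1 -[LHS]trmxK trmx_mul !projmx_sym h2 projmx_sym.
Qed.

Lemma cvg_projmx {T} {F : set_system T} {FF : Filter F} {d m} (f : T -> 'M[R]_(d, m))
  (A : 'M[R]_(d, m)) : f t @[t --> F] --> A -> (forall t, row_free (f t)) -> row_free A ->
  projmx (f t) @[t --> F] --> projmx A.
Proof.
move=> fA ff rA; apply: cvg_mulmx => //; apply: cvg_mulmx; first exact: cvg_trmx.
apply: cvg_invmx; [|exact: gram_unit|by move=> t; exact: gram_unit].
by apply: cvg_mulmx => //; exact: cvg_trmx.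
Qed.
End Projectors.

Section GrProjector.
Local Open Scope quotient_scope.
Context {R : realType} (V : vectType R) (d : nat).
Notation B := (bform V).
Notation m := (dim B).

Definition frame_mx (b : @frames R V d) : 'M[R]_(d, m) := \matrix_(i < d) v2r (set_val b i).

Lemma frame_mx_comb (b : @frames R V d) (y : 'rV[R]_d) :
  y *m frame_mx b = v2r (\sum_i y 0 i *: set_val b i).
Proof.
rewrite mulmx_sum_row linear_sum; apply: eq_bigr => i _.
by rewrite rowK linearZ.
Qed.

Lemma frame_span_mx (b : @frames R V d) (q : B) :
  q \in frame_span b <-> (v2r q <= frame_mx b)%MS.
Proof.
split=> [|/submxP [y]]; last first.
  rewrite frame_mx_comb => /(can_inj v2rK) ->; apply: memv_suml => i _.
  by apply/memvZ/memv_span/map_f; rewrite mem_enum.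
move=> /(coord_span (X := in_tuple _)) ->; rewrite linear_sum summx_sub // => i _.
rewrite linearZ scalemx_sub //=.
have : [seq set_val b i | i : 'I_d]`_i \in [seq set_val b i | i : 'I_d] by apply: mem_nth.
move=> /mapP [j _ ->]; rewrite (_ : v2r _ = row j (frame_mx b)) ?row_sub //.
by rewrite rowK.
Qed.

Lemma frame_mx_free (b : @frames R V d) : row_free (frame_mx b).
Proof.
have [_ fb] := set_valP b.
rewrite -kermx_eq0; apply/eqP/row_matrixP => j; rewrite row0; set y := row j _.
have e : y *m frame_mx b = 0 by rewrite -row_mul mulmx_ker row0.
move: e; rewrite frame_mx_comb => /(congr1 r2v); rewrite v2rK linear0 => e.
have sz : size [seq set_val b i | i : 'I_d] = d by rewrite size_map size_enum_ord.
apply/rowP => i; rewrite [RHS]mxE.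
have [t Et] : exists t : d.-tuple B, tval t = [seq set_val b i | i : 'I_d].
  by exists (tcast sz (in_tuple _)); rewrite val_tcast.
move: fb; rewrite -Et => /freeP /(_ (fun i => y 0 i)); apply.
rewrite -[RHS]e; apply: eq_bigr => k _; congr (_ *: _).
by rewrite Et (nth_map k) ?size_enum_ord // nth_ord_enum.
Qed.

(** The projector depends on the span of a frame only and is continuous in the frame, so it gives
    continuous matrix coordinates on the quotient. *)
Definition Gr_proj (P : Gr V d) : 'M[R]_m := projmx (frame_mx (repr P)).

Lemma Gr_proj_pi b : Gr_proj (\pi_(Gr V d) b) = projmx (frame_mx b).
Proof.
rewrite /Gr_proj; set c := repr _.
have : frame_rel c b.
  by have := reprK (\pi_(Gr V d) b); rewrite -/c => /eqquotP.
move=> /eqP sp; apply: projmx_eq; try exact: frame_mx_free.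
apply/eqmxP/andP; split; apply/row_subP => i; rewrite rowK; apply/frame_span_mx.
  by rewrite -sp; apply/memv_span/map_f; rewrite mem_enum.
by rewrite sp; apply/memv_span/map_f; rewrite mem_enum.
Qed.

Lemma frame_coord_continuous (i : 'I_d) : continuous (fun b : @frames R V d => set_val b i : B).
Proof.
move=> b; apply: (@cont_comp _ _ _ (fun b : @frames R V d => set_val b) (fun f : {ptws 'I_d -> B} => f i)).
  exact: initial_continuous.
exact: proj_continuous.
Qed.

Lemma Gr_proj_continuous : continuous Gr_proj.
Proof.
have h : continuous (projmx \o frame_mx).
  move=> b; apply: (@cvg_projmx _ _ (nbhs b)); [|by move=> ?; exact: frame_mx_free|exact: frame_mx_free].
  apply: cvg_mx => i j.
  rewrite mxE; under eq_cvg do rewrite mxE.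
  apply: cvg_coord.
  exact: (@cont_comp _ _ _ (fun b : @frames R V d => set_val b i : B) v2r b
    (@frame_coord_continuous i b) (@v2r_continuous _ V _)).
apply: (@repr_comp_continuous _ _ _ (projmx \o frame_mx)) => //.
move=> a b /eqP e; apply/eqP; rewrite /= -!Gr_proj_pi; congr Gr_proj; exact: e.
Qed.

End GrProjector.

Lemma cont_normalize {R : realType} {n} (r : 'rV[R]_n) : r != 0 ->
  {for r, continuous (fun r : 'rV[R]_n => `|r|^-1 *: r)}.
Proof.
move=> r0; have h : `|x|^-1 @[x --> r] --> `|r|^-1.
  apply: (@cont_comp _ _ _ (fun x : 'rV[R]_n => `|x|) (fun x : R => x^-1)).
    exact: norm_continuous.
  by apply: inv_continuous; rewrite normr_eq0.
by apply: (cvgZ h); exact: cvg_id.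
Qed.

(** * The sphere bundle *)

Section Bundle.
Local Open Scope quotient_scope.
Context {R : realType} {V : vectType R} {d : nat} {E : topologicalType}.
Variable u : E -> Gr V d.
Hypothesis u_cont : continuous u.
Notation B := (bform V).
Notation m := (dim B).
Notation SE := (sphere_bundle u).

Definition Pi (x : E) : 'M[R]_m := Gr_proj (u x).

Lemma Pi_continuous : continuous Pi.
Proof. by move=> x; apply: (@cont_comp _ _ _ u (@Gr_proj _ V d)); [exact: u_cont|exact: Gr_proj_continuous]. Qed.

Lemma PiP x (q : B) : q \in pencil (u x) <-> v2r q *m Pi x = v2r q.
Proof.
rewrite frame_span_mx; exact: projmxP (frame_mx_free _).
Qed.

Lemma Pi_idem x : Pi x *m Pi x = Pi x.
Proof.
by rewrite {1}/Pi /Gr_proj {1}/projmx -mulmxA projmx_fix ?frame_mx_free.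
Qed.

Lemma Pi_rank x : \rank (Pi x) = d.
Proof.
apply/eqP; rewrite eqn_leq; apply/andP; split.
  by apply: leq_trans (mxrankS (projmx_sub _)) _; exact: rank_leq_row.
have := frame_mx_free (repr (u x)); rewrite /row_free => /eqP {1}<-.
by rewrite -{1}(projmx_fix (frame_mx_free (repr (u x)))) mxrankM_maxr.
Qed.

Lemma pencil_symm x (q : B) : q \in pencil (u x) -> form_symmetric q.
Proof.
apply: form_symmetric_span => q' /mapP [i _ ->].
by have [h _] := set_valP (repr (u x)); exact: h.
Qed.

(* The rows fixed by Pi x are the coordinates of the elements of the pencil u x. *)
Definition fiber_vec (x : E) (r : 'rV[R]_m) := r *m Pi x = r /\ r != 0.

Lemma fiber_vec_mem x r : fiber_vec x r -> pullback0 u (x, r2v r).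
Proof.
move=> [h h0]; split => /=; first by apply/PiP; rewrite (r2vK r).
by apply: contra h0 => /eqP e; rewrite -(r2vK r) e linear0.
Qed.

Definition ray_of x r (h : fiber_vec x r) : pullback0 u :=
  SigSub (mem_set (fiber_vec_mem h)).

Lemma ray_ofE x r (h : fiber_vec x r) : set_val (ray_of h) = (x, r2v r : B).
Proof. by []. Qed.

(* z0 is a junk value, for r outside the fibre of x or zero. *)
Definition ray (z0 : SE) (x : E) (r : 'rV[R]_m) : SE :=
  if pselect (fiber_vec x r) is left h then ray_class (ray_of h) else z0.

Definition base (z : SE) : E := base_point z.
Definition rawvec (a : pullback0 u) : 'rV[R]_m := v2r (set_val a).2.
Definition nvec (a : pullback0 u) : 'rV[R]_m := `|rawvec a|^-1 *: rawvec a.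
(** Normalization in the sup norm chooses one vector in each ray, continuously. *)
Definition vec (z : SE) : 'rV[R]_m := nvec (repr z).

Lemma rawvec_neq0 a : 0 < `|rawvec a|.
Proof.
rewrite normr_gt0; have [_ h] := set_valP a; apply: contra h => /eqP e.
by rewrite -(v2rK (set_val a).2) -/(rawvec a) e linear0.
Qed.

Lemma ray_classP (a b : pullback0 u) : ray_class a = ray_class b <->
  (set_val a).1 = (set_val b).1 /\ exists c : R, 0 < c /\ rawvec b = c *: rawvec a.
Proof.
split.
  move=> /eqquotP /= /asboolP [h [c [c0 E']]]; split=> //; exists c; split => //.
  by rewrite /rawvec E' linearZ.
move=> [h [c [c0 E']]]; apply/eqquotP => /=; apply/asboolP; split=> //; exists c; split => //.
by apply: (can_inj v2rK); rewrite linearZ.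
Qed.

Lemma ray_class_repr z : ray_class (repr z : pullback0 u) = z.
Proof. exact: reprK. Qed.

Lemma nvec_class a b : ray_class a = ray_class b -> nvec a = nvec b.
Proof.
move=> /ray_classP [_ [c [c0 e]]]; rewrite /nvec e normrZ scalerA gtr0_norm // invfM.
by rewrite mulrAC mulVf ?mul1r // gt_eqF.
Qed.

Lemma base_class a : base (ray_class a) = (set_val a).1.
Proof. by have /ray_classP [] := ray_class_repr (ray_class a). Qed.

Lemma vec_class a : vec (ray_class a) = nvec a.
Proof. by apply: nvec_class; exact: ray_class_repr. Qed.

Lemma rawvec_fiber a : fiber_vec (set_val a).1 (rawvec a).
Proof.
split; last by rewrite -normr_gt0 rawvec_neq0.
by apply/PiP; have [] := set_valP a.
Qed.

Lemma fiber_vecZ c x r : 0 < c -> fiber_vec x r -> fiber_vec x (c *: r).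
Proof.
by move=> c0 [h h0]; split; [rewrite -scalemxAl h|rewrite scaler_eq0 negb_or h0 gt_eqF].
Qed.

Lemma vec_fiber z : fiber_vec (base z) (vec z).
Proof. by apply: fiber_vecZ (rawvec_fiber _); rewrite invr_gt0 rawvec_neq0. Qed.

Lemma vec_norm z : `|vec z| = 1.
Proof. by rewrite normrZ ger0_norm ?invr_ge0 // mulVf // gt_eqF // rawvec_neq0. Qed.

Lemma vec_symm z : symm (vec z).
Proof.
have [h _] := vec_fiber z; apply: pencil_symm (_ : _ \in pencil (u (base z))).
by apply/PiP; rewrite (r2vK (vec z)).
Qed.

Lemma sphere_ext z z' : base z = base z' -> vec z = vec z' -> z = z'.
Proof.
rewrite -(ray_class_repr z) -(ray_class_repr z') !base_class !vec_class => h e.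
apply/ray_classP; split=> //; exists (`|rawvec (repr z')| * `|rawvec (repr z)|^-1).
split; first by rewrite divr_gt0 // rawvec_neq0.
by rewrite -scalerA -/(nvec _) e /nvec scalerA mulfV ?scale1r // gt_eqF // rawvec_neq0.
Qed.

Lemma ray_base z0 x r : fiber_vec x r -> base (ray z0 x r) = x.
Proof. by rewrite /ray => h; case: pselect => // h'; rewrite base_class. Qed.

Lemma rawvec_ray x r (h : fiber_vec x r) : rawvec (ray_of h) = r.
Proof. exact: (r2vK r). Qed.

Lemma ray_vec z0 x r : fiber_vec x r -> vec (ray z0 x r) = `|r|^-1 *: r.
Proof.
by rewrite /ray => h; case: pselect => // h'; rewrite vec_class /nvec rawvec_ray.
Qed.

Lemma ray_base_vec z0 z : ray z0 (base z) (vec z) = z.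
Proof.
have h := vec_fiber z; apply: sphere_ext; first by rewrite ray_base.
by rewrite ray_vec // vec_norm invr1 scale1r.
Qed.

Lemma base_continuous : continuous base.
Proof.
apply: (@repr_comp_continuous _ _ _ (fun a : pullback0 u => (set_val a).1)).
  move=> a; apply: (@cont_comp _ _ _ (fun a : pullback0 u => set_val a) (fun z => z.1)).
    exact: initial_continuous.
  exact: cvg_fst.
by move=> a b /eqP e; apply/eqP; have /ray_classP [] : ray_class a = ray_class b by exact: e.
Qed.

Lemma vec_continuous : continuous vec.
Proof.
have rc : continuous rawvec.
  move=> a; apply: (@cont_comp _ _ _ (fun a : pullback0 u => (set_val a).2) (v2r : B -> _)); last exact: v2r_continuous.
  apply: (@cont_comp _ _ _ (fun a : pullback0 u => set_val a) (fun z => z.2)).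
    exact: initial_continuous.
  exact: cvg_snd.
apply: (@repr_comp_continuous _ _ _ nvec).
  move=> a; apply: (@cont_comp _ _ _ rawvec (fun r => `|r|^-1 *: r)); first exact: rc.
  apply: cont_normalize; by rewrite -normr_gt0 rawvec_neq0.
by move=> a b /eqP e; apply/eqP/nvec_class; exact: e.
Qed.

Lemma ray_near z0 x r (A : set SE) : fiber_vec x r -> nbhs (ray z0 x r) A ->
  \forall z \near (x, r), fiber_vec z.1 z.2 -> A (ray z0 z.1 z.2).
Proof.
move=> h; rewrite {1}/ray; case: pselect => // h' nA.
have : nbhs (ray_of h') (@ray_class _ _ _ _ u @^-1` A).
  by apply: (@pi_continuous _ {eq_quot ray_equiv u}); exact: nA.
move=> [C [[U oU <-] Ux] UC].
have : \forall z \near (x, r), U (z.1, r2v z.2 : B).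
  apply: (@open_comp_near _ _ (fun z : E * 'rV[R]_m => (z.1, r2v z.2 : B)) U (x, r)) => //.
  apply: cont_pair; first exact: cvg_fst.
  by apply: (@cont_comp _ _ _ (fun z : E * 'rV[R]_m => z.2)); [exact: cvg_snd|exact: r2v_continuous].
apply: filterS => -[x' r'] /= Uz hz; rewrite /ray; case: pselect => // h2.
by apply: UC.
Qed.

Lemma ray_continuous {T : topologicalType} z0 (f : T -> E) (g : T -> 'rV[R]_m) t :
  {for t, continuous f} -> {for t, continuous g} -> fiber_vec (f t) (g t) ->
  (\forall t' \near t, fiber_vec (f t') (g t')) ->
  {for t, continuous (fun t => ray z0 (f t) (g t))}.
Proof.
move=> cf cg ht hn A /(ray_near ht) nA.
have nA' : \forall t' \near t, fiber_vec (f t') (g t') -> A (ray z0 (f t') (g t')) := cont_pair cf cg nA.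
have key : \forall t' \near t, A (ray z0 (f t') (g t')).
  by apply: filterS2 nA' hn => t' /= h h'; exact: h.
exact: key.
Qed.

(** Fibres are compact, being unit spheres of subspaces that vary continuously, so a local property
    holds on whole fibres near [x], with the same [i]. *)
Lemma fiber_compact {I : Type} (F : set_system I) {FF : Filter F} (P : I -> SE -> Prop) (x : E) :
  (forall z : SE, \forall z' \near z & i \near F, P i z') ->
  \forall x' \near x & i \near F, forall z, base z = x' -> P i z.
Proof.
move=> loc; have [[z0 _]|no] := pselect (exists z : SE, True); last first.
  by near=> xi => z _; exfalso; apply: no; exists z.
have := @compact_unif _ _ [set r : 'rV[R]_m | `|r| = 1] (filter_prod (nbhs x) F) _
  (fun xi r => fiber_vec xi.1 r -> P xi.2 (ray z0 xi.1 r)) (@rV_sphere_compact R m 1).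
have h r : [set r : 'rV[R]_m | `|r| = 1] r -> \forall r' \near r & xi \near filter_prod (nbhs x) F,
   fiber_vec xi.1 r' -> P xi.2 (ray z0 xi.1 r').
  move=> r1; have [hf|hf] := pselect (fiber_vec x r).
    have [[A BB] /= [nA FB] AB] := loc (ray z0 x r).
    have [[X Y] /= [nX nY] XY] := ray_near hf nA.
    exists (Y, [set xi | X xi.1 /\ BB xi.2]) => /=.
      by split=> //; exists (X, BB).
    move=> [r' [x' i]] /= [Yr [Xx Bi]] hf'; apply: (AB (ray z0 x' r', i)); split=> //=.
    by apply: (XY (x', r')).
  (* A unit vector outside the fibre of [x] has a neighbourhood disjoint from all nearby fibres, so
     there the claim is vacuous. *)
  have ne : r *m Pi x != r.
    apply: contra_notN hf => /eqP e; split=> //; rewrite -normr_gt0.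
    by move: r1; rewrite /= => ->.
  have : \forall z \near (r, x), 0 < `|z.1 *m Pi z.2 - z.1|.
    apply: (@near_gt _ _ (fun z : 'rV[R]_m * E => `|z.1 *m Pi z.2 - z.1|)).
    - apply: cvg_norm; apply: cvgB; last exact: cvg_fst.
      apply: cvg_mulmx; first exact: cvg_fst.
      apply: (@cont_comp _ _ _ (fun z : 'rV[R]_m * E => z.2) Pi); [exact: cvg_snd|exact: Pi_continuous].
    - by rewrite normr_gt0 subr_eq0.
  move=> [[X Y] /= [nX nY] XY].
  exists (X, [set xi | Y xi.1]) => /=.
    by split=> //; exists (Y, setT) => //=; [split=> //; exact: filterT | move=> ? []].
  move=> [r' [x' i]] /= [Xr Yx] [e _]; have := XY (r', x') (conj Xr Yx).
  by rewrite /= e subrr normr0 ltxx.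
move=> /(_ _ h) [[X Y] /= [nX nY] XY]; exists (X, Y) => // -[x' i] /= [Xx Yi] z zx.
rewrite -(ray_base_vec z0 z) zx; apply: (XY (x', i)) => //=; first exact: vec_norm.
by rewrite -zx; exact: vec_fiber.
Unshelve. all: by end_near. Qed.

End Bundle.

(** * Equivariance and uniformity over the cover *)

Section Equivariant.
Context {R : realType} {V : vectType R} {vol : ('I_(\dim {:V}) -> V) -> R}.
Context {d : nat} {E N : topologicalType} (p : E -> N) (rho : deck p -> 'End(V)).
Variable u : E -> Gr V d.
Hypothesis vol_form : volume_form vol.
Hypothesis rho_rep : representation vol rho.
Hypothesis u_equiv : equivariant_map rho u.
Notation B := (bform V).
Notation m := (dim B).
Notation SE := (sphere_bundle u).

Definition actr a (r : 'rV[R]_m) : 'rV[R]_m := v2r (form_act (rho a) (r2v r : B) : B).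

Lemma rho_ker a : lker (rho a) == 0%VS.
Proof. by have [h _] := rho_rep; exact: (SL_ker vol_form (h a)). Qed.

Lemma rho1 v : rho 1%g v = v.
Proof.
have [_ h] := rho_rep; have := h 1%g 1%g; rewrite mulg1 => /lfunP /(_ v).
by rewrite comp_lfunE => /(congr1 (rho 1%g)^-1%VF); rewrite !lker0_lfunK ?rho_ker.
Qed.

Lemma rhoV a v : (rho a)^-1%VF v = rho a^-1%g v.
Proof.
have [_ h] := rho_rep; apply: (can_inj (lker0_lfunK (rho_ker a))).
by rewrite lker0_lfunVK ?rho_ker // -comp_lfunE -h mulgV rho1.
Qed.

Lemma actrD a r r' : actr a (r + r') = actr a r + actr a r'.
Proof. by rewrite /actr linearD form_actD linearD. Qed.
Lemma actrZ a c r : actr a (c *: r) = c *: actr a r.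
Proof. by rewrite /actr linearZ form_actZ linearZ. Qed.
Lemma actrB a r r' : actr a (r - r') = actr a r - actr a r'.
Proof. by rewrite actrD -scaleN1r actrZ scaleN1r. Qed.

Lemma quad_actr a r v : quad (actr a r) v = quad r (rho a^-1%g v).
Proof. by rewrite /quad /actr v2rK form_actE !rhoV. Qed.

Lemma posdef_actr a r : posdef r -> posdef (actr a r).
Proof. by move=> h; rewrite /posdef /actr v2rK; apply: form_act_positive (rho_ker a) h. Qed.

Lemma actr0 a : actr a 0 = 0.
Proof. by have := actrZ a 0 0; rewrite !scale0r. Qed.

Lemma quad_inj (r : 'rV[R]_m) : symm r -> (forall v, quad r v = 0) -> r = 0.
Proof.
move=> sr h; have : (r2v r : B) = 0 by apply: psd_eq0 => //; split=> // v; rewrite -/(quad r v) h.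
by move=> e; rewrite -(r2vK r) e linear0.
Qed.

Lemma actr_fiber (a : deck p) x r : fiber_vec u x r -> fiber_vec u (a x) (actr a r).
Proof.
move=> hr; have [h h0] := hr; split.
  apply/PiP; have -> : form_act (rho a) (r2v r : B) \in pencil (u (a x)) =
      [set q | q \in pencil (u (a x))] (form_act (rho a) (r2v r : B)) :> Prop by [].
  by rewrite u_equiv; exists (r2v r) => //=; apply/PiP; rewrite (r2vK r).
apply: contraNneq h0 => e; apply/eqP/quad_inj.
  by apply: pencil_symm (_ : _ \in pencil (u x)); apply/PiP; rewrite (r2vK r).
by move=> v; rewrite -(lker0_lfunK (rho_ker a) v) rhoV -quad_actr e quad0.
Qed.

Lemma actr_fiber_onto (a : deck p) x r : fiber_vec u (a x) r ->
  exists2 r', fiber_vec u x r' & actr a r' = r.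
Proof.
move=> [h h0]; have : [set q | q \in pencil (u (a x))] (r2v r : B).
  by apply/PiP; rewrite (r2vK r).
rewrite u_equiv => -[q qx e]; have e' : actr a (v2r q) = r by rewrite /actr v2rK e (r2vK r).
exists (v2r q) => //; split; first exact/PiP.
by apply: contraNneq h0 => q0; rewrite -e' q0 actr0.
Qed.

Lemma sphere_actP (a : deck p) (z w : SE) : sphere_act a (rho a) z w <->
  base w = a (base z) /\ exists c : R, 0 < c /\ vec w = c *: actr a (vec z).
Proof.
split.
  move=> [x [y [-> -> e]]]; rewrite !base_class !vec_class e; split=> //.
  have rawe : rawvec y = actr a (rawvec x) by rewrite /rawvec e /actr v2rK.
  exists (`|rawvec y|^-1 * `|rawvec x|); split; first by rewrite mulr_gt0 ?invr_gt0 // rawvec_neq0.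
  rewrite /nvec actrZ -rawe scalerA -mulrA mulfV ?mulr1 //.
  by rewrite gt_eqF // rawvec_neq0.
move=> [bw [c [c0 vw]]]; have fz := vec_fiber z.
exists (ray_of fz), (ray_of (actr_fiber a fz)); split.
- apply: sphere_ext; rewrite ?base_class ?vec_class //=.
  by rewrite /nvec rawvec_ray vec_norm invr1 scale1r.
- apply: sphere_ext; rewrite ?base_class ?vec_class //=.
  have := vec_norm w; rewrite vw normrZ gtr0_norm // /nvec rawvec_ray => e.
  congr (_ *: _); apply/eqP; rewrite -(inj_eq (@mulIf _ `|actr a (vec z)| _)).
    by rewrite e mulVf //; apply: contra_eq_neq e => ->; rewrite mulr0 eq_sym oner_eq0.
  by apply: contra_eq_neq e => ->; rewrite mulr0 eq_sym oner_eq0.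
- by rewrite !ray_ofE /= /actr v2rK.
Qed.

Lemma sphere_act_onto (a : deck p) x (w : SE) : base w = a x ->
  exists2 z, base z = x & sphere_act a (rho a) z w.
Proof.
move=> bw; have := vec_fiber w; rewrite bw => /actr_fiber_onto [r fr e].
exists (ray_class (ray_of fr)); first by rewrite base_class.
apply/sphere_actP; rewrite base_class vec_class; split=> //.
exists `|r|; rewrite /nvec rawvec_ray actrZ e scalerA mulfV ?scale1r; last first.
  by rewrite normr_eq0; case: fr.
by rewrite normr_gt0; case: fr.
Qed.

Hypothesis u_cont : continuous u.
Hypothesis p_cov : covering_map p.
Hypothesis deck_trans : forall x x', p x = p x' -> exists a : deck p, a x = x'.
Hypothesis N_compact : compact [set: N].

(** Compactness of [N] makes the choice of [i] uniform over the base; deck transformations carry the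
    property from one point of a fibre of [p] to the others. *)
Lemma uniform_on_base {I : Type} (F : set_system I) {FF : Filter F} (Q : I -> E -> Prop) :
  (forall x : E, \forall x' \near x & i \near F, Q i x') ->
  (forall i (a : deck p) x, Q i x -> Q i (a x)) -> \forall i \near F, forall x, Q i x.
Proof.
move=> loc inv.
have := @compact_unif _ _ [set: N] F _ (fun i y => forall x, p x = y -> Q i x) N_compact.
have h y : [set: N] y -> \forall y' \near y & i \near F, forall x, p x = y' -> Q i x.
  move=> _; have [x0 <-] : exists x, p x = y by case: p_cov.
  have [[A C] /= [nA FC] AC] := loc x0.
  exists (p @` A, C); first by split=> //; exact: covering_open p_cov _ _ nA.
  move=> [_ i] /= [[x1 Ax <-] Ci] x /esym/deck_trans [a <-].
  by apply: inv; apply: (AC (x1, i)).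
by move=> /(_ _ h); apply: filterS => i hi x; apply: (hi (p x)).
Qed.

Lemma uniform_on_bundle {I : Type} (F : set_system I) {FF : Filter F} (P : I -> SE -> Prop) :
  (forall z : SE, \forall z' \near z & i \near F, P i z') ->
  (forall i (a : deck p) z w, sphere_act a (rho a) z w -> P i z -> P i w) ->
  \forall i \near F, forall z, P i z.
Proof.
move=> loc inv.
have : \forall i \near F, forall x, forall z, base z = x -> P i z.
  apply: uniform_on_base => [x|i a x h w bw]; first exact: fiber_compact.
  by have [z bz zw] := sphere_act_onto bw; apply: inv zw (h z bz).
by apply: filterS => i h z; exact: h.
Qed.

End Equivariant.

(** * Growth along the flow and quasi-geodesics *)

Section Flow.
Context {R : realType} {V : vectType R} {vol : ('I_(\dim {:V}) -> V) -> R}.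
Context {d : nat} {E N : topologicalType} (p : E -> N) (rho : deck p -> 'End(V)).
Variable u : E -> Gr V d.
Hypothesis vol_form : volume_form vol.
Hypothesis rho_rep : representation vol rho.
Hypothesis u_equiv : equivariant_map rho u.
Hypothesis u_cont : continuous u.
Hypothesis p_cov : covering_map p.
Hypothesis deck_trans : forall x x', p x = p x' -> exists a : deck p, a x = x'.
Hypothesis N_compact : compact [set: N].
Notation B := (bform V).
Notation m := (dim B).
Notation SE := (sphere_bundle u).
Variable Phi : R -> SE -> SE.
Hypothesis Phi_fitting : fitting_flow Phi.
Hypothesis Phi_equiv : equivariant_flow rho Phi.

Lemma flow_continuous : continuous (fun tz : R * SE => Phi tz.1 tz.2).
Proof. by case: Phi_fitting => -[]. Qed.
Lemma flow0 z : Phi 0 z = z.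
Proof. by case: Phi_fitting => -[]. Qed.
Lemma flowD s t z : Phi (s + t) z = Phi s (Phi t z).
Proof. by case: Phi_fitting => -[]. Qed.

Lemma flow_fit z t : 0 < t -> exists a b : R, [/\ 0 < a, 0 < b &
  posdef (b *: vec (Phi t z) - a *: vec z)].
Proof.
case: Phi_fitting => _ /[apply] /(_ z) [x [y [-> -> pos]]].
exists `|rawvec x|, `|rawvec y|; split; rewrite ?rawvec_neq0 //.
rewrite !vec_class /nvec !scalerA !mulfV ?scale1r ?gt_eqF ?rawvec_neq0 //.
exact: posdef_v2rB.
Qed.

(** Both conditions are needed because [r] is indefinite: the first says that positive values grow
    by the factor [mu], the second that negative values shrink by it. The nonstrict [wgrowth] also
    allows the factor 1 and composes. *)
Definition growth (mu : R) (r r' : 'rV[R]_m) :=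
  posdef (r' - mu *: r) /\ posdef (r' - mu^-1 *: r).

Definition wgrowth (mu : R) (r r' : 'rV[R]_m) :=
  forall v : V, mu * quad r v <= quad r' v /\ mu^-1 * quad r v <= quad r' v.

Lemma growth_weak mu r r' : growth mu r r' -> wgrowth mu r r'.
Proof.
move=> [h h'] v.
have H c : posdef (r' - c *: r) -> c * quad r v <= quad r' v.
  move=> pc; rewrite -subr_ge0 -quadZ -quadB.
  have [->|v0] := eqVneq v 0; last by apply: ltW; exact: pc.
  by rewrite -(scale0r (0 : V)) quadZv expr0n /= mul0r.
by split; exact: H.
Qed.

Lemma wgrowth_trans mu nu r r' r'' : 0 < mu -> 0 < nu -> wgrowth mu r r' -> wgrowth nu r' r'' ->
  wgrowth (nu * mu) r r''.
Proof.
move=> m0 n0 h h' v; have [h1 h2] := h v; have [h3 h4] := h' v; split.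
  by apply: le_trans h3; rewrite -mulrA ler_pM2l.
by rewrite invfM -mulrA; apply: le_trans h4; rewrite ler_pM2l ?invr_gt0.
Qed.

Lemma wgrowth_scale mu r r' k : 0 <= k -> wgrowth mu r r' -> wgrowth mu (k *: r) (k *: r').
Proof.
by move=> k0 h v; have [h1 h2] := h v; rewrite !quadZ 2!(mulrCA _ k) !ler_wpM2l.
Qed.

Lemma growth_actr mu a r r' : growth mu r r' -> growth mu (actr rho a r) (actr rho a r').
Proof.
by case=> h1 h2; split; rewrite -actrZ -actrB; apply: (posdef_actr vol_form rho_rep).
Qed.

(** For [mu = 1] both conditions are the fitting condition. Positive definiteness is open, so some
    [mu > 1] works near each point; the factors [a], [b] absorb the scaling of representatives under
    the action, and cocompactness gives one [mu] for all. *)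
Lemma flow_growth t : 0 < t -> exists2 mu : R, 1 < mu & forall z,
  exists a b : R, [/\ 0 < a, 0 < b & growth mu (a *: vec z) (b *: vec (Phi t z))].
Proof.
move=> t0.
have : \forall mu \near (1 : R)^'+, forall z, exists a b : R, [/\ 0 < a, 0 < b &
    growth mu (a *: vec z) (b *: vec (Phi t z))].
  apply: (@uniform_on_bundle _ _ _ _ _ _ p rho u vol_form rho_rep u_equiv u_cont p_cov deck_trans N_compact
    _ (at_right 1) _ (fun mu z => exists a b : R, [/\ 0 < a, 0 < b &
    growth mu (a *: vec z) (b *: vec (Phi t z))])).
    move=> z; have [a [b [a0 b0 pos]]] := flow_fit z t0.
    have h : \forall z' \near z & mu \near (1 : R), growth mu (a *: vec z') (b *: vec (Phi t z')).
      have c1 (w : SE * R) : {for w, continuous (fun w : SE * R => b *: vec (Phi t w.1))}.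
        apply: (@cvgZr _ _ _ (nbhs w)).
        apply: (@cont_comp _ _ _ (fun w : SE * R => Phi t w.1) (@vec _ _ _ _ u)); last exact: vec_continuous.
        apply: (@cont_comp _ _ _ (fun w : SE * R => w.1) (Phi t)); first exact: cvg_fst.
        exact: (cont_slice_r flow_continuous).
      have c2 (w : SE * R) : {for w, continuous (fun w : SE * R => a *: vec w.1)}.
        apply: (@cvgZr _ _ _ (nbhs w)).
        by apply: (@cont_comp _ _ _ (fun w : SE * R => w.1) (@vec _ _ _ _ u)); [exact: cvg_fst|exact: vec_continuous].
      apply: filterI.
        apply: (@open_comp_near _ _ (fun w : SE * R => b *: vec (Phi t w.1) - w.2 *: (a *: vec w.1)) (@posdef _ V) (z, 1)).
        - apply: (@cvgB _ _ _ (nbhs (z, 1 : R))); first exact: c1.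
          by apply: (@cvgZ _ _ _ (nbhs (z, 1 : R))); [exact: cvg_snd|exact: c2].
        - exact: posdef_open.
        - by rewrite /= scale1r.
      apply: (@open_comp_near _ _ (fun w : SE * R => b *: vec (Phi t w.1) - w.2^-1 *: (a *: vec w.1)) (@posdef _ V) (z, 1)).
      - apply: (@cvgB _ _ _ (nbhs (z, 1 : R))); first exact: c1.
        apply: (@cvgZ _ _ _ (nbhs (z, 1 : R))); last exact: c2.
        apply: (@cont_comp _ _ _ (fun w : SE * R => w.2) (fun x : R => x^-1)); first exact: cvg_snd.
        by apply: inv_continuous; rewrite /= oner_neq0.
      - exact: posdef_open.
      - by rewrite /= invr1 scale1r.
    move: h => [[X Y] /= [nX nY] XY]; exists (X, Y) => /=; first by split=> //; exact: cvg_within nY.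
    by move=> [z' mu] /= [Xz Ym]; exists a, b; split=> //; exact: (XY (z', mu)).
  move=> mu a z w zw [k [l [k0 l0 [g1 g2]]]].
  have [_ [c [c0 vw]]] := (sphere_actP vol_form rho_rep u_equiv a z w).1 zw.
  have [_ [c' [c'0 vw']]] := (sphere_actP vol_form rho_rep u_equiv a _ _).1 (Phi_equiv t zw).
  exists (k / c), (l / c'); split; first exact: divr_gt0.
    exact: divr_gt0.
  have e1 : (k / c) *: vec w = actr rho a (k *: vec z).
    by rewrite vw actrZ scalerA mulfVK // gt_eqF.
  have e2 : (l / c') *: vec (Phi t w) = actr rho a (l *: vec (Phi t z)).
    by rewrite vw' actrZ scalerA mulfVK // gt_eqF.
  by rewrite e1 e2; apply: growth_actr.
move=> h; have h' : \forall mu \near (1 : R)^'+, 1 < mu by exact: nbhs_right_gt.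
have [mu []] := @filter_ex _ _ (at_right_proper_filter (1 : R)) _ (filterI h h').
by exists mu.
Qed.

Lemma flow_chain t : 0 < t -> exists2 mu : R, 1 < mu & forall n z, exists2 b : R, 0 < b &
  wgrowth (mu ^+ n) (vec z) (b *: vec (Phi (n%:R * t) z)).
Proof.
move=> t0; have [mu m1 hmu] := flow_growth t0; exists mu => // n z.
have m0 : 0 < mu by apply: lt_trans m1.
elim: n => [|n [b b0 IH]].
  by exists 1 => // v; rewrite expr0 invr1 !mul1r scale1r mul0r flow0.
have [a' [b' [a0 b'0 /growth_weak hg]]] := hmu (Phi (n%:R * t) z).
(* The next step is rescaled by [b / a'] so that it starts with the form already reached. *)
exists (b / a' * b'); first by rewrite mulr_gt0 // divr_gt0.
have -> : n.+1%:R * t = t + n%:R * t by rewrite -natr1; ring.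
rewrite flowD exprS; apply: wgrowth_trans IH _ => //; first exact: exprn_gt0.
have ba : 0 <= b / a' by rewrite divr_ge0 // ltW.
by have := wgrowth_scale ba hg; rewrite !scalerA mulfVK // gt_eqF.
Qed.

End Flow.

Section LinearBounds.
Context {R : realType} (V : vectType R).
Notation m := (dim (bform V)).

Definition vnorm (v : V) : R := `|v2r v : 'rV[R]_(dim V)|.

Lemma vnorm_ge0 v : 0 <= vnorm v. Proof. exact: normr_ge0. Qed.
Lemma vnorm_gt0 v : v != 0 -> 0 < vnorm v.
Proof. by move=> v0; rewrite normr_gt0; apply: contra v0 => /eqP e; rewrite -(v2rK v) e linear0. Qed.

Lemma quad_bound : exists2 M : R, 0 < M & forall (r : 'rV[R]_m) (v : V),
  `|quad r v| <= M * `|r| * vnorm v ^+ 2.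
Proof.
pose c k i j : R := `|form_val (r2v (delta_mx 0 k : 'rV[R]_m) : bform V) (r2v (delta_mx 0 i)) (r2v (delta_mx 0 j) : V)|.
exists (1 + \sum_k \sum_i \sum_j c k i j).
  by rewrite ltr_pwDl // !sumr_ge0 // => k _; rewrite sumr_ge0 // => i _; rewrite sumr_ge0 // => j _; exact: normr_ge0.
move=> r v; rewrite -{1}(v2rK v) quad_coord /vnorm; set w := v2r v.
apply: (@le_trans _ _ ((\sum_k \sum_i \sum_j c k i j) * `|r| * `|w| ^+ 2)); last first.
  by rewrite ler_wpM2r ?exprn_ge0 // ler_wpM2r // lerDr.
rewrite !mulr_suml; apply: le_trans (ler_norm_sum _ _ _) _; apply: ler_sum => k _.
rewrite !mulr_suml; apply: le_trans (ler_norm_sum _ _ _) _; apply: ler_sum => i _.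
rewrite !mulr_suml; apply: le_trans (ler_norm_sum _ _ _) _; apply: ler_sum => j _.
rewrite !normrM -/(c k i j).
have h1 := rV_coord_le r k; have h2 := rV_coord_le w i; have h3 := rV_coord_le w j.
have -> : c k i j * `|r| * `|w| ^+ 2 = `|r| * (`|w| * (`|w| * c k i j)) by ring.
do 3! (apply: ler_pM => //; rewrite ?mulr_ge0 ?normr_ge0 //).
Qed.

Lemma lfun_bound (f : 'End(V)) : exists2 C : R, 0 < C & forall v, vnorm (f v) <= C * vnorm v.
Proof.
exists (1 + \sum_i vnorm (f (r2v (delta_mx 0 i)))).
  by rewrite ltr_pwDl // sumr_ge0 // => i _; exact: vnorm_ge0.
move=> v; rewrite /vnorm -{1}(v2rK v); set w := v2r v.
rewrite {1}(row_sum_delta w) !linear_sum.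
apply: le_trans (ler_norm_sum _ _ _) _; rewrite mulrDl mul1r mulr_suml ler_wpDl // ler_sum // => i _.
by rewrite !linearZ normrZ mulrC ler_wpM2l // rV_coord_le.
Qed.
End LinearBounds.

Lemma compact_finite_cover {T : topologicalType} (C : T -> set T) : compact [set: T] ->
  (forall y, nbhs y (C y)) -> exists D : seq T, forall z, exists2 y, y \in D & C y z.
Proof.
move=> cT nC.
(* The filter generated by the extensions of a finite list; along it a finite cover is found by the
   uniform principle [compact_unif]. *)
pose F : set_system (seq T) := [set P : set (seq T) | exists D0 : seq T, forall D : seq T, {subset D0 <= D} -> P D].
have FF : Filter F.
  split; first by exists [::].
    move=> P Q [D0 h0] [D1 h1]; exists (D0 ++ D1) => D hD; split; [apply: h0|apply: h1];
    by move=> y yD; apply: hD; rewrite mem_cat yD ?orbT.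
  by move=> P Q PQ [D0 h0]; exists D0 => D /h0; exact: PQ.
have [|D0 hD0] := @compact_unif _ _ [set: T] F FF (fun D z => exists2 y, y \in D & C y z) cT.
  move=> z _; exists (C z, [set D : seq T | z \in D]) => /=.
    split; first exact: nC.
    by exists [:: z] => D hD /=; apply: hD; rewrite inE.
  by move=> [z' D] /= [Cz zD]; exists z.
by exists D0 => z; exact: (hD0 D0 _ z I).
Qed.

(** * An equivariant family of norms *)

Section Gauge.
Context {R : realType} {V : vectType R} {vol : ('I_(\dim {:V}) -> V) -> R}.
Context {E N : topologicalType} (p : E -> N) (rho : deck p -> 'End(V)).
Hypothesis vol_form : volume_form vol.
Hypothesis rho_rep : representation vol rho.
Hypothesis p_cov : covering_map p.
Hypothesis deck_trans : forall x x', p x = p x' -> exists a : deck p, a x = x'.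
Hypothesis deck_free : forall (a b : deck p) x, a x = b x -> a = b.
Hypothesis N_compact : compact [set: N].
Hypothesis N_hausdorff : hausdorff_space N.

(* A gauge: an equivariant family of positive functions h x on V that behave like
   squared norms, without any continuity in x. *)
Definition locally_comparable (h : E -> V -> R) := forall x : E, exists C : R, 0 < C /\
  \forall x' \near x, forall v, h x' v <= C * vnorm v ^+ 2 /\ vnorm v ^+ 2 <= C * h x' v.

(** Finitely many closed sets with sections of [p] cover [N]. A fixed norm is transported by the
    deck element [ga x] that brings the chosen section to [x]. Freeness makes [ga] equivariant, and
    closedness of the sets lets only finitely many elements occur near a point. *)
Lemma gauge_ex : exists h : E -> V -> R,
  (forall (a : deck p) x v, h (a x) v = h x (rho a^-1%g v)) /\ locally_comparable h.
Proof.
have data (y : N) : exists WsC : set E * (N -> E) * set N,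
   [/\ open WsC.1.1, forall z, WsC.2 z -> p (WsC.1.2 z) = z /\ WsC.1.1 (WsC.1.2 z),
     forall e, WsC.1.1 e -> WsC.1.2 (p e) = e, closed WsC.2 & nbhs y WsC.2].
  have [U [[oU Uy] hU]] := evenly_coveredP p_cov y.
  have [e pe] : exists e, p e = y by case: p_cov.
  have Upe : U (p e) by rewrite pe.
  have [W [s [oW We cs s1 s2]]] := hU e Upe.
  have [C [nC cC] CU] : exists2 C, nbhs y C /\ closed C & C `<=` U.
    have [C nC CU] := @compact_regular N y [set: N] N_hausdorff N_compact (@filterT _ _ _) U (open_nbhs_nbhs (conj oU Uy)).
    exists (closure C) => //; split; last exact: closed_closure.
    by apply: filterS nC; exact: subset_closure.
  exists (W, s, C); split=> //= z.
    by move=> /CU /s1 [].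
  by move=> /s2 [].
have [dt hdt] := choice data.
pose W y := (dt y).1.1; pose s y := (dt y).1.2; pose C y := (dt y).2.
have [D DN] : exists D : seq N, forall z, exists2 y, y \in D & C y z.
  by apply: compact_finite_cover => // y; have [] := hdt y.
have DN' z : exists y, y \in D /\ C y z by have [y] := DN z; exists y.
have [i hi] := choice DN'.
have gex x : exists a : deck p, a (s (i (p x)) (p x)) = x.
  by apply: deck_trans; have [_ /(_ _ (hi (p x)).2) []] := hdt (i (p x)).
have [ga hga] := choice gex.
exists (fun x v => vnorm (rho (ga x)^-1%g v) ^+ 2); split.
  move=> a x v; have -> : ga (a x) = (a * ga x)%g.
    apply: (@deck_free _ _ (s (i (p x)) (p x))).
    by have := hga (a x); rewrite deck_proj => ->; rewrite -[RHS]/(a (ga x _)) hga.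
  by rewrite invgM; case: rho_rep => _ ->; rewrite comp_lfunE.
move=> x.
(* Induction on the list of possible indices [i (p x')]; an index whose closed set does not contain
   [p x] does not occur near [x]. *)
have bnd (D' : seq N) : exists C : R, 0 < C /\ \forall x' \near x, i (p x') \in D' -> forall v : V,
   vnorm (rho (ga x')^-1%g v) ^+ 2 <= C * vnorm v ^+ 2 /\
   vnorm v ^+ 2 <= C * vnorm (rho (ga x')^-1%g v) ^+ 2.
  elim: D' => [|y D' [K [K0 IH]]]; first by exists 1; split=> //; near=> x'.
  have [Cx|nCx] := pselect (C y (p x)); last first.
    exists K; split=> //; have [_ _ _ cC _] := hdt y.
    have oC : open (~` C y) by exact: closed_openC.
    have : \forall x' \near x, (~` C y) (p x').
      by apply: (@open_comp_near _ _ p) => //; case: p_cov => cp _ _; exact: cp.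
    apply: filterS2 IH => x' h nC; rewrite inE => /orP [/eqP e|]; last exact: h.
    by exfalso; apply: nC; rewrite -e; exact: (hi (p x')).2.
  have [oW s1 s2 _ _] := hdt y; have [ps Ws] := s1 _ Cx.
  have [a ax] := deck_trans ps; pose b : deck p := a^-1%g.
  have bK e : b (a e) = e by rewrite -[LHS]/(((a^-1 * a)%g : deck p) e) mulVg.
  have aK e : a (b e) = e by rewrite -[LHS]/(((a * a^-1)%g : deck p) e) mulgV.
  have nW : \forall x' \near x, W y (b x').
    apply: (@open_comp_near _ _ b) => //; first exact: deck_cont.
    by rewrite -ax bK.
  (* While the index stays [y], nearby points lie in one translated sheet, so the deck element is
     constantly [a]. *)
  have gaE : \forall x' \near x, i (p x') = y -> ga x' = a.
    apply: filterS nW => x' /s2; rewrite deck_proj => e iy.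
    apply: (@deck_free _ _ (s y (p x'))); rewrite -{1}iy hga [s y _]e.
    by rewrite aK.
  have [K1 K10 hK1] := lfun_bound (rho a^-1%g); have [K2 K20 hK2] := lfun_bound (rho a).
  exists (K + K1 ^+ 2 + K2 ^+ 2); split; first by rewrite !addr_gt0 // exprn_gt0.
  have p1 := exprn_gt0 2 K10; have p2 := exprn_gt0 2 K20.
  apply: filterS2 IH gaE => x' h1 h2; rewrite inE => /orP [/eqP e|/h1 h] v; last first.
    have [l1 l2] := h v.
    split; [apply: le_trans l1 _|apply: le_trans l2 _]; rewrite ler_wpM2r ?sqr_ge0 //; lra.
  rewrite (h2 e); have := hK2 (rho a^-1%g v).
  rewrite -comp_lfunE -(proj2 rho_rep) mulgV (rho1 vol_form rho_rep) => l2; have l1 := hK1 v.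
  have n1 := vnorm_ge0 v; have n2 := vnorm_ge0 (rho a^-1%g v).
  split.
    apply: (@le_trans _ _ ((K1 * vnorm v) ^+ 2)).
      by rewrite lerXn2r ?nnegrE ?mulr_ge0 // ltW.
    by rewrite exprMn ler_wpM2r ?sqr_ge0 //; lra.
  apply: (@le_trans _ _ ((K2 * vnorm (rho a^-1%g v)) ^+ 2)).
    by rewrite lerXn2r ?nnegrE ?mulr_ge0 // ltW.
  by rewrite exprMn ler_wpM2r ?sqr_ge0 //; lra.
have [K [K0 hK]] := bnd D; exists K; split=> //.
by apply: filterS hK => x' h; apply: h; exact: (hi (p x')).1.
Unshelve. all: by end_near. Qed.

End Gauge.

(** * Comparison of flow time and length *)

Section Quasi.
Context {R : realType} {V : vectType R} {vol : ('I_(\dim {:V}) -> V) -> R}.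
Context {d : nat} {E N : topologicalType} (A : smooth_atlas R d N).
Variables (g : chart_index A -> 'rV[R]_d -> 'M[R]_d) (p : E -> N) (rho : deck p -> 'End(V)).
Variable u : E -> Gr V d.
Hypothesis g_metric : riemannian_metric g.
Hypothesis vol_form : volume_form vol.
Hypothesis rho_rep : representation vol rho.
Hypothesis u_equiv : equivariant_map rho u.
Hypothesis u_cont : continuous u.
Hypothesis u_mixed : forall x, mixed (pencil (u x)).
Hypothesis p_cov : covering_map p.
Hypothesis E_conn : connected [set: E].
Hypothesis deck_trans : forall x x', p x = p x' -> exists a : deck p, a x = x'.
Hypothesis deck_free : forall (a b : deck p) x, a x = b x -> a = b.
Hypothesis N_compact : compact [set: N].
Hypothesis N_hausdorff : hausdorff_space N.
Notation SE := (sphere_bundle u).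
Variable Phi : R -> SE -> SE.
Hypothesis Phi_fitting : fitting_flow Phi.
Hypothesis Phi_equiv : equivariant_flow rho Phi.

Let unif_bundle {I : Type} := @uniform_on_bundle R V vol d E N p rho u vol_form rho_rep u_equiv
  u_cont p_cov deck_trans N_compact I.
Let unif_base {I : Type} := @uniform_on_base E N p p_cov deck_trans N_compact I.
Let saP := @sphere_actP R V vol d E N p rho u vol_form rho_rep u_equiv.

Lemma flow_joined_unit : exists2 L : R, 0 < L & forall z s, 0 <= s <= 1 ->
  joined g p L (base z) (base (Phi s z)).
Proof.
have : \forall L \near +oo, forall z : SE, forall s, 0 <= s <= 1 -> joined g p L (base z) (base (Phi s z)).
  apply: (@unif_bundle R (pinfty_nbhs R) _ (fun L z => forall s, 0 <= s <= 1 -> joined g p L (base z) (base (Phi s z)))).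
    move=> z.
    have := @compact_unif _ _ `[(0 : R), 1]%classic (filter_prod (nbhs z) (pinfty_nbhs R)) _
      (fun zL s => joined g p zL.2 (base zL.1) (base (Phi s zL.1))) (@segment_compact _ _ _).
    have h s : `[(0 : R), 1]%classic s -> \forall s' \near s & zL \near filter_prod (nbhs z) (pinfty_nbhs R),
        joined g p zL.2 (base zL.1) (base (Phi s' zL.1)).
      move=> _; have [Z0 [Z1 [n0 n1 [L L0 hL]]]] := joined_locally_bounded g_metric p_cov (base z) (base (Phi s z)) E_conn.
      have h1 : \forall z' \near z, Z0 (base z') by exact: base_continuous n0.
      have c2 : {for (s, z), continuous (fun w : R * SE => base (Phi w.1 w.2))}.
        apply: (@cont_comp _ _ _ (fun w : R * SE => Phi w.1 w.2) (@base _ _ _ _ u)); first exact: (flow_continuous Phi_fitting).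
        exact: base_continuous.
      have [[S Z] /= [nS nZ] SZ] : \forall w \near (s, z), Z1 (base (Phi w.1 w.2)) by exact: c2 n1.
      exists (S, [set zL : SE * R | (Z zL.1 /\ Z0 (base zL.1)) /\ L <= zL.2]) => /=.
        split=> //; exists (Z `&` [set z' | Z0 (base z')], [set L' | L <= L']) => /=.
          by split; [exact: filterI|exact: nbhs_pinfty_ge (num_real _)].
        by move=> [z' L'] /= [[? ?] ?].
      move=> [s' [z' L']] /= [Ss [[Zz Z0z] LL]]; apply: joined_le LL _.
      by apply: hL => //; exact: (SZ (s', z')).
    move=> /(_ _ h) [[X Y] /= [nX nY] XY]; exists (X, Y) => //.
  move=> L a z w zw hz s s01; have [-> _] := (saP a z w).1 zw.
  have [-> _] := (saP a _ _).1 (Phi_equiv s zw).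
  by apply: joined_deck => //; exact: hz.
move=> h; have h' : \forall L \near +oo, (0 : R) < L by exact: nbhs_pinfty_gt (num_real _).
by have [L []] := filter_ex (filterI h h'); exists L.
Qed.

Lemma flow_joined L z n t : 0 < L -> (forall z s, 0 <= s <= 1 -> joined g p L (base z) (base (Phi s z))) ->
  0 <= t <= n.+1%:R -> joined g p (n.+1%:R * L) (base z) (base (Phi t z)).
Proof.
move=> L0 hL; elim: n t => [|n IH] t /andP[t0 tn].
  by rewrite mul1r; apply: hL; rewrite t0.
have [t1|t1] := leP t 1.
  apply: joined_le (hL z t _); last by rewrite t0.
  by rewrite ler_peMl ?ler1n // ltW.
rewrite -natr1 mulrDl mul1r.
apply: (joined_trans p_cov (y := base (Phi (t - 1) z))) => //.
- by rewrite mulr_gt0 // ltr0n.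
- by apply: IH; rewrite subr_ge0 ltW //= lerBlDr natr1.
- have e : t = 1 + (t - 1) by ring.
  by have := hL (Phi (t - 1) z) 1; rewrite -(flowD Phi_fitting) -e; apply; rewrite ler01 lexx.
Qed.

Section WithGauge.
Variable h : E -> V -> R.
Hypothesis h_equiv : forall (a : deck p) x v, h (a x) v = h x (rho a^-1%g v).
Hypothesis h_comp : locally_comparable h.

Lemma gauge_ge0 x v : 0 <= h x v.
Proof.
have [C [C0 /nbhs_singleton /(_ v) [_ hC]]] := h_comp x.
by rewrite -(pmulr_rge0 _ C0); apply: le_trans hC; rewrite exprn_ge0 // vnorm_ge0.
Qed.

Lemma gauge_dominates x (r : 'rV[R]_(dim (bform V))) : exists2 m : R, 0 <= m & forall v, - (m * h x v) <= quad r v.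
Proof.
have [M M0 hM] := quad_bound V.
have [C [C0 /nbhs_singleton hC]] := h_comp x.
have p0 : 0 <= M * `|r| by rewrite mulr_ge0 // ltW.
exists (M * `|r| * C) => [|v]; first by rewrite mulr_ge0 // ltW.
have := hM r v; rewrite ler_norml => /andP[l _]; apply: le_trans l.
by rewrite lerN2 -[_ * C * _]mulrA; apply: ler_wpM2l => //; have [] := hC v.
Qed.

(* By mixedness a nonzero element of a pencil has both signs, and by compactness
   its positive and negative parts have comparable sizes. *)
Lemma gauge_balanced : exists2 K : R, 0 < K & forall x r m, fiber_vec u x r -> 0 <= m ->
  (forall v, - (m * h x v) <= quad r v) -> forall v, quad r v <= K * m * h x v.
Proof.
have : \forall K \near +oo, forall z : SE, forall m, 0 <= m ->
  (forall v, - (m * h (base z) v) <= quad (vec z) v) -> forall v, quad (vec z) v <= K * m * h (base z) v.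
  apply: (@unif_bundle R (pinfty_nbhs R) _ (fun K z => forall m, 0 <= m ->
    (forall v, - (m * h (base z) v) <= quad (vec z) v) -> forall v, quad (vec z) v <= K * m * h (base z) v)).
    move=> z; have [v0 neg] : exists v0, quad (vec z) v0 < 0.
      apply: (@mixed_indefinite _ V (pencil (u (base z)))) => //.
      - by have [] := fiber_vec_mem (vec_fiber z).
      - by have [] := fiber_vec_mem (vec_fiber z).
      - exact: vec_symm.
    have [C [C0 hC]] := h_comp (base z); have [M M0 hM] := quad_bound V.
    pose e := - quad (vec z) v0 / 2; have e0 : 0 < e by rewrite divr_gt0 // oppr_gt0.
    have cq : {for z, continuous (fun z' : SE => quad (vec z') v0)}.
      rewrite -(v2rK v0); apply: (@quad_cvg _ _ _ (nbhs z)).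
        exact: vec_continuous.
      exact: cvg_cst.
    have nq : \forall z' \near z, quad (vec z') v0 < - e.
      by apply: near_lt cq _; rewrite /e; lra.
    have nh : \forall z' \near z, forall v, h (base z') v <= C * vnorm v ^+ 2 /\ vnorm v ^+ 2 <= C * h (base z') v.
      exact: base_continuous hC.
    have v0n : 0 < vnorm v0.
      apply: vnorm_gt0; apply: contraTneq neg => ->.
      by rewrite -(scale0r (0 : V)) quadZv expr0n /= mul0r ltxx.
    pose K0 := M * C * (C * vnorm v0 ^+ 2) / e.
    exists ([set z' | quad (vec z') v0 < - e /\ forall v, h (base z') v <= C * vnorm v ^+ 2 /\ vnorm v ^+ 2 <= C * h (base z') v],
       [set K | K0 <= K]) => /=.
      by split; [exact: filterI|exact: nbhs_pinfty_ge (num_real _)].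
    move=> [z' K] /= [[q0 hz] KK] m m0 hm v.
    (* The fixed vector [v0], on which all nearby forms are below [- e], bounds [m] from below;
       [quad_bound] then bounds the positive part by a multiple of [m]. *)
    have m1 : e <= m * (C * vnorm v0 ^+ 2).
      have := hm v0; have [l _] := hz v0; have := ler_wpM2l m0 l; lra.
    have : M * C <= K * m.
      apply: (@le_trans _ _ (K0 * m)); last by rewrite ler_wpM2r.
      have -> : K0 * m = M * C * (m * (C * vnorm v0 ^+ 2) / e) by rewrite /K0; ring.
      have l1 : 1 <= m * (C * vnorm v0 ^+ 2) / e by rewrite ler_pdivlMr // mul1r.
      by apply: ler_peMr => //; rewrite mulr_ge0 // ltW.
    move=> l; apply: (@le_trans _ _ (M * C * h (base z') v)); last by rewrite ler_wpM2r // gauge_ge0.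
    have := hM (vec z') v; rewrite vec_norm mulr1 ler_norml => /andP[_ l2]; apply: le_trans l2 _.
    by rewrite -[M * C * _]mulrA; apply: ler_wpM2l; [exact: ltW|have [] := hz v].
  move=> K a z w zw hz m m0 hm v.
  have [bw [c [c0 vw]]] := (saP a z w).1 zw.
  have E1 v' : quad (vec w) v' = c * quad (vec z) (rho a^-1%g v').
    by rewrite vw quadZ (quad_actr vol_form rho_rep).
  rewrite E1 bw h_equiv.
  have mc : 0 <= m / c by rewrite divr_ge0 // ltW.
  have := hz (m / c) mc; have -> : K * (m / c) = K * m / c by rewrite mulrA.
  move=> /(_ _ (rho a^-1%g v)); rewrite -ler_pdivlMl // => H.
  have -> : c^-1 * (K * m * h (base z) (rho a^-1%g v)) = K * m / c * h (base z) (rho a^-1%g v) by ring.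
  apply: H => v'; have := hm (rho a v'); rewrite E1 bw h_equiv -comp_lfunE -(proj2 rho_rep) mulVg (rho1 vol_form rho_rep) => l.
  by rewrite -(ler_pM2l c0) mulrN mulrA (mulrCA c) mulfV ?mulr1 // gt_eqF.
move=> H; have H' : \forall L \near +oo, (0 : R) < L by exact: nbhs_pinfty_gt (num_real _).
have [K [hK K0]] := filter_ex (filterI H H'); exists K => // x r m fr m0 hm v.
have r0 : 0 < `|r| by rewrite normr_gt0; case: fr.
have := hK (ray_class (ray_of fr)) (m / `|r|); rewrite base_class vec_class /nvec rawvec_ray /= => H1.
have {H1} := H1 _ _ v; rewrite quadZ ler_pdivrMl // => H1.
have -> : K * m * h x v = `|r| * (K * (m / `|r|) * h x v) by field; rewrite gt_eqF.
apply: H1; first by rewrite divr_ge0 // ltW.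
move=> v'; rewrite quadZ -(ler_pM2l r0) mulrA mulfV ?mul1r ?gt_eqF // mulrN mulrA mulrCA mulfV ?mulr1 //.
by rewrite gt_eqF.
Qed.

(** Near a point all gauges are within a factor [C] of one fixed norm, hence within [C * C] of each
    other, and short curves stay where this holds. *)
Lemma gauge_short : exists C r : R, [/\ 1 < C, 0 < r & forall (k : R -> E) F a b,
  continuous k -> C1_curve A (p \o k) -> arclength g (p \o k) F -> 0 <= a -> a <= b ->
  F b - F a < r -> forall v, h (k b) v <= C * h (k a) v /\ h (k a) v <= C * h (k b) v].
Proof.
pose Q (Cr : R * R) (x : E) := forall (k : R -> E) F a b,
  continuous k -> C1_curve A (p \o k) -> arclength g (p \o k) F -> 0 <= a -> a <= b -> k a = x ->
  F b - F a < Cr.2 -> forall v, h (k b) v <= Cr.1 * h (k a) v /\ h (k a) v <= Cr.1 * h (k b) v.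
have : \forall Cr \near filter_prod (pinfty_nbhs R) (0 : R)^'+, forall x, Q Cr x.
  apply: unif_base.
    move=> x; have [C [C0 hC]] := h_comp x.
    have [Z [nZ [r r0 hr]]] := short_curves g_metric p_cov N_hausdorff hC.
    exists (Z `&` [set x' | forall v, h x' v <= C * vnorm v ^+ 2 /\ vnorm v ^+ 2 <= C * h x' v],
      [set Cr : R * R | C * C <= Cr.1 /\ Cr.2 < r]) => /=.
      split; first exact: filterI.
      exists ([set L | C * C <= L], [set r' | r' < r]) => /=; last by move=> [? ?] [].
      by split; [exact: nbhs_pinfty_ge (num_real _)|exact: nbhs_right_lt].
    move=> [x' Cr] /= [[Zx hx] [CC rr]] k F a b ck C1 hF a0 ab ka Fr v.
    have hb := hr k F a b ck C1 hF a0 ab _ (lt_trans Fr rr).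
    rewrite ka in hb *; have [b1 b2] := hb Zx v; have [a1 a2] := hx v.
    have g1 := gauge_ge0 x' v; have g2 := gauge_ge0 (k b) v.
    split.
      apply: le_trans b1 _; apply: (@le_trans _ _ (C * (C * h x' v))).
        by rewrite ler_wpM2l // ltW.
      by rewrite mulrA ler_wpM2r.
    apply: le_trans a1 _; apply: (@le_trans _ _ (C * (C * h (k b) v))).
      by rewrite ler_wpM2l // ltW.
    by rewrite mulrA ler_wpM2r.
  move=> Cr a x hx k F s t ck C1 hF s0 st ks Fr v.
  pose b : deck p := a^-1%g.
  have bK e : b (a e) = e by rewrite -[LHS]/(((a^-1 * a)%g : deck p) e) mulVg.
  have aK e : a (b e) = e by rewrite -[LHS]/(((a * a^-1)%g : deck p) e) mulgV.
  have pe : p \o (b \o k) = p \o k by apply/funext => y /=; rewrite deck_proj.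
  have := hx (b \o k) F s t; rewrite pe => H.
  have := H _ C1 hF s0 st _ Fr (rho a^-1%g v); rewrite /= -!h_equiv !aK; apply.
    by move=> y; apply: (@cont_comp _ _ _ k b); [exact: ck|exact: deck_cont].
  by rewrite ks bK.
move=> H; have H' : \forall Cr \near filter_prod (pinfty_nbhs R) (0 : R)^'+, 1 < Cr.1 /\ 0 < Cr.2.
  exists ([set L | 1 < L], [set r' | 0 < r']) => /=; last by move=> [? ?] [].
  by split; [exact: nbhs_pinfty_gt (num_real _)|exact: nbhs_right_gt].
have [[C r] [/= hQ [C1 r0]]] := filter_ex (filterI H H').
by exists C, r; split=> // k F a b ck C1' hF a0 ab; exact: hQ.
Qed.

(** The last piece, of arclength [r / 2], is cut off by the intermediate value theorem, and each
    piece costs one factor [C]. *)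
Lemma gauge_along C r (k : R -> E) F : 1 < C -> 0 < r ->
  (forall (k : R -> E) F a b,
  continuous k -> C1_curve A (p \o k) -> arclength g (p \o k) F -> 0 <= a -> a <= b ->
  F b - F a < r -> forall v, h (k b) v <= C * h (k a) v /\ h (k a) v <= C * h (k b) v) ->
  continuous k -> C1_curve A (p \o k) -> arclength g (p \o k) F ->
  forall n b, 0 <= b -> F b - F 0 < r + n%:R * (r / 2) ->
  forall v, h (k b) v <= C ^+ n.+1 * h (k 0) v /\ h (k 0) v <= C ^+ n.+1 * h (k b) v.
Proof.
move=> C1 r0 hC ck C1k hF; elim=> [|n IH] b b0 Fb v.
  by apply: hC hF _ _ _ v => //; move: Fb; rewrite mul0r addr0.
have g0 := gauge_ge0.
have C0 : 0 < C by apply: lt_trans C1.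
have [lt|ge] := ltP (F b - F 0) (r + n%:R * (r / 2)).
  have [h1 h2] := IH b b0 lt v.
  have aux y : 0 <= y -> C ^+ n.+1 * y <= C ^+ n.+2 * y.
    move=> y0; rewrite (exprS _ n.+1) ler_wpM2r //; apply: ler_peMl; last exact: ltW.
    by rewrite exprn_ge0 // ltW.
  by split; [apply: le_trans h1 _|apply: le_trans h2 _]; exact: aux.
have Fc : {within `[0, b], continuous F}.
  apply: continuous_in_subspaceT => x; rewrite inE /= in_itv /= => /andP[x0 _].
  have := hF x (lt_le_trans _ x0); rewrite ltrN10 => /(_ isT) hx.
  by apply: differentiable_continuous; apply/derivable1_diffP; exact: ex_derive.
have F0b : F 0 <= F b by apply: (arclength_le hF) => //; rewrite ltrN10.
have vin : Num.min (F 0) (F b) <= F b - r / 2 <= Num.max (F 0) (F b).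
  rewrite (min_idPl F0b) (max_idPr F0b); apply/andP; split; last by rewrite gerBl; lra.
  have : 0 <= n%:R * (r / 2) by rewrite mulr_ge0 //; lra.
  by move: ge; lra.
have [c] := IVT b0 Fc vin; rewrite in_itv /= => /andP[c0 cb] Fcb.
have Fc1 : F c - F 0 < r + n%:R * (r / 2).
  by rewrite Fcb; move: Fb; rewrite -natr1; lra.
have Fc2 : F b - F c < r by rewrite Fcb; lra.
have [h1 h2] := IH c c0 Fc1 v.
have [h3 h4] := hC k F c b ck C1k hF c0 cb Fc2 v.
split.
  by apply: le_trans h3 _; rewrite exprS -mulrA ler_wpM2l // ltW.
apply: le_trans h2 _; rewrite (exprSr _ n.+1) -[_ * C * _]mulrA; apply: ler_wpM2l => //.
by rewrite exprn_ge0 // ltW.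
Qed.

(* If K * C < mu, then a bound - m h <= r improves by a definite factor on going to
   r' and back; iterating, r is psd, which mixedness excludes. *)
Lemma growth_gauge K C x y mu (r r' : 'rV[R]_(dim (bform V))) : 0 < K -> 0 < C -> 0 < mu ->
  (forall x r m, fiber_vec u x r -> 0 <= m ->
    (forall v, - (m * h x v) <= quad r v) -> forall v, quad r v <= K * m * h x v) ->
  fiber_vec u x r -> fiber_vec u y r' -> wgrowth mu r r' ->
  (forall v, h y v <= C * h x v /\ h x v <= C * h y v) -> mu <= K * C.
Proof.
move=> K0 C0 mu0 bal fr fr' gr hC; rewrite leNgt; apply/negP => lt.
(* The round trip uses balance, change of gauge and growth twice each, so a lower bound with
   constant [m] improves by the square of [K * C / mu]. *)
have g0 := gauge_ge0; pose th := K * K * (C * C) / (mu * mu).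
have th0 : 0 <= th by rewrite divr_ge0 // ?mulr_ge0 // ltW.
have th1 : th < 1.
  by rewrite ltr_pdivrMr ?mulr_gt0 // mul1r mulrACA ltr_pM // mulr_ge0 // ltW.
have step m : 0 <= m -> (forall v, - (m * h x v) <= quad r v) ->
    forall v, - (th * m * h x v) <= quad r v.
  move=> m0 hm.
  have m1 : 0 <= mu^-1 * m * C by rewrite !mulr_ge0 ?invr_ge0 // ltW.
  have b1 v : quad r' v <= K * (mu^-1 * m * C) * h y v.
    apply: bal => // v'; have [_ g2] := gr v'; apply: le_trans g2.
    have [_ l] := hC v'; rewrite -(ler_pM2l mu0) mulrA mulfV ?gt_eqF // mul1r.
    apply: le_trans (hm v'); rewrite mulrN lerN2.
    have -> : mu * (mu^-1 * m * C * h y v') = m * (C * h y v') by field; rewrite gt_eqF.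
    by rewrite ler_wpM2l.
  (* Balance applies to [- r] too and turns the new upper bound for [r] into a lower one. *)
  have fN : fiber_vec u x (- r) by have [e n] := fr; split; rewrite ?mulNmx ?e // oppr_eq0.
  pose m2 := mu^-1 * (K * (mu^-1 * m * C)) * C.
  have m20 : 0 <= m2 by rewrite /m2 !mulr_ge0 ?invr_ge0 // ltW.
  have b2 v : - (m2 * h x v) <= quad (- r) v.
    rewrite quadN lerN2; have [g1 _] := gr v; have [l _] := hC v.
    rewrite -(ler_pM2l mu0); apply: le_trans g1 _; apply: le_trans (b1 v) _.
    have -> : mu * (m2 * h x v) = K * (mu^-1 * m * C) * (C * h x v) by rewrite /m2; field; rewrite gt_eqF.
    by rewrite ler_wpM2l // mulr_ge0 // ltW.
  move=> v; have := bal _ _ _ fN m20 b2 v; rewrite quadN lerNl.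
  by have -> : K * m2 * h x v = th * m * h x v by rewrite /m2 /th; field; rewrite gt_eqF.
have [m m0 hm] := gauge_dominates x r.
have iter n : forall v, - (th ^+ n * m * h x v) <= quad r v.
  elim: n => [|n IH] v; first by rewrite expr0 mul1r.
  rewrite exprS -(mulrA th); apply: step => //.
  by rewrite mulr_ge0 // exprn_ge0.
have [v neg] : exists v, quad r v < 0.
  have [h1 h2] := fiber_vec_mem fr.
  apply: (@mixed_indefinite _ V (pencil (u x))) => //.
  by apply: pencil_symm h1.
have cv : th ^+ n * (m * h x v) @[n --> \oo] --> 0 * (m * h x v).
  by apply: cvgMl; apply: cvg_expr; rewrite ger0_norm.
rewrite mul0r in cv.
have : \forall n \near \oo, th ^+ n * (m * h x v) < - quad r v.
  by apply: (cvgr_lt 0 cv); rewrite oppr_gt0.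
move=> /filter_ex [n ln].
by have := iter n v; rewrite -mulrA; lra.
Qed.

End WithGauge.

(** The time beyond the integer [n] contributes growth with factor 1, directly from the fitting
    condition. *)
Lemma flow_chain_real : exists2 mu : R, 1 < mu & forall n (t : R) z, n%:R <= t ->
  exists2 b : R, 0 < b & wgrowth (mu ^+ n) (vec z) (b *: vec (Phi t z)).
Proof.
have [mu mu1 H] := flow_chain vol_form rho_rep u_equiv u_cont p_cov deck_trans N_compact Phi_fitting Phi_equiv ltr01.
exists mu => // n t z; rewrite le_eqVlt => /orP [/eqP <-|lt].
  by have := H n z; rewrite mulr1.
have [b b0] := H n z; rewrite mulr1 => gr.
have s0 : 0 < t - n%:R by rewrite subr_gt0.
have e : t = (t - n%:R) + n%:R by rewrite subrK.
have [a' [b' [a0 b'0 pos]]] := flow_fit Phi_fitting (Phi n%:R z) s0.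
have w1 : wgrowth 1 (a' *: vec (Phi n%:R z)) (b' *: vec (Phi t z)).
  have -> : Phi t z = Phi (t - n%:R) (Phi n%:R z) by rewrite -(flowD Phi_fitting) -e.
  by apply: growth_weak; split; rewrite ?invr1 scale1r.
exists (b / a' * b'); first by rewrite mulr_gt0 // divr_gt0.
have ba : 0 <= b / a' by rewrite divr_ge0 // ltW.
have := wgrowth_scale ba w1; rewrite !(scalerA (b / a')) mulfVK ?gt_eqF // => w2.
rewrite -[mu ^+ n]mul1r; apply: wgrowth_trans gr w2 => //.
by rewrite exprn_gt0 // (lt_trans _ mu1).
Qed.

Lemma fiber_vec_scale (b : R) (z : SE) : 0 < b -> fiber_vec u (base z) (b *: vec z).
Proof. by move=> b0; apply: fiber_vecZ => //; exact: vec_fiber. Qed.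

Lemma flow_quasi_geodesic : exists C D : R, [/\ 0 < C, 0 < D &
    forall z : SE, quasi_geodesic (lifted_distance p g) C D (fun t => base_point (Phi t z))].
Proof.
have [L L0 hL] := flow_joined_unit.
have [h [h_equiv h_comp]] := gauge_ex vol_form rho_rep p_cov deck_trans deck_free N_compact N_hausdorff.
have [K K0 hK] := gauge_balanced h_equiv h_comp.
have [C [r [C1 r0 hC]]] := gauge_short h_equiv h_comp.
have [mu mu1 hmu] := flow_chain_real.
have C0 : 0 < C by apply: lt_trans C1.
have mu0 : 0 < mu by apply: lt_trans mu1.
have lC : 0 < ln C by rewrite ln_gt0.
have lmu : 0 < ln mu by rewrite ln_gt0.
(* Take logarithms in [mu ^+ n' <= K * C ^+ n.+1], where [n'] is the integer part of [t] and [n]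
   that of [2 * l / r], and solve for [l]: the result is [al * t - be <= l]. *)
pose al := r / 2 * (ln mu / ln C).
pose be := r / 2 * ((ln mu + `|ln K| + ln C) / ln C).
have al0 : 0 < al by rewrite /al mulr_gt0 ?divr_gt0.
have upper z t : 0 <= t -> joined g p ((t + 1) * L) (base z) (base (Phi t z)).
  move=> t0; have := Num.Theory.truncn_itv t0 => /andP[t1 t2].
  have jn : joined g p ((Num.trunc t).+1%:R * L) (base z) (base (Phi t z)).
    by apply: (flow_joined z L0 hL); rewrite t0 ltW.
  apply: joined_le jn.
  by apply: ler_wpM2r; [exact: ltW|rewrite -natr1 lerD2r].
have lower z t l (x y : E) : 0 <= t -> x = base z /\ y = base (Phi t z) \/ y = base z /\ x = base (Phi t z) ->
    lifted_distance p g x y < l -> al * t - be <= l.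
  move=> t0 xy dl.
  have [L' jxy] : exists L', joined g p L' x y.
    by have [L' _ ?] := joined_ex g_metric p_cov x y E_conn; exists L'.
  have [k [ck C1k k0 k1 kl]] := lifted_distance_curve jxy dl.
  have cpk : continuous (p \o k).
    by move=> s; apply: continuous_comp (ck s) _; case: p_cov => cp _ _; exact: cp.
  have [F [hF Fl]] := arclength_ex g_metric cpk C1k.
  have l0 : 0 < l by apply: le_lt_trans kl; exact: curve_length_ge0.
  have l0' : 0 <= 2 * l / r by rewrite divr_ge0 ?mulr_ge0 ?ltW.
  have := Num.Theory.truncn_itv l0'; set n := Num.trunc _ => /andP[n1 n2].
  have Fr : F 1 - F 0 < r + n%:R * (r / 2).
    rewrite -Fl; apply: lt_trans kl _.
    have e : n.+1%:R = n%:R + 1 :> R by rewrite natr1.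
    move: n2; rewrite e ltr_pdivrMr //; lra.
  have cmp := gauge_along h_comp C1 r0 hC ck C1k hF ler01 Fr.
  rewrite k0 k1 in cmp.
  have := Num.Theory.truncn_itv t0; set n' := Num.trunc t => /andP[t1 t2].
  have [b b0 gr] := hmu n' t z t1.
  have bound : mu ^+ n' <= K * C ^+ n.+1.
    apply: (growth_gauge h_comp K0 (exprn_gt0 n.+1 C0) (exprn_gt0 n' mu0) hK (vec_fiber z) (fiber_vec_scale (Phi t z) b0) gr).
    by move=> v; have [c1 c2] := cmp v; case: xy => -[<- <-].
  have : ln (mu ^+ n') <= ln (K * C ^+ n.+1) by rewrite ler_ln ?posrE // ?mulr_gt0 // exprn_gt0.
  rewrite lnM ?posrE ?exprn_gt0 // !lnXn // -[_ *+ n']mulr_natl -[_ *+ n.+1]mulr_natl => lb.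
  have n1' : n.+1%:R <= 2 * l / r + 1 by rewrite -natr1 lerD2r.
  have h1 : n.+1%:R * ln C <= (2 * l / r + 1) * ln C by rewrite ler_wpM2r // ltW.
  have h2 : (t - 1) * ln mu <= n'%:R * ln mu by rewrite ler_wpM2r ?ltW // ltrBlDr natr1.
  have h3 : ln K <= `|ln K| by exact: ler_norm.
  have h4 : (t - 1) * ln mu - `|ln K| - ln C <= 2 * l / r * ln C by lra.
  have -> : al * t - be = r / 2 / ln C * ((t - 1) * ln mu - `|ln K| - ln C).
    by rewrite /al /be; field; rewrite gt_eqF.
  have -> : l = r / 2 / ln C * (2 * l / r * ln C) by field; rewrite !gt_eqF.
  by rewrite ler_wpM2l // !divr_ge0 // ltW.
have dist_lower z t x y : 0 <= t -> x = base z /\ y = base (Phi t z) \/ y = base z /\ x = base (Phi t z) ->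
    al * t - be <= lifted_distance p g x y.
  (* [lower] speaks of lengths strictly above the distance; it is applied halfway between the
     distance and the bound to be proved. *)
  move=> t0 xy; rewrite leNgt; apply/negP => lt.
  have := lower z t ((lifted_distance p g x y + (al * t - be)) / 2) x y t0 xy.
  by rewrite midf_lt // => /(_ isT); lra.
(* The upper estimate asks for a constant at least [L], the lower one for a constant whose inverse
   is at most [al]. *)
exists (L + al^-1), (L + `|be| + 1); split.
- by rewrite addr_gt0 // invr_gt0.
- by rewrite !ltr_wpDr // addr_ge0 // ltW.
have ali : (L + al^-1)^-1 <= al.
  rewrite -[leRHS]invrK lef_pV2 ?posrE ?invr_gt0 ?addr_gt0 ?invr_gt0 //.
  by rewrite lerDr ltW.
move=> z t1 t2.
have [z' [t [t0 e1 [e2 e3]]]] : exists (z' : SE) (t : R), [/\ 0 <= t, `|t1 - t2| = t &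
   (base (Phi t1 z) = base z' /\ base (Phi t2 z) = base (Phi t z') \/
   base (Phi t2 z) = base z' /\ base (Phi t1 z) = base (Phi t z')) /\
   joined g p ((t + 1) * L) (base (Phi t1 z)) (base (Phi t2 z))].
  have [le|lt] := leP t1 t2.
    exists (Phi t1 z), (t2 - t1); rewrite -(flowD Phi_fitting) subrK; split; rewrite ?subr_ge0 //.
      by rewrite ler0_norm ?opprB // subr_le0.
    by split; [left|have := upper (Phi t1 z) (t2 - t1); rewrite -(flowD Phi_fitting) subrK subr_ge0; exact].
  exists (Phi t2 z), (t1 - t2); rewrite -(flowD Phi_fitting) subrK; split; rewrite ?subr_ge0 ?(ltW lt) //.
    by rewrite ger0_norm // subr_ge0 ltW.
  split; first by right.
  apply: (joined_sym p_cov); have := upper (Phi t2 z) (t1 - t2); rewrite -(flowD Phi_fitting) subrK subr_ge0.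
  by apply; exact: ltW.
rewrite e1; apply/andP; split.
  apply: le_trans (dist_lower z' t _ _ t0 e2).
  have := ler_wpM2r t0 ali; have := ler_norm be; have : 0 < L by []. lra.
apply: le_trans (lifted_distance_le g_metric p_cov e3) _.
have : 0 <= al^-1 * t by rewrite mulr_ge0 // invr_ge0 ltW.
by have := normr_ge0 be; lra.
Qed.
End Quasi.

(** * Discs swept out by flow lines *)

Section Transport.
Context {R : realType} {V : vectType R} {d : nat} {E : topologicalType}.
Variable u : E -> Gr V d.
Hypothesis u_cont : continuous u.
Notation m := (dim (bform V)).

(* An open condition under which the orthogonal projection from u a to u b is
   injective. *)
Definition near_pencils (a b : E) :=
  \det (Pi u a *m Pi u b *m Pi u a + (1%:M - Pi u a)) != 0.

Lemma near_pencils_inj a b (r : 'rV[R]_m) : near_pencils a b -> fiber_vec u a r ->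
  fiber_vec u b (r *m Pi u b).
Proof.
move=> nd [ra r0]; split; first by rewrite -mulmxA Pi_idem.
apply: contra_neq r0 => rb.
have un : (Pi u a *m Pi u b *m Pi u a + (1%:M - Pi u a)) \in unitmx by rewrite unitmxE unitfE.
have e : r *m (Pi u a *m Pi u b *m Pi u a + (1%:M - Pi u a)) = 0.
  rewrite mulmxDr [X in _ + X]mulmxBr mulmx1.
  by rewrite mulmxA mulmxA ra rb mul0mx subrr addr0.
by rewrite -[LHS](mulmxK un) e mul0mx.
Qed.

Lemma near_pencils_near (e : E) : \forall a \near e & b \near e, near_pencils a b.
Proof.
pose D (z : E * E) : 'M[R]_m := Pi u z.1 *m Pi u z.2 *m Pi u z.1 + (1%:M - Pi u z.1).
have cD : \det (D z) @[z --> (e, e)] --> \det (D (e, e)).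
  have c1 : Pi u z.1 @[z --> (e, e)] --> Pi u e.
    by apply: (@cont_comp _ _ _ (fun z : E * E => z.1) (Pi u) (e, e)); [exact: cvg_fst|exact: Pi_continuous].
  have c2 : Pi u z.2 @[z --> (e, e)] --> Pi u e.
    by apply: (@cont_comp _ _ _ (fun z : E * E => z.2) (Pi u) (e, e)); [exact: cvg_snd|exact: Pi_continuous].
  apply: cvg_det; apply: (@cvgD _ _ _ (nbhs (e, e))).
    by apply: cvg_mulmx; [apply: cvg_mulmx|].
  by apply: (@cvgB _ _ _ (nbhs (e, e))); [exact: cvg_cst|].
have D1 : D (e, e) = 1%:M by rewrite /D /= !Pi_idem addrC subrK.
have : \forall z \near (e, e), \det (D z) != 0.
  have : 0 < \det (D (e, e)) by rewrite D1 det1.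
  move=> /(near_gt cD); apply: filterS => z h; by rewrite gt_eqF.
by [].
Qed.

(** A replacement for parallel transport: project successively onto the pencils at the times [h],
    [2 h], ..., [k h]. It is continuous in [w], and is the identity on the fibre along a constant
    path. *)
Fixpoint proj_transport {W : Type} (ga : R -> W -> E) (h : R) (k : nat) (w : W) : 'M[R]_m :=
  if k is k'.+1 then proj_transport ga h k' w *m Pi u (ga (k%:R * h) w) else 1%:M.

Lemma proj_transport_continuous {W : topologicalType} (ga : R -> W -> E) h k :
  continuous (fun z : R * W => ga z.1 z.2) -> continuous (proj_transport ga h k).
Proof.
move=> cg; elim: k => [|k IH] w; first exact: cvg_cst.
apply: cvg_mulmx; first exact: IH.
apply: (@cont_comp _ _ _ (ga (k.+1%:R * h)) (Pi u)); last exact: Pi_continuous.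
exact: (cont_slice_r cg).
Qed.

(** By compactness, consecutive pencils are near along all the paths at once when the step is
    [n%:R^-1], so no projection kills a vector. *)
Lemma proj_transport_uniform {W : topologicalType} (ga : R -> W -> E) (K : set W) :
  compact K -> continuous (fun z : R * W => ga z.1 z.2) ->
  exists n : nat, (0 < n)%N /\ forall w r, K w -> fiber_vec u (ga 0 w) r ->
    fiber_vec u (ga 1 w) (r *m proj_transport ga n%:R^-1 n w).
Proof.
move=> cK cg.
have := @compact_unif _ _ (`[(0 : R), 1]%classic `*` K) (nbhs (0 : R)) _
   (fun h (z : R * W) => near_pencils (ga z.1 z.2) (ga (z.1 + h) z.2))
   (compact_setX (@segment_compact _ _ _) cK).
have loc z : (`[(0 : R), 1]%classic `*` K) z -> \forall z' \near z & h \near (0 : R),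
    near_pencils (ga z'.1 z'.2) (ga (z'.1 + h) z'.2).
  move=> _; have [[X Y] /= [nX nY] XY] := near_pencils_near (ga z.1 z.2).
  pose f1 (q : (R * W) * R) := ga q.1.1 q.1.2.
  pose f2 (q : (R * W) * R) := ga (q.1.1 + q.2) q.1.2.
  have c1 : {for (z, 0), continuous f1}.
    by apply: (@cont_comp _ _ _ (fun q : (R * W) * R => q.1) (fun z : R * W => ga z.1 z.2)); [exact: cvg_fst|exact: cg].
  have c2 : {for (z, 0), continuous f2}.
    apply: (@cont_comp _ _ _ (fun q : (R * W) * R => (q.1.1 + q.2, q.1.2)) (fun z : R * W => ga z.1 z.2)); last exact: cg.
    apply: cont_pair.
      apply: (@cvgD _ _ _ (nbhs (z, (0 : R)))); last exact: cvg_snd.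
      by apply: (@cont_comp _ _ _ (fun q : (R * W) * R => q.1) (fun z => z.1)); exact: cvg_fst.
    by apply: (@cont_comp _ _ _ (fun q : (R * W) * R => q.1) (fun z => z.2)); [exact: cvg_fst|exact: cvg_snd].
  have nX' : nbhs (f1 (z, 0)) X by exact: nX.
  have nY' : nbhs (f2 (z, 0)) Y by rewrite /f2 /= addr0; exact: nY.
  have h1 : \forall q \near (z, (0 : R)), X (f1 q) := c1 _ nX'.
  have h2 : \forall q \near (z, (0 : R)), Y (f2 q) := c2 _ nY'.
  apply: filterS2 h1 h2 => q Xq Yq.
  exact: (XY (_, _)).
move=> /(_ _ loc) /nbhs_ballP [e /= e0 he].
pose n := (Num.trunc e^-1).+1.
have n0 : 0 < n%:R :> R by rewrite ltr0n.
have ne : n%:R^-1 < e.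
  rewrite invf_plt ?posrE //; have ei : 0 <= e^-1 by rewrite invr_ge0 ltW.
  by have /andP[] := Num.Theory.truncn_itv ei.
exists n; split=> // w r Kw fr.
have st k : (k <= n)%N -> fiber_vec u (ga (k%:R * n%:R^-1) w) (r *m proj_transport ga n%:R^-1 k w).
  elim: k => [|k IH] kn; first by rewrite mul0r mulmx1.
  rewrite /= mulmxA; apply: near_pencils_inj (IH (ltnW kn)).
  have -> : k.+1%:R * n%:R^-1 = k%:R * n%:R^-1 + n%:R^-1 :> R.
    have e1 : k.+1%:R = k%:R + 1 :> R by rewrite natr1.
    by rewrite e1 mulrDl mul1r.
  apply: (he n%:R^-1 _ (k%:R * n%:R^-1, w)).
    by rewrite /ball /= sub0r normrN ger0_norm // invr_ge0 ltW.
  split=> //=; rewrite in_itv /=; apply/andP; split; first by rewrite mulr_ge0 // invr_ge0 ltW.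
  by rewrite ler_pdivrMr // mul1r ler_nat ltnW.
by have := st n (leqnn _); rewrite mulfV ?gt_eqF.
Qed.

Lemma proj_transport_const {W : Type} (ga : R -> W -> E) (e : E) h k w (r : 'rV[R]_m) :
  (forall j, (j <= k)%N -> ga (j%:R * h) w = e) -> r *m Pi u e = r -> r *m proj_transport ga h k w = r.
Proof.
move=> hc re; elim: k hc => [|k IH] hc; first by rewrite mulmx1.
by rewrite /= mulmxA IH ?hc // => j jk; apply: hc; exact: leqW.
Qed.

End Transport.

Lemma self_dot_gt0 {R : realType} {n} (r : 'rV[R]_n) : r != 0 -> 0 < (r *m r^T) 0 0.
Proof.
move=> r0; rewrite lt_def mxE; apply/andP; split; last first.
  by apply: sumr_ge0 => i _; rewrite mxE -expr2 sqr_ge0.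
apply: contra r0; rewrite psumr_eq0 => [/allP h|i _]; last by rewrite mxE -expr2 sqr_ge0.
apply/eqP/rowP => i; have := h i (mem_index_enum _).
by rewrite [r^T _ _]mxE -expr2 sqrf_eq0 [in RHS]mxE => /eqP.
Qed.

Section Obstruct.
Context {R : realType} {V : vectType R} {d : nat} {E : topologicalType}.
Variable u : E -> Gr V d.
Hypothesis u_cont : continuous u.
Notation m := (dim (bform V)).
Notation SE := (sphere_bundle u).
Variable Phi : R -> SE -> SE.
Hypothesis Phi_cont : continuous (fun tz : R * SE => Phi tz.1 tz.2).
Hypothesis Phi0 : forall z, Phi 0 z = z.

Lemma frame_of_fiber (x : E) : exists A : 'M[R]_(d, m),
  row_free A /\ forall y : 'rV[R]_d, y != 0 -> fiber_vec u x (y *m A).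
Proof.
exists (frame_mx (repr (u x))); split; first exact: frame_mx_free.
move=> y y0; split.
  by rewrite -mulmxA projmx_fix // frame_mx_free.
apply: contra y0 => /eqP e; apply/eqP/(row_free_inj (frame_mx_free (repr (u x)))).
by rewrite e mul0mx.
Qed.

(* A d x m matrix mapping nonzero rows to nonzero vectors of a fibre is a frame
   of this fibre, because fibres have dimension d. *)
Lemma frame_full (x : E) (A : 'M[R]_(d, m)) :
  (forall y : 'rV[R]_d, y != 0 -> fiber_vec u x (y *m A)) ->
  forall r : 'rV[R]_m, r *m Pi u x = r -> exists y, r = y *m A.
Proof.
move=> hA r rx.
have fA : row_free A.
  rewrite -kermx_eq0; apply/eqP/row_matrixP => i; rewrite row0.
  apply/eqP; rewrite -[_ == _]negbK; apply/negP => /hA [_].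
  by rewrite -row_mul mulmx_ker row0 eqxx.
have sub : (A <= Pi u x)%MS.
  apply/row_subP => i; have [->|n0] := eqVneq (row i A) 0; first exact: sub0mx.
  have : delta_mx 0 i != 0 :> 'rV[R]_d.
    by apply: contra n0 => /eqP e; rewrite rowE e mul0mx.
  by move=> /hA [e _]; rewrite rowE -e submxMl.
have : (Pi u x <= A)%MS.
  by case: (mxrank_leqif_sup sub) => _ <-; rewrite Pi_rank; move/eqP: fA => ->.
move=> /(submx_trans (submxMl r _)); rewrite rx => /submxP [y ->].
by exists y.
Qed.

Section Polar.
Variables (z0 : SE) (A : 'M[R]_(d, m)) (T : R).
Hypothesis hA : forall y : 'rV[R]_d, y != 0 -> fiber_vec u (base z0) (y *m A).

(* The disc swept out by the flow lines of length T from the point x = base z0: the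
   direction of w is the starting ray and 2 |w| - 1 is the fraction of T elapsed. *)
Definition polar_ray (w : 'rV[R]_d) : SE := ray z0 (base z0) (w *m A).
Definition polar_time (w : 'rV[R]_d) : R := T * clamp 0 1 (2 * `|w| - 1).
Definition polar_flow (w : 'rV[R]_d) : SE := Phi (polar_time w) (polar_ray w).
Definition polar (w : 'rV[R]_d) : E := base (polar_flow w).

Lemma polar_ray_base w : base (polar_ray w) = base z0.
Proof.
have [->|w0] := eqVneq w 0; last by rewrite ray_base //; exact: hA.
rewrite /polar_ray /ray mul0mx; case: pselect => // h.
by exfalso; case: h => _; rewrite eqxx.
Qed.

Lemma polar_ray_continuous w : w != 0 -> {for w, continuous polar_ray}.
Proof.
move=> w0; apply: ray_continuous.
- exact: cst_continuous.
- by apply: (@cvg_mulmx _ _ (nbhs w)); [exact: cvg_id|exact: cvg_cst].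
- exact: hA.
- have : \forall w' \near w, 0 < `|w'| by apply: near_gt; [exact: norm_continuous|rewrite normr_gt0].
  by apply: filterS => w'; rewrite normr_gt0 => /hA.
Qed.

Lemma clamp01_le0 t : t <= 0 -> clamp 0 1 t = 0 :> R.
Proof. by move=> t0; rewrite /clamp max_l // min_r. Qed.
Lemma clamp01_ge1 t : 1 <= t -> clamp 0 1 t = 1 :> R.
Proof. by move=> t0; rewrite /clamp max_r ?min_l // (le_trans _ t0). Qed.

Lemma polar_time_continuous : continuous polar_time.
Proof.
move=> w; apply: (@cvgM _ _ (nbhs w)); first exact: cvg_cst.
apply: (@cont_comp _ _ _ (fun w : 'rV[R]_d => 2 * `|w| - 1) (clamp 0 1)); last exact: clamp_continuous.
apply: (@cvgB _ _ _ (nbhs w)); last exact: cvg_cst.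
by apply: (@cvgM _ _ (nbhs w)); [exact: cvg_cst|exact: norm_continuous].
Qed.

Lemma polar_flow_continuous w : w != 0 -> {for w, continuous polar_flow}.
Proof.
move=> w0; apply: (@cont_comp _ _ _ (fun w => (polar_time w, polar_ray w)) (fun tz : R * SE => Phi tz.1 tz.2)); last exact: Phi_cont.
by apply: cont_pair; [exact: polar_time_continuous|exact: polar_ray_continuous].
Qed.

Lemma polar_center w : `|w| <= 1 / 2 -> polar w = base z0.
Proof.
move=> wn; rewrite /polar /polar_flow /polar_time clamp01_le0; last lra.
by rewrite mulr0 Phi0 polar_ray_base.
Qed.

Lemma polar_continuous : continuous polar.
Proof.
move=> w; have [->|w0] := eqVneq w 0.
  apply: (@cont_near_eq _ _ _ (fun=> base z0)); last exact: cst_continuous.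
  have : \forall w' \near (0 : 'rV[R]_d), `|w'| < 1 / 2.
    by apply: near_lt; [exact: norm_continuous|rewrite normr0; lra].
  by apply: filterS => w' /ltW; exact: polar_center.
by apply: (@cont_comp _ _ _ polar_flow (@base _ _ _ _ u)); [exact: polar_flow_continuous|exact: base_continuous].
Qed.

Lemma ray_scale (c : R) (w : 'rV[R]_d) : 0 < c -> w != 0 -> polar_ray (c *: w) = polar_ray w.
Proof.
move=> c0 w0; have cw0 : c *: w != 0 by rewrite scaler_eq0 negb_or w0 gt_eqF.
apply: sphere_ext; first by rewrite !polar_ray_base.
rewrite !ray_vec; [|exact: hA|exact: hA].
rewrite -scalemxAl normrZ gtr0_norm // scalerA invfM mulrAC mulVf ?mul1r // gt_eqF //.
Qed.

Variables (H : R -> 'rV[R]_d -> E) (th : 'rV[R]_d -> 'cV[R]_m).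
Hypothesis H_cont : continuous (fun z : R * 'rV[R]_d => H z.1 z.2).
Hypothesis H0 : forall w, `|w| <= 1 -> H 0 w = polar w.
Hypothesis H_bd : forall s w, 0 <= s <= 1 -> `|w| = 1 -> H s w = polar w.
Hypothesis th_cont : continuous th.
Hypothesis th_nz : forall w, `|w| <= 1 -> Pi u (H 1 w) *m th w != 0.
Hypothesis th_bd : forall w, `|w| = 1 -> 0 < dval (vec (polar_flow w)) (th w).

(* Otherwise, in a frame transported along the disc, th would extend the vector
   field w |-> w of the sphere to a nonvanishing field on the ball: near the
   boundary of the disc th is homotopic to the dual of the flow direction, which is
   radial at the starting point. *)
Lemma polar_obstruction : False.
Proof.
have cpol : continuous (fun z : R * 'rV[R]_d => polar (z.1 *: z.2)).
  move=> z; apply: (@cont_comp _ _ _ (fun z : R * 'rV[R]_d => z.1 *: z.2) polar); last exact: polar_continuous.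
  by apply: (@cvgZ _ _ _ (nbhs z)); [exact: cvg_fst|exact: cvg_snd].
have [n1 [n10 tr1]] := @proj_transport_uniform _ _ _ _ u u_cont _ (fun (l : R) (w : 'rV[R]_d) => polar (l *: w)) _ (@rV_closed_ball_compact R d 1) cpol.
have [n2 [n20 tr2]] := proj_transport_uniform u_cont (@rV_closed_ball_compact R d 1) H_cont.
pose U1 := proj_transport u (fun (l : R) (w : 'rV[R]_d) => polar (l *: w)) n1%:R^-1 n1.
pose U2 := proj_transport u H n2%:R^-1 n2.
have cU1 : continuous U1 by exact: proj_transport_continuous.
have cU2 : continuous U2 by exact: proj_transport_continuous.
have fr1 w (y : 'rV[R]_d) : `|w| <= 1 -> y != 0 -> fiber_vec u (polar w) (y *m A *m U1 w).
  move=> w1 y0; have := tr1 w (y *m A) w1; rewrite scale0r scale1r; apply.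
  by rewrite polar_center ?normr0 //; exact: hA.
have fr2 w (y : 'rV[R]_d) : `|w| <= 1 -> y != 0 -> fiber_vec u (H 1 w) (y *m A *m U1 w *m U2 w).
  by move=> w1 y0; apply: tr2 => //; rewrite H0 //; exact: fr1.
have U2bd w (y : 'rV[R]_d) : `|w| = 1 -> y *m A *m U1 w *m U2 w = y *m A *m U1 w.
  move=> w1; have [->|y0] := eqVneq y 0; first by rewrite !mul0mx.
  have wl : `|w| <= 1 by rewrite w1.
  have [e _] := fr1 w y wl y0.
  apply: (@proj_transport_const _ _ _ _ u _ _ (polar w)) => // j jn; apply: H_bd => //.
  rewrite mulr_ge0 ?invr_ge0 //= ler_pdivrMr ?ltr0n // mul1r ler_nat //.
have U1c w (y : 'rV[R]_d) : `|w| <= 1 / 2 -> y *m A *m U1 w = y *m A.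
  move=> w1; have [->|y0] := eqVneq y 0; first by rewrite !mul0mx.
  have [e _] := hA y0.
  apply: (@proj_transport_const _ _ _ _ u _ _ (base z0)) => // j jn; apply: polar_center.
  rewrite normrZ ger0_norm ?mulr_ge0 ?invr_ge0 //.
  apply: le_trans w1; apply: ler_piMl => //.
  by rewrite ler_pdivrMr ?ltr0n // mul1r ler_nat.
(* The field [f] on the ball of radius 2 is built in shells. For [|w| <= 1] it is [th] read in the
   transported frame. Up to 5/4 the functional [th] is deformed into the dual [v] of the flow
   direction. Up to 3/2 the point [pt w] moves inwards to radius 1/2, where the elapsed time is 0
   and [v] is proportional to the transpose of [hat w *m A]. Beyond, [f] is deformed into [w]. [J]
   drops [U2], which is the identity over the unit sphere. *)
pose mu (w : 'rV[R]_d) : R := Num.max 1 `|w|.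
pose hat (w : 'rV[R]_d) : 'rV[R]_d := (mu w)^-1 *: w.
pose a1 (w : 'rV[R]_d) : R := clamp 0 1 (4 * (`|w| - 1)).
pose la (w : 'rV[R]_d) : R := 1 - clamp 0 1 (4 * (`|w| - 5 / 4)) / 2.
pose a2 (w : 'rV[R]_d) : R := clamp 0 1 (4 * (`|w| - 3 / 2)).
pose pt (w : 'rV[R]_d) : 'rV[R]_d := la w *: hat w.
pose v (w : 'rV[R]_d) : 'cV[R]_m := (vec (polar_flow (pt w)))^T.
pose g (w : 'rV[R]_d) : 'cV[R]_m := (1 - a1 w) *: th (hat w) + a1 w *: v w.
pose J (w : 'rV[R]_d) : 'M[R]_m := a1 w *: 1%:M + (1 - a1 w) *: U2 (hat w).
pose f (w : 'rV[R]_d) : 'rV[R]_d := (1 - a2 w) *: (A *m (U1 (pt w) *m J w *m g w))^T + a2 w *: w.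
have cc c0 : continuous (fun w : 'rV[R]_d => clamp 0 1 (4 * (`|w| - c0)) : R).
  move=> w; apply: (@cont_comp _ _ _ (fun w : 'rV[R]_d => 4 * (`|w| - c0)) (clamp 0 1)); last exact: clamp_continuous.
  apply: (@cvgM _ _ (nbhs w)); first exact: cvg_cst.
  by apply: (@cvgB _ _ _ (nbhs w)); [exact: norm_continuous|exact: cvg_cst].
have mu1 w : 1 <= mu w by rewrite le_max lexx.
have mu0 w : 0 < mu w by apply: lt_le_trans (mu1 w).
have chat : continuous hat.
  move=> w; apply: (@cvgZ _ _ _ (nbhs w)); last exact: cvg_id.
  apply: (@cont_comp _ _ _ mu (fun x : R => x^-1)); last by apply: inv_continuous; rewrite gt_eqF.
  by apply: continuous_max; [exact: cst_continuous|exact: norm_continuous].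
have cla : continuous la.
  move=> w; apply: (@cvgB _ _ _ (nbhs w)); first exact: cvg_cst.
  by apply: (@cvgM _ _ (nbhs w)); [exact: cc|exact: cvg_cst].
have la12 w : 1 / 2 <= la w <= 1.
  have /andP[] := @clamp_itv R 0 1 (4 * (`|w| - 5 / 4)) ler01.
  by rewrite /la => h1 h2; apply/andP; split; lra.
have cpt : continuous pt by move=> w; apply: (@cvgZ _ _ _ (nbhs w)); [exact: cla|exact: chat].
have hat_norm w : `|hat w| <= 1.
  have h0 : 0 <= (mu w)^-1 by rewrite invr_ge0 ltW.
  rewrite normrZ (ger0_norm h0) ler_pdivrMl // mulr1.
  by rewrite le_max lexx orbT.
have hat1 w : 1 <= `|w| -> `|hat w| = 1.
  have h0 : 0 <= (mu w)^-1 by rewrite invr_ge0 ltW.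
  move=> w1; rewrite normrZ (ger0_norm h0) /mu max_r // mulVf //.
  by rewrite gt_eqF // (lt_le_trans _ w1).
have hat_in w : `|w| <= 1 -> hat w = w.
  by move=> w1; rewrite /hat /mu max_l // invr1 scale1r.
have a1_in w : `|w| <= 1 -> a1 w = 0 by move=> w1; apply: clamp01_le0; lra.
have a1_out w : 5 / 4 <= `|w| -> a1 w = 1 by move=> w1; apply: clamp01_ge1; lra.
have cf : continuous f.
  have ct (w : 'rV[R]_d) : {for w, continuous ((fun w : 'rV[R]_d => a1 w *: v w) : 'rV[R]_d -> 'cV[R]_m)}.
    have [lt|ge] := ltP `|w| 1.
      apply: (@cont_near_eq 'rV[R]_d 'cV[R]_m _ (fun=> 0) w); last exact: cst_continuous.
      have : \forall w' \near w, `|w'| < 1 by apply: near_lt => //; exact: norm_continuous.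
      by apply: filterS => w' /ltW /a1_in ->; rewrite scale0r.
    apply: (@cvgZ _ _ _ (nbhs w)); first exact: cc.
    apply: cvg_trmx; apply: (@cont_comp _ _ _ (fun w => polar_flow (pt w)) (@vec _ _ _ _ u)); last exact: vec_continuous.
    apply: (@cont_comp _ _ _ pt polar_flow); first exact: cpt.
    apply: polar_flow_continuous; rewrite -normr_gt0 normrZ (hat1 w ge) mulr1 normr_gt0.
    by have /andP[l1 _] := la12 w; rewrite gt_eqF //; lra.
  have cg : continuous g.
    move=> w; apply: (@cvgD _ _ _ (nbhs w)); last exact: ct.
    apply: (@cvgZ _ _ _ (nbhs w)).
      by apply: (@cvgB _ _ _ (nbhs w)); [exact: cvg_cst|exact: cc].
    by apply: (@cont_comp _ _ _ hat th); [exact: chat|exact: th_cont].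
  have cJ : continuous J.
    move=> w; apply: (@cvgD _ _ _ (nbhs w)); apply: (@cvgZ _ _ _ (nbhs w)).
    - exact: cc.
    - exact: cvg_cst.
    - by apply: (@cvgB _ _ _ (nbhs w)); [exact: cvg_cst|exact: cc].
    - by apply: (@cont_comp _ _ _ hat U2); [exact: chat|exact: cU2].
  move=> w; apply: (@cvgD _ _ _ (nbhs w)); apply: (@cvgZ _ _ _ (nbhs w)).
  - by apply: (@cvgB _ _ _ (nbhs w)); [exact: cvg_cst|exact: cc].
  - apply: cvg_trmx; apply: cvg_mulmx; first exact: cvg_cst.
    apply: cvg_mulmx; last exact: cg.
    apply: cvg_mulmx; last exact: cJ.
    by apply: (@cont_comp _ _ _ pt U1); [exact: cpt|exact: cU1].
  - exact: cc.
  - exact: cvg_id.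
have fbd (w : 'rV[R]_d) i : `|w| <= 2 -> `|w 0 i| = 2 -> f w 0 i = w 0 i.
  move=> w2 wi; have wn : `|w| = 2 by apply/eqP; rewrite eq_le w2 -wi rV_coord_le.
  have -> : f w = w; last by [].
  rewrite /f /a2 clamp01_ge1; first by rewrite subrr scale0r add0r scale1r.
  by rewrite wn; lra.
have [w w2 fw] := brouwer_zero cf fbd.
(* As [A *m F] is a frame of the whole fibre, it detects a functional that is nonzero on a single
   vector of the fibre. *)
have kill (w' : 'rV[R]_d) (g' : 'cV[R]_m) (e : E) (F : 'M[R]_m) (r : 'rV[R]_m) :
    (forall y : 'rV[R]_d, y != 0 -> fiber_vec u e (y *m A *m F)) -> r *m Pi u e = r ->
    dval r g' != 0 -> A *m (F *m g') != 0.
  move=> hF re nz; apply: contra_neq nz => e0.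
  have [y ->] := @frame_full e (A *m F) (fun y y0 => eq_ind_r (fun r => fiber_vec u e r) (hF y y0) (mulmxA _ _ _)) r re.
  by rewrite /dval -!mulmxA e0 mulmx0 mxE.
have [w1|w1] := leP `|w| 1.
  have h1 := hat_in w w1.
  have pw : pt w = w by rewrite /pt h1 /la clamp01_le0 ?mul0r ?subr0 ?scale1r //; lra.
  move: fw; rewrite /f /J /g /a2 clamp01_le0 ?subr0 ?scale1r ?scale0r ?addr0; last lra.
  rewrite (a1_in w w1) subr0 !scale1r !scale0r add0r addr0 pw h1 => /(congr1 trmx); rewrite trmxK trmx0.
  apply/eqP; have nz := th_nz w1.
  apply: contra_neq nz => e0; apply/row_matrixP => i; rewrite row0 row_mul.
  have ri : row i (Pi u (H 1 w)) *m Pi u (H 1 w) = row i (Pi u (H 1 w)) by rewrite -row_mul Pi_idem.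
  have hF (y : 'rV[R]_d) : y != 0 -> fiber_vec u (H 1 w) (y *m (A *m (U1 w *m U2 w))).
    by move=> y0; rewrite !mulmxA; exact: fr2.
  have [y ->] := frame_full hF ri.
  by move: e0; rewrite -!mulmxA => ->; rewrite mulmx0.
have hw := hat1 w (ltW w1).
have hw0 : hat w != 0 by rewrite -normr_gt0 hw.
have [w54|w54] := leP `|w| (5 / 4).
  have pw : pt w = hat w by rewrite /pt /la clamp01_le0 ?mul0r ?subr0 ?scale1r //; lra.
  move: fw; rewrite /f /a2 clamp01_le0 ?subr0 ?scale1r ?scale0r ?addr0; last lra.
  rewrite pw => /(congr1 trmx); rewrite trmxK trmx0; apply/eqP.
  have JU (y : 'rV[R]_d) : y *m A *m (U1 (hat w) *m J w) = y *m A *m U1 (hat w).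
    rewrite mulmxA /J mulmxDr -!scalemxAr mulmx1 U2bd // -scalerDl.
    by rewrite addrC subrK scale1r.
  apply: (@kill w (g w) (polar (hat w)) (U1 (hat w) *m J w) (vec (polar_flow (hat w)))).
  - by move=> y y0; rewrite JU; apply: fr1 => //; rewrite hw.
  - by have [] := vec_fiber (polar_flow (hat w)).
  - have b1 := th_bd hw.
    have b2 : 0 < dval (vec (polar_flow (hat w))) (v w).
      rewrite /v pw; by apply: self_dot_gt0; rewrite -normr_gt0 vec_norm ltr01.
    have /andP[c1 c2] := @clamp_itv R 0 1 (4 * (`|w| - 1)) ler01.
    rewrite -/(a1 w) in c1 c2; rewrite gt_eqF // /g dvalDr !dvalZr.
    have [->|na] := eqVneq (a1 w) 0; first by rewrite subr0 mul0r addr0 mul1r.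
    apply: ltr_wpDl; first by rewrite mulr_ge0 ?subr_ge0 // ltW.
    by rewrite mulr_gt0 // lt_def na.
have a11 := a1_out w (ltW w54).
have gJ : J w = 1%:M /\ g w = v w.
  by rewrite /J /g a11 subrr !scale0r !scale1r addr0 add0r.
have pn : `|pt w| <= 1.
  rewrite /pt normrZ hw mulr1; have /andP[l1 l2] := la12 w; rewrite ger0_norm //; lra.
have [w32|w32] := leP `|w| (3 / 2).
  move: fw; rewrite /f /a2 clamp01_le0 ?subr0 ?scale1r ?scale0r ?addr0; last lra.
  case: gJ => -> ->; rewrite mulmx1 => /(congr1 trmx); rewrite trmxK trmx0; apply/eqP.
  apply: (@kill w (v w) (polar (pt w)) (U1 (pt w)) (vec (polar_flow (pt w)))).
  - by move=> y y0; exact: fr1.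
  - by have [] := vec_fiber (polar_flow (pt w)).
  - rewrite gt_eqF // /v; by apply: self_dot_gt0; rewrite -normr_gt0 vec_norm ltr01.
have law : la w = 1 / 2 by rewrite /la clamp01_ge1; lra.
have pn2 : `|pt w| <= 1 / 2 by rewrite /pt law normrZ hw mulr1 ger0_norm //; lra.
move: fw; rewrite /f; case: gJ => -> ->; rewrite mulmx1.
have AU : A *m U1 (pt w) = A.
  by apply/row_matrixP => i; rewrite row_mul !rowE U1c.
have vE : v w = ((`|hat w *m A|)^-1 *: (hat w *m A))^T.
  rewrite /v /polar_flow /polar_time clamp01_le0; last lra.
  rewrite mulr0 Phi0 /pt law ray_scale ?divr_gt0 //.
  by rewrite ray_vec //; exact: hA.
rewrite mulmxA AU vE trmx_mul trmxK => /(congr1 (fun z => (z *m (hat w)^T) 0 0)); rewrite mul0mx [RHS]mxE => /eqP.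
have hA0 : 0 < `|hat w *m A| by rewrite normr_gt0; have [] := hA hw0.
have E1 : ((`|hat w *m A|^-1 *: (hat w *m A)) *m A^T *m (hat w)^T) 0 0 = `|hat w *m A|^-1 * dval (hat w *m A) (hat w *m A)^T.
  by rewrite /dval trmx_mul -!scalemxAl mxE !mulmxA.
have E2 : (w *m (hat w)^T) 0 0 = mu w * (hat w *m (hat w)^T) 0 0.
  have {1}-> : w = mu w *: hat w by rewrite /hat scalerA mulfV ?scale1r // gt_eqF.
  by rewrite -scalemxAl mxE.
have q1 : 0 < (hat w *m (hat w)^T) 0 0 by exact: (self_dot_gt0 hw0).
have q2 : 0 < dval (hat w *m A) (hat w *m A)^T by apply: self_dot_gt0; rewrite -normr_gt0.
have lin (a b : R) (X Y : 'rV[R]_d) (Z : 'cV[R]_d) :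
    ((a *: X + b *: Y) *m Z) 0 0 = a * (X *m Z) 0 0 + b * (Y *m Z) 0 0.
  by rewrite mulmxDl -!scalemxAl [LHS]mxE; congr (_ + _); rewrite [LHS]mxE.
rewrite lin E1 E2.
have /andP[c1 c2] := @clamp_itv R 0 1 (4 * (`|w| - 3 / 2)) ler01.
rewrite -/(a2 w) in c1 c2; apply/negP; rewrite gt_eqF //.
have p1 : 0 < `|hat w *m A|^-1 * dval (hat w *m A) (hat w *m A)^T by rewrite mulr_gt0 // invr_gt0.
have p2 : 0 < mu w * (hat w *m (hat w)^T) 0 0 by rewrite mulr_gt0.
have [->|na] := eqVneq (a2 w) 0; first by rewrite subr0 mul0r addr0 mul1r.
apply: ltr_wpDl; first by rewrite mulr_ge0 ?subr_ge0 // ltW.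
by rewrite mulr_gt0 // lt_def na.
Qed.
End Polar.
End Obstruct.

(** * Perturbing a map off zero on the boundary of a cube *)

Section Avoid.
Context {R : realType}.

Lemma unif_continuous_ball {d} (h : 'rV[R]_d -> R) (e : R) : continuous h -> 0 < e ->
  exists2 dl : R, 0 < dl & forall x y : 'rV[R]_d, `|x| <= 1 -> `|x - y| < dl -> `|h x - h y| < e.
Proof.
move=> ch e0.
have loc (x0 : 'rV[R]_d) : [set w : 'rV[R]_d | `|w| <= 1] x0 -> \forall x \near x0 & k \near (0 : 'rV[R]_d), `|h x - h (x + k)| < e.
  move=> _; apply: (@near_lt _ _ (fun z : 'rV[R]_d * 'rV[R]_d => `|h z.1 - h (z.1 + z.2)|) (x0, 0)).
    apply: (@cvg_norm _ _ _ (nbhs (x0, (0 : 'rV[R]_d)))).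
    apply: (@cvgB _ _ _ (nbhs (x0, (0 : 'rV[R]_d)))).
      by apply: (@cont_comp _ _ _ (fun z : 'rV[R]_d * 'rV[R]_d => z.1) h); [exact: cvg_fst|exact: ch].
    apply: (@cont_comp _ _ _ (fun z : 'rV[R]_d * 'rV[R]_d => z.1 + z.2) h); last exact: ch.
    by apply: (@cvgD _ _ _ (nbhs (x0, (0 : 'rV[R]_d)))); [exact: cvg_fst|exact: cvg_snd].
  by rewrite /= addr0 subrr normr0.
have := @compact_unif _ _ [set w : 'rV[R]_d | `|w| <= 1] (nbhs (0 : 'rV[R]_d)) _
  (fun k x => `|h x - h (x + k)| < e) (@rV_closed_ball_compact R d 1).
move=> /(_ _ loc) /nbhs_ballP [dl /= dl0 hdl]; exists dl => // x y x1 xy.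
have E : x + (y - x) = y by rewrite addrC subrK.
have := hdl (y - x) _ x x1; rewrite E; apply.
by rewrite -ball_normE /= sub0r opprB.
Qed.

(** The infimum of [h y + L * |x - y|] over the ball is [L]-Lipschitz in [x]. With [|h| <= C] and
    [L * dl = 2 * C], points [y] farther than [dl] cannot do better than [y = x]. *)
Lemma lipschitz_approx {d} (h : 'rV[R]_d -> R) (e : R) : continuous h -> 0 < e ->
  exists (L : R) (k : 'rV[R]_d -> R), [/\ 0 < L, forall x y, `|k x - k y| <= L * `|x - y| &
    forall x, `|x| <= 1 -> `|k x - h x| <= e].
Proof.
move=> ch e0.
have [C [C0 hC]] : exists C : R, 0 < C /\ forall x, `|x| <= 1 -> `|h x| <= C.
  have := @compact_unif _ _ [set w : 'rV[R]_d | `|w| <= 1] (pinfty_nbhs R) _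
    (fun C x => `|h x| <= C) (@rV_closed_ball_compact R d 1).
  have loc (x0 : 'rV[R]_d) : [set w : 'rV[R]_d | `|w| <= 1] x0 -> \forall x \near x0 & C \near +oo, `|h x| <= C.
    move=> _; exists ([set x | `|h x| < `|h x0| + 1], [set C | `|h x0| + 1 <= C]) => /=.
      split; last exact: nbhs_pinfty_ge (num_real _).
      apply: (@near_lt _ _ (fun x => `|h x|)); last by rewrite ltrDl.
      by apply: (@cvg_norm _ _ _ (nbhs x0)); exact: ch.
    by move=> [x C] /= [/ltW h1]; exact: le_trans.
  move=> /(_ _ loc) H; have H' : \forall C \near +oo, (0 : R) < C by exact: nbhs_pinfty_gt (num_real _).
  by have [C [h1 h2]] := filter_ex (filterI H H'); exists C.
have [dl dl0 hdl] := unif_continuous_ball ch e0.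
pose L := 2 * C / dl; have L0 : 0 < L by rewrite divr_gt0 // mulr_gt0.
pose S (x : 'rV[R]_d) : set R := [set h y + L * `|x - y| | y in [set y : 'rV[R]_d | `|y| <= 1]].
have lbS x : lbound (S x) (- C).
  move=> _ [y /= y1 <-]; have := hC y y1; rewrite ler_norml => /andP[l _].
  by apply: le_trans l _; rewrite lerDl mulr_ge0 // ltW.
have S0 x : S x !=set0 by exists (h 0 + L * `|x - 0|), 0 => //=; rewrite normr0.
have infle x y : `|y| <= 1 -> inf (S x) <= h y + L * `|x - y|.
  by move=> y1; apply: ge_inf; [exists (- C)|exists y].
exists L, (fun x => inf (S x)); split=> // x.
  have half y : inf (S x) <= inf (S y) + L * `|x - y|.
    rewrite -lerBlDr; apply: lb_le_inf => // _ [z /= z1 <-]; rewrite lerBlDr.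
    apply: le_trans (infle x z z1) _; rewrite -addrA lerD2l -mulrDr.
    by apply: ler_wpM2l; [exact: ltW|rewrite (addrC `|y - z|); exact: ler_distD].
  have half' y : inf (S y) <= inf (S x) + L * `|x - y|.
    rewrite -lerBlDr; apply: lb_le_inf => // _ [z /= z1 <-]; rewrite lerBlDr.
    apply: le_trans (infle y z z1) _; rewrite -addrA lerD2l -mulrDr.
    by apply: ler_wpM2l; [exact: ltW|rewrite (addrC `|x - z|) (distrC x y); exact: ler_distD].
  by move=> y; rewrite ler_norml; apply/andP; split; have := half y; have := half' y; lra.
move=> x1; rewrite ler_norml; apply/andP; split.
  rewrite lerBrDr addrC; apply: lb_le_inf => // _ [y /= y1 <-].
  have [lt|ge] := ltP `|x - y| dl.
    have := hdl x y x1 lt; rewrite ltr_norml => /andP[_ h2].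
    have : 0 <= L * `|x - y| by rewrite mulr_ge0 // ltW.
    by lra.
  have : 2 * C <= L * `|x - y|.
    by rewrite /L mulrAC ler_pdivlMr // ler_wpM2l // mulr_ge0 // ltW.
  by have := hC x x1; have := hC y y1; rewrite !ler_norml => /andP[? ?] /andP[? ?]; lra.
by have := infle x x x1; rewrite subrr normr0 mulr0 addr0; lra.
Qed.

(* Volume count: a Lipschitz image of the boundary of the unit cube of R^d is
   covered by O(M^(d-1)) cubes of size 1/M, hence misses one of the M^d points
   of a grid of that mesh. *)
Lemma lipschitz_misses {d} (k : 'rV[R]_d -> 'rV[R]_d) (L e : R) : 0 < L -> 0 < e ->
  (forall x y, `|k x - k y| <= L * `|x - y|) ->
  exists2 c : 'rV[R]_d, `|c| <= e & forall v, `|v| = 1 -> k v != c.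
Proof.
move=> L0 e0 hk; apply: contrapT => no.
have hit (c : 'rV[R]_d) : `|c| <= e -> exists v : 'rV[R]_d, `|v| = 1 /\ k v = c.
  move=> ce; apply: contrapT => nv; apply: no; exists c => // v v1.
  by apply/eqP => kv; apply: nv; exists v.
have [v0 [v01 _]] := hit 0 (eq_ind_r (fun x => x <= e) (ltW e0) (normr0 _)).
have [i0 _] : exists i, `|v0 0 i| = `|v0| by apply: rV_norm_attained; rewrite v01.
case: d i0 k hk hit {no v0 v01} => [[]//|d] _ k hk hit.
(* Since [a > L / e], the mesh [1 / n] gives [L / n < e / M], the spacing of the candidate values.
   [M] is chosen so that the boundary cells, at most [(d + 1) * 2 * (3 a M) ^ d] in number, are
   fewer than the [M ^ (d + 1)] candidates. *)
pose a := (Num.trunc (L / e)).+1.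
have aL : L / e < a%:R by have /andP[] := Num.Theory.truncn_itv (divr_ge0 (ltW L0) (ltW e0)).
pose M := (2 * d.+1 * (3 * a) ^ d).+1.
pose n := (a * M)%N.
have M0 : 0 < M%:R :> R by rewrite ltr0n.
have a0 : 0 < a%:R :> R by rewrite ltr0n.
have n0 : 0 < n%:R :> R by rewrite natrM mulr_gt0.
pose cand (q : {ffun 'I_d.+1 -> 'I_M}) : 'rV[R]_d.+1 := \row_j (e / M%:R * (q j)%:R).
have candn q : `|cand q| <= e.
  apply/rV_normleP => [|j]; first exact: ltW.
  have h0 : 0 <= e / M%:R * (q j)%:R by apply: mulr_ge0 => //; apply: divr_ge0 => //; exact: ltW.
  rewrite mxE (ger0_norm h0).
  rewrite mulrAC ler_pdivrMr //; apply: ler_wpM2l; first exact: ltW.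
  by rewrite ler_nat ltnW.
have [v hv] := choice (fun q => hit _ (candn q)).
have att q : exists i, `|v q 0 i| = 1.
  by have [v1 _] := hv q; have [|i e1] := @rV_norm_attained R _ (v q); [rewrite v1|exists i; rewrite e1].
have [ii hii] := choice att.
have vb q j : -1 <= v q 0 j <= 1.
  by rewrite -ler_norml; have [v1 _] := hv q; rewrite -v1 rV_coord_le.
pose cd q (j : 'I_d) := Num.trunc ((v q 0 (lift (ii q) j) + 1) * n%:R).
have cdP q j : (cd q j)%:R <= (v q 0 (lift (ii q) j) + 1) * n%:R < (cd q j).+1%:R.
  apply: Num.Theory.truncn_itv; rewrite mulr_ge0 ?(ltW n0) //.
  by have /andP[h1 _] := vb q (lift (ii q) j); lra.
have cdn q j : (cd q j < (2 * n).+1)%N.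
  have /andP[h1 _] := cdP q j; rewrite ltnS -(ler_nat R); apply: le_trans h1 _.
  rewrite natrM ler_wpM2r ?(ltW n0) //.
  by have /andP[_ h2] := vb q (lift (ii q) j); lra.
(* A preimage is coded by its face, the sign there and its cell in that face. Equal codes mean
   distance at most [1 / n], hence the same candidate. *)
pose code q : 'I_d.+1 * bool * {ffun 'I_d -> 'I_(2 * n).+1} :=
  (ii q, 0 <= v q 0 (ii q), [ffun j => Ordinal (cdn q j)]).
have code_inj : injective code.
  move=> q q' [e1 e2 e3].
  have dist j : `|v q 0 j - v q' 0 j| <= n%:R^-1.
    have [ij|ij] := eqVneq (ii q) j.
      have -> : v q 0 j = v q' 0 j.
        have h1 := hii q; have h2 := hii q'; rewrite -e1 in h2 e2; rewrite -ij.
        move: h1 h2 e2; case: (lerP 0 (v q 0 (ii q))) => s1; case: (lerP 0 (v q' 0 (ii q))) => s2 //.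
          by rewrite !ger0_norm // => -> ->.
        by rewrite !ltr0_norm // => h1 h2 _; apply: oppr_inj; rewrite h1 h2.
      by rewrite subrr normr0 invr_ge0 ltW.
    have [j' ->] : exists j', j = lift (ii q) j'.
      by have := unliftP (ii q) j; case=> [j' ->|e']; [exists j'|rewrite e' eqxx in ij].
    have c1 := cdP q j'; have c2 := cdP q' j'.
    have cde : cd q j' = cd q' j'.
      by have := congr1 (fun f : {ffun _ -> _} => val (f j')) e3; rewrite !ffunE.
    rewrite -cde -e1 in c2; move: c1 c2 => /andP[c1 c1'] /andP[c2 c2'].
    have s : (cd q j').+1%:R = (cd q j')%:R + 1 :> R by rewrite natr1.
    rewrite s in c1' c2'.
    rewrite -(ler_pM2r n0) mulVf ?gt_eqF // -{1}(ger0_norm (ltW n0)) -normrM mulrBl.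
    by rewrite ler_norml; apply/andP; split; lra.
  have dv : `|v q - v q'| <= n%:R^-1.
    apply/rV_normleP => [|j]; first by rewrite invr_ge0 ltW.
    by rewrite !mxE; exact: dist.
  have kc : `|cand q - cand q'| <= L / n%:R.
    have [_ <-] := hv q; have [_ <-] := hv q'; apply: le_trans (hk _ _) _.
    by rewrite ler_wpM2l // ltW.
  have Ln : L / n%:R < e / M%:R.
    rewrite /n natrM invfM mulrA ltr_pM2r ?invr_gt0 //.
    by rewrite ltr_pdivrMr // mulrC -ltr_pdivrMr.
  apply/ffunP => j; apply: val_inj => /=.
  have := le_lt_trans (le_trans (rV_coord_le (cand q - cand q') j) kc) Ln.
  rewrite !mxE -mulrBr normrM (ger0_norm (divr_ge0 (ltW e0) (ltW M0))).
  rewrite -[ltRHS]mulr1 ltr_pM2l ?divr_gt0 // ltr_norml => /andP[h1 h2].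
  have l1 : (q j < (q' j).+1)%N by rewrite -(ltr_nat R) -natr1; lra.
  have l2 : (q' j < (q j).+1)%N by rewrite -(ltr_nat R) -natr1; lra.
  by apply/eqP; rewrite eqn_leq -ltnS l1 -ltnS l2.
have := leq_card code code_inj.
rewrite !card_prod card_bool !card_ffun !card_ord => le.
have lt : (d.+1 * 2 * (2 * n).+1 ^ d < M ^ d.+1)%N.
  have h1 : ((2 * n).+1 ^ d <= (3 * a * M) ^ d)%N.
    have n1 : (0 < n)%N by rewrite -(ltr_nat R).
    have h : ((2 * n).+1 <= 3 * a * M)%N by rewrite -mulnA -/n; clear -n1; lia.
    by case: (d) => [//|d']; rewrite leq_exp2r.
  apply: (@leq_ltn_trans (d.+1 * 2 * ((3 * a) ^ d * M ^ d))); first by rewrite -expnMn leq_mul2l h1 orbT.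
  rewrite expnS mulnA ltn_mul2r expn_gt0 /=.
  by rewrite /M ltnS (mulnC d.+1).
by move: le; rewrite leqNgt lt.
Qed.

(** A Lipschitz approximation misses some small value [c] on the boundary of the cube; subtracting
    [c] removes the zeros there. *)
Lemma avoid_zero_on_cube {d} (f : 'rV[R]_d -> 'rV[R]_d) (e : R) : continuous f -> 0 < e ->
  exists2 k : 'rV[R]_d -> 'rV[R]_d, continuous k &
    forall v, `|v| = 1 -> k v != 0 /\ `|k v - f v| < e.
Proof.
move=> cf e0; have e3 : 0 < e / 3 by rewrite divr_gt0.
have fi i : exists Lk : R * ('rV[R]_d -> R), [/\ 0 < Lk.1, forall x y, `|Lk.2 x - Lk.2 y| <= Lk.1 * `|x - y| &
    forall x, `|x| <= 1 -> `|Lk.2 x - f x 0 i| <= e / 3].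
  have cfi : continuous (fun x => f x 0 i) by move=> x; apply: (@cvg_coord _ _ (nbhs x)); exact: cf.
  by have [L [k h]] := lipschitz_approx cfi e3; exists (L, k).
have [Lk hLk] := choice fi.
pose L := 1 + \sum_i (Lk i).1.
have L0 : 0 < L by rewrite ltr_pwDl // sumr_ge0 // => i _; have [/ltW] := hLk i.
have LL i : (Lk i).1 <= L.
  rewrite /L (bigD1 i) //= addrCA lerDl addr_ge0 // sumr_ge0 // => j _.
  by have [/ltW] := hLk j.
pose k (x : 'rV[R]_d) : 'rV[R]_d := \row_i (Lk i).2 x.
have kL x y : `|k x - k y| <= L * `|x - y|.
  apply/rV_normleP => [|i]; first by rewrite mulr_ge0 // ltW.
  rewrite !mxE; have [_ h _] := hLk i; apply: le_trans (h x y) _.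
  by rewrite ler_wpM2r.
have [c ce hc] := lipschitz_misses L0 e3 kL.
exists (fun x => k x - c).
  move=> x; apply: (@cvgB _ _ _ (nbhs (x : 'rV[R]_d))); last exact: cvg_cst.
  apply/cvgrPdist_lt => s s0.
  have : \forall y \near (x : 'rV[R]_d), `|(x : 'rV[R]_d) - y| < s / L.
    apply: (@near_lt _ _ (fun y : 'rV[R]_d => `|x - y|)); last by rewrite subrr normr0 divr_gt0.
    apply: (@cvg_norm _ _ _ (nbhs x)); apply: (@cvgB _ _ _ (nbhs x)); [exact: cvg_cst|exact: cvg_id].
  apply: filterS => y; rewrite ltr_pdivlMr // mulrC; apply: le_lt_trans; exact: kL.
move=> v v1; split; first by rewrite subr_eq0; exact: hc.
have -> : k v - c - f v = (k v - f v) - c by rewrite addrAC.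
apply: le_lt_trans (ler_normB _ _) _.
have : `|k v - f v| <= e / 3.
  apply/rV_normleP => [|i]; first exact: ltW.
  by rewrite !mxE; have [_ _ h] := hLk i; apply: h; rewrite v1.
by move: ce e3; lra.
Qed.
End Avoid.

(** * Zeros of positive functionals *)

Section Zeros.
Context {R : realType} {V : vectType R} {d : nat} {E : topologicalType}.
Variable u : E -> Gr V d.
Hypothesis d_gt0 : (0 < d)%N.
Hypothesis u_cont : continuous u.
Hypothesis u_mixed : forall x, mixed (pencil (u x)).
Notation m := (dim (bform V)).
Notation SE := (sphere_bundle u).
Variable Phi : R -> SE -> SE.
Hypothesis Phi_fitting : fitting_flow Phi.

(** On symmetric forms such a [th] is a positive definite tensor in the annihilator of [u y], a
    witness of mixedness. *)
Definition vanishes_at (th : 'cV[R]_m) (y : E) := dual_pos th /\ Pi u y *m th = 0.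

Lemma vanishes_ex y : exists th, vanishes_at th y.
Proof.
have [th [pth h]] := mixed_dual (u_mixed y); exists th; split=> //.
apply/row_matrixP => i; rewrite row0 row_mul; apply/rowP => j; rewrite ord1 [RHS]mxE.
have := h (r2v (row i (Pi u y))); rewrite (r2vK (row i (Pi u y))); apply.
by apply/PiP; rewrite (r2vK (row i (Pi u y))) -row_mul Pi_idem.
Qed.

Lemma vanishes_dval th y r : Pi u y *m th = 0 -> fiber_vec u y r -> dval r th = 0.
Proof. by move=> h [<- _]; rewrite /dval -mulmxA h mulmx0 mxE. Qed.

Lemma fiber_indefinite x r : fiber_vec u x r -> exists v, quad r v < 0.
Proof.
move=> fr; have [h1 h2] := fiber_vec_mem fr.
by apply: (@mixed_indefinite _ V (pencil (u x))) => //; exact: pencil_symm h1.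
Qed.

Lemma vec_indefinite (z : SE) : exists v, quad (vec z) v < 0.
Proof. exact: fiber_indefinite (vec_fiber z). Qed.

Lemma vec_pos (z : SE) : exists v, 0 < quad (vec z) v.
Proof.
have [e n] := vec_fiber z.
have fN : fiber_vec u (base z) (- vec z) by split; rewrite ?mulNmx ?e // oppr_eq0.
by have [v] := fiber_indefinite fN; rewrite quadN oppr_lt0; exists v.
Qed.

Lemma symm_comb (a b : R) (r r' : 'rV[R]_m) : symm r -> symm r' -> symm (a *: r + b *: r').
Proof.
move=> h h'; rewrite /symm linearD !linearZ.
by apply: form_symmetricD; apply: form_symmetricZ.
Qed.

(** [th] is positive on the positive definite increment. Rays are defined up to scaling, so only the
    sign of the value can be tracked. *)
Lemma flow_mono th z t : dual_pos th -> 0 < t -> 0 <= dval (vec z) th ->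
  0 < dval (vec (Phi t z)) th.
Proof.
move=> pth t0 nn; have [a [b [a0 b0 pos]]] := flow_fit Phi_fitting z t0.
rewrite -(pmulr_rgt0 _ b0) -dvalZ; apply: le_lt_trans (_ : a * dval (vec z) th < _).
  by rewrite mulr_ge0 // ltW.
rewrite -dvalZ -subr_gt0 -dvalB; apply: pth.
  apply: posdef_psd => //; rewrite -scaleNr; apply: symm_comb; exact: vec_symm.
apply: contraTneq isT => e; have [v neg] := vec_indefinite z.
have v0 : v != 0.
  by apply: contraTneq neg => ->; rewrite -(scale0r (0 : V)) quadZv expr0n /= mul0r ltxx.
by have := pos v v0; rewrite e -/(quad 0 v) quad0 ltxx.
Qed.

Lemma flow_escapes th z t : vanishes_at th (base z) -> 0 < t -> 0 < dval (vec (Phi t z)) th.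
Proof.
move=> [pth h] t0; apply: flow_mono => //.
by rewrite (vanishes_dval h (vec_fiber z)).
Qed.

Lemma dval_vec_nz th (z : SE) : dval (vec z) th != 0 -> Pi u (base z) *m th != 0.
Proof. by apply: contra_neq => h; rewrite (vanishes_dval h (vec_fiber z)). Qed.

Lemma fiber_inhabited x : exists z : SE, base z = x.
Proof.
have [A [_ hA]] := frame_of_fiber u x.
have y0 : const_mx 1 != 0 :> 'rV[R]_d.
  by apply/eqP => /rowP /(_ (Ordinal d_gt0)) /eqP; rewrite !mxE oner_eq0.
by exists (ray_class (ray_of (hA _ y0))); rewrite base_class.
Qed.

(** Without a zero on the disc of flow lines up to time [T], [polar_obstruction] would apply with
    the constant homotopy and the constant functional. *)
Lemma flow_hits_zero th x T : dual_pos th -> 0 <= T ->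
  (forall z, base z = x -> 0 < dval (vec (Phi T z)) th) ->
  exists z t, [/\ base z = x, 0 <= t <= T & Pi u (base (Phi t z)) *m th = 0].
Proof.
move=> pth T0 hT; apply: contrapT => no.
have [z0 z0x] := fiber_inhabited x; have [A [_ hA]] := frame_of_fiber u (base z0).
have cP := flow_continuous Phi_fitting; have P0 := flow0 Phi_fitting.
apply: (@polar_obstruction _ _ _ _ u u_cont Phi cP P0 z0 A T hA
  (fun _ w => polar Phi z0 A T w) (fun=> th)) => //.
- move=> z; apply: (@cont_comp _ _ _ (fun z : R * 'rV[R]_d => z.2) (polar Phi z0 A T)); first exact: cvg_snd.
  exact: polar_continuous.
- by move=> w; exact: cst_continuous.
- move=> w w1; apply/eqP => e; apply: no.
  exists (polar_ray z0 A w), (polar_time T w); rewrite polar_ray_base //; split=> //.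
  have /andP[c1 c2] := @clamp_itv R 0 1 (2 * `|w| - 1) ler01.
  by rewrite /polar_time mulr_ge0 //= ler_piMr.
- move=> w w1; rewrite /polar_flow /polar_time clamp01_ge1; last by rewrite w1; lra.
  by rewrite mulr1; apply: hT; rewrite polar_ray_base.
Qed.

Section Push.
Hypothesis E_hausdorff : hausdorff_space E.
Variables (y0 : E) (S : set E) (ka : E -> 'rV[R]_d) (ps : 'rV[R]_d -> E) (ro : R).
Notation x0 := (ka y0).
Hypothesis ro0 : 0 < ro.
Hypothesis S_open : open S.
Hypothesis Sy0 : S y0.
Hypothesis ka_cont : forall e, S e -> {for e, continuous ka}.
Hypothesis ka_S : forall e, S e -> `|ka e - x0| < ro.
Hypothesis psK : forall e, S e -> ps (ka e) = e.
Hypothesis kaK : forall v, `|v - x0| < ro -> S (ps v) /\ ka (ps v) = v.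
Hypothesis ps_cont : forall v, `|v - x0| < ro -> {for v, continuous ps}.

Definition chart_cell (v : 'rV[R]_d) (s : R) : set E := [set e | S e /\ `|ka e - v| <= s].

Lemma chart_cell_closed v s : `|v - x0| + s < ro -> closed (chart_cell v s).
Proof.
move=> vs; have sub w : `|w - v| <= s -> `|w - x0| < ro.
  move=> ws; apply: le_lt_trans vs; apply: le_trans (ler_distD v _ _) _.
  by rewrite [X in X <= _]addrC lerD2l.
have -> : chart_cell v s = ps @` [set w | `|w - v| <= s].
  apply/seteqP; split=> [e [Se es]|_ [w /= ws <-]]; first by exists (ka e) => //; exact: psK.
  by have [h1 h2] := kaK (sub w ws); split; rewrite ?h2.
apply: compact_closed => //; apply: continuous_compact; last exact: rV_closed_ball_compact_at.
by apply: continuous_in_subspaceT => w; rewrite inE => /sub; exact: ps_cont.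
Qed.

Lemma ka_inj e e' : S e -> S e' -> ka e = ka e' -> e = e'.
Proof. by move=> h h' k; rewrite -(psK h) k psK. Qed.

Lemma S_near e : S e -> \forall e' \near e, S e'.
Proof. by move=> Se; apply: open_nbhs_nbhs. Qed.

Lemma far_from_center e : e != y0 -> \forall e' \near e & s \near (0 : R)^'+, ~ chart_cell x0 s e'.
Proof.
move=> ne; have [Se|nS] := pselect (chart_cell x0 (ro / 2) e); last first.
  exists (~` chart_cell x0 (ro / 2), [set s | s < ro / 2]) => /=.
    split; last by apply: nbhs_right_lt; rewrite divr_gt0.
    apply: open_nbhs_nbhs; split=> //; apply: closed_openC; apply: chart_cell_closed.
    by rewrite subrr normr0 add0r ltr_pdivrMr // mulr_natr mulr2n ltrDl.
  move=> [e' s] /= [n l] [h1 h2]; apply: n; split=> //; apply: le_trans h2 (ltW l).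
have [h1 h2] := Se.
have n0 : 0 < `|ka e - x0|.
  by rewrite normr_gt0 subr_eq0; apply: contra ne => /eqP /ka_inj ->.
exists ([set e' | `|ka e - x0| / 2 < `|ka e' - x0|], [set s | s < `|ka e - x0| / 2]) => /=.
  split; last by apply: nbhs_right_lt; rewrite divr_gt0.
  apply: (@near_gt _ _ (fun e' => `|ka e' - x0|)); last by lra.
  by apply: (@cont_comp _ _ _ ka (fun v => `|v - x0|)); [exact: ka_cont|exact: cont_norm_sub].
by move=> [e' s] /= [n l] [_ h]; move: n l h; lra.
Qed.

(** A flow line from [y0] is not back at [y0] at time 1, because a functional vanishing at [y0] has
    become positive on its direction. Compactness of the fibre extends this to starting points near
    [y0] and a whole cell around it. *)
Lemma flow_leaves : exists s Z, [/\ 0 < s, s < ro, nbhs y0 Z &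
  forall z, Z (base z) -> ~ chart_cell x0 s (base (Phi 1 z))].
Proof.
have : \forall x' \near y0 & s \near (0 : R)^'+, forall z : SE, base z = x' ->
    ~ (chart_cell x0 s (base z) /\ chart_cell x0 s (base (Phi 1 z))).
  apply: (@fiber_compact _ _ _ _ _ u_cont R (at_right 0) _ (fun s z => ~ (chart_cell x0 s (base z) /\ chart_cell x0 s (base (Phi 1 z))))).
  move=> z; have [bz|nb] := eqVneq (base z) y0; last first.
    have [[X Y] /= [nX nY] XY] := far_from_center nb.
    exists (@base _ _ _ _ u @^-1` X, Y) => /=.
      by split=> //; exact: base_continuous nX.
    by move=> [z' s] /= [h1 h2] [h3 _]; exact: (XY (base z', s)).
  have nb : base (Phi 1 z) != y0.
    have [th hth] := vanishes_ex y0; have := @flow_escapes th z 1.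
    rewrite bz => /(_ hth ltr01) pos; apply: contraTneq pos => e.
    have [_ hv] := hth; rewrite -e in hv.
    by rewrite (vanishes_dval hv (vec_fiber _)) ltxx.
  have [[X Y] /= [nX nY] XY] := far_from_center nb.
  exists ([set z' | X (base (Phi 1 z'))], Y) => /=.
    split=> //; have c1 : {for z, continuous (fun z => base (Phi 1 z))}.
      apply: (@cont_comp _ _ _ (Phi 1) (@base _ _ _ _ u)); last exact: base_continuous.
      exact: (cont_slice_r (flow_continuous Phi_fitting)).
    exact: c1 nX.
  by move=> [z' s] /= [h1 h2] [_ h3]; exact: (XY (base (Phi 1 z'), s)).
move=> [[X Y] /= [nX nY] XY].
have h1 : \forall s \near (0 : R)^'+, s < ro by exact: nbhs_right_lt.
have h2 : \forall s \near (0 : R)^'+, 0 < s by exact: nbhs_right_gt.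
have [s [[sr s0] Ys]] := @filter_ex _ _ (at_right_proper_filter (0 : R)) _ (filterI (filterI h1 h2) nY).
exists s, (X `&` [set e | chart_cell x0 s e]); split=> //.
  apply: filterI => //.
  apply: filterS2 (S_near Sy0) (_ : \forall e \near y0, `|ka e - x0| < s); first by move=> e Se /ltW.
  apply: (@near_lt _ _ (fun e' => `|ka e' - x0|)); last by rewrite subrr normr0.
  by apply: (@cont_comp _ _ _ ka (fun v => `|v - x0|)); [exact: ka_cont|exact: cont_norm_sub].
by move=> z [Xz cz] cz'; exact: (XY (base z, s) (conj Xz Ys) z erefl).
Qed.

(** Radial retraction onto the unit ball of the sup norm; it extends maps of the disc to the whole
    space, where [polar_obstruction] asks for continuity. *)
Definition to_ball (q : 'rV[R]_d) : 'rV[R]_d := (Num.max 1 `|q|)^-1 *: q.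

Lemma to_ball_continuous : continuous to_ball.
Proof.
move=> w; apply: (@cvgZ _ _ _ (nbhs w)); last exact: cvg_id.
apply: (@cont_comp _ _ _ (fun q : 'rV[R]_d => Num.max 1 `|q|) (fun x : R => x^-1)).
  by apply: continuous_max; [exact: cst_continuous|exact: norm_continuous].
by apply: inv_continuous; rewrite gt_eqF // lt_max ltr01.
Qed.

Lemma to_ball_norm q : `|to_ball q| <= 1.
Proof.
have m0 : 0 < Num.max 1 `|q| by rewrite lt_max ltr01.
have h0 : 0 <= (Num.max 1 `|q|)^-1 by rewrite invr_ge0 ltW.
by rewrite normrZ (ger0_norm h0) ler_pdivrMl // mulr1 le_max lexx orbT.
Qed.

Lemma to_ball_id q : `|q| <= 1 -> to_ball q = q.
Proof. by move=> q1; rewrite /to_ball max_l // invr1 scale1r. Qed.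

(* If y' <> y were a zero of th near y, the disc swept by the flow lines from y
   could be pushed radially off y' inside a small cube around y'. After a small
   perturbation on the boundary of the cube, th would not vanish on the pushed
   disc, against polar_obstruction. *)
Section Pushing.
Variables (y y' : E) (th : 'cV[R]_m) (s : R).
Hypotheses (Sy : S y) (Sy' : S y') (s0 : 0 < s).
Notation v' := (ka y').
Hypothesis vs : `|v' - x0| + s < ro.
Hypothesis ys : `|ka y - v'| < s.
Hypothesis leave : forall z, base z = y -> ~ chart_cell v' s (base (Phi 1 z)).
Hypothesis th_y : vanishes_at th y.
Hypothesis th_y' : vanishes_at th y'.
Hypothesis yy' : y != y'.
Variables (z0 : SE) (A : 'M[R]_(d, m)).
Hypothesis z0y : base z0 = y.
Hypothesis hA : forall w : 'rV[R]_d, w != 0 -> fiber_vec u (base z0) (w *m A).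

(** The swept disc, extended by [to_ball]. Below, [q] is the chart centred at [y'] and scaled so
    that the cell of size [s] becomes the unit ball. *)
Let K (w : 'rV[R]_d) : E := polar Phi z0 A 1 (to_ball w).
Let cP := flow_continuous Phi_fitting.
Let P0 := flow0 Phi_fitting.
Let q (e : E) : 'rV[R]_d := s^-1 *: (ka e - v').
Let in_cell e : Prop := S e /\ `|q e| <= 1.

Lemma in_cellE e : in_cell e <-> chart_cell v' s e.
Proof.
rewrite /in_cell /chart_cell /= /q; split=> -[Se h]; split=> //; move: h;
  by rewrite normrZ gtr0_norm ?invr_gt0 // ler_pdivrMl // mulr1.
Qed.

Lemma K_cont : continuous K.
Proof.
move=> w; apply: (@cont_comp _ _ _ to_ball (polar Phi z0 A 1)); first exact: to_ball_continuous.
exact: polar_continuous.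
Qed.

(** Off [y] the elapsed time is positive, so [th] has become positive on the flow direction. *)
Lemma polar_nz w : polar Phi z0 A 1 w != y -> 0 < dval (vec (polar_flow Phi z0 A 1 w)) th.
Proof.
move=> ne; apply: flow_escapes; first by rewrite polar_ray_base // z0y.
have /andP[c1 _] := @clamp_itv R 0 1 (2 * `|w| - 1) ler01.
rewrite /polar_time mul1r lt_def c1 andbT; apply: contraNneq ne => e.
by rewrite /polar /polar_flow /polar_time mul1r e P0 polar_ray_base // z0y.
Qed.

(** [th] vanishes on [u y'] but is positive on a vector over each point of the disc other than
    [y]. *)
Lemma K_avoids w : K w != y'.
Proof.
have [e|ne] := eqVneq (K w) y; first by rewrite e.
apply/eqP => e; have := polar_nz ne.
have [_ h'] := th_y'; rewrite -e in h'.
by rewrite (vanishes_dval h' (vec_fiber (polar_flow Phi z0 A 1 (to_ball w)))) ltxx.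
Qed.

Lemma q_nz w : S (K w) -> 0 < `|q (K w)|.
Proof.
move=> SK; rewrite normr_gt0 scaler_eq0 negb_or invr_eq0 gt_eqF //= subr_eq0.
by apply: contraNneq (K_avoids w) => e; apply/eqP/(ka_inj SK Sy' e).
Qed.

Lemma q_cont e : S e -> {for e, continuous q}.
Proof.
move=> Se; apply: (@cvgZr _ _ _ (nbhs e)); apply: (@cvgB _ _ _ (nbhs e)); last exact: cvg_cst.
exact: ka_cont.
Qed.

Lemma qK_cont w : S (K w) -> {for w, continuous (fun w => q (K w))}.
Proof. by move=> SK; apply: (@cont_comp _ _ _ K q); [exact: K_cont|exact: q_cont]. Qed.

Lemma ka_q e : ka e = v' + s *: q e.
Proof. by rewrite /q scalerA mulfV ?gt_eqF // scale1r addrC subrK. Qed.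

Lemma ball_cell (k : 'rV[R]_d) : `|k| <= 1 -> `|v' + s *: k - x0| < ro.
Proof.
move=> k1; apply: le_lt_trans vs; rewrite addrAC; apply: le_trans (ler_normD _ _) _.
by rewrite lerD2l normrZ gtr0_norm // ler_piMr // ltW.
Qed.

Lemma near_S w : S (K w) -> \forall w' \near w, S (K w').
Proof. by move=> SK; exact: K_cont (S_near SK). Qed.

Lemma near_out w : ~ in_cell (K w) -> \forall w' \near w, ~ in_cell (K w').
Proof.
move=> nc; have : \forall e \near K w, ~ in_cell e.
  have : nbhs (K w) (~` chart_cell v' s).
    apply: open_nbhs_nbhs; split; first by apply: closed_openC; exact: chart_cell_closed vs.
    by move=> h; apply: nc; apply/in_cellE.
  by apply: filterS => e h h'; apply: h; apply/in_cellE.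
exact: (@K_cont w).
Qed.

(** Multiplication by [fac t k] is the identity for [t = 0] and for [t = 1] moves the punctured unit
    cube radially to its boundary, without touching points outside. *)
Let fac (t : R) (k : 'rV[R]_d) : R := 1 + clamp 0 1 t * (Num.max 1 `|k|^-1 - 1).

Lemma fac_out t k : 1 <= `|k| -> fac t k = 1.
Proof.
move=> k1; rewrite /fac max_l ?subrr ?mulr0 ?addr0 //.
by rewrite invf_le1 // (lt_le_trans _ k1).
Qed.

Lemma fac_norm t k : 0 < `|k| -> `|k| <= 1 -> `|fac t k *: k| <= 1.
Proof.
move=> k0 k1; have ki : 1 <= `|k|^-1 by rewrite -invr1 lef_pV2 ?posrE.
have /andP[c1 c2] := @clamp_itv R 0 1 t ler01.
have f1 : 1 <= fac t k by rewrite /fac max_r // lerDl mulr_ge0 // subr_ge0.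
rewrite normrZ ger0_norm ?(le_trans _ f1) // /fac max_r // -ler_pdivlMr // mul1r.
by rewrite -lerBrDl ler_piMl // subr_ge0.
Qed.

(** The factor is 1 off the cell, so both branches give [K w] there and the pushing glues
    continuously. *)
Let H (t : R) (w : 'rV[R]_d) : E :=
  if pselect (S (K w)) then ps (v' + s *: (fac t (q (K w)) *: q (K w))) else K w.

Lemma H_in t w : S (K w) -> H t w = ps (v' + s *: (fac t (q (K w)) *: q (K w))).
Proof. by rewrite /H; case: pselect. Qed.

Lemma H_out t w : ~ in_cell (K w) -> H t w = K w.
Proof.
rewrite /H; case: pselect => // SK nc.
have h : 1 <= `|q (K w)| by rewrite leNgt; apply/negP => /ltW h; exact: nc.
by rewrite fac_out // scale1r -ka_q psK.
Qed.

Lemma fac_cont t k : k != 0 -> {for (t, k), continuous (fun z : R * 'rV[R]_d => fac z.1 z.2)}.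
Proof.
move=> k0; apply: (@cvgD _ _ _ (nbhs (t, k))); first exact: cvg_cst.
apply: (@cvgM _ _ (nbhs (t, k))).
  by apply: (@cont_comp _ _ _ (fun z : R * 'rV[R]_d => z.1) (clamp 0 1)); [exact: cvg_fst|exact: clamp_continuous].
apply: (@cvgB _ _ _ (nbhs (t, k))); last exact: cvg_cst.
apply: (@cont_comp _ _ _ (fun z : R * 'rV[R]_d => `|z.2|^-1) (fun x : R => Num.max 1 x)).
  apply: (@cont_comp _ _ _ (fun z : R * 'rV[R]_d => `|z.2|) (fun x : R => x^-1)).
    by apply: (@cvg_norm _ _ _ (nbhs (t, k))); exact: cvg_snd.
  by apply: inv_continuous; rewrite normr_eq0.
by apply: continuous_max; [exact: cst_continuous|move=> x; exact: cvg_id].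
Qed.

Lemma H_cont : continuous (fun z : R * 'rV[R]_d => H z.1 z.2).
Proof.
move=> [t w]; have [SK|nS] := pselect (S (K w)).
  apply: (@cont_near_eq _ _ _ (fun z : R * 'rV[R]_d => ps (v' + s *: (fac z.1 (q (K z.2)) *: q (K z.2))))).
    have : \forall z \near (t, w), S (K z.2).
      have c2 : {for (t, w), continuous (fun z : R * 'rV[R]_d => z.2)} by exact: cvg_snd.
      exact: c2 (near_S SK).
    by apply: filterS => z Sz; rewrite /H; case: pselect.
  have cq : {for (t, w), continuous (fun z : R * 'rV[R]_d => q (K z.2))}.
    by apply: (@cont_comp _ _ _ (fun z : R * 'rV[R]_d => z.2) (fun w => q (K w))); [exact: cvg_snd|exact: qK_cont].
  have q0 := q_nz SK.
  apply: (@cont_comp _ _ _ (fun z : R * 'rV[R]_d => v' + s *: (fac z.1 (q (K z.2)) *: q (K z.2))) ps).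
    apply: (@cvgD _ _ _ (nbhs (t, w))); first exact: cvg_cst.
    apply: (@cvgZr _ _ _ (nbhs (t, w))); apply: (@cvgZ _ _ _ (nbhs (t, w))); last exact: cq.
    apply: (@cont_comp _ _ _ (fun z : R * 'rV[R]_d => (z.1, q (K z.2))) (fun z : R * 'rV[R]_d => fac z.1 z.2)).
      by apply: cont_pair; [exact: cvg_fst|exact: cq].
    by apply: fac_cont; rewrite -normr_gt0.
  apply: ps_cont => /=; have [k1|k1] := leP `|q (K w)| 1.
    by apply: ball_cell; exact: fac_norm.
  by rewrite fac_out ?(ltW k1) // scale1r -ka_q; exact: ka_S.
have nc : ~ in_cell (K w) by case.
apply: (@cont_near_eq _ _ _ (fun z : R * 'rV[R]_d => K z.2)).
  have c2 : {for (t, w), continuous (fun z : R * 'rV[R]_d => z.2)} by exact: cvg_snd.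
  have : \forall z \near (t, w), ~ in_cell (K z.2) by exact: c2 (near_out nc).
  by apply: filterS => z; exact: H_out.
by apply: (@cont_comp _ _ _ (fun z : R * 'rV[R]_d => z.2) K); [exact: cvg_snd|exact: K_cont].
Qed.

Let cube_pt (l : R) (k : 'rV[R]_d) : E := ps (v' + s *: (clamp 0 1 l *: to_ball k)).

Lemma cube_pt_cont : continuous (fun z : R * 'rV[R]_d => cube_pt z.1 z.2).
Proof.
move=> z; apply: (@cont_comp _ _ _ (fun z : R * 'rV[R]_d => v' + s *: (clamp 0 1 z.1 *: to_ball z.2)) ps).
  apply: (@cvgD _ _ _ (nbhs z)); first exact: cvg_cst.
  apply: (@cvgZr _ _ _ (nbhs z)); apply: (@cvgZ _ _ _ (nbhs z)).
    by apply: (@cont_comp _ _ _ (fun z : R * 'rV[R]_d => z.1) (clamp 0 1)); [exact: cvg_fst|exact: clamp_continuous].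
  by apply: (@cont_comp _ _ _ (fun z : R * 'rV[R]_d => z.2) to_ball); [exact: cvg_snd|exact: to_ball_continuous].
apply: ps_cont; apply: ball_cell; have /andP[c1 c2] := @clamp_itv R 0 1 z.1 ler01.
rewrite normrZ ger0_norm //; apply: le_trans (to_ball_norm z.2).
by rewrite ler_piMl.
Qed.

(** Transport a frame at [y'] along the rays of the cell; the outer [to_ball] makes it defined for
    all [k]. *)
Lemma cube_frame : exists F : 'rV[R]_d -> 'M[R]_(d, m), continuous F /\
  forall k (w : 'rV[R]_d), w != 0 -> fiber_vec u (ps (v' + s *: to_ball k)) (w *m F k).
Proof.
have [B [_ hB]] := frame_of_fiber u y'.
have [n [n0 tr]] := proj_transport_uniform u_cont (@rV_closed_ball_compact R d 1) cube_pt_cont.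
exists (fun k => B *m proj_transport u cube_pt n%:R^-1 n (to_ball k)); split.
  move=> k; apply: (@cvg_mulmx _ _ (nbhs k)); first exact: cvg_cst.
  apply: (@cont_comp _ _ _ to_ball (proj_transport u cube_pt n%:R^-1 n)); first exact: to_ball_continuous.
  exact: proj_transport_continuous cube_pt_cont _.
move=> k w w0; have := tr (to_ball k) (w *m B) (to_ball_norm k).
have e1 : cube_pt 0 (to_ball k) = y'.
  by rewrite /cube_pt clamp01_le0 // scale0r scaler0 addr0 psK.
have e2 : cube_pt 1 (to_ball k) = ps (v' + s *: to_ball k).
  by rewrite /cube_pt clamp01_ge1 // scale1r (to_ball_id (to_ball_norm k)).
by rewrite e1 e2 mulmxA; apply; exact: hB.
Qed.

Lemma frame_free (e : E) (F : 'M[R]_(d, m)) :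
  (forall w : 'rV[R]_d, w != 0 -> fiber_vec u e (w *m F)) -> row_free F.
Proof.
move=> hF; rewrite -kermx_eq0; apply/eqP/row_matrixP => i; rewrite row0.
apply/eqP; rewrite -[_ == _]negbK; apply/negP => /hF [_].
by rewrite -row_mul mulmx_ker row0 eqxx.
Qed.

Lemma frame_kills (e : E) (F : 'M[R]_(d, m)) (g : 'cV[R]_m) :
  (forall w : 'rV[R]_d, w != 0 -> fiber_vec u e (w *m F)) -> F *m g != 0 -> Pi u e *m g != 0.
Proof.
move=> hF; apply: contra_neq => h; apply/row_matrixP => i; rewrite row0 row_mul.
have [->|n0] := eqVneq (row i F) 0; first by rewrite mul0mx.
have : delta_mx 0 i != 0 :> 'rV[R]_d by apply: contra n0 => /eqP e'; rewrite rowE e' mul0mx.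
by move=> /hF [e' _]; rewrite rowE -e' -mulmxA h mulmx0.
Qed.

Lemma frame_detects (e : E) (F : 'M[R]_(d, m)) (g : 'cV[R]_m) :
  (forall w : 'rV[R]_d, w != 0 -> fiber_vec u e (w *m F)) -> Pi u e *m g != 0 -> F *m g != 0.
Proof.
move=> hF; apply: contra_neq => h; apply/row_matrixP => i; rewrite row0 row_mul.
have ri : row i (Pi u e) *m Pi u e = row i (Pi u e) by rewrite -row_mul Pi_idem.
by have [w ->] := frame_full hF ri; rewrite -mulmxA h mulmx0.
Qed.

Lemma pushing_contradiction : False.
Proof.
have [F [cF hF]] := cube_frame.
(* The components of [th] in the frame over the cube. They are nonzero where the disc meets the
   boundary of the cell, but may vanish elsewhere on this boundary, where the pushed disc may
   arrive. *)
pose f (k : 'rV[R]_d) : 'rV[R]_d := (F k *m th)^T.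
have cf : continuous f.
  by move=> k; apply: (@cvg_trmx _ _ (nbhs k)); apply: (@cvg_mulmx _ _ (nbhs k)); [exact: cF|exact: cvg_cst].
have K_nz w : K w != y -> Pi u (K w) *m th != 0.
  by move=> /polar_nz pos; apply: dval_vec_nz; rewrite gt_eqF.
have y_cell : in_cell y.
  by split=> //; rewrite /q normrZ gtr0_norm ?invr_gt0 // ler_pdivrMl // mulr1 ltW.
have yq : `|q y| < 1 by rewrite /q normrZ gtr0_norm ?invr_gt0 // ltr_pdivrMl // mulr1.
have f_nz w : S (K w) -> `|q (K w)| = 1 -> f (q (K w)) != 0.
  move=> SK q1; have Ky : K w != y by apply: contraTneq yq => e; rewrite -leNgt -e q1.
  have := hF (q (K w)); rewrite to_ball_id ?q1 // -ka_q psK // => hFw.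
  have := frame_detects hFw (K_nz w Ky).
  by apply: contra => /eqP /(congr1 trmx); rewrite trmxK trmx0 => ->.
(* A lower bound for [f] where the disc meets the boundary. The correction is confined to where [f]
   is smaller than [c], so it leaves those points alone. *)
have [c c0 hc] : exists2 c : R, 0 < c & forall w, `|w| <= 1 -> S (K w) -> `|q (K w)| = 1 -> c <= `|f (q (K w))|.
  have := @compact_unif _ _ [set w : 'rV[R]_d | `|w| <= 1] ((0 : R)^'+) _
    (fun c w => S (K w) -> `|q (K w)| = 1 -> c <= `|f (q (K w))|) (@rV_closed_ball_compact R d 1).
  have loc (w : 'rV[R]_d) : [set w : 'rV[R]_d | `|w| <= 1] w -> \forall w' \near w & c \near (0 : R)^'+,
      S (K w') -> `|q (K w')| = 1 -> c <= `|f (q (K w'))|.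
    move=> _; have cT : \forall c \near (0 : R)^'+, True by exact: filterT.
    have [ic|nc] := pselect (in_cell (K w)); last first.
      exists ([set w' | ~ in_cell (K w')], setT) => /=; first by split=> //; exact: near_out.
      by move=> [w' c] /= [h _] h1 h2; exfalso; apply: h; split=> //; rewrite h2.
    have [SK _] := ic; have cq := qK_cont SK.
    have cqn : {for w, continuous (fun w => `|q (K w)|)} by apply: (@cvg_norm _ _ _ (nbhs w)); exact: cq.
    have [q1|qn] := eqVneq `|q (K w)| 1; last first.
      have : \forall w' \near w, `|q (K w')| != 1.
        move: qn; rewrite neq_lt => /orP [l|l].
          by apply: filterS (near_lt cqn l) => w' l'; rewrite lt_eqF.
        by apply: filterS (near_gt cqn l) => w' l'; rewrite gt_eqF.
      move=> nq; exists ([set w' | `|q (K w')| != 1], setT) => /=; first by split=> //; exact: filterT.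
      by move=> [w' c] /= [h _] _ h2; move: h; rewrite h2 eqxx.
    have fn := f_nz w SK q1; rewrite -normr_gt0 in fn.
    exists ([set w' | `|f (q (K w))| / 2 < `|f (q (K w'))|], [set c | c < `|f (q (K w))| / 2]) => /=.
      split; last by apply: nbhs_right_lt; rewrite divr_gt0.
      apply: (@near_gt _ _ (fun w' => `|f (q (K w'))|)); last by lra.
      apply: (@cvg_norm _ _ _ (nbhs w)).
      by apply: (@cont_comp _ _ _ (fun w => q (K w)) f); [exact: cq|exact: cf].
    by move=> [w' c] /= [h h'] _ _; apply/ltW/(lt_trans h').
  move=> /(_ _ loc) hn; have h2 : \forall c \near (0 : R)^'+, 0 < c by exact: nbhs_right_gt.
  have [c [c0 hc]] := @filter_ex _ _ (at_right_proper_filter (0 : R)) _ (filterI h2 hn).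
  by exists c => // w w1; exact: hc w1.
have c20 : 0 < c / 2 by rewrite divr_gt0.
have [k ck hk] := avoid_zero_on_cube cf c20.
(* For [|f| <= c / 2] the factor is 1 and the corrected components are [k], which is nonzero on the
   boundary; for [|f| > c / 2] the change, smaller than [c / 2], cannot cancel [f]; for [|f| >= c]
   there is no change. *)
pose chi (t : R) : R := clamp 0 1 (2 - 2 * t / c).
(* The right inverse of the frame matrix turns the wanted change of components into a functional. *)
pose corr (x : 'rV[R]_d) : 'cV[R]_m :=
  (F x)^T *m invmx (F x *m (F x)^T) *m (chi `|f x| *: (k x - f x))^T.
have Ffree x : row_free (F x) by exact: frame_free (hF x).
have cc : continuous corr.
  move=> x; apply: (@cvg_mulmx _ _ (nbhs x)).
    apply: (@cvg_mulmx _ _ (nbhs x)); first by apply: (@cvg_trmx _ _ (nbhs x)); exact: cF.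
    apply: (@cvg_invmx _ _ (nbhs x)); [|exact: gram_unit|by move=> t; exact: gram_unit].
    by apply: (@cvg_mulmx _ _ (nbhs x)); [exact: cF|apply: (@cvg_trmx _ _ (nbhs x)); exact: cF].
  apply: (@cvg_trmx _ _ (nbhs x)); apply: (@cvgZ _ _ _ (nbhs x)).
    apply: (@cont_comp _ _ _ (fun x => 2 - 2 * `|f x| / c) (clamp 0 1)); last exact: clamp_continuous.
    apply: (@cvgB _ _ _ (nbhs x)); first exact: cvg_cst.
    apply: (@cvgMl _ _ (nbhs x)); apply: (@cvgMr _ _ (nbhs x)).
    by apply: (@cvg_norm _ _ _ (nbhs x)); exact: cf.
  by apply: (@cvgB _ _ _ (nbhs x)); [exact: ck|exact: cf].
pose dir (w : 'rV[R]_d) : 'rV[R]_d := `|q (K w)|^-1 *: q (K w).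
(* Extension by 0 is continuous because the correction vanishes where the disc crosses the boundary
   of the cell. *)
pose G (w : 'rV[R]_d) : 'cV[R]_m := if pselect (in_cell (K w)) then corr (dir w) else 0.
have cdir w : S (K w) -> {for w, continuous dir}.
  move=> SK; apply: (@cont_comp _ _ _ (fun w => q (K w)) (fun r : 'rV[R]_d => `|r|^-1 *: r)).
    exact: qK_cont.
  by apply: cont_normalize; rewrite -normr_gt0; exact: q_nz.
have ccd w : S (K w) -> {for w, continuous (fun w => corr (dir w))}.
  by move=> SK; apply: (@cont_comp _ _ _ dir corr); [exact: cdir|exact: cc].
have G_in w : in_cell (K w) -> G w = corr (dir w) by rewrite /G; case: pselect.
have G_out w : ~ in_cell (K w) -> G w = 0 by rewrite /G; case: pselect.
have cG : continuous G.
  move=> w; have [ic|nc] := pselect (in_cell (K w)); last first.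
    apply: (@cont_near_eq 'rV[R]_d 'cV[R]_m _ (fun=> 0) w); last exact: cst_continuous.
    by apply: filterS (near_out nc) => w' n'; exact: G_out.
  have [SK q1] := ic; have cqn : {for w, continuous (fun w => `|q (K w)|)}.
    by apply: (@cvg_norm _ _ _ (nbhs w)); exact: (qK_cont SK).
  move: q1; rewrite le_eqVlt => /orP [/eqP q1|q1]; last first.
    apply: (@cont_near_eq 'rV[R]_d 'cV[R]_m _ (fun w => corr (dir w)) w); last exact: ccd.
    apply: filterS2 (near_S SK) (near_lt cqn q1) => w' SK' /ltW q1'.
    by apply: G_in; split.
  have cz : corr (dir w) = 0.
    rewrite /corr /dir q1 invr1 scale1r /chi clamp01_le0 ?scale0r ?trmx0 ?mulmx0 //.
    have wb := to_ball_norm w.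
    have KE : K (to_ball w) = K w by rewrite /K (to_ball_id wb).
    have := hc (to_ball w) wb; rewrite KE => /(_ SK q1) cf1.
    by rewrite subr_le0 ler_pdivlMr // ler_wpM2l.
  have Gw : G w = 0 by rewrite G_in.
  have cd0 : corr (dir w') @[w' --> w] --> (0 : 'cV[R]_m) by rewrite -cz; exact: ccd.
  apply/(@cvgrPdist_lt _ _ _ (nbhs w)) => ep ep0; rewrite Gw.
  have : \forall w' \near w, `|0 - corr (dir w')| < ep by move/cvgrPdist_lt: cd0; exact.
  by apply: filterS => w' l; have [h|h] := pselect (in_cell (K w')); [rewrite (G_in _ h)|rewrite (G_out _ h) subrr normr0].
apply: (@polar_obstruction _ _ _ _ u u_cont Phi cP P0 z0 A 1 hA H (fun w => th + G w) H_cont).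
- move=> w w1; have <- : K w = polar Phi z0 A 1 w by rewrite /K to_ball_id.
  have [SK|nS] := pselect (S (K w)); last by apply: H_out; case.
  by rewrite (H_in _ SK) /fac clamp01_le0 // mul0r addr0 scale1r -ka_q psK.
- move=> t w _ w1; rewrite -[in RHS](to_ball_id (_ : `|w| <= 1)) ?w1 // -/(K w); apply: H_out.
  rewrite /K to_ball_id ?w1 // => /in_cellE.
  rewrite /polar /polar_flow /polar_time clamp01_ge1; last by rewrite w1; lra.
  by rewrite mulr1; apply: leave; rewrite polar_ray_base.
- by move=> w; apply: (@cvgD _ _ _ (nbhs w)); [exact: cvg_cst|exact: cG].
- move=> w w1; have [ic|nc] := pselect (in_cell (K w)); last first.
    rewrite H_out //; rewrite (G_out _ nc).
    by rewrite addr0; apply: K_nz; apply: contra_notN nc => /eqP ->.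
  have [SK q1] := ic; have q0 := q_nz SK.
  have dn : `|dir w| = 1.
    by rewrite normrZ ger0_norm ?invr_ge0 // mulVf // gt_eqF.
  have HE : H 1 w = ps (v' + s *: to_ball (dir w)).
    rewrite (H_in _ SK); congr (ps (_ + s *: _)).
    rewrite to_ball_id ?dn // /fac clamp01_ge1 // mul1r addrC subrK max_r //.
    by rewrite -invr1 lef_pV2 ?posrE.
  rewrite (G_in _ ic).
  rewrite HE; apply: (frame_kills (hF (dir w))).
  have -> : F (dir w) *m (th + corr (dir w)) = (f (dir w) + chi `|f (dir w)| *: (k (dir w) - f (dir w)))^T.
    rewrite mulmxDr /corr !mulmxA mulmxV ?gram_unit // mul1mx [RHS]linearD; congr (_ + _).
    exact: esym (trmxK (F (dir w) *m th)).
  have [kn kf] := hk (dir w) dn; set x := dir w in kn kf *.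
  suff : f x + chi `|f x| *: (k x - f x) != 0.
    by apply: contra => /eqP /(congr1 trmx); rewrite trmxK trmx0 => ->.
  have [small|big] := leP `|f x| (c / 2).
    rewrite /chi clamp01_ge1; first by rewrite scale1r addrC subrK.
    have : 2 * `|f x| / c <= 1 by rewrite ler_pdivrMr // mul1r; lra.
    by lra.
  rewrite -normr_gt0; have /andP[c1 c2] := @clamp_itv R 0 1 (2 - 2 * `|f x| / c) ler01.
  rewrite -/(chi `|f x|) in c1 c2.
  have : `|chi `|f x| *: (k x - f x)| <= `|k x - f x| by rewrite normrZ ger0_norm // ler_piMl.
  have := lerB_normD (f x) (chi `|f x| *: (k x - f x)).
  by move: big kf; lra.
- move=> w w1; have KE : K w = polar Phi z0 A 1 w by rewrite /K to_ball_id ?w1.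
  have nc : ~ in_cell (K w).
    rewrite KE => /in_cellE; rewrite /polar /polar_flow /polar_time clamp01_ge1; last by rewrite w1; lra.
    by rewrite mulr1; apply: leave; rewrite polar_ray_base.
  rewrite (G_out _ nc).
  rewrite addr0; apply: polar_nz; rewrite -KE.
  by apply: contra_notN nc => /eqP ->.
Qed.
End Pushing.

Lemma local_uniqueness : exists Z : set E, nbhs y0 Z /\ forall y y' th, Z y -> Z y' ->
  vanishes_at th y -> vanishes_at th y' -> y = y'.
Proof.
have [s [Z [s0 sr nZ hZ]]] := flow_leaves.
(* With both points within [s / 8] of the centre, the cell of size [s / 2] around [y'] contains [y]
   and lies in the cell of size [s] that flow lines have left at time 1. *)
have s8 : 0 < s / 8 by rewrite divr_gt0.
exists (Z `&` [set e | S e /\ `|ka e - x0| < s / 8]); split.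
  apply: filterI => //; apply: filterI; first exact: S_near.
  apply: (@near_lt _ _ (fun e' => `|ka e' - x0|)); last by rewrite subrr normr0.
  by apply: (@cont_comp _ _ _ ka (fun v => `|v - x0|)); [exact: ka_cont|exact: cont_norm_sub].
move=> y y' th [Zy [Sy hy]] [Zy' [Sy' hy']] ty ty'; apply/eqP; rewrite -[_ == _]negbK; apply/negP => ne.
have [z0 z0y] := fiber_inhabited y; have [A [_ hA]] := frame_of_fiber u (base z0).
have s2 : 0 < s / 2 by rewrite divr_gt0.
have v1 : `|ka y' - x0| + s / 2 < ro by lra.
have v2 : `|ka y - ka y'| < s / 2.
  have := ler_distD x0 (ka y) (ka y'); rewrite (distrC x0); lra.
apply: (@pushing_contradiction y y' th (s / 2) Sy Sy' s2 v1 v2 _ ty ty' ne z0 A z0y hA).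
move=> z bz [h1 h2]; apply: (hZ z); first by rewrite bz.
split=> //; have := ler_distD (ka y') (ka (base (Phi 1 z))) x0; lra.
Qed.
End Push.
End Zeros.

(** * Uniqueness of zeros and flow lines between two points *)

Section Dual.
Context {R : realType} {V : vectType R}.
Notation m := (dim (bform V)).

Lemma form_val_continuous v w : continuous (fun r : 'rV[R]_m => form_val (r2v r : bform V) v w).
Proof.
have E (r' : 'rV[R]_m) : form_val (r2v r' : bform V) v w =
    \sum_k r' 0 k * form_val (r2v (delta_mx 0 k) : bform V) v w.
  have vr (I : seq 'I_m) (q : 'I_m -> bform V) : form_val (\sum_(k <- I) q k) v w = \sum_(k <- I) form_val (q k) v w.
    by elim/big_rec2: _ => [|k x y _ <-]; rewrite ?form_val0 ?form_valD.
  rewrite {1}(row_sum_delta r') linear_sum vr; apply: eq_bigr => k _.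
  by rewrite linearZ form_valZ.
rewrite (_ : (fun r => _) = (fun r' : 'rV[R]_m => \sum_k r' 0 k *
    form_val (r2v (delta_mx 0 k) : bform V) v w)); last by apply/funext => r; exact: E.
move=> r; by apply: (@cvg_bigsum _ _ (nbhs r)) => k _; apply: (@cvgM _ _ (nbhs r)); [apply: (@cvg_coord _ _ (nbhs r)); exact: cvg_id|exact: cvg_cst].
Qed.

Lemma not_psd_near (r : 'rV[R]_m) : ~ psdr r -> \forall r' \near r, ~ psdr r'.
Proof.
move=> h; have [sr|nsr] := pselect (symm r).
  have [v neg] : exists v, quad r v < 0.
    apply: contrapT => no; apply: h; split=> // v; rewrite leNgt; apply/negP => l.
    by apply: no; exists v.
  have : \forall r' \near r, quad r' v < 0.
    by apply: (@near_lt _ _ (fun r' => quad r' v)) => //; exact: form_val_continuous.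
  by apply: filterS => r' l [_ /(_ v)]; rewrite -/(quad r' v) leNgt l.
have [v [w ne]] : exists v w, form_val (r2v r : bform V) v w - form_val (r2v r : bform V) w v != 0.
  apply: contrapT => no; apply: nsr => v w; apply/eqP; rewrite -subr_eq0.
  by rewrite -[_ == _]negbK; apply/negP => ne; apply: no; exists v, w.
have : \forall r' \near r, 0 < `|form_val (r2v r' : bform V) v w - form_val (r2v r' : bform V) w v|.
  apply: (@near_gt _ _ (fun r' : 'rV[R]_m => `|form_val (r2v r' : bform V) v w - form_val (r2v r' : bform V) w v|)).
    apply: (@cvg_norm _ _ _ (nbhs r)).
    by apply: (@cvgB _ _ _ (nbhs r)); exact: form_val_continuous.
  by rewrite normr_gt0.
by apply: filterS => r' l [s _]; move: l; rewrite s subrr normr0 ltxx.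
Qed.

(** The positive semidefinite forms of norm 1 are a closed part of the compact unit sphere. *)
Lemma psd_uniform {I : Type} (F : set_system I) {FF : Filter F} (P : I -> 'rV[R]_m -> Prop) :
  (forall r : 'rV[R]_m, psdr r -> `|r| = 1 -> \forall r' \near r & i \near F, P i r') ->
  \forall i \near F, forall r, psdr r -> `|r| = 1 -> P i r.
Proof.
move=> loc; have := @compact_unif _ _ [set r : 'rV[R]_m | `|r| = 1] F _
  (fun i r => psdr r -> P i r) (@rV_sphere_compact R m 1).
have h (r : 'rV[R]_m) : [set r : 'rV[R]_m | `|r| = 1] r -> \forall r' \near r & i \near F, psdr r' -> P i r'.
  move=> r1; have [pr|npr] := pselect (psdr r).
    by apply: filterS (loc r pr r1) => z ? _.
  exists ([set r' | ~ psdr r'], setT) => /=.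
    by split; [exact: not_psd_near|exact: filterT].
  by move=> [r' i] /= [n _].
by move=> /(_ _ h); apply: filterS => i hi r pr r1; exact: hi.
Qed.

Lemma psdr_scale a (r : 'rV[R]_m) : 0 <= a -> psdr r -> psdr (a *: r).
Proof.
move=> a0 [s h]; split.
  by rewrite linearZ; exact: form_symmetricZ.
by move=> v; rewrite -/(quad _ v) quadZ mulr_ge0 //; exact: h.
Qed.

Lemma psd_unit (r : 'rV[R]_m) : psdr r -> r = 0 \/ exists a r1, [/\ 0 < a, psdr r1, `|r1| = 1 & r = a *: r1].
Proof.
move=> pr; have [->|r0] := eqVneq r 0; [by left|right].
have n0 : 0 < `|r| by rewrite normr_gt0.
have h0 : 0 <= `|r|^-1 by rewrite invr_ge0.
exists `|r|, (`|r|^-1 *: r); split=> //.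
- exact: psdr_scale.
- by rewrite normrZ (ger0_norm h0) mulVf // gt_eqF.
- by rewrite scalerA mulfV ?scale1r // gt_eqF.
Qed.

Lemma dval0l th : dval (0 : 'rV[R]_m) th = 0.
Proof. by rewrite /dval mul0mx mxE. Qed.

Lemma dual_pos_ge0 (th : 'cV[R]_m) (r : 'rV[R]_m) : dual_pos th -> psdr r -> 0 <= dval r th.
Proof.
move=> pth pr; have [->|r0] := eqVneq r 0; first by rewrite dval0l.
exact/ltW/pth.
Qed.

Lemma dual_dominates_quad (th : 'cV[R]_m) (v : V) : dual_pos th ->
  exists2 dl : R, 0 < dl & forall r, psdr r -> dl * quad r v <= dval r th.
Proof.
move=> pth.
have : \forall dl \near (0 : R)^'+, forall r, psdr r -> `|r| = 1 -> dl * quad r v <= dval r th.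
  apply: psd_uniform => r pr r1.
  have r0 : r != 0 by rewrite -normr_gt0 r1.
  have [[X Y] /= [nX nY] XY] : \forall z \near (r, (0 : R)), 0 < dval z.1 th - z.2 * quad z.1 v.
    apply: (@near_gt _ _ (fun z : 'rV[R]_m * R => dval z.1 th - z.2 * quad z.1 v)); last first.
      by rewrite /= mul0r subr0; exact: pth.
    apply: (@cvgB _ _ _ (nbhs (r, (0 : R)))).
      by apply: (@dval_cvg _ _ _ (nbhs (r, (0 : R)))); [exact: cvg_fst|exact: cvg_cst].
    apply: (@cvgM _ _ (nbhs (r, (0 : R)))); first exact: cvg_snd.
    apply: (@cont_comp _ _ _ (fun z : 'rV[R]_m * R => z.1) (fun r => quad r v)); first exact: cvg_fst.
    exact: form_val_continuous.
  exists (X, Y) => /=; first by split=> //; exact: cvg_within nY.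
  by move=> [r' dl] /= h; have := XY (r', dl) h; rewrite /= subr_gt0 => /ltW.
move=> h; have h' : \forall dl \near (0 : R)^'+, 0 < dl by exact: nbhs_right_gt.
have [dl [d0 hd]] := @filter_ex _ _ (at_right_proper_filter (0 : R)) _ (filterI h' h).
exists dl => // r pr; have [->|[a [r1 [a0 pr1 n1 ->]]]] := psd_unit pr.
  by rewrite quad0 mulr0 dval0l.
by rewrite quadZ dvalZ mulrCA ler_pM2l //; exact: hd.
Qed.

(** Closeness relative to [th] itself and tested on semidefinite forms only: it is insensitive to
    scaling and survives interpolation with a third functional, so one [ep] can serve for all
    functionals. *)
Definition dclose (ep : R) (th th' : 'cV[R]_m) := forall r, psdr r ->
  (1 - ep) * dval r th <= dval r th' <= (1 + ep) * dval r th.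

Lemma close_near ep (th : 'cV[R]_m) : 0 < ep -> dual_pos th ->
  \forall a \near th & b \near th, dclose ep a b.
Proof.
move=> e0 pth.
have : \forall ab \near filter_prod (nbhs th) (nbhs th), forall r, psdr r -> `|r| = 1 ->
    `|dval r ab.2 - dval r ab.1| <= ep * dval r ab.1.
  apply: psd_uniform => r pr r1.
  have r0 : r != 0 by rewrite -normr_gt0 r1.
  have : \forall z \near (r, (th, th)), 0 < ep * dval z.1 z.2.1 - `|dval z.1 z.2.2 - dval z.1 z.2.1|.
    have d1 : {for (r, (th, th)), continuous (fun z : 'rV[R]_m * ('cV[R]_m * 'cV[R]_m) => z.2.1)}.
      by apply: (@cont_comp _ _ _ (fun z : 'rV[R]_m * ('cV[R]_m * 'cV[R]_m) => z.2) (fun z => z.1)); [exact: cvg_snd|exact: cvg_fst].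
    have d2 : {for (r, (th, th)), continuous (fun z : 'rV[R]_m * ('cV[R]_m * 'cV[R]_m) => z.2.2)}.
      by apply: (@cont_comp _ _ _ (fun z : 'rV[R]_m * ('cV[R]_m * 'cV[R]_m) => z.2) (fun z => z.2)); exact: cvg_snd.
    have c1 : dval z.1 z.2.1 @[z --> (r, (th, th))] --> dval r th.
      apply: (@dval_cvg _ _ _ (nbhs (r, (th, th)))); first exact: cvg_fst.
      exact: d1.
    have c2 : dval z.1 z.2.2 @[z --> (r, (th, th))] --> dval r th.
      apply: (@dval_cvg _ _ _ (nbhs (r, (th, th)))); first exact: cvg_fst.
      exact: d2.
    apply: (@near_gt _ _ (fun z : 'rV[R]_m * ('cV[R]_m * 'cV[R]_m) => ep * dval z.1 z.2.1 - `|dval z.1 z.2.2 - dval z.1 z.2.1|)); last first.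
      by rewrite /= subrr normr0 subr0 mulr_gt0 //; exact: pth.
    apply: (@cvgB _ _ _ (nbhs (r, (th, th)))).
      by apply: (@cvgM _ _ (nbhs (r, (th, th)))); [exact: cvg_cst|exact: c1].
    by apply: (@cvg_norm _ _ _ (nbhs (r, (th, th)))); apply: (@cvgB _ _ _ (nbhs (r, (th, th)))).
  by apply: filterS => z; rewrite subr_gt0 => /ltW.
apply: filterS => -[a b] /= hab r pr; have [->|[c [r1 [c0 pr1 n1 ->]]]] := psd_unit pr.
  by rewrite !dval0l !mulr0 lexx.
have := hab r1 pr1 n1; rewrite ler_norml => /andP[h1 h2].
rewrite !dvalZ !(mulrCA _ c) !ler_pM2l //; apply/andP; split; lra.
Qed.

Lemma close_dual_pos ep th th' : ep < 1 -> dual_pos th -> dclose ep th th' -> dual_pos th'.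
Proof.
move=> e1 pth h r pr r0; have /andP[l _] := h r pr; apply: lt_le_trans l.
by rewrite mulr_gt0 ?subr_gt0 //; exact: pth.
Qed.

Definition seg (th1 th2 : 'cV[R]_m) (a : R) : 'cV[R]_m := (1 - a) *: th1 + a *: th2.

Lemma seg0 th1 th2 : seg th1 th2 0 = th1.
Proof. by rewrite /seg subr0 scale1r scale0r addr0. Qed.
Lemma seg1 th1 th2 : seg th1 th2 1 = th2.
Proof. by rewrite /seg subrr scale1r scale0r add0r. Qed.
Lemma segxx th a : seg th th a = th.
Proof. by rewrite /seg -scalerDl subrK scale1r. Qed.

Lemma seg_dual_pos th1 th2 a : 0 <= a <= 1 -> dual_pos th1 -> dual_pos th2 -> dual_pos (seg th1 th2 a).
Proof.
move=> /andP[a0 a1] h1 h2; apply: dual_pos_conv => //; first by rewrite subr_ge0.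
by rewrite subrK.
Qed.

Lemma seg_close ep th th1 th2 a : 0 <= ep -> 0 <= a <= 1 -> dual_pos th -> dclose ep th1 th2 ->
  dclose ep (seg th1 th a) (seg th2 th a).
Proof.
move=> e0 /andP[a0 a1] pth h r pr; have /andP[h1 h2] := h r pr.
have g0 := dual_pos_ge0 pth pr; rewrite /seg !dvalDr !dvalZr.
have a1' : 0 <= 1 - a by rewrite subr_ge0.
have l1 := ler_wpM2l a1' h1; have l2 := ler_wpM2l a1' h2.
have l3 : 0 <= ep * (a * dval r th) by rewrite !mulr_ge0.
by apply/andP; split; nra.
Qed.

Lemma seg_fine ep th1 th2 : 0 < ep -> dual_pos th1 -> dual_pos th2 ->
  exists n0 : nat, forall n j, (n0 <= n)%N -> (j < n)%N ->
    dclose ep (seg th1 th2 (j%:R / n%:R)) (seg th1 th2 (j.+1%:R / n%:R)).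
Proof.
move=> e0 p1 p2.
have := @compact_unif _ _ `[(0 : R), 1]%classic (nbhs (0 : R)) _
   (fun h a => dclose ep (seg th1 th2 a) (seg th1 th2 (a + h))) (@segment_compact _ _ _).
have cs : continuous (seg th1 th2).
  move=> a; apply: (@cvgD _ _ _ (nbhs a)); apply: (@cvgZ _ _ _ (nbhs a)); try exact: cvg_cst; last exact: cvg_id.
  by apply: (@cvgB _ _ _ (nbhs a)); [exact: cvg_cst|exact: cvg_id].
have loc (a : R) : `[(0 : R), 1]%classic a -> \forall a' \near a & h \near (0 : R),
    dclose ep (seg th1 th2 a') (seg th1 th2 (a' + h)).
  rewrite /= in_itv /= => a01.
  have [[X Y] /= [nX nY] XY] := close_near e0 (seg_dual_pos a01 p1 p2).
  pose f1 (q : R * R) := seg th1 th2 q.1; pose f2 (q : R * R) := seg th1 th2 (q.1 + q.2).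
  have c1 : {for (a, 0), continuous f1}.
    by apply: (@cont_comp _ _ _ (fun q : R * R => q.1) (seg th1 th2)); [exact: cvg_fst|exact: cs].
  have c2 : {for (a, 0), continuous f2}.
    apply: (@cont_comp _ _ _ (fun q : R * R => q.1 + q.2) (seg th1 th2)); last exact: cs.
    by apply: (@cvgD _ _ _ (nbhs (a, (0 : R)))); [exact: cvg_fst|exact: cvg_snd].
  have nX' : nbhs (f1 (a, 0)) X by exact: nX.
  have nY' : nbhs (f2 (a, 0)) Y by rewrite /f2 /= addr0; exact: nY.
  have h1 : \forall q \near (a, (0 : R)), X (f1 q) := c1 _ nX'.
  have h2 : \forall q \near (a, (0 : R)), Y (f2 q) := c2 _ nY'.
  apply: filterS2 h1 h2 => q Xq Yq; exact: (XY (_, _)).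
move=> /(_ _ loc) /nbhs_ballP [e /= e1 he].
exists (Num.trunc e^-1).+1 => n j nn jn.
have n0 : 0 < n%:R :> R by rewrite ltr0n (leq_trans _ nn).
have ne : n%:R^-1 < e.
  rewrite invf_plt ?posrE //; have ei : 0 <= e^-1 by rewrite invr_ge0 ltW.
  have /andP[_ l] := Num.Theory.truncn_itv ei; apply: lt_le_trans l _.
  by rewrite ler_nat.
have s : j.+1%:R = j%:R + 1 :> R by rewrite natr1.
rewrite s mulrDl mul1r; apply: (he n%:R^-1).
  by rewrite /ball /= sub0r normrN ger0_norm // invr_ge0 ltW.
rewrite /= in_itv /=; apply/andP; split; first by rewrite mulr_ge0 // invr_ge0 ltW.
by rewrite ler_pdivrMr // mul1r ler_nat ltnW.
Qed.

End Dual.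

Section Reach.
Context {R : realType} {V : vectType R} {vol : ('I_(\dim {:V}) -> V) -> R}.
Context {d : nat} {E N : topologicalType} (A : smooth_atlas R d N).
Variables (g : chart_index A -> 'rV[R]_d -> 'M[R]_d) (p : E -> N) (rho : deck p -> 'End(V)).
Variable u : E -> Gr V d.
Hypothesis d_gt0 : (0 < d)%N.
Hypothesis g_metric : riemannian_metric g.
Hypothesis vol_form : volume_form vol.
Hypothesis rho_rep : representation vol rho.
Hypothesis u_equiv : equivariant_map rho u.
Hypothesis u_cont : continuous u.
Hypothesis u_mixed : forall x, mixed (pencil (u x)).
Hypothesis p_cov : covering_map p.
Hypothesis E_conn : connected [set: E].
Hypothesis deck_trans : forall x x', p x = p x' -> exists a : deck p, a x = x'.
Hypothesis N_compact : compact [set: N].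
Hypothesis N_hausdorff : hausdorff_space N.
Notation SE := (sphere_bundle u).
Notation m := (dim (bform V)).
Variable Phi : R -> SE -> SE.
Hypothesis Phi_fitting : fitting_flow Phi.
Hypothesis Phi_equiv : equivariant_flow rho Phi.

Let unif_bundle {I : Type} := @uniform_on_bundle R V vol d E N p rho u vol_form rho_rep u_equiv
  u_cont p_cov deck_trans N_compact I.
Let unif_base {I : Type} := @uniform_on_base E N p p_cov deck_trans N_compact I.
Let saP := @sphere_actP R V vol d E N p rho u vol_form rho_rep u_equiv.

Lemma vanishesP (th : 'cV[R]_m) y :
  Pi u y *m th = 0 <-> forall r : 'rV[R]_m, r *m Pi u y = r -> dval r th = 0.
Proof.
split=> [h r <-|h]; first by rewrite /dval -mulmxA h mulmx0 mxE.
apply/row_matrixP => i; rewrite row0 row_mul; apply/rowP => j; rewrite ord1 [RHS]mxE.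
by apply: h; rewrite -row_mul Pi_idem.
Qed.

(** The dual action on functionals, given by its values on the coordinate basis of forms. *)
Definition pullth (a : deck p) (th : 'cV[R]_m) : 'cV[R]_m :=
  \col_k dval (actr rho a (delta_mx 0 k)) th.

Lemma pullthE a th r : dval r (pullth a th) = dval (actr rho a r) th.
Proof.
have ds (I : seq 'I_m) (q : 'I_m -> 'rV[R]_m) : dval (actr rho a (\sum_(k <- I) q k)) th = \sum_(k <- I) dval (actr rho a (q k)) th.
  elim/big_rec2: _ => [|k x y _ <-]; last by rewrite actrD dvalD.
  by rewrite actr0 dval0l.
rewrite {2}(row_sum_delta r) ds /dval mxE; apply: eq_bigr => k _.
by rewrite mxE actrZ -/(dval _ th) dvalZ.
Qed.

Lemma pullth_vanishes (a : deck p) th x : vanishes_at u th (a x) -> vanishes_at u (pullth a th) x.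
Proof.
move=> [pth h]; split.
  move=> r [sr pr] r0; rewrite pullthE; apply: pth.
    split; last by move=> v; rewrite -/(quad _ v) (quad_actr vol_form rho_rep); exact: pr.
    by move=> v w; rewrite /actr v2rK !form_actE sr.
  apply: contra_neq r0 => e; apply: quad_inj => // v.
  have e1 : rho a^-1%g (rho a v) = v by rewrite -comp_lfunE -(proj2 rho_rep) mulVg (rho1 vol_form rho_rep).
  by rewrite -e1 -(quad_actr vol_form rho_rep) e quad0.
apply/vanishesP => r rx; have [->|r0] := eqVneq r 0; first by rewrite dval0l.
rewrite pullthE; apply: (vanishes_dval h).
by apply: (actr_fiber vol_form rho_rep u_equiv); split.
Qed.

(** [joined_short] turns the neighbourhood of local uniqueness into a radius, and [pullth]
    transports zeros under deck transformations, so cocompactness gives one radius. *)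
Lemma uniform_uniqueness : exists2 r : R, 0 < r & forall y y' th, joined g p r y y' ->
  vanishes_at u th y -> vanishes_at u th y' -> y = y'.
Proof.
have hE := covering_hausdorff p_cov N_hausdorff.
have : \forall r \near (0 : R)^'+, forall y, forall y' th, joined g p r y y' ->
    vanishes_at u th y -> vanishes_at u th y' -> y = y'.
  apply: unif_base.
    move=> x; have [c _] := cube_ex g_metric p_cov (@filterT _ (nbhs x) _).
    pose ka (e : E) := chart (s := A) (ci c) (p e).
    have pc : continuous p by case: p_cov.
    have [Z [nZ hZ]] : exists Z : set E, nbhs x Z /\ forall y y' th, Z y -> Z y' ->
        vanishes_at u th y -> vanishes_at u th y' -> y = y'.
      apply: (@local_uniqueness _ _ _ _ u d_gt0 u_cont u_mixed Phi Phi_fitting hE x (sheet c) ka (cpsi c) (cr c)).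
      - exact: cr_gt0.
      - exact: copen.
      - by have := nbhs_singleton (sheet_nbhs c).
      - move=> e [de _ _]; apply: (@cont_comp _ _ _ p (chart (s := A) (ci c))); first exact: pc.
        exact: chart_continuous.
      - by move=> e [].
      - by move=> e [].
      - by move=> v vr; split; [exact: cpsi_sheet|apply: cpsiK; exact: ltW].
      - by move=> v /ltW; exact: cpsi_cont.
    have [Z0 [nZ0 [r1 r10 hr1]]] := joined_short g_metric p_cov N_hausdorff nZ.
    exists (Z0 `&` Z, [set r | r < r1]) => /=.
      by split; [exact: filterI|exact: nbhs_right_lt].
    move=> [y r] /= [[Zy Zy'] rr] y' th jn; apply: hZ => //.
    by apply: (hr1 y) => //; apply: joined_le jn; exact: ltW.
  move=> r a x hx y' th jn vx vy'.
  pose b : deck p := a^-1%g.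
  have bK e : b (a e) = e by rewrite -[LHS]/(((a^-1 * a)%g : deck p) e) mulVg.
  have aK e : a (b e) = e by rewrite -[LHS]/(((a * a^-1)%g : deck p) e) mulgV.
  have jb : joined g p r x (b y') by have := joined_deck b jn; rewrite bK.
  rewrite -(aK y') (hx _ (pullth a th) jb) //; first exact: pullth_vanishes.
  by apply: pullth_vanishes; rewrite aK.
move=> h; have h' : \forall r \near (0 : R)^'+, 0 < r by exact: nbhs_right_gt.
have [r [r0 hr]] := @filter_ex _ _ (at_right_proper_filter (0 : R)) _ (filterI h' h).
by exists r.
Qed.

Lemma flow_short (r : R) : 0 < r -> exists2 t : R, 0 < t & forall z s, 0 <= s <= t ->
  joined g p r (base z) (base (Phi s z)).
Proof.
move=> r0.
have : \forall t \near (0 : R)^'+, forall z : SE, forall s, 0 <= s <= t -> joined g p r (base z) (base (Phi s z)).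
  apply: (@unif_bundle R (at_right 0) _ (fun t z => forall s, 0 <= s <= t -> joined g p r (base z) (base (Phi s z)))).
    move=> z; have [Z0 [n0 hZ0]] := joined_near g_metric p_cov (base z) r0.
    have c2 : {for ((0 : R), z), continuous (fun w : R * SE => base (Phi w.1 w.2))}.
      apply: (@cont_comp _ _ _ (fun w : R * SE => Phi w.1 w.2) (@base _ _ _ _ u)); first exact: (flow_continuous Phi_fitting).
      exact: base_continuous.
    have n0' : nbhs (base (Phi 0 z)) Z0 by rewrite (flow0 Phi_fitting).
    have [[S Z] /= [nS nZ] SZ] : \forall w \near ((0 : R), z), Z0 (base (Phi w.1 w.2)) := c2 _ n0'.
    have nb : \forall z' \near z, Z0 (base z') by exact: base_continuous n0.
    move/nbhs_ballP: nS => [e /= e0 he].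
    exists (Z `&` [set z' | Z0 (base z')], [set t | t < e]) => /=.
      by split; [exact: filterI|exact: nbhs_right_lt].
    move=> [z' t] /= [[Zz Z0z] te] s /andP[s0 st]; apply: hZ0 => //.
    apply: (SZ (s, z')); split=> //=; apply: he.
    by rewrite /ball /= sub0r normrN ger0_norm // (le_lt_trans st).
  move=> t a z w zw hz s s01; have [-> _] := (saP a z w).1 zw.
  have [-> _] := (saP a _ _).1 (Phi_equiv s zw).
  by apply: joined_deck => //; exact: hz.
move=> h; have h' : \forall r \near (0 : R)^'+, 0 < r by exact: nbhs_right_gt.
have [t [t0 ht]] := @filter_ex _ _ (at_right_proper_filter (0 : R)) _ (filterI h' h).
by exists t.
Qed.

(* The short flow lines from y make th', which is close to th, positive as well. *)
Lemma zeros_persist (r : R) : 0 < r -> exists ep : R, [/\ 0 < ep, ep < 1 & forall th y th',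
  vanishes_at u th y -> dual_pos th' -> dclose ep th th' ->
  exists y', joined g p r y y' /\ vanishes_at u th' y'].
Proof.
move=> r0; have [t t0 ht] := flow_short r0.
have [mu mu1 hmu] := flow_growth vol_form rho_rep u_equiv u_cont p_cov deck_trans N_compact Phi_fitting Phi_equiv t0.
have mu0 : 0 < mu by apply: lt_trans mu1.
have mui : mu^-1 < mu by apply: (@lt_trans _ _ 1) => //; rewrite invf_lt1.
(* As [th] kills the initial form, both increments have the same value [P] under [th]. Their values
   under [th'] then differ by at most [2 * ep * P], which bounds [Y] from below, and [X] is at least
   [P * (1 - ep * (1 + 2 * ka))]. The choice of [ep] makes this [P / 2]. *)
pose ka := mu^-1 / (mu - mu^-1).
have ka0 : 0 < ka by rewrite divr_gt0 ?invr_gt0 // subr_gt0.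
pose ep := (2 * (1 + 2 * ka))^-1.
have den : 0 < 2 * (1 + 2 * ka) by rewrite mulr_gt0 // addr_gt0 // mulr_gt0.
have ep0 : 0 < ep by rewrite invr_gt0.
have epk : ep * (1 + 2 * ka) = 1 / 2 by rewrite /ep; field; lra.
exists ep; split=> //; first by nra.
move=> th y th' [pth vy] pth' cl.
have [|z [s [bz s0t vz]]] := flow_hits_zero d_gt0 u_cont Phi_fitting pth' (ltW t0) (x := y); last first.
  by exists (base (Phi s z)); split=> //; rewrite -bz; exact: ht.
move=> z bz; have [a [b [a0 b0 [g1 g2]]]] := hmu z.
have sy (c : R) : symm (b *: vec (Phi t z) - c *: (a *: vec z)).
  rewrite scalerA -scaleNr; apply: symm_comb; exact: vec_symm.
have P1 := posdef_psd (sy mu) g1; have P2 := posdef_psd (sy mu^-1) g2.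
have tz : dval (vec z) th = 0 by apply: (vanishes_dval _ (vec_fiber z)); rewrite bz.
have /andP[l1 l2] := cl _ P1; have /andP[l3 l4] := cl _ P2.
have dE (v0 v1 : 'rV[R]_m) (c : R) (th0 : 'cV[R]_m) :
    dval (b *: v1 - c *: (a *: v0)) th0 = b * dval v1 th0 - c * (a * dval v0 th0).
  by rewrite dvalB !dvalZ.
rewrite !dE tz !mulr0 !subr0 in l1 l2 l3 l4.
have PP : 0 < b * dval (vec (Phi t z)) th.
  by rewrite mulr_gt0 //; apply: (flow_mono u_mixed Phi_fitting); rewrite ?tz.
set P := b * dval (vec (Phi t z)) th in l1 l2 l3 l4 PP.
set X := b * dval (vec (Phi t z)) th' in l1 l2 l3 l4.
set Y := a * dval (vec z) th' in l1 l2 l3 l4.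
suff X0 : 0 < X by rewrite /X pmulr_rgt0 in X0.
have dm : 0 < mu - mu^-1 by rewrite subr_gt0.
have h1 : - (2 * ep * P) <= (mu - mu^-1) * Y by lra.
have h2 : - (2 * ep * P) * ka <= mu^-1 * Y.
  have -> : mu^-1 * Y = (mu - mu^-1) * Y * ka by rewrite /ka [RHS]mulrC -mulrA mulKf // gt_eqF.
  by rewrite ler_wpM2r // ltW.
have h3 : (1 - ep) * P - 2 * ep * P * ka <= X by lra.
apply: lt_le_trans h3.
have -> : (1 - ep) * P - 2 * ep * P * ka = P * (1 - ep * (1 + 2 * ka)) by ring.
by rewrite epk mulr_gt0 //; lra.
Qed.

Section Global.
Variables (x : E) (th : 'cV[R]_m).
Hypothesis th_x : vanishes_at u th x.
Variables (r ep : R).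
Hypothesis r0 : 0 < r.
Hypothesis unique : forall y y' th, joined g p (r + r + r + r) y y' ->
  vanishes_at u th y -> vanishes_at u th y' -> y = y'.
Hypotheses (ep0 : 0 < ep) (ep1 : ep < 1).
Hypothesis persist : forall th y th', vanishes_at u th y -> dual_pos th' -> dclose ep th th' ->
  exists y', joined g p r y y' /\ vanishes_at u th' y'.

(* The zero of th1 at e is continued along the segment from th1 to th and must
   arrive at x. *)
Definition track n (e : E) (th1 : 'cV[R]_m) (y : nat -> E) :=
  [/\ y 0%N = e, y n = x, forall j, (j <= n)%N -> vanishes_at u (seg th1 th (j%:R / n%:R)) (y j) &
    forall j, (j < n)%N -> joined g p r (y j) (y j.+1)].

(** Tracks are asked for at all large [n], because moving the functional in [reach_step] requires a
    subdivision fine enough for the new segment as well. *)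
Definition reach e th1 := exists n0 : nat, forall n, (n0 <= n)%N -> (0 < n)%N ->
  exists y, track n e th1 y.

Lemma joined_refl e : joined g p r e e.
Proof.
have [Z [nZ h]] := joined_near g_metric p_cov e r0.
by apply: h; exact: nbhs_singleton.
Qed.

(** Comparing consecutive points of two neighbouring tracks takes four hops of size [r], whence the
    radius in the uniqueness hypothesis. *)
Lemma joined4 a b c e f : joined g p r a b -> joined g p r b c -> joined g p r c e ->
  joined g p r e f -> joined g p (r + r + r + r) a f.
Proof.
move=> h1 h2 h3 h4; have r2 : 0 < r + r by rewrite addr_gt0.
have r3 : 0 < r + r + r by rewrite addr_gt0.
by apply: (joined_trans p_cov (y := e)) h4 => //; apply: (joined_trans p_cov (y := c)) h3 => //;
  apply: (joined_trans p_cov (y := b)) h2.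
Qed.

Lemma unit_frac j n : (j <= n)%N -> (0 < n)%N -> 0 <= (j%:R / n%:R : R) <= 1.
Proof.
move=> jn n0; have n0' : 0 < n%:R :> R by rewrite ltr0n.
by rewrite divr_ge0 //= ler_pdivrMr // mul1r ler_nat.
Qed.

(** Every point of the old track is moved by persistence to a zero for the new segment. Uniqueness
    identifies the ends with [e'] and [x], and shows that successive new points are again joined
    within [r]. *)
Lemma reach_step e e' th1 th2 : reach e th1 -> vanishes_at u th2 e' -> joined g p r e e' ->
  dclose ep th1 th2 -> reach e' th2.
Proof.
move=> [n1 h1] v2 je cl; have [pth2 _] := v2; have [pth _] := th_x.
have [n2 h2] := seg_fine ep0 pth2 pth.
exists (maxn n1 n2) => n; rewrite geq_max => /andP[nn1 nn2] n0.
have [y [y0 yn yv yj]] := h1 n nn1 n0.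
have near j : exists e1, (j <= n)%N -> joined g p r (y j) e1 /\ vanishes_at u (seg th2 th (j%:R / n%:R)) e1.
  have [jn|jn] := leqP j n; last by exists (y j).
  have fr := unit_frac jn n0.
  have [e1 ?] := persist (yv j jn) (seg_dual_pos fr pth2 pth) (seg_close (ltW ep0) fr pth cl).
  by exists e1.
have [w hw] := choice near.
have nn : n%:R != 0 :> R by rewrite pnatr_eq0 -lt0n.
exists w; split.
- have [j0 v0] := hw 0%N (leq0n n); rewrite mul0r seg0 y0 in j0 v0.
  apply: esym; apply: unique v2 v0.
  apply: (joined4 _ j0 (joined_refl _) (joined_refl _)); exact: joined_sym je.
- have [j1 v1] := hw n (leqnn n); rewrite mulfV // seg1 yn in j1 v1.
  apply: esym; apply: unique th_x v1.
  exact: joined4 j1 (joined_refl _) (joined_refl _) (joined_refl _).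
- by move=> j jn; have [] := hw j jn.
- move=> j jn; have [j1 v1] := hw j (ltnW jn); have [j2 v2'] := hw j.+1 jn.
  have fr := unit_frac jn n0.
  have [e1 [je1 ve1]] := persist v1 (seg_dual_pos fr pth2 pth) (h2 n j nn2 jn).
  suff <- : e1 = w j.+1 by [].
  apply: unique ve1 v2'.
  apply: joined4 (joined_sym p_cov je1) (joined_sym p_cov j1) (yj j jn) j2.
Qed.

(** The functionals that vanish at [e] form a convex set, so one moves along a segment while the
    point stays fixed. *)
Lemma reach_fiber e th1 th2 : reach e th1 -> vanishes_at u th1 e -> vanishes_at u th2 e -> reach e th2.
Proof.
move=> h [p1 v1] [p2 v2]; have [n0 hn] := seg_fine ep0 p1 p2.
pose n := n0.+1; have st j : (j <= n)%N -> reach e (seg th1 th2 (j%:R / n%:R)).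
  elim: j => [|j IH] jn; first by rewrite mul0r seg0.
  apply: reach_step (IH (ltnW jn)) _ (joined_refl e) (hn n j (leqnSn _) jn).
  split; first by apply: seg_dual_pos => //; exact: unit_frac.
  by rewrite mulmxDr -!scalemxAr v1 v2 !scaler0 addr0.
by have := st n (leqnn n); rewrite mulfV ?seg1 // pnatr_eq0.
Qed.

Lemma reach_all e th1 : vanishes_at u th1 e -> reach e th1.
Proof.
move: th1; apply: (@connected_ind _ [set: E] (fun e => forall th1, vanishes_at u th1 e -> reach e th1) x) => //.
  move=> {}e _; have [th1 v1] := vanishes_ex u_mixed e; have [p1 z1] := v1.
  have [[X Y] /= [nX nY] XY] := close_near ep0 p1.
  (* Projecting [th1] to the annihilator of [u e'] gives a functional that vanishes on [u e'] and,
     being close to [th1], is still positive. *)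
  have c1 : {for e, continuous (fun e' => (1%:M - Pi u e') *m th1)}.
    apply: (@cvg_mulmx _ _ (nbhs e)); last exact: cvg_cst.
    by apply: (@cvgB _ _ _ (nbhs e)); [exact: cvg_cst|exact: Pi_continuous].
  have e1 : (1%:M - Pi u e) *m th1 = th1 by rewrite mulmxBl mul1mx z1 subr0.
  have nXY : \forall e' \near e, (X `&` Y) ((1%:M - Pi u e') *m th1).
    by have := c1 (X `&` Y); rewrite e1 => h; apply: h; exact: filterI.
  have [Z [nZ hZ]] := joined_near g_metric p_cov e r0.
  have Ze := nbhs_singleton nZ.
  have Xt := nbhs_singleton nX; have Yt := nbhs_singleton nY.
  apply: filterS2 nXY nZ => e' [X2 Y2] Ze' _; set th2 := _ *m th1 in X2 Y2.
  have cl12 : dclose ep th1 th2 by exact: (XY (th1, th2)).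
  have cl21 : dclose ep th2 th1 by exact: (XY (th2, th1)).
  have v2 : vanishes_at u th2 e'.
    split; first exact: close_dual_pos cl12.
    by rewrite /th2 mulmxA mulmxBr mulmx1 Pi_idem subrr mul0mx.
  split=> h th3 v3.
    by apply: (reach_fiber _ v1 v3); apply: reach_step (h _ v2) v1 (hZ _ _ Ze' Ze) cl21.
  by apply: (reach_fiber _ v2 v3); apply: reach_step (h _ v1) v2 (hZ _ _ Ze Ze') cl12.
move=> th1 v1; apply: (reach_fiber _ th_x v1); exists 0%N => n _ n0.
exists (fun=> x); split=> // j jn; last exact: joined_refl.
by rewrite segxx.
Qed.

(** The segment from [th] to itself is constant, so by local uniqueness the track from [y] to [x]
    never moves. *)
Lemma zero_unique y : vanishes_at u th y -> y = x.
Proof.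
move=> vy; have [n0 h] := reach_all vy.
have [w [w0 wn wv wj]] := h n0.+1 (leqnSn _) isT.
have st j : (j <= n0.+1)%N -> w j = y.
  elim: j => // j IH jn; rewrite -(IH (ltnW jn)); apply: esym.
  have v1 := wv j (ltnW jn); have v2 := wv j.+1 jn; rewrite !segxx in v1 v2.
  apply: unique v1 v2.
  exact: joined4 (wj j jn) (joined_refl _) (joined_refl _) (joined_refl _).
by rewrite -(st _ (leqnn _)).
Qed.
End Global.

(** At a vector [v] where the initial form is positive, the values grow like [mu ^+ n], while the
    initial form enters with the small weight [q]. [dual_dominates_quad] turns the growth at [v]
    into a lower bound for [th] that wins; [flow_mono] and compactness of the fibre then give a
    common time. *)
Lemma flow_eventually_pos (th : 'cV[R]_m) x : dual_pos th -> exists2 T : R, 0 <= T &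
  forall z : SE, base z = x -> 0 < dval (vec (Phi T z)) th.
Proof.
move=> pth.
have [mu mu1 hmu] := flow_chain vol_form rho_rep u_equiv u_cont p_cov deck_trans N_compact Phi_fitting Phi_equiv ltr01.
have mu0 : 0 < mu by apply: lt_trans mu1.
have one (z : SE) : exists n : nat, 0 < dval (vec (Phi n%:R z)) th.
  have [v qv] := vec_pos u_mixed z; have [dl dl0 hdl] := dual_dominates_quad v pth.
  pose D := `|dval (vec z) th|; pose c := dl * quad (vec z) v.
  have c0 : 0 < c by rewrite mulr_gt0.
  have D0 : 0 <= D by exact: normr_ge0.
  have cv : mu^-1 ^+ n @[n --> \oo] --> (0 : R).
    by apply: cvg_expr; rewrite ger0_norm ?invr_ge0 ?(ltW mu0) // invf_lt1.
  have cD : 0 < c / (c + D) by rewrite divr_gt0 // ltr_wpDr.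
  have : \forall n \near \oo, mu^-1 ^+ n < c / (c + D) by apply: (cvgr_lt 0 cv).
  move=> /filter_ex [n ln]; exists n.
  have [b b0 gr] := hmu n z; rewrite mulr1 in gr.
  have mn0 : 0 < mu ^+ n by rewrite exprn_gt0.
  rewrite exprVn in ln; set q := (mu ^+ n)^-1 in ln.
  have q0 : 0 < q by rewrite invr_gt0.
  have q1 : q <= 1 by rewrite invf_le1 // exprn_ege1 // ltW.
  pose pp := b *: vec (Phi n%:R z) - q *: vec z.
  have ppsd : psdr pp.
    split.
      by rewrite /pp -scaleNr; apply: symm_comb; exact: vec_symm.
    by move=> w; rewrite -/(quad pp w) quadB (quadZ b) (quadZ q) subr_ge0; have [_ l] := gr w; rewrite (quadZ b) in l; exact: l.
  have h1 := hdl _ ppsd.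
  have h2 : (mu ^+ n - q) * quad (vec z) v <= quad pp v.
    rewrite quadB (quadZ b) (quadZ q) mulrBl lerD2r; have [l _] := gr v; rewrite (quadZ b) in l; exact: l.
  have h3 : (mu ^+ n - q) * c <= dval pp th.
    apply: le_trans h1; rewrite /c mulrCA ler_wpM2l // ltW //.
  rewrite /pp dvalB (dvalZ b) (dvalZ q) in h3; rewrite -(pmulr_rgt0 _ b0).
  have h4 : - D <= dval (vec z) th by rewrite lerNl; apply: le_trans (ler_norm _) _; rewrite normrN.
  have h5 : - (q * D) <= q * dval (vec z) th by rewrite -mulrN ler_wpM2l // ltW.
  have h6 : q * (c + D) < c by rewrite -ltr_pdivlMr // ltr_wpDr.
  have h7 : 1 * c <= mu ^+ n * c by rewrite ler_wpM2r ?(ltW c0) // exprn_ege1 // ltW.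
  rewrite mul1r in h7; nra.
have : \forall x' \near x & T \near +oo, forall z : SE, base z = x' -> 0 < dval (vec (Phi T z)) th.
  apply: (@fiber_compact _ _ _ _ u u_cont R (pinfty_nbhs R) _ (fun T z => 0 < dval (vec (Phi T z)) th)) => z.
  have [n hn] := one z.
  exists ([set z' | 0 < dval (vec (Phi n%:R z')) th], [set T | n%:R <= T]) => /=.
    split; last exact: nbhs_pinfty_ge (num_real _).
    apply: (@near_gt _ _ (fun z' => dval (vec (Phi n%:R z')) th)) => //.
    apply: (@dval_cvg _ _ _ (nbhs z)); last exact: cvg_cst.
    apply: (@cont_comp _ _ _ (Phi n%:R) (@vec _ _ _ _ u)); last exact: vec_continuous.
    exact: (cont_slice_r (flow_continuous Phi_fitting)).
  move=> [z' T] /= [pos nT]; move: nT; rewrite le_eqVlt => /orP [/eqP <- //|lt].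
  have -> : Phi T z' = Phi (T - n%:R) (Phi n%:R z') by rewrite -(flowD Phi_fitting) subrK.
  by apply: (flow_mono u_mixed Phi_fitting) => //; [rewrite subr_gt0|exact: ltW].
move=> [[X Y] /= [nX nY] XY].
have h' : \forall T \near +oo, (0 : R) < T by exact: nbhs_pinfty_gt (num_real _).
have [T [T0 YT]] := filter_ex (filterI h' nY).
exists T; first exact: ltW.
by move=> z bz; apply: (XY (x, T)) bz; split=> //; exact: nbhs_singleton.
Qed.

Lemma flow_line_ex (x y : E) : exists (z : SE) (T : R),
  [/\ 0 <= T, base_point z = x & base_point (Phi T z) = y].
Proof.
have [th vy] := vanishes_ex u_mixed y; have [pth _] := vy.
have [T T0 hT] := flow_eventually_pos x pth.
have [z [t [bz /andP[t0 _] vz]]] := flow_hits_zero d_gt0 u_cont Phi_fitting pth T0 hT.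
have [r0 r00 hr0] := uniform_uniqueness.
(* A quarter of the uniqueness radius leaves room for the four hops of [joined4]. *)
have r4 : 0 < r0 / 4 by rewrite divr_gt0.
have [ep [ep0 ep1 hep]] := zeros_persist r4.
exists z, t; split=> //.
apply: (zero_unique vy r4 _ ep0 ep1 hep); last by split.
have -> : r0 / 4 + r0 / 4 + r0 / 4 + r0 / 4 = r0 by field.
exact: hr0.
Qed.

End Reach.

Theorem proposition4p5 (R : realType)
    (V : vectType R) (vol : ('I_(\dim {:V}) -> V) -> R)
    (d : nat) (N E : topologicalType) (A : smooth_atlas R d N)
    (g : chart_index A -> 'rV[R]_d -> 'M[R]_d)
    (p : E -> N) (rho : deck p -> 'End(V))
    (u : E -> Gr V d) (Phi : R -> sphere_bundle u -> sphere_bundle u)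
    (V_even : ~~ odd (\dim {:V})) (vol_form : volume_form vol)
    (d_gt0 : (0 < d)%N)
    (N_closed_connected : closed_connected N)
    (p_universal : universal_cover R p)
    (g_metric : riemannian_metric g)
    (rho_rep : representation vol rho)
    (u_continuous : continuous u)
    (u_mixed : forall x, mixed (pencil (u x)))
    (u_equivariant : equivariant_map rho u)
    (Phi_fitting : fitting_flow Phi)
    (Phi_equivariant : equivariant_flow rho Phi) :
  (exists C D : R, [/\ 0 < C, 0 < D &
    forall z : sphere_bundle u,
      quasi_geodesic (lifted_distance p g) C D (fun t => base_point (Phi t z))]) /\
  (forall x y : E, exists (z : sphere_bundle u) (T : R),
    [/\ 0 <= T, base_point z = x & base_point (Phi T z) = y]).
Proof.
have [N_hausdorff N_compact _] := N_closed_connected.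
have [p_cov E_sc] := p_universal.
have lpc := cover_lpc g_metric p_cov.
have E_conn := cover_connected E_sc.
have trans := deck_transitive p_cov E_sc lpc.
have free (a b : deck p) x : a x = b x -> a = b by exact: (deck_free p_cov E_sc).
split; first exact: (flow_quasi_geodesic g_metric vol_form rho_rep u_equivariant u_continuous
  u_mixed p_cov E_conn trans free N_compact N_hausdorff Phi_fitting Phi_equivariant).
exact: (flow_line_ex d_gt0 g_metric vol_form rho_rep u_equivariant u_continuous
  u_mixed p_cov E_conn trans N_compact N_hausdorff Phi_fitting Phi_equivariant).
Qed.
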